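(* There exists a constant $C>0$ such that the following holds. Suppose $u \colon \mathbb{R}^{1+2} \to \mathbb{R}^2$ is a (weak) solution of the system of wave equations $$ \begin{cases} \square u = f \\ u|_{t = 0} = u_0 \\ \partial_t u|_{t = 0} = u_1 \end{cases} $$ where $f = (f_1, f_2) \colon \mathbb{R}^{1+2} \to \mathbb{R}^2$ is a divergence free vector field at each given time $t$, i.e. $\partial_{x_1} f_1 + \partial_{x_2} f_2 = 0$ for each $t$. Then $$ \|u\|_{C^0_t L^2_x} + \|\partial_t u\|_{C^0_t \dot{H}^{-1}_x} \leq C \left( \|u_0\|_{L^2} + \|u_1\|_{\dot{H}^{-1}} + \|f\|_{L^1_t L^1_x} \right). $$
   Context: Points of $\mathbb{R}^{1+2}$ are written $(t,x)$ with $t\in\mathbb{R}$, $x=(x_1,x_2)\in\mathbb{R}^2$. $\square = -\partial_t^2 + \Delta$ is the d'Alembertian ($\Delta$ being the Laplacian in $x$), acting componentwise on $u$. $\dot{H}^s=\dot{W}^{s,2}$ is the homogeneous Sobolev space, with norm $\|g\|_{\dot H^s}=\|(-\Delta)^{s/2}g\|_{L^2}$; norms of vector-valued functions are taken componentwise. For a normed space $X$ of functions of $x$, $\|v\|_{C^0_t X_x}=\sup_t\|v(t,\cdot)\|_X$ (for $v$ continuous in $t$ with values in $X$), and $\|v\|_{L^q_tL^r_x}$ is the $L^q$ norm in $t$ of $\|v(t,\cdot)\|_{L^r}$. The constant $C$ is independent of $u,f,u_0,u_1$. *)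

(* Defs.v *)
From HB Require Import structures.
From mathcomp Require Export all_boot all_order all_algebra.
From mathcomp Require Export all_classical all_reals all_analysis.
From mathcomp Require Export complex.

Set Implicit Arguments.
Unset Strict Implicit.
Unset Printing Implicit Defensive.

Export Order.TTheory GRing.Theory Num.Theory.
Export numFieldNormedType.Exports.

Local Open Scope classical_set_scope.
Local Open Scope ring_scope.

Section TestFunctions.
Context {R : realType} {V : normedModType R}.

(* D_(v_1) (D_(v_2) (... f)) for s = [:: v_1; v_2; ...] *)
Fixpoint iter_derive (s : seq V) (f : V -> R) : V -> R :=
  if s is v :: s' then fun x => 'D_v (iter_derive s' f) x else f.

Definition smooth (f : V -> R) : Prop :=
  forall s : seq V, continuous (iter_derive s f) /\
    forall x v, derivable (iter_derive s f) x v.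

(* C_c^oo(V), for V finite dimensional *)
Definition test_function (f : V -> R) : Prop :=
  smooth f /\ exists r : R, forall x, r < `|x| -> f x = 0.

End TestFunctions.

Section Measures.
Context {R : realType}.

Definition leb1 : set (measurableTypeR R) -> \bar R := @lebesgue_measure R.
HB.instance Definition _ := SigmaFiniteMeasure.on leb1.

Definition leb2 : set (measurableTypeR R * measurableTypeR R)%type -> \bar R :=
  (leb1 \x leb1)%E.
HB.instance Definition _ := Measure.on leb2.

(* The canonical sigma-finite structure on products is only found for
   subprobability measures. *)
Let leb2_sigma_finite : sigma_finite setT leb2.
Proof.
have /sigma_finiteP[F [TF ndF Foo]] := sigma_finiteT (@leb1).
exists (fun n => F n `*` F n).
  rewrite -setXTT TF predeqE => -[x y]; split.
    move=> [/= [n _ Fnx] [k _ Fky]]; exists (maxn n k) => //; split.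
    - by move: x Fnx; exact/subsetPset/ndF/leq_maxl.
    - by move: y Fky; exact/subsetPset/ndF/leq_maxr.
  by move=> [n _ []/= ? ?]; split; exists n.
move=> k; have [? ?] := Foo k.
split; first exact: measurableX.
by rewrite /leb2 product_measure1E// lte_mul_pinfty// ge0_fin_numE.
Qed.
HB.instance Definition _ := Measure_isSigmaFinite.Build _ _ _ leb2
  leb2_sigma_finite.

Definition leb12 : set (measurableTypeR R *
    (measurableTypeR R * measurableTypeR R))%type -> \bar R :=
  (leb1 \x leb2)%E.
HB.instance Definition _ := Measure.on leb12.

End Measures.

Section SpaceTime.
Context {R : realType}.

(* A spacetime point is (t, (x_1, x_2)). *)
Notation R2 := (R * R)%type.
Notation R12 := (R * (R * R))%type.

Definition d1 (p : R2 -> R) : R2 -> R := 'D_((1, 0) : R2) p.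
Definition d2 (p : R2 -> R) : R2 -> R := 'D_((0, 1) : R2) p.

Definition dalembertian (p : R12 -> R) (z : R12) : R :=
  let et : R12 := (1, (0, 0)) in
  let e1 : R12 := (0, (1, 0)) in
  let e2 : R12 := (0, (0, 1)) in
  - 'D_et ('D_et p) z + 'D_e1 ('D_e1 p) z + 'D_e2 ('D_e2 p) z.

(* The norms of R2 and R12 are max norms, so these sets are closed cubes. *)
Definition locally_integrable2 (g : R2 -> R) : Prop :=
  forall r : R, leb2.-integrable [set x | `|x| <= r] (EFin \o g).
Definition locally_integrable12 (g : R12 -> R) : Prop :=
  forall r : R, leb12.-integrable [set z | `|z| <= r] (EFin \o g).

(* A distribution on R^2 is given by its values on real test functions.
   Linearity and continuity are not part of the type: they hold on test
   functions as soon as Hdot_norm below is finite. *)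
Definition distribution2 := (R2 -> R) -> R.

Definition distr_of_fun (g : R2 -> R) : distribution2 :=
  fun p => \int[leb2]_x (g x * p x).

Definition at_time (T : Type) (u : R12 -> T) (t : R) : R2 -> T :=
  fun x => u (t, x).

(* The distribution d_t u(t, .); it pairs with p as (d/dt) <u(t, .), p>. *)
Definition dt_distr (u : R12 -> R) (t : R) : distribution2 :=
  fun p => derive1 (fun s : R => distr_of_fun (at_time u s) p) t.

(* A scalar weak solution: u(t, .) is a differentiable distribution-valued
   function of t, so that both initial conditions are meaningful, and the
   equation holds in the sense of distributions on R^{1+2}. *)
Definition weak_solution (u f : R12 -> R) (u0 : R2 -> R) (u1 : distribution2)
    : Prop :=
  [/\ locally_integrable12 u /\ locally_integrable12 f,
      (forall t, locally_integrable2 (at_time u t)) /\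
      (forall p, test_function p -> forall t : R,
         derivable (fun s : R => distr_of_fun (at_time u s) p) t 1),
      forall p : R12 -> R, test_function p ->
        \int[leb12]_z (u z * dalembertian p z) = \int[leb12]_z (f z * p z),
      {ae leb2, forall x, u (0, x) = u0 x} &
      forall p, test_function p -> dt_distr u 0 p = u1 p].

Definition comp1 (T : Type) (v : T -> R2) : T -> R := fun x => (v x).1.
Definition comp2 (T : Type) (v : T -> R2) : T -> R := fun x => (v x).2.

Definition weak_solution_system (u f : R12 -> R2) (u0 : R2 -> R2)
    (u1 : distribution2 * distribution2) : Prop :=
  weak_solution (comp1 u) (comp1 f) (comp1 u0) u1.1 /\
  weak_solution (comp2 u) (comp2 f) (comp2 u0) u1.2.

Definition divergence_free (v : R2 -> R2) : Prop :=
  [/\ locally_integrable2 (comp1 v), locally_integrable2 (comp2 v) &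
      forall p, test_function p ->
        \int[leb2]_x (comp1 v x * d1 p x + comp2 v x * d2 p x) = 0].

(* Norms take values in \bar R and are +oo outside the corresponding space. *)

Definition Lp_norm (r : \bar R) (g : R2 -> R) : \bar R :=
  if `[< measurable_fun [set: R2] g >] then 'N[leb2]_r[EFin \o g]%E else +oo%E.

Definition Lp_norm_vec (r : \bar R) (v : R2 -> R2) : \bar R :=
  (Lp_norm r (comp1 v) + Lp_norm r (comp2 v))%E.

Definition mixed_norm (q r : \bar R) (v : R12 -> R2) : \bar R :=
  Lnorm leb1 q (fun t => Lp_norm_vec r (at_time v t)).

Definition dot (x y : R2) : R := x.1 * y.1 + x.2 * y.2.

Definition Cintegral (g : R2 -> R[i]) : R[i] :=
  ((\int[leb2]_x complex.Re (g x)) +i* (\int[leb2]_x complex.Im (g x)))%C.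

Definition inverse_fourier (p : R2 -> R) (xi : R2) : R[i] :=
  Cintegral (fun x => ((p x * cos (2 * pi * dot x xi)) +i*
                       (p x * sin (2 * pi * dot x xi)))%C).

(* The function G is the Fourier transform of the real distribution g, with
   \hat g(xi) = \int e^{-2 pi i x.xi} g(x) dx; this is
   <\hat g, inverse_fourier p> = <g, p>, imposed for p in C_c^oo, which is
   dense in the Schwartz space. *)
Definition has_fourier (g : distribution2) (G : R2 -> R[i]) : Prop :=
  [/\ measurable_fun [set: R2] (fun xi => complex.Re (G xi)),
      measurable_fun [set: R2] (fun xi => complex.Im (G xi)) &
      forall p, test_function p ->
        Cintegral (fun xi => G xi * inverse_fourier p xi) = (g p)%:C%C].

(* ||(-Delta)^{s/2} g||_{L^2}, computed by Plancherel as the L^2 norm of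
   |2 pi xi|^s \hat g, for s < 1. For such s, finiteness of this L^2 norm makes
   \hat g locally integrable and tempered, hence unique up to null sets; the
   infimum is over at most one value, and is +oo if there is none. *)
Definition Hdot_norm (s : R) (g : distribution2) : \bar R :=
  ereal_inf [set Lp_norm 2 (fun xi =>
                   (2 * pi * Num.sqrt (dot xi xi)) `^ s * Normc.normc (G xi))
            | G in has_fourier g].

Definition Hdot_norm_vec (s : R) (g : distribution2 * distribution2) : \bar R :=
  (Hdot_norm s g.1 + Hdot_norm s g.2)%E.

(* The norm of C^0_t X_x, where X = {N < +oo}: the supremum over t if v is a
   continuous function of t with values in X, and +oo otherwise. *)
Definition C0_norm (X : zmodType) (N : X -> \bar R) (v : R -> X) : \bar R :=
  if `[< (forall t, N (v t) < +oo)%E /\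
         (forall t : R, N (v s - v t) @[s --> t] --> 0%E) >]
  then ereal_sup (range (N \o v)) else +oo%E.

Definition dt_distr_vec (u : R12 -> R2) (t : R)
    : distribution2 * distribution2 :=
  (dt_distr (comp1 u) t, dt_distr (comp2 u) t).

End SpaceTime.

Arguments distribution2 R : clear implicits.

(* Main.v *)
(* At each frequency xi, with om = 2 pi |xi|, the equation is an oscillator
   V'' + om^2 V = - F, so |V| and |V'| / om are bounded, uniformly in time, by
   N = |V(0)| + |V'(0)| / om + int |F(s)| / om ds, and it suffices that N is square
   integrable with the expected bound. For the last term, the divergence condition
   xi1 F1 + xi2 F2 = 0 gives |F|^2 / |xi|^2 = - Re (F1 conj F2) / (xi1 xi2); since
   1 / xi1 and 1 / xi2 have bounded Fourier transforms, the integral of |F|^2 / om^2 over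
   the frequencies is at most a constant times the square of the
   L^1 norm of f at each time. Minkowski's inequality in time is replaced by a
   Cauchy-Schwarz inequality whose weight is that L^1 norm.

   The explicit solution and the weak solution coincide by uniqueness for the homogeneous
   equation: evaluating a distributional solution on the translates of a test function
   gives a smooth solution, whose energy in a backward light cone vanishes.

   Fourier transforms are handled through their real and imaginary parts: fc and fs are
   the cosine and sine transforms, so that the transform of g is fc g - i fs g, and Vc, Vs
   are the real and imaginary parts of V. *)

(* A bounded transform F does not make |F| / om square integrable in the plane, since |xi|^-2 is
   integrable neither at 0 nor at infinity; the divergence condition supplies the missing
   cancellation. The transform of 1 / (xi1 xi2) is a multiple of a product of two signs, but only as
   a conditionally convergent integral. Each 1 / xi_i is therefore replaced by the integrable kernel
   [skern], whose transforms are bounded uniformly, and Fatou's lemma removes the truncation.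
   Gaussian damping plays the same role in Parseval's formula.

   The solution u is only locally integrable, with no growth condition, so it has no Fourier
   transform to start from. V is built from the data alone and compared with u through pairings with
   test functions; finite speed of propagation requires no bound at infinity. Local integrability in
   space-time controls these pairings only after integration in time, so uniqueness is proved on
   their time primitives.

   The norm in C^0_t X is infinite for a discontinuous function. Continuity in time thus has to be
   proved too; it follows by dominated convergence, with a multiple of N^2 as majorant. *)
Require Import Defs.
From mathcomp Require Import measurable_realfun ring lra.
Set Implicit Arguments.
Unset Strict Implicit.
Unset Printing Implicit Defensive.
Local Open Scope classical_set_scope.
Local Open Scope ring_scope.

(** * Real-valued integrals *)

Section Integrable.
Context {R : realType} d (T : measurableType d).
Variable mu : {measure set T -> \bar R}.
Implicit Types f g : T -> R.

Definition integ f := mu.-integrable setT (EFin \o f).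

Lemma integ_meas f : integ f -> measurable_fun setT f.
Proof. by move/measurable_int/measurable_EFinP. Qed.

Lemma integ_le g f : measurable_fun setT f -> (forall x, `|f x| <= g x) ->
  integ g -> integ f.
Proof.
move=> mf fg; apply: le_integrable => //; first exact/measurable_EFinP.
by move=> x _ /=; rewrite lee_fin (le_trans (fg x))// ler_norm.
Qed.

Lemma eq_integ f g : f =1 g -> integ f -> integ g.
Proof. by move=> /funext ->. Qed.

Lemma integD f g : integ f -> integ g -> integ (fun x => f x + g x).
Proof. by move=> fi gi; exact: (integrableD measurableT fi gi). Qed.

Lemma integN f : integ f -> integ (fun x => - f x).
Proof. by move=> fi; exact: (integrableN fi). Qed.

Lemma integB f g : integ f -> integ g -> integ (fun x => f x - g x).
Proof. by move=> fi gi; exact: (integrableB measurableT fi gi). Qed.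

Lemma integZ (c : R) f : integ f -> integ (fun x => c * f x).
Proof. by move=> fi; exact: (integrableZl measurableT c fi). Qed.

Lemma integZr (c : R) f : integ f -> integ (fun x => f x * c).
Proof. by move=> fi; under eq_fun do rewrite mulrC; exact: integZ. Qed.

Lemma integ_norm f : integ f -> integ (fun x => `|f x|).
Proof. by move=> fi; apply: (integrable_norm fi). Qed.

Lemma integ0 : integ (fun=> 0).
Proof. exact: integrable0. Qed.

Lemma integMb (M : R) (h : T -> R) f : integ f -> measurable_fun setT h ->
  (forall x, `|h x| <= M) -> integ (fun x => h x * f x).
Proof.
move=> fi mh hM; apply: (integ_le (g := fun x => M * `|f x|)).
- by apply: measurable_funM => //; exact: integ_meas.
- by move=> x; rewrite normrM ler_wpM2r.
- exact/integZ/integ_norm.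
Qed.

Lemma RintD f g : integ f -> integ g ->
  \int[mu]_x (f x + g x) = \int[mu]_x f x + \int[mu]_x g x.
Proof. by move=> fi gi; rewrite RintegralD. Qed.

Lemma RintB f g : integ f -> integ g ->
  \int[mu]_x (f x - g x) = \int[mu]_x f x - \int[mu]_x g x.
Proof. by move=> fi gi; rewrite RintegralB. Qed.

Lemma RintZ (c : R) f : integ f -> \int[mu]_x (c * f x) = c * \int[mu]_x f x.
Proof. by move=> fi; rewrite RintegralZl. Qed.

Lemma RintZr (c : R) f : integ f -> \int[mu]_x (f x * c) = \int[mu]_x f x * c.
Proof. by move=> fi; rewrite RintegralZr. Qed.

Lemma RintN f : integ f -> \int[mu]_x (- f x) = - \int[mu]_x f x.
Proof.
move=> fi; rewrite -mulN1r -RintZ//; apply: eq_Rintegral => x _.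
by rewrite mulN1r.
Qed.

Lemma Rint0 : \int[mu]_x (0 : R) = 0.
Proof. by rewrite /Rintegral integral0. Qed.

Lemma Rint_eq f g : f =1 g -> \int[mu]_x f x = \int[mu]_x g x.
Proof. by move=> /funext ->. Qed.

Lemma Rint_le f g : integ f -> integ g -> (forall x, f x <= g x) ->
  \int[mu]_x f x <= \int[mu]_x g x.
Proof. by move=> fi gi fg; apply: le_Rintegral. Qed.

Lemma Rint_ge0 f : (forall x, 0 <= f x) -> 0 <= \int[mu]_x f x.
Proof. by move=> f0; apply: Rintegral_ge0. Qed.

Lemma Rint_norm f : integ f -> `|\int[mu]_x f x| <= \int[mu]_x `|f x|.
Proof. by move=> fi; apply: le_normr_Rintegral. Qed.

Lemma Rint_norm_le f g : measurable_fun setT f -> integ g ->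
  (forall x, `|f x| <= g x) -> `|\int[mu]_x f x| <= \int[mu]_x g x.
Proof.
move=> mf gi fg; have fi : integ f by apply: integ_le gi.
by apply: (le_trans (Rint_norm fi)); apply: Rint_le => //; exact: integ_norm.
Qed.

Lemma EFin_Rint f : integ f -> (\int[mu]_x f x)%:E = (\int[mu]_x (f x)%:E)%E.
Proof. by move=> fi; rewrite /Rintegral fineK//; exact: integrable_fin_num. Qed.

Lemma ae_eq_Rint f g : measurable_fun setT f -> measurable_fun setT g ->
  {ae mu, forall x, f x = g x} -> \int[mu]_x f x = \int[mu]_x g x.
Proof.
move=> mf mg fg; rewrite /Rintegral; congr fine.
apply: ae_eq_integral => //; try exact/measurable_EFinP.
by apply: filterS fg => x /= ->.
Qed.

Lemma ae_eq_integ f g : measurable_fun setT g -> integ f ->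
  {ae mu, forall x, f x = g x} -> integ g.
Proof.
move=> mg fi fg; apply/integrableP; split; first exact/measurable_EFinP.
move/integrableP : fi => [mf]; apply: le_lt_trans.
rewrite le_eqVlt; apply/orP; left; apply/eqP/esym; apply: ge0_ae_eq_integral => //.
- by apply: measurableT_comp.
- by apply: measurableT_comp => //; exact/measurable_EFinP.
- by apply: filterS fg => x /= ->.
Qed.

Lemma integ_ge0_lty f : measurable_fun setT f -> (forall x, 0 <= f x) ->
  (\int[mu]_x (f x)%:E < +oo)%E -> integ f.
Proof.
move=> mf f0 foo; apply/integrableP; split; first exact/measurable_EFinP.
by under eq_integral do rewrite /= ger0_norm//.
Qed.

Lemma Rint_cvg (f_ : nat -> T -> R) f g :
  (forall n, measurable_fun setT (f_ n)) -> measurable_fun setT f -> integ g ->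
  {ae mu, forall x, f_ ^~ x @ \oo --> f x} ->
  (forall n x, `|f_ n x| <= g x) ->
  integ f /\ \int[mu]_x f_ n x @[n --> \oo] --> \int[mu]_x f x.
Proof.
move=> mf_ mf gi ff fg.
have [|||||fi _ h] := @dominated_convergence _ _ _ mu setT measurableT
  (fun n => EFin \o f_ n) (EFin \o f) (EFin \o g).
- by move=> n; exact/measurable_EFinP.
- exact/measurable_EFinP.
- by apply: filterS ff => x h _; apply: cvg_EFin; [exact: nearW|exact: h].
- exact: gi.
- by apply: nearW => x n _; rewrite lee_fin.
split=> //; rewrite /Rintegral; apply: fine_cvg; rewrite fineK//.
exact: integrable_fin_num.
Qed.

Lemma Rint_lim (f_ : nat -> T -> R) f g : integ g ->
  (forall n, measurable_fun setT (f_ n)) -> measurable_fun setT f ->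
  {ae mu, forall x, f_ ^~ x @ \oo --> f x} ->
  (forall n x, `|f_ n x| <= g x) ->
  \int[mu]_x f_ n x @[n --> \oo] --> \int[mu]_x f x.
Proof. by move=> gi mf_ mf ff fg; have [] := Rint_cvg mf_ mf gi ff fg. Qed.

(* (int f g)^2 <= int f^2 int g^2, through 2 |fg| <= l f^2 + g^2 / l *)
Lemma integ_sqM f g : measurable_fun setT f -> measurable_fun setT g ->
  integ (fun x => f x ^+ 2) -> integ (fun x => g x ^+ 2) ->
  integ (fun x => f x * g x).
Proof.
move=> mf mg f2 g2; apply: (integ_le (g := fun x => f x ^+ 2 + g x ^+ 2)).
- exact: measurable_funM.
- move=> x; rewrite normrM -[f x ^+ 2]real_normK ?num_real//.
  rewrite -[g x ^+ 2]real_normK ?num_real//.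
  by nra.
- exact: integD.
Qed.

(** The choice l = c / A suffices and involves no square root. If A = 0 and c > 0, then l = (B + 1)
    / c contradicts the hypothesis. *)
Lemma sqr_le_of_young (c A B : R) : 0 <= A -> 0 <= B -> 0 <= c ->
  (forall l, 0 < l -> 2 * c <= l * A + l^-1 * B) -> c ^+ 2 <= A * B.
Proof.
move=> A0 B0 c0 h.
have [->|cn0] := eqVneq c 0; first by rewrite expr0n/= mulr_ge0.
have cp : 0 < c by rewrite lt_neqAle eq_sym cn0.
have [A00|An0] := eqVneq A 0.
  have lp : 0 < (B + 1) / c by rewrite divr_gt0// ltr_wpDl.
  have := h _ lp; rewrite A00 mulr0 add0r invf_div mulrAC.
  rewrite ler_pdivlMr ?ltr_wpDl//; nra.
have Ap : 0 < A by rewrite lt_neqAle eq_sym An0.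
have lp : 0 < c / A by rewrite divr_gt0.
have := h _ lp; rewrite divfK// invf_div.
rewrite -lerBlDl (_ : 2 * c - c = c); last by ring.
by rewrite mulrAC ler_pdivlMr// expr2.
Qed.

Lemma Rint_CS f g : measurable_fun setT f -> measurable_fun setT g ->
  integ (fun x => f x ^+ 2) -> integ (fun x => g x ^+ 2) ->
  (\int[mu]_x (f x * g x)) ^+ 2 <=
  (\int[mu]_x (f x ^+ 2)) * (\int[mu]_x (g x ^+ 2)).
Proof.
move=> mf mg f2 g2; rewrite -[_ ^+ 2]real_normK ?num_real//.
apply: sqr_le_of_young => //; try by apply: Rint_ge0 => x; rewrite sqr_ge0.
move=> l l0; rewrite -[in X in X + _]RintZ// -RintZ// -RintD; try exact: integZ.
have fgi := integ_sqM mf mg f2 g2.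
apply: (@le_trans _ _ (2 * \int[mu]_x `|f x * g x|)).
  by rewrite ler_wpM2l// Rint_norm.
rewrite -RintZ; last exact: integ_norm.
apply: Rint_le; [exact/integZ/integ_norm|by apply: integD; exact: integZ|].
move=> x; rewrite normrM -[f x ^+ 2]real_normK ?num_real//.
rewrite -[g x ^+ 2]real_normK ?num_real//.
set a := `|f x|; set b := `|g x|.
have : 0 <= l * (a - l^-1 * b) ^+ 2 by rewrite mulr_ge0 ?sqr_ge0// ltW.
rewrite (_ : l * _ = l * a ^+ 2 - 2 * (a * b) + l^-1 * b ^+ 2); last first.
  by field; rewrite gt_eqF.
by lra.
Qed.

End Integrable.
Arguments integ {R d T} mu f.

(** * Fubini and Tonelli for real-valued integrals *)

Section Fubini.
Context {R : realType} d1 d2 (T1 : measurableType d1) (T2 : measurableType d2).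
Variables (m1 : {sigma_finite_measure set T1 -> \bar R})
  (m2 : {sigma_finite_measure set T2 -> \bar R}).
Implicit Types f : T1 * T2 -> R.

(** Tonelli applies to the positive and negative parts separately and [fine] is measurable, so no
    integrability is required. *)
Lemma meas_Rint1 f : measurable_fun setT f ->
  measurable_fun setT (fun x => \int[m2]_y f (x, y)).
Proof.
move=> mf; rewrite /Rintegral; apply: (measurableT_comp (f := fine)) => //.
under eq_fun do rewrite integralE.
have mf' : measurable_fun setT (EFin \o f) by exact/measurable_EFinP.
apply: emeasurable_funB.
- apply: eq_measurable_fun (measurable_fun_fubini_tonelli_F (m2 := m2) _
    (measurable_funepos mf') (funepos_ge0 _)) => x _.
  by apply: eq_integral => y _; rewrite !funeposE.
- apply: eq_measurable_fun (measurable_fun_fubini_tonelli_F (m2 := m2) _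
    (measurable_funeneg mf') (funeneg_ge0 _)) => x _.
  by apply: eq_integral => y _; rewrite !funenegE.
Qed.

Lemma meas_Rint2 f : measurable_fun setT f ->
  measurable_fun setT (fun y => \int[m1]_x f (x, y)).
Proof.
move=> mf; rewrite /Rintegral; apply: (measurableT_comp (f := fine)) => //.
under eq_fun do rewrite integralE.
have mf' : measurable_fun setT (EFin \o f) by exact/measurable_EFinP.
apply: emeasurable_funB.
- apply: eq_measurable_fun (measurable_fun_fubini_tonelli_G (m1 := m1) _
    (measurable_funepos mf') (funepos_ge0 _)) => x _.
  by apply: eq_integral => y _; rewrite !funeposE.
- apply: eq_measurable_fun (measurable_fun_fubini_tonelli_G (m1 := m1) _
    (measurable_funeneg mf') (funeneg_ge0 _)) => x _.
  by apply: eq_integral => y _; rewrite !funenegE.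
Qed.

(** An integrable extended-real function is finite almost everywhere, so [fine] alters it on a null
    set only. This makes the marginals in Fubini's theorem real valued. *)
Lemma fine_ae_integ d (T : measurableType d) (mu : {measure set T -> \bar R})
    (F : T -> \bar R) : mu.-integrable setT F ->
  integ mu (fun x => fine (F x)) /\
  \int[mu]_x fine (F x) = fine (\int[mu]_x F x)%E.
Proof.
move=> iF; have mF := measurable_int _ iF.
have mfF : measurable_fun setT (EFin \o (fun x => fine (F x))).
  by apply/measurable_EFinP; apply: measurableT_comp.
have ae : {ae mu, forall x, setT x -> F x = (fine (F x))%:E}.
  by apply: filterS (integrable_ae measurableT iF) => x h _; rewrite fineK// h.
split.
  apply/integrableP; split => //; move/integrableP : iF => [_].
  apply: le_lt_trans; rewrite le_eqVlt; apply/orP; left; apply/eqP.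
  apply: ge0_ae_eq_integral => //; try exact: measurableT_comp.
  by apply: filterS ae => x /(_ I) h _ /=; rewrite [in RHS]h.
by rewrite /Rintegral; congr fine; apply/esym/ae_eq_integral.
Qed.

Lemma fubini1 f : integ (m1 \x m2)%E f ->
  integ m1 (fun x => \int[m2]_y f (x, y)) /\
  \int[m1]_x (\int[m2]_y f (x, y)) = \int[(m1 \x m2)%E]_z f z.
Proof.
move=> fi; have iF := integrable_fubini_F fi.
have [h1 h2] := fine_ae_integ iF; split; first exact: h1.
by rewrite [LHS]h2; congr fine; rewrite integral12_prod_meas1.
Qed.

Lemma fubini2 f : integ (m1 \x m2)%E f ->
  integ m2 (fun y => \int[m1]_x f (x, y)) /\
  \int[m2]_y (\int[m1]_x f (x, y)) = \int[(m1 \x m2)%E]_z f z.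
Proof.
move=> fi.
have iG : m2.-integrable setT (fubini_G m1 (EFin \o f)).
  have mf := measurable_int _ fi.
  apply/integrableP; split; first exact: (measurable_fubini_G fi).
  apply: le_lt_trans ((integrable21ltyP m1 m2 mf).1 fi).
  apply: ge0_le_integral => //.
  - by apply: measurableT_comp => //; exact: (measurable_fubini_G fi).
  - by apply: (measurable_fun_fubini_tonelli_G (m1 := m1) (abse \o (EFin \o f)));
      [exact: measurableT_comp|move=> ? /=].
  - move=> y _; apply: le_abse_integral => //.
    exact: measurableT_comp.
have [h1 h2] := fine_ae_integ iG; split; first exact: h1.
by rewrite [LHS]h2; congr fine; rewrite integral21_prod_meas1.
Qed.

Lemma fubiniC f : integ (m1 \x m2)%E f ->
  \int[m1]_x (\int[m2]_y f (x, y)) = \int[m2]_y (\int[m1]_x f (x, y)).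
Proof. by move=> fi; rewrite (fubini1 fi).2 (fubini2 fi).2. Qed.

Lemma ae_integ_section1 f : integ (m1 \x m2)%E f ->
  {ae m1, forall x, integ m2 (fun y => f (x, y))}.
Proof. by move=> fi; apply: (ae_integrable1 fi). Qed.

Lemma integ_tonelli f (g : T1 -> R) : measurable_fun setT f -> integ m1 g ->
  (forall x, integ m2 (fun y => f (x, y))) ->
  (forall x, \int[m2]_y `|f (x, y)| <= g x) -> integ (m1 \x m2)%E f.
Proof.
move=> mf gi fi fg; apply/(integrable12ltyP m1 m2); first exact/measurable_EFinP.
have [_] := integrableP _ _ _ gi; apply: le_lt_trans.
apply: ge0_le_integral => //.
- by move=> x _; apply: integral_ge0.
- by apply: (measurable_fun_fubini_tonelli_F (m2 := m2) (abse \o (EFin \o f)));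
    [apply: measurableT_comp => //; exact/measurable_EFinP|move=> ? /=].
- by apply: measurableT_comp => //; exact: measurable_int gi.
- move=> x _ /=; rewrite -(EFin_Rint (integ_norm (fi x))) lee_fin.
  by rewrite (le_trans (fg x))// ler_norm.
Qed.

Lemma integ_tensor f (g : T1 -> R) (h : T2 -> R) : measurable_fun setT f ->
  integ m1 g -> integ m2 h -> (forall x y, `|f (x, y)| <= `|g x| * `|h y|) ->
  integ (m1 \x m2)%E f.
Proof.
move=> mf gi hi fgh.
have sf x : measurable_fun setT (fun y => f (x, y)).
  exact: measurableT_comp.
have fi x : integ m2 (fun y => f (x, y)).
  by apply: integ_le (fgh x) _ => //; exact/integZ/integ_norm.
apply: (integ_tonelli (g := fun x => `|g x| * \int[m2]_y `|h y|)) => //.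
  by apply: integZr; exact: integ_norm.
move=> x; rewrite -RintZ; last exact: integ_norm.
by apply: Rint_le; [exact: integ_norm|exact/integZ/integ_norm|exact: fgh].
Qed.

End Fubini.

Section Caratheodory.
Context {R : realType} d (T : measurableType d).

(* f is the pointwise limit of f (floor (n x) / n, y) *)
Lemma caratheodory_meas (f : R * T -> R) :
  (forall y, continuous (fun x : R => f (x, y))) ->
  (forall x : R, measurable_fun setT (fun y => f (x, y))) ->
  measurable_fun [set: measurableTypeR R * T] f.
Proof.
move=> cf mf.
pose r n (x : R) : R := (Num.floor (n.+1%:R * x))%:~R / n.+1%:R.
have rx x : r ^~ x @ \oo --> x.
  apply/cvgrPdist_le => /= e e0.
  have : (n.+1%:R : R)^-1 @[n --> \oo] --> 0 by exact: cvg_harmonic.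
  move/cvgrPdist_le => /(_ e e0); apply: filterS => n; rewrite sub0r normrN.
  rewrite gtr0_norm ?invr_gt0// => ne.
  have n0 : 0 < n.+1%:R :> R by [].
  rewrite /r -[x in x - _](mulKf (lt0r_neq0 n0)) mulrC -mulrBl normrM.
  rewrite [X in _ * X]gtr0_norm ?invr_gt0// (le_trans _ ne)//.
  rewrite ler_piMl ?invr_ge0// ler_norml.
  have /andP[] := Num.Theory.floor_itv (n.+1%:R * x); rewrite intrD1; lra.
apply: (@measurable_fun_cvg _ _ _ _ (fun n z => f (r n z.1, z.2))) => //.
- move=> n _ A mA; rewrite setTI.
  rewrite [X in measurable X](_ : _ = \bigcup_(k in [set: int])
    ([set x : measurableTypeR R | Num.floor (n.+1%:R * x) = k] `*`
     ((fun y => f (k%:~R / n.+1%:R, y)) @^-1` A))); last first.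
    apply/seteqP; split=> [[x y] /= h|[x y] [k _] /= [<-]//].
    by exists (Num.floor (n.+1%:R * x)).
  apply: countable_bigcupT_measurable => // k; apply: measurableX.
    rewrite (_ : [set x | _] = `[(k%:~R / n.+1%:R : R), ((k + 1)%:~R / n.+1%:R)[%classic).
      exact: measurable_itv.
    apply/seteqP; split => x /=; rewrite in_itv/= ler_pdivrMr// ltr_pdivlMr//.
      by move=> <-; rewrite ![x * _]mulrC; exact: Num.Theory.floor_itv.
    by move=> h; apply/eqP; rewrite Num.Theory.floor_eq [n.+1%:R * x]mulrC.
  by rewrite -[X in measurable X]setTI; exact: mf.
- by move=> [x y] _ /=; exact: (cvg_comp _ _ (rx x) (cf y x)).
Qed.

End Caratheodory.

(** * Continuity and differentiation of integrals depending on a parameter *)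

Section ParameterIntegral.
Context {R : realType} d (Y : measurableType d) (mu : {measure set Y -> \bar R}).
Variables (f : R -> Y -> R) (G : Y -> R).
Hypothesis Gi : integ mu G.

Lemma Rint_continuous : (forall x, measurable_fun setT (f x)) ->
  (forall y, continuous (f ^~ y)) -> (forall x y, `|f x y| <= G y) ->
  continuous (fun x => \int[mu]_y f x y).
Proof.
move=> mf cf fG x; apply: (@continuity_under_integral R _ Y mu f setT measurableT
  (x - 1) (x + 1) _ _ G) => //.
- by move=> z _; apply: (integ_le (g := G)).
- by apply: nearW => y _ z _; exact: cf.
- by move=> z _; apply: nearW => y _; exact: fG.
- by rewrite inE/= in_itv/= ltrDl ltrBlDr ltrDl ltr01.
Qed.

Variable df : R -> Y -> R.
Lemma Rint_derive : (forall x, integ mu (f x)) ->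
  (forall (x : R) y, is_derive x (1 : R) (f ^~ y) (df x y)) ->
  (forall x y, `|df x y| <= G y) ->
  forall x : R,
    is_derive x (1 : R) (fun x => \int[mu]_y f x y) (\int[mu]_y df x y).
Proof.
move=> fi fd fG x.
have G0 y : 0 <= G y by rewrite (le_trans _ (fG x y)).
have p1E z y : partial1of2 f z y = df z y.
  by rewrite partial1of2E; have [_ ->] := fd z y.
have Ix : `](x - 1), (x + 1)[%classic x.
  by rewrite /= in_itv/= ltrDl ltrBlDr ltrDl ltr01.
have d1 : forall z y, `](x - 1), (x + 1)[%classic z -> [set: Y] y ->
    derivable (f ^~ y) z 1 by move=> z y _ _; have [] := fd z y.
have ub : forall z y, `](x - 1), (x + 1)[%classic z -> [set: Y] y ->
    `|partial1of2 f z y| <= G y by move=> z y _ _; rewrite p1E.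
have di := @derivable_under_integral R _ Y mu f setT measurableT x (x - 1) (x + 1)
  Ix (fun z _ => fi z) d1 G G0 Gi ub.
have dv := @differentiation_under_integral R _ Y mu f setT measurableT x (x - 1) (x + 1)
  Ix (fun z _ => fi z) d1 G G0 Gi ub.
apply: DeriveDef; first exact: di.
by rewrite -derive1E dv; apply: Rint_eq => y; rewrite p1E.
Qed.

End ParameterIntegral.

Lemma derive_continuous {R : realType} (f df : R -> R) :
  (forall x : R, is_derive x (1 : R) f (df x)) -> continuous f.
Proof.
move=> fd x; apply: differentiable_continuous.
by apply/derivable1_diffP; have [] := fd x.
Qed.

(** * Integration on the line *)

Section Line.
Context {R : realType}.
Notation mu := (@leb1 R).
Implicit Types f g F : R -> R.

Lemma integ_indic_itv (a b : R) (b0 b1 : bool) :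
  integ mu (\1_[set` Interval (BSide b0 a) (BSide b1 b)]).
Proof. exact: integrable_indic_itv. Qed.

Lemma cont_itv_bounded f (r : R) : continuous f ->
  exists2 M : R, 0 < M & forall x, `|x| <= r -> `|f x| <= M.
Proof.
move=> cf; have [M [_ hM]] := compact_bounded
  (continuous_compact (@continuous_subspaceT _ _ `[- r, r]%classic _ cf)
    (@segment_compact R (- r) r)).
exists (Num.max M 0 + 1); first by rewrite ltr_wpDl// le_max lexx orbT.
move=> x xr; apply: hM; first by rewrite ltr_pwDr// le_max lexx.
by exists x => //=; rewrite in_itv/= -ler_norml.
Qed.

Lemma integ_csupp f (r : R) : continuous f -> (forall x, r < `|x| -> f x = 0) ->
  integ mu f.
Proof.
move=> cf fr; have [M M0 fM] := cont_itv_bounded r cf.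
apply: (integ_le _ _ (integZ M (integ_indic_itv (- r) r true false))).
- exact: continuous_measurable_fun.
- move=> x; rewrite indicE; case: (boolP (x \in _)) => [|/negP] /=; rewrite inE/= in_itv/= -ler_norml.
    by rewrite mulr1; exact: fM.
  by move/negP; rewrite -ltNge mulr0 => /fr ->; rewrite normr0.
Qed.

(* sgi t is the oriented indicator of [0, t], so that oint g t is the oriented
   integral of g from 0 to t *)
Definition sgi (t s : R) : R := (s <= t)%R%:R - (s <= 0)%R%:R.
Definition oint g (t : R) : R := \int[mu]_s (sgi t s * g s).

Lemma sgi_le1 t s : `|sgi t s| <= 1.
Proof.
by rewrite /sgi; case: (s <= t); case: (s <= 0);
  rewrite ?subrr ?normr0 ?subr0 ?sub0r ?normrN ?normr1.
Qed.

Lemma sgi_eq0 t s : `|t| < `|s| -> sgi t s = 0.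
Proof.
move=> ts; rewrite /sgi; suff -> : (s <= t) = (s <= 0) by rewrite subrr.
have [s0|s0] := leP s 0; last first.
  apply/negbTE; rewrite -ltNge; move: ts; rewrite (gtr0_norm s0).
  by apply: le_lt_trans; exact: ler_norm.
move: ts; rewrite (ler0_norm s0) => /ltW; rewrite lerNr => /le_trans; apply.
by rewrite lerNl -normrN ler_norm.
Qed.

Lemma sgi0 s : sgi 0 s = 0. Proof. by rewrite /sgi subrr. Qed.

Lemma measurable_sgi t : measurable_fun setT (sgi t).
Proof.
rewrite (_ : sgi t = fun s => \1_(`]-oo, t]%classic) s - \1_(`]-oo, 0]%classic) s).
  by apply: measurable_funB; exact: measurable_indic.
apply/funext => s; rewrite /sgi !indicE; congr (_%:R - _%:R);
  by congr nat_of_bool; apply/idP/idP; rewrite inE/= in_itv.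
Qed.

Lemma integ_sgi f (t : R) : continuous f -> integ mu (fun s => sgi t s * f s).
Proof.
move=> cf; have [M M0 fM] := cont_itv_bounded `|t| cf.
apply: (integ_le _ _ (integZ M (integ_indic_itv (- `|t|) `|t| true false))).
- apply: measurable_funM; first exact: measurable_sgi.
  exact: continuous_measurable_fun.
- move=> x; rewrite normrM indicE.
  case: (boolP (x \in _)) => [|/negP] /=; rewrite inE/= in_itv/= -ler_norml.
    move=> xt; rewrite mulr1 -[leRHS]mul1r ler_pM// ?sgi_le1//.
    exact: fM.
  by move/negP; rewrite -ltNge mulr0 => /sgi_eq0 ->; rewrite normr0 mul0r.
Qed.

Lemma oint0 g : oint g 0 = 0.
Proof.
by rewrite /oint; under eq_Rintegral do rewrite sgi0 mul0r; exact: Rint0.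
Qed.

Lemma oint_derive g (t : R) : continuous g -> is_derive t (1 : R) (oint g) (g t).
Proof.
(* The base point [a] lies below both 0 and t, so near t the oriented integral is F y - F 0 whatever
   the sign of t. *)
move=> cg; pose a : R := - (`|t| + 1).
pose F (y : R) : R := \int[mu]_(x in [set` Interval (BLeft a) (BRight y)]) g x.
have ti : mu.-integrable [set` Interval (BLeft a) (BRight (`|t| + 1))] (EFin \o g).
  apply: continuous_compact_integrable; first exact: segment_compact.
  exact: continuous_subspaceT.
have tt1 : t < `|t| + 1 by rewrite (le_lt_trans (ler_norm _))// ltrDl.
have at1 : a < t.
  by rewrite /a ltrNl (le_lt_trans (ler_norm _))// normrN ltrDl.
have [dF F't] : derivable F t 1 /\ F^`()%classic t = g t
  := @continuous_FTC1 R g (BLeft a) t (`|t| + 1) tt1 ti at1 (cg t).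
have a0 : a < 0 by rewrite /a oppr_lt0 ltr_wpDl.
have FE y : F y = \int[mu]_x (\1_(`[a, y]%classic) x * g x).
  rewrite /F Rintegral_mkcond; apply: Rint_eq => x; rewrite patchE indicE.
  by case: ifP => _; rewrite ?mul1r ?mul0r.
have iF y : integ mu (fun x => \1_(`[a, y]%classic) x * g x).
  have [M M0 gM] := cont_itv_bounded (Num.max `|a| `|y|) cg.
  apply: (integ_le _ _ (integZ M (integ_indic_itv a y true false))).
  - apply: measurable_funM; first exact: measurable_indic.
    exact: continuous_measurable_fun.
  - move=> x; rewrite normrM indicE.
    case: (boolP (x \in _)) => [|_]; last by rewrite normr0 mul0r mulr0.
    rewrite inE/= in_itv/= => /andP[ax xy]; rewrite normr1 mul1r mulr1.
    apply: gM; rewrite ler_norml; apply/andP; split.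
      rewrite lerNl (le_trans (_ : _ <= - a)) ?lerN2// (le_trans (ler_norm _))//.
      by rewrite normrN le_max lexx.
    by rewrite (le_trans xy)// le_max ler_norm orbT.
  have oE y : a < y -> oint g y = F y - F 0.
  move=> ay; rewrite !FE -RintB//; apply: Rint_eq => x.
  rewrite -mulrBl /sgi !indicE; congr (_ * _).
  have [ax|xa] := leP a x.
    by congr (_%:R - _%:R); congr nat_of_bool; apply/idP/idP;
      rewrite inE/= in_itv/= ax.
  rewrite (le_trans (ltW xa) (ltW ay)) (le_trans (ltW xa) (ltW a0)) subrr.
  by rewrite !memNset ?subrr//= in_itv/= leNgt xa.
have dF' : is_derive t (1 : R) (fun y => F y - F 0) (g t).
  have dF1 : is_derive t (1 : R) F (g t).
    by apply: (DeriveDef dF); rewrite -derive1E; exact: F't.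
  by apply: is_derive_eq; rewrite subr0.
have nE : {near t, oint g =1 (fun y => F y - F 0)}.
  by near=> y; apply: oE; near: y; exact: lt_nbhsr.
apply: DeriveDef.
  apply: (near_eq_derivable (f := fun y => F y - F 0)); last first.
    exact: (@ex_derive _ _ _ _ _ _ _ dF').
  by near=> y; rewrite (near nE y).
by rewrite (near_eq_derive _ nE) derive_val.
Unshelve. all: by end_near. Qed.

Lemma oint_FTC F f (t : R) : continuous f ->
  (forall x : R, is_derive x (1 : R) F (f x)) -> oint f t = F t - F 0.
Proof.
move=> cf dF.
have dh (x : R) : is_derive x (1 : R) (fun y => oint f y - F y) 0.
  have h1 := oint_derive x cf; have h2 := dF x.
  by apply: is_derive_eq; rewrite subrr.
have /eqP := is_derive_0_is_cst t 0 dh.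
by rewrite oint0 sub0r subr_eq addrC => /eqP.
Qed.

Lemma RintT_derive F f : continuous f -> integ mu f ->
  (forall x : R, is_derive x (1 : R) F (f x)) ->
  F n%:R @[n --> \oo] --> 0 -> F (- n%:R) @[n --> \oo] --> 0 ->
  \int[mu]_x f x = 0.
Proof.
move=> cf fi dF Foo FNoo.
have mf : measurable_fun setT f by exact: integ_meas fi.
(* This is f cut to the interval ]-n, n]: the two constant parts of [sgi] cancel. *)
pose f_ (n : nat) s : R := sgi n%:R s * f s - sgi (- n%:R) s * f s.
have fE (n : nat) : \int[mu]_s f_ n s = F n%:R - F (- n%:R).
  rewrite /f_ RintB; try exact: integ_sgi.
  by rewrite -!/(oint _ _) !(oint_FTC _ cf dF); ring.
have h1 : \int[mu]_s f_ n s @[n --> \oo] --> \int[mu]_s f s.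
  apply: (Rint_lim (integZ 2 (integ_norm fi))).
  - move=> n; apply: measurable_funB; apply: measurable_funM => //;
      exact: measurable_sgi.
  - exact: mf.
  - apply: nearW => /= s; apply: cvg_near_cst.
    near=> n; rewrite /f_ -mulrBl.
    have /andP[ns sn] : (- n%:R < (s : R)) && ((s : R) <= n%:R).
      rewrite ltrNl; apply/andP; split.
        by near: n; exact: nbhs_infty_gtr.
      by near: n; exact: nbhs_infty_ger.
    have ns' : ((s : R) <= - n%:R) = false by apply/negbTE; rewrite -ltNge.
    by rewrite /sgi sn ns' sub0r opprK addrNK mul1r.
  - move=> n s; rewrite /f_ -mulrBl normrM ler_wpM2r// (le_trans (ler_normB _ _))//.
    by rewrite [leRHS](_ : 2 = 1 + 1)// lerD// sgi_le1.
have h2 : \int[mu]_s f_ n s @[n --> \oo] --> 0.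
  have h := cvgB Foo FNoo; rewrite subrr in h.
  by rewrite (funext fE); exact: h.
exact: (cvg_unique _ h1 h2).
Unshelve. all: by end_near. Qed.

Lemma derive_csupp F f (r : R) : (forall x : R, is_derive x (1 : R) F (f x)) ->
  (forall x, r < `|x| -> F x = 0) -> forall x, r < `|x| -> f x = 0.
Proof.
move=> dF Fr x rx.
have [_ <-] := dF x; rewrite (near_eq_derive (g := cst 0)) ?derive_cst//.
near=> y; apply: Fr; near: y.
have cn : {for x, continuous (fun y : R => `|y|)} by exact: norm_continuous.
exact: (cvgr_gt _ cn).
Unshelve. all: by end_near. Qed.

Lemma RintT_derive_csupp F f (r : R) : continuous f ->
  (forall x : R, is_derive x (1 : R) F (f x)) ->
  (forall x, r < `|x| -> F x = 0) -> \int[mu]_x f x = 0.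
Proof.
move=> cf dF Fr; apply: (RintT_derive cf _ dF).
- apply: (integ_csupp cf (r := r)); exact: derive_csupp dF Fr.
- apply: cvg_near_cst; near=> n; apply: Fr; rewrite ger0_norm//.
  by near: n; exact: nbhs_infty_gtr.
- apply: cvg_near_cst; near=> n; apply: Fr; rewrite normrN ger0_norm//.
  by near: n; exact: nbhs_infty_gtr.
Unshelve. all: by end_near. Qed.

(** The pushforward of Lebesgue measure by negation agrees with it on half-open intervals, hence on
    all measurable sets. *)
Lemma Rint_oppr f : measurable_fun setT f ->
  \int[mu]_x f (- x) = \int[mu]_x f x.
Proof.
move=> mf.
have mN : measurable_fun [set: measurableTypeR R] (-%R : R -> measurableTypeR R).
  by apply: continuous_measurable_fun; exact: opp_continuous.
have [nu nu_def] : exists nu : {measure set (measurableTypeR R) -> \bar R},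
    nu = pushforward (@lebesgue_measure R) (-%R : R -> measurableTypeR R) :> (_ -> _).
  by unshelve eexists (pushforward (@lebesgue_measure R)
    (-%R : R -> measurableTypeR R) : {measure set (measurableTypeR R) -> \bar R}).
have nuE A : measurable A -> (@lebesgue_measure R) A = nu A.
  apply: lebesgue_measure_unique => X [[a b]] /= _ <-.
  rewrite nu_def /pushforward (_ : _ @^-1` _ = `[- b, - a[%classic); last first.
    by apply/seteqP; split=> x /=; rewrite !in_itv/= lerNl ltrNr andbC.
  by rewrite !lebesgue_measure_itv/= !lte_fin ltrN2 opprK addrC.
have E (h : measurableTypeR R -> \bar R) : measurable_fun setT h ->
    (forall x, 0 <= h x)%E -> (\int[mu]_x h (- (x : R))%R = \int[mu]_x h x)%E.
  move=> mh h0; transitivity (\int[nu]_x h x)%E; last first.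
    by apply: eq_measure_integral => A mA _; rewrite -nuE.
  have <- := @ge0_integral_pushforward _ _ _ _ _ _ mN (@lebesgue_measure R) setT h
    measurableT mh (fun x _ => h0 x).
  by apply: eq_measure_integral => A mA _; rewrite nu_def.
rewrite /Rintegral; congr fine; rewrite integralE [RHS]integralE.
have mf' : measurable_fun setT (EFin \o f) by exact/measurable_EFinP.
congr (_ - _)%E.
- rewrite -(E _ (measurable_funepos mf') (funepos_ge0 _)).
  by apply: eq_integral => x _; rewrite !funeposE.
- rewrite -(E _ (measurable_funeneg mf') (funeneg_ge0 _)).
  by apply: eq_integral => x _; rewrite !funenegE.
Qed.

End Line.

(** * Gaussians and the Plancherel inequality *)

Section Gauss.
Context {R : realType}.
Notation mu := (@leb1 R).

Lemma is_derive_cosl (b c x : R) :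
  is_derive x (1 : R) (fun x => cos (b * x + c)) (- (b * sin (b * x + c))).
Proof. by apply: trigger_derive; rewrite /GRing.scale /=; ring. Qed.

Lemma is_derive_sinl (b c x : R) :
  is_derive x (1 : R) (fun x => sin (b * x + c)) (b * cos (b * x + c)).
Proof. by apply: trigger_derive; rewrite /GRing.scale /=; ring. Qed.

Lemma continuous_cosl (b c : R) : continuous (fun x : R => cos (b * x + c)).
Proof. exact: derive_continuous (is_derive_cosl b c). Qed.

Lemma continuous_sinl (b c : R) : continuous (fun x : R => sin (b * x + c)).
Proof. exact: derive_continuous (is_derive_sinl b c). Qed.

Definition gss (tau x : R) : R := expR (- (tau * x ^+ 2)).

Section tau.
Variables (tau : R) (tau0 : 0 < tau).
Local Notation G := (gss tau).

Lemma gss_gt0 x : 0 < G x. Proof. exact: expR_gt0. Qed.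

Lemma gss_le1 x : G x <= 1.
Proof. by rewrite /gss -expR0 ler_expR oppr_le0 mulr_ge0 ?sqr_ge0// ltW. Qed.

(** The standard deviation for which the normal density is proportional to [gss tau]; integrability
    and total mass are inherited from that density. *)
Let sig : R := (Num.sqrt (2 * tau))^-1.
Let sig0 : sig != 0.
Proof. by rewrite invr_neq0// gt_eqF// sqrtr_gt0 mulr_gt0. Qed.

Lemma gss_normal : G =1 normal_fun 0 sig.
Proof.
move=> x; rewrite /gss /normal_fun subr0; congr expR.
rewrite /sig -mulr_natr exprVn sqr_sqrtr ?mulr_ge0 ?ltW//.
by field; rewrite gt_eqF.
Qed.

Lemma gss_pdf x : G x = (normal_peak sig)^-1 * normal_pdf 0 sig x.
Proof.
by rewrite normal_pdfE// gss_normal mulKf// gt_eqF// normal_peak_gt0.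
Qed.

Lemma integ_gss : integ mu G.
Proof.
apply: (@eq_integ _ _ _ mu (fun x => (normal_peak sig)^-1 * normal_pdf 0 sig x)).
  by move=> x; rewrite gss_pdf.
by apply: integZ; exact: integrable_normal_pdf.
Qed.

Lemma Rint_gss : \int[mu]_x G x = (normal_peak sig)^-1.
Proof.
rewrite (Rint_eq mu (g := fun x => (normal_peak sig)^-1 * normal_pdf 0 sig x)).
  rewrite RintZ; last exact: integrable_normal_pdf.
  by rewrite /Rintegral integral_normal_pdf mulr1.
by move=> x; rewrite gss_pdf.
Qed.

Lemma gss_derive (x : R) : is_derive x (1 : R) G (- (2 * tau * x) * G x).
Proof.
by apply: trigger_derive; rewrite /GRing.scale /gss /=; ring.
Qed.

Lemma gss_continuous : continuous G.
Proof. exact: derive_continuous gss_derive. Qed.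

(** Follows from exp(-y) <= 1 / (1 + y) and n + 1 <= (1 + 1 / tau) (1 + tau n^2). *)
Lemma gss_cvg0 (u : nat -> R) : (forall n, `|u n| = n%:R) ->
  G (u n) @[n --> \oo] --> 0.
Proof.
move=> un.
have h : (1 + tau^-1) * harmonic n @[n --> \oo] --> (1 + tau^-1) * (0 : R).
  by apply: cvgM; [exact: cvg_cst|exact: cvg_harmonic].
rewrite mulr0 in h; apply: squeeze_cvgr h; last exact: cvg_cst.
apply: nearW => n; rewrite (ltW (gss_gt0 _))/= /gss /harmonic/=.
have t0 : 0 <= tau * u n ^+ 2 by rewrite mulr_ge0 ?sqr_ge0// ltW.
rewrite expRN -[leRHS]invrK lef_pV2 ?posrE ?expR_gt0 ?invr_gt0 ?mulr_gt0 ?addr_gt0 ?invr_gt0//.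
apply: le_trans (expR_ge1Dx _).
rewrite -[u n ^+ 2]real_normK ?num_real// un invfM invrK.
rewrite ler_pdivrMl ?addr_gt0 ?invr_gt0//.
rewrite (_ : _ * (1 + _) = 1 + tau^-1 + tau * n%:R ^+ 2 + n%:R ^+ 2); last first.
  by field; rewrite gt_eqF.
rewrite -natr1; have : (n%:R : R) <= n%:R ^+ 2 by rewrite -natrX ler_nat; case: (n) => // m; rewrite expnS leq_pmulr// expn_gt0.
have : 0 <= tau * n%:R ^+ 2 by rewrite mulr_ge0 ?sqr_ge0 ?ltW.
have : 0 < tau^-1 by rewrite invr_gt0.
by lra.
Qed.

End tau.

Section tau2.
Variables (tau : R) (tau0 : 0 < tau).
Local Notation G := (gss tau).

(** One half of the exponent absorbs the factor: |x| exp(- tau x^2 / 2) <= 1 + 1 / tau, and the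
    other half is an integrable Gaussian. *)
Lemma integ_xgss : integ mu (fun x => x * G x).
Proof.
have t20 : 0 < tau / 2 by rewrite divr_gt0.
have integ2 := integ_gss t20.
apply: (integ_le _ _ (integZ (1 + tau^-1) integ2)).
  apply: measurable_funM => //; apply: continuous_measurable_fun.
  exact: gss_continuous tau.
move=> x; rewrite normrM (gtr0_norm (gss_gt0 _ _)).
have -> : G x = gss (tau / 2) x * gss (tau / 2) x.
  by rewrite /gss -expRD; congr expR; field.
rewrite mulrA ler_wpM2r ?(ltW (expR_gt0 _))//.
have : 1 + tau / 2 * x ^+ 2 <= expR (tau / 2 * x ^+ 2) by exact: expR_ge1Dx.
rewrite /gss expRN ler_pdivrMr ?expR_gt0//.
move=> h; rewrite (le_trans _ (ler_wpM2l _ h)) ?addr_ge0 ?invr_ge0 ?ltW//.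
rewrite (_ : _ * _ = 1 + tau^-1 + x ^+ 2 / 2 + tau / 2 * x ^+ 2); last first.
  by field; rewrite gt_eqF.
have : 0 < tau^-1 by rewrite invr_gt0.
have : 0 <= tau / 2 * x ^+ 2 by rewrite mulr_ge0 ?sqr_ge0 ?ltW.
rewrite -[x ^+ 2]real_normK ?num_real//; nra.
Qed.

Variable c : R.

(** As a function of b, the integral I satisfies I' = - b I / (2 tau), by differentiation under the
    integral and integration by parts; hence I exp(b^2 / (4 tau)) is constant. The phase c covers
    cosine and sine at once. *)
Lemma gss_cos (b : R) : \int[mu]_x (cos (b * x + c) * G x) =
  cos c * expR (- (b ^+ 2 / (4 * tau))) * \int[mu]_x G x.
Proof.
move: b; have mcos (b : R) : measurable_fun setT (fun x : R => cos (b * x + c)).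
  by apply: continuous_measurable_fun; exact: continuous_cosl.
have msin (b : R) : measurable_fun setT (fun x : R => sin (b * x + c)).
  by apply: continuous_measurable_fun; exact: continuous_sinl.
have icos (b : R) : integ mu (fun x => cos (b * x + c) * G x).
  by apply: (integMb (integ_gss tau0) (mcos b) (fun x => cos_max _)).
have isin (b : R) : integ mu (fun x => sin (b * x + c) * (x * G x)).
  by apply: (integMb integ_xgss (msin b) (fun x => sin_max _)).
pose I b := \int[mu]_x (cos (b * x + c) * G x).
pose S b := \int[mu]_x (sin (b * x + c) * (x * G x)).
have dI b : is_derive (b : R) (1 : R) I (- S b).
  rewrite /S -RintN//.
  apply: (@Rint_derive _ _ _ mu _ _ (integ_norm integ_xgss)
    (fun b x => - (sin (b * x + c) * (x * G x))) icos) => [{}b x|{}b x].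
    by apply: trigger_derive; rewrite /GRing.scale /=; ring.
  by rewrite normrN normrM ler_piMl// sin_max.
have SI b : b * I b = 2 * tau * S b.
  apply/eqP; rewrite -subr_eq0 -!RintZ// -RintB; try exact: integZ.
  have cF : {near \oo, forall n : nat, True} by exact: nearW.
  have bd (u : nat -> R) : (forall n, `|u n| = n%:R) ->
      sin (b * u n + c) * G (u n) @[n --> \oo] --> 0.
    move=> /(gss_cvg0 tau0) h; apply/cvgr0Pnorm_le => /= e e0.
    move/cvgr0Pnorm_le : h => /(_ e e0); apply: filterS => n; apply: le_trans.
    by rewrite normrM ler_piMl// sin_max.
  apply/eqP; apply: (RintT_derive (F := fun x => sin (b * x + c) * G x)).
  - move=> x; apply: (@cvgB _ R^o).
      apply: cvgM; [exact: cvg_cst|apply: cvgM].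
        exact: continuous_cosl.
      exact: gss_continuous.
    apply: cvgM; [exact: cvg_cst|apply: cvgM; [exact: continuous_sinl|]].
    by apply: cvgM; [exact: cvg_id|exact: gss_continuous].
  - by apply: integB; exact: integZ.
  - by move=> x; apply: trigger_derive; rewrite /GRing.scale /= /gss; ring.
  - by apply: bd => n; rewrite ger0_norm.
  - by apply: bd => n; rewrite normrN ger0_norm.
have dH (b : R) : is_derive b (1 : R) (fun b => I b * expR (b ^+ 2 / (4 * tau))) 0.
  have h := dI b; apply: trigger_derive; rewrite /GRing.scale /=.
  have : S b = b * I b / (2 * tau) by rewrite SI; field; rewrite gt_eqF.
  by move=> ->; field; rewrite gt_eqF.
move=> b; have := is_derive_0_is_cst b 0 dH.
rewrite expr0n mul0r expR0 mulr1 => h.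
have I0 : I 0 = cos c * \int[mu]_x G x.
  rewrite -RintZ; last exact: integ_gss.
  by apply: Rint_eq => x; rewrite mul0r add0r.
by rewrite mulrAC -I0 -h -mulrA -expRD subrr expR0 mulr1.
Qed.

End tau2.

(** The Fourier transform of the normal density with standard deviation s; it increases to 1 as s
    decreases to 0. *)
Definition gam (s : R) : R -> R := gss (2 * pi ^+ 2 * s ^+ 2).

Section gam.
Variables (s : R) (s0 : 0 < s).

Let tau0 : 0 < 2 * pi ^+ 2 * s ^+ 2.
Proof. by rewrite !mulr_gt0 ?exprn_gt0 ?pi_gt0. Qed.

Lemma gam_gt0 x : 0 < gam s x. Proof. exact: gss_gt0. Qed.
Lemma gam_le1 x : gam s x <= 1. Proof. exact: gss_le1. Qed.
Lemma integ_gam : integ mu (gam s). Proof. exact: integ_gss. Qed.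

Lemma gam_cos (a c : R) : \int[mu]_x (cos (2 * pi * a * x + c) * gam s x) =
  cos c * normal_pdf 0 s a.
Proof.
have p0 : 0 < pi :> R by exact: pi_gt0.
rewrite gss_cos// Rint_gss// normal_pdfE ?gt_eqF// /normal_fun subr0 -mulrA.
congr (_ * _); rewrite mulrC; congr (_ * expR _).
  rewrite /normal_peak invrK.
  have E (z : R) : (z * pi) *+ 2 = 2 * z * pi by ring.
  rewrite !E.
  rewrite exprVn sqr_sqrtr; last first.
    by rewrite mulr_ge0// ltW.
  rewrite -sqrtrV; last by rewrite !mulr_ge0 ?sqr_ge0 ?ltW.
  congr Num.sqrt; move: (pi : R) p0 => p p0.
  by field; rewrite !gt_eqF.
rewrite [s ^+ 2 *+ 2](_ : _ = 2 * s ^+ 2); last by ring.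
move: (pi : R) p0 => p p0.
by field; rewrite !gt_eqF.
Qed.

End gam.

Lemma gam_cvg1 (x : R) : gam (n.+1%:R^-1) x @[n --> \oo] --> (1 : R).
Proof.
have h : (n.+1%:R : R)^-1 @[n --> \oo] --> 0 by exact: cvg_harmonic.
have h2 : - (2 * pi ^+ 2 * n.+1%:R^-1 ^+ 2 * x ^+ 2) @[n --> \oo] -->
    - (2 * pi ^+ 2 * (0 * 0) * x ^+ 2).
  apply: cvgN; apply: cvgM; last exact: cvg_cst.
  apply: cvgM; first exact: cvg_cst.
  by under eq_fun do rewrite expr2; apply: cvgM.
have := cvg_comp _ _ h2 (@continuous_expR R _).
by rewrite mulr0 mulr0 mul0r oppr0 expR0.
Qed.

End Gauss.

Section Meas.
Context {R : realType} d (T : measurableType d).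

Lemma meas_cos (f : T -> R) : measurable_fun setT f ->
  measurable_fun setT (fun x => cos (f x)).
Proof.
move=> mf; apply: (measurableT_comp (f := @cos R)) => //.
by apply: continuous_measurable_fun; exact: continuous_cos.
Qed.

Lemma meas_sin (f : T -> R) : measurable_fun setT f ->
  measurable_fun setT (fun x => sin (f x)).
Proof.
move=> mf; apply: (measurableT_comp (f := @sin R)) => //.
by apply: continuous_measurable_fun; exact: continuous_sin.
Qed.

Lemma meas_comp d' (T' : measurableType d') (f : T -> R) (g : T' -> T) :
  measurable_fun setT f -> measurable_fun setT g ->
  measurable_fun setT (fun x => f (g x)).
Proof. by move=> mf mg; apply: (measurableT_comp mf mg). Qed.

Lemma meas_fst d' (T' : measurableType d') d'' (T'' : measurableType d'')
  (f : T -> T' * T'') : measurable_fun setT f ->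
  measurable_fun setT (fun x => (f x).1).
Proof. by move=> mf; apply: (measurableT_comp (@measurable_fst _ _ _ _) mf). Qed.

Lemma meas_snd d' (T' : measurableType d') d'' (T'' : measurableType d'')
  (f : T -> T' * T'') : measurable_fun setT f ->
  measurable_fun setT (fun x => (f x).2).
Proof. by move=> mf; apply: (measurableT_comp (@measurable_snd _ _ _ _) mf). Qed.

Lemma meas_id : measurable_fun [set: T] (fun x => x).
Proof. exact: measurable_id. Qed.

End Meas.

(** * Cosine and sine transforms in the plane *)

Section Plane.
Context {R : realType}.
Notation mu1 := (@leb1 R).
Notation mu2 := (@leb2 R).
Notation R2 := (R * R)%type.
Implicit Types (x y z xi : R2) (f g h p w : R2 -> R).

Definition ph x xi : R := 2 * pi * dot x xi.
Definition fc g xi : R := \int[mu2]_x (g x * cos (ph x xi)).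
Definition fs g xi : R := \int[mu2]_x (g x * sin (ph x xi)).

Lemma phC x xi : ph x xi = ph xi x.
Proof. by rewrite /ph /dot; ring. Qed.

Lemma phB x y xi : ph (x - y) xi = ph x xi - ph y xi.
Proof. by rewrite /ph /dot /=; ring. Qed.

Lemma meas_ph d (T : measurableType d)
    (F G : T -> measurableTypeR R * measurableTypeR R) :
  measurable_fun setT F -> measurable_fun setT G ->
  measurable_fun setT (fun v : T => ph (F v) (G v)).
Proof.
move=> mF mG; rewrite /ph /dot; apply: measurable_funM => //.
by apply: measurable_funD; apply: measurable_funM;
  do ?[exact: meas_fst|exact: meas_snd].
Qed.

Lemma meas_phl xi : measurable_fun setT (ph ^~ xi).
Proof. by apply: meas_ph => //; exact: meas_id. Qed.

Lemma meas_phr x : measurable_fun setT (ph x).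
Proof. by apply: meas_ph => //; exact: meas_id. Qed.

Lemma integ_cos g xi : integ mu2 g -> integ mu2 (fun x => g x * cos (ph x xi)).
Proof.
move=> gi; under eq_fun do rewrite mulrC.
by apply: (integMb gi) => [|x]; [apply: meas_cos; exact: meas_phl|exact: cos_max].
Qed.

Lemma integ_sin g xi : integ mu2 g -> integ mu2 (fun x => g x * sin (ph x xi)).
Proof.
move=> gi; under eq_fun do rewrite mulrC.
by apply: (integMb gi) => [|x]; [apply: meas_sin; exact: meas_phl|exact: sin_max].
Qed.

Lemma fc_le g xi : integ mu2 g -> `|fc g xi| <= \int[mu2]_x `|g x|.
Proof.
move=> gi; apply: Rint_norm_le; first exact: integ_meas (integ_cos xi gi).
  exact: integ_norm.
by move=> x; rewrite normrM ler_piMr// cos_max.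
Qed.

Lemma fs_le g xi : integ mu2 g -> `|fs g xi| <= \int[mu2]_x `|g x|.
Proof.
move=> gi; apply: Rint_norm_le; first exact: integ_meas (integ_sin xi gi).
  exact: integ_norm.
by move=> x; rewrite normrM ler_piMr// sin_max.
Qed.

Lemma meas_fc g : measurable_fun setT g -> measurable_fun setT (fc g).
Proof.
move=> mg; apply: (meas_Rint2 mu2 (f := fun z : R2 * R2 => g z.1 * cos (ph z.1 z.2))).
apply: measurable_funM; first by apply: meas_comp mg _; exact: measurable_fst.
by apply: meas_cos; apply: meas_ph; [exact: measurable_fst|exact: measurable_snd].
Qed.

Lemma meas_fs g : measurable_fun setT g -> measurable_fun setT (fs g).
Proof.
move=> mg; apply: (meas_Rint2 mu2 (f := fun z : R2 * R2 => g z.1 * sin (ph z.1 z.2))).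
apply: measurable_funM; first by apply: meas_comp mg _; exact: measurable_fst.
by apply: meas_sin; apply: meas_ph; [exact: measurable_fst|exact: measurable_snd].
Qed.

Lemma integ_fcM g w : integ mu2 g -> integ mu2 w -> integ mu2 (fun xi => w xi * fc g xi).
Proof.
move=> gi wi; under eq_fun do rewrite mulrC.
apply: (integMb wi) => [|xi]; last exact: fc_le.
exact: meas_fc (integ_meas gi).
Qed.

Lemma integ_fsM g w : integ mu2 g -> integ mu2 w -> integ mu2 (fun xi => w xi * fs g xi).
Proof.
move=> gi wi; under eq_fun do rewrite mulrC.
apply: (integMb wi) => [|xi]; last exact: fs_le.
exact: meas_fs (integ_meas gi).
Qed.

(* multiplication formula for the Fourier transform *)
Lemma Rint_fcM g w : integ mu2 g -> integ mu2 w ->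
  \int[mu2]_xi (w xi * fc g xi) = \int[mu2]_x (fc w x * g x).
Proof.
move=> gi wi.
transitivity (\int[mu2]_xi \int[mu2]_x (w xi * (g x * cos (ph x xi)))).
  by apply: Rint_eq => xi; rewrite RintZ//; exact: integ_cos.
have H : integ (mu2 \x mu2)%E
    (fun z : R2 * R2 => w z.1 * (g z.2 * cos (ph z.2 z.1))).
  apply: (integ_tensor _ wi gi) => [|xi x].
    apply: measurable_funM; first exact: meas_comp (integ_meas wi) (@measurable_fst _ _ _ _).
    apply: measurable_funM; first exact: meas_comp (integ_meas gi) (@measurable_snd _ _ _ _).
    by apply: meas_cos; apply: meas_ph; [exact: measurable_snd|exact: measurable_fst].
  by rewrite !normrM ler_wpM2l// ler_piMr// cos_max.
transitivity (\int[mu2]_x \int[mu2]_xi (w xi * (g x * cos (ph x xi)))).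
  exact: (fubiniC H).
apply: Rint_eq => x; rewrite mulrC -RintZ; last exact: integ_cos.
by apply: Rint_eq => xi; rewrite phC; ring.
Qed.

Lemma Rint_fsM g w : integ mu2 g -> integ mu2 w ->
  \int[mu2]_xi (w xi * fs g xi) = \int[mu2]_x (fs w x * g x).
Proof.
move=> gi wi.
transitivity (\int[mu2]_xi \int[mu2]_x (w xi * (g x * sin (ph x xi)))).
  by apply: Rint_eq => xi; rewrite RintZ//; exact: integ_sin.
have H : integ (mu2 \x mu2)%E
    (fun z : R2 * R2 => w z.1 * (g z.2 * sin (ph z.2 z.1))).
  apply: (integ_tensor _ wi gi) => [|xi x].
    apply: measurable_funM; first exact: meas_comp (integ_meas wi) (@measurable_fst _ _ _ _).
    apply: measurable_funM; first exact: meas_comp (integ_meas gi) (@measurable_snd _ _ _ _).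
    by apply: meas_sin; apply: meas_ph; [exact: measurable_snd|exact: measurable_fst].
  by rewrite !normrM ler_wpM2l// ler_piMr// sin_max.
transitivity (\int[mu2]_x \int[mu2]_xi (w xi * (g x * sin (ph x xi)))).
  exact: (fubiniC H).
apply: Rint_eq => x; rewrite mulrC -RintZ; last exact: integ_sin.
by apply: Rint_eq => xi; rewrite phC; ring.
Qed.

(* Parseval's formula with a weight w; the phase c gives the real and the
   imaginary part at once. *)
Lemma weighted_parseval g h w (c : R) (K : R2 -> R2 -> R) :
  integ mu2 g -> integ mu2 h -> integ mu2 w ->
  (forall x y, \int[mu2]_xi (cos (ph (x - y) xi + c) * w xi) = K x y) ->
  \int[mu2]_xi (w xi * (cos c * (fc g xi * fc h xi + fs g xi * fs h xi)
    - sin c * (fs g xi * fc h xi - fc g xi * fs h xi))) =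
  \int[mu2]_x (g x * \int[mu2]_y (h y * K x y)).
Proof.
move=> gi hi wi KE.
(* The integrand is w (A fc g + B fs g), so the multiplication formula moves the transform from g to
   w A and w B. The same device, with [C] and [S] below, then frees h. *)
pose A xi := cos c * fc h xi + sin c * fs h xi.
pose B xi := cos c * fs h xi - sin c * fc h xi.
have mw := integ_meas wi.
have wAi : integ mu2 (fun xi => w xi * A xi).
  rewrite /A; under eq_fun do rewrite mulrDr mulrCA [X in _ + X]mulrCA.
  by apply: integD; apply: integZ; [exact: integ_fcM|exact: integ_fsM].
have wBi : integ mu2 (fun xi => w xi * B xi).
  rewrite /B; under eq_fun do rewrite mulrBr mulrCA [X in _ - X]mulrCA.
  by apply: integB; apply: integZ; [exact: integ_fsM|exact: integ_fcM].
transitivity (\int[mu2]_xi ((w xi * A xi) * fc g xi + (w xi * B xi) * fs g xi)).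
  by apply: Rint_eq => xi; rewrite /A /B; ring.
rewrite RintD; [|exact: integ_fcM|exact: integ_fsM].
rewrite Rint_fcM// Rint_fsM// -RintD; last 2 first.
- under eq_fun do rewrite mulrC; exact: integ_fcM.
- under eq_fun do rewrite mulrC; exact: integ_fsM.
apply: Rint_eq => x; rewrite -mulrDl mulrC; congr (_ * _).
rewrite /fc /fs -RintD; [|exact: integ_cos|exact: integ_sin].
have wpi (f : R -> R) (e : R) : measurable_fun setT f -> (forall t, `|f t| <= 1) ->
    integ mu2 (fun xi => f (ph xi x + e) * w xi).
  move=> mf f1; apply: (integMb wi) => [|xi]; last exact: f1.
  by apply: (meas_comp mf); apply: measurable_funD => //; exact: meas_phl.
have mcos : measurable_fun setT (@cos R).
  by apply: continuous_measurable_fun; exact: continuous_cos.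
have msin : measurable_fun setT (@sin R).
  by apply: continuous_measurable_fun; exact: continuous_sin.
pose C xi := cos (ph xi x + c) * w xi.
pose S xi := sin (ph xi x + c) * w xi.
have Ci : integ mu2 C by apply: wpi => // t; exact: cos_max.
have Si : integ mu2 S by apply: wpi => // t; exact: sin_max.
transitivity (\int[mu2]_xi (C xi * fc h xi + S xi * fs h xi)).
  by apply: Rint_eq => xi; rewrite /A /B /C /S cosD sinD; ring.
rewrite RintD; [|exact: integ_fcM|exact: integ_fsM].
rewrite Rint_fcM// Rint_fsM// -RintD; last 2 first.
- under eq_fun do rewrite mulrC; exact: integ_fcM.
- under eq_fun do rewrite mulrC; exact: integ_fsM.
apply: Rint_eq => y; rewrite -mulrDl mulrC; congr (_ * _).
rewrite /fc /fs -RintD; [|exact: integ_cos|exact: integ_sin].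
rewrite -KE; apply: Rint_eq => xi; rewrite /C /S phB.
rewrite (phC xi x) (phC xi y).
rewrite (_ : ph x xi - ph y xi + c = (ph x xi + c) - ph y xi); last by ring.
by rewrite cosB; ring.
Qed.

End Plane.

Lemma le_integ {R : realType} d (T : measurableType d)
    (mu : {measure set T -> \bar R}) (g f : T -> R) :
  integ mu g -> measurable_fun setT f -> (forall x, `|f x| <= g x) -> integ mu f.
Proof. by move=> gi mf fg; exact: integ_le mf fg gi. Qed.

Section Fatou.
Context {R : realType} d (T : measurableType d).
Variable mu : {measure set T -> \bar R}.

(** Provides the integrability of the limit as well as the bound: this is how a regularisation is
    removed when only uniform bounds on the regularised integrals are known. *)
Lemma Rint_fatou (f_ : nat -> T -> R) (f : T -> R) (C : R) :
  (forall n, integ mu (f_ n)) -> (forall n x, 0 <= f_ n x) ->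
  measurable_fun setT f -> (forall x, 0 <= f x) ->
  {ae mu, forall x, f_ ^~ x @ \oo --> f x} ->
  (forall n, \int[mu]_x f_ n x <= C) -> integ mu f /\ \int[mu]_x f x <= C.
Proof.
move=> fi f0 mf f_0 ff fC.
have h : (\int[mu]_x (f x)%:E <= C%:E)%E.
  apply: (@le_trans _ _ (\int[mu]_x limn_einf (fun n => (f_ n x)%:E))%E).
    rewrite le_eqVlt; apply/orP; left; apply/eqP; apply: ae_eq_integral => //.
    - exact/measurable_EFinP.
    - under eq_fun do rewrite -[limn_einf _]oppeK -limn_esupN.
      apply: measurableT_comp => //; apply: measurable_fun_limn_esup => n.
      by apply: measurableT_comp => //; exact: measurable_int (fi n).
    - apply: filterS ff => x h _.
      have h' : (f_ n x)%:E @[n --> \oo] --> (f x)%:E.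
        by apply: cvg_EFin; [exact: nearW|exact: h].
      by rewrite (cvg_limn_einf_sup h').1.
  apply: (le_trans (@fatou _ _ _ mu setT measurableT (fun n x => (f_ n x)%:E) _ _)).
  - by move=> n; exact: measurable_int (fi n).
  - by move=> n x _; rewrite lee_fin.
  - have E n : (\int[mu]_x (f_ n x)%:E <= C%:E)%E.
      by rewrite -EFin_Rint// lee_fin.
    apply: (le_trans (limn_einf_sup _)); rewrite limn_esup_lim.
    apply: lime_le; first exact: is_cvg_esups.
    apply: nearW => n; apply: ge_ereal_sup => _ [m _ <-]; exact: E.
have fint : integ mu f.
  by apply: integ_ge0_lty => //; apply: le_lt_trans h _; rewrite ltry.
by split => //; rewrite -lee_fin EFin_Rint.
Qed.

End Fatou.

Section Tonelli2.
Context {R : realType} d1 d2 (T1 : measurableType d1) (T2 : measurableType d2).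
Variables (m1 : {sigma_finite_measure set T1 -> \bar R})
  (m2 : {sigma_finite_measure set T2 -> \bar R}).

Lemma integ_tonelli2 (f : T1 * T2 -> R) (g : T2 -> R) : measurable_fun setT f ->
  integ m2 g ->
  (forall y, integ m1 (fun x => f (x, y))) ->
  (forall y, \int[m1]_x `|f (x, y)| <= g y) -> integ (m1 \x m2)%E f.
Proof.
move=> mf gi fi fg; apply/(integrable21ltyP m1 m2); first exact/measurable_EFinP.
have [_] := integrableP _ _ _ gi; apply: le_lt_trans.
apply: ge0_le_integral => //.
- by move=> x _; apply: integral_ge0.
- by apply: (measurable_fun_fubini_tonelli_G (m1 := m1) (abse \o (EFin \o f)));
    [apply: measurableT_comp => //; exact/measurable_EFinP|move=> ? /=].
- by apply: measurableT_comp => //; exact: measurable_int gi.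
- move=> x _ /=; rewrite -(EFin_Rint (integ_norm (fi x))) lee_fin.
  by rewrite (le_trans (fg x))// ler_norm.
Qed.

Lemma Rint_tensor (g : T1 -> R) (h : T2 -> R) : integ m1 g -> integ m2 h ->
  integ (m1 \x m2)%E (fun z => g z.1 * h z.2) /\
  \int[(m1 \x m2)%E]_z (g z.1 * h z.2) = (\int[m1]_x g x) * (\int[m2]_y h y).
Proof.
move=> gi hi.
have gh : integ (m1 \x m2)%E (fun z => g z.1 * h z.2).
  apply: (integ_tensor _ gi hi) => [|x y]; last by rewrite normrM.
  apply: measurable_funM.
    exact: meas_comp (integ_meas gi) (@measurable_fst _ _ _ _).
  exact: meas_comp (integ_meas hi) (@measurable_snd _ _ _ _).
split => //; rewrite -(fubini1 gh).2 -RintZr//.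
by apply: Rint_eq => x /=; rewrite RintZ.
Qed.

End Tonelli2.

(** * The Gaussian kernel in the plane and Plancherel's inequality *)

Section Plane2.
Context {R : realType}.
Notation mu1 := (@leb1 R).
Notation mu2 := (@leb2 R).
Notation R2 := (R * R)%type.
Implicit Types (x y z xi : R2) (f g h p w : R2 -> R) (s : R).

Definition gam2 s xi : R := gam s xi.1 * gam s xi.2.
(** The transform of [gam2 s]: a positive kernel of mass 1 that concentrates at the origin as s
    tends to 0. *)
Definition heat s z : R := normal_pdf 0 s z.1 * normal_pdf 0 s z.2.

Lemma gam2_gt0 s xi : 0 < gam2 s xi.
Proof. by rewrite mulr_gt0 ?gam_gt0. Qed.

Lemma gam2_le1 s xi : 0 < s -> gam2 s xi <= 1.
Proof.
by move=> s0; rewrite mulr_ile1 ?gam_le1// ltW// gam_gt0.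
Qed.

Lemma gam2_cvg1 xi : gam2 (n.+1%:R^-1) xi @[n --> \oo] --> (1 : R).
Proof.
by have h := cvgM (gam_cvg1 xi.1) (gam_cvg1 xi.2); rewrite mulr1 in h; exact: h.
Qed.

Lemma integ_gam2 s : 0 < s -> integ mu2 (gam2 s).
Proof. by move=> s0; apply: (Rint_tensor (integ_gam s0) (integ_gam s0)).1. Qed.

(** For a fixed first coordinate a, the inner integral is the one-dimensional formula with phase 2
    pi z1 a + c; this is why [gam_cos] carries a phase. *)
Lemma gam2_cos s z (c : R) : 0 < s ->
  \int[mu2]_xi (cos (ph z xi + c) * gam2 s xi) = cos c * heat s z.
Proof.
move=> s0.
have mi : integ mu2 (fun xi => cos (ph z xi + c) * gam2 s xi).
  apply: (integMb (integ_gam2 s0)) => [|xi]; last exact: cos_max.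
  by apply: meas_cos; apply: measurable_funD => //; exact: meas_phr.
rewrite -(fubini1 mi).2 /=.
transitivity (\int[mu1]_a (cos (2 * pi * z.1 * a + c) * gam s a * normal_pdf 0 s z.2)).
  apply: Rint_eq => a; rewrite mulrAC -gam_cos// -RintZr; last first.
    apply: (integMb (integ_gam s0)) => [|xi]; last exact: cos_max.
    by apply: continuous_measurable_fun; exact: continuous_cosl.
  apply: Rint_eq => b; rewrite /ph /dot /gam2 /=.
  rewrite (_ : 2 * pi * (z.1 * a + z.2 * b) + c =
    2 * pi * z.2 * b + (2 * pi * z.1 * a + c)); last by ring.
  by ring.
rewrite RintZr ?gam_cos// ?mulrA//.
apply: (integMb (integ_gam s0)) => [|xi]; last exact: cos_max.
by apply: continuous_measurable_fun; exact: continuous_cosl.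
Qed.

Lemma normal_shift s (a b : R) : s != 0 -> normal_pdf 0 s (a - b) = normal_pdf a s b.
Proof.
by move=> s0; rewrite !normal_pdfE// /normal_fun subr0 -sqrrN opprB.
Qed.

Lemma heat_ge0 s z : 0 <= heat s z.
Proof. by rewrite mulr_ge0 ?normal_pdf_ge0. Qed.

Lemma heat_shift s x : 0 < s -> (fun y => heat s (x - y)) =
  (fun y => normal_pdf x.1 s y.1 * normal_pdf x.2 s y.2).
Proof.
by move=> s0; apply/funext => y; rewrite /heat /= !normal_shift// gt_eqF.
Qed.

Lemma Rint_normal (m s : R) : \int[mu1]_x normal_pdf m s x = 1.
Proof. by rewrite /Rintegral integral_normal_pdf. Qed.

Lemma integ_heat s x : 0 < s -> integ mu2 (fun y => heat s (x - y)).
Proof.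
by move=> s0; rewrite heat_shift//; apply: (Rint_tensor (m1 := mu1) (m2 := mu1)
  (integrable_normal_pdf _ _) (integrable_normal_pdf _ _)).1.
Qed.

Lemma Rint_heat s x : 0 < s -> \int[mu2]_y heat s (x - y) = 1.
Proof.
move=> s0; rewrite heat_shift//.
have := (Rint_tensor (m1 := mu1) (m2 := mu1)
  (integrable_normal_pdf x.1 s) (integrable_normal_pdf x.2 s)).2.
by move=> ->; rewrite !Rint_normal mulr1.
Qed.

Lemma heatC s x y : 0 < s -> heat s (x - y) = heat s (y - x).
Proof.
move=> s0; rewrite /heat /= !normal_pdfE ?gt_eqF// /normal_fun !subr0.
by rewrite -[(x.1 - y.1) ^+ 2]sqrrN -[(x.2 - y.2) ^+ 2]sqrrN !opprB.
Qed.

Lemma meas_heat s : 0 < s -> measurable_fun setT (fun z : R2 * R2 => heat s (z.1 - z.2)).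
Proof.
move=> s0; rewrite /heat /=; apply: measurable_funM.
  apply: (meas_comp (measurable_normal_pdf 0 s)); apply: measurable_funB.
    by apply: meas_fst; exact: measurable_fst.
  by apply: meas_fst; exact: measurable_snd.
apply: (meas_comp (measurable_normal_pdf 0 s)); apply: measurable_funB.
  by apply: meas_snd; exact: measurable_fst.
by apply: meas_snd; exact: measurable_snd.
Qed.

(** Schur's test: 2 |g(x) g(y)| <= g(x)^2 + g(y)^2, and the kernel has mass 1 in each variable. *)
Lemma Rint_heat_le s g : 0 < s -> integ mu2 g -> integ mu2 (fun x => g x ^+ 2) ->
  \int[mu2]_x (g x * \int[mu2]_y (g y * heat s (x - y))) <= \int[mu2]_x (g x ^+ 2).
Proof.
move=> s0 gi g2i; have mg := integ_meas gi.
have mg1 : measurable_fun setT (fun z : R2 * R2 => g z.1).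
  exact: meas_comp mg (@measurable_fst _ _ _ _).
have mg2 : measurable_fun setT (fun z : R2 * R2 => g z.2).
  exact: meas_comp mg (@measurable_snd _ _ _ _).
have mh := meas_heat s0.
pose a := fun z : R2 * R2 => g z.1 ^+ 2 * heat s (z.1 - z.2).
pose b := fun z : R2 * R2 => g z.2 ^+ 2 * heat s (z.1 - z.2).
pose q := fun z : R2 * R2 => g z.1 * (g z.2 * heat s (z.1 - z.2)).
have ai : integ (mu2 \x mu2)%E a.
  apply: (integ_tonelli _ g2i) => [|x|x].
  - apply: measurable_funM mh; exact: measurable_funX.
  - exact: (integZ (g x ^+ 2) (integ_heat x s0)).
  - rewrite (Rint_eq mu2 (g := fun y => g x ^+ 2 * heat s (x - y))).
      by rewrite RintZ ?Rint_heat ?mulr1//; exact: integ_heat.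
    by move=> y; rewrite /a /= ger0_norm// mulr_ge0 ?sqr_ge0 ?heat_ge0.
have bi : integ (mu2 \x mu2)%E b.
  apply: (integ_tonelli2 _ g2i) => [|y|y].
  - apply: measurable_funM mh; exact: measurable_funX.
  - rewrite /b /=; under eq_fun do rewrite heatC//.
    exact: (integZ (g y ^+ 2) (integ_heat y s0)).
  - rewrite (Rint_eq mu2 (g := fun x => g y ^+ 2 * heat s (y - x))).
      by rewrite RintZ ?Rint_heat ?mulr1//; exact: integ_heat.
    move=> x; rewrite /b /= (heatC x y s0) ger0_norm//.
    by rewrite mulr_ge0 ?sqr_ge0 ?heat_ge0.
have qle (z : R2 * R2) : `|q z| <= 2^-1 * (a z + b z).
  have := heat_ge0 s (z.1 - z.2); rewrite /q /a /b.
  move: (heat s _) => k k0; rewrite -mulrDl !normrM (ger0_norm k0) !mulrA.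
  rewrite ler_wpM2r// -[g z.1 ^+ 2]real_normK ?num_real//.
  rewrite -[g z.2 ^+ 2]real_normK ?num_real//.
  have := sqr_ge0 (`|g z.1| - `|g z.2|); lra.
have qi : integ (mu2 \x mu2)%E q.
  apply: (le_integ (integZ 2^-1 (integD ai bi))); last exact: qle.
  by apply: measurable_funM => //; exact: measurable_funM.
have -> : \int[mu2]_x (g x * \int[mu2]_y (g y * heat s (x - y))) =
    \int[(mu2 \x mu2)%E]_z q z.
  rewrite -(fubini1 qi).2; apply: Rint_eq => x; rewrite -RintZ//.
  apply: (le_integ (integZ (normal_peak s * normal_peak s) (integ_norm gi))).
    apply: measurable_funM => //; exact: integ_meas (integ_heat x s0).
  move=> y; rewrite normrM mulrC ler_wpM2r// ger0_norm ?heat_ge0//.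
  by rewrite /heat /= ler_pM ?normal_pdf_ge0// normal_pdf_ub// gt_eqF.
apply: (@le_trans _ _ (\int[(mu2 \x mu2)%E]_z (2^-1 * (a z + b z)))).
  apply: Rint_le => //; first by apply: integZ; exact: integD.
  by move=> z; rewrite (le_trans (ler_norm _)).
rewrite RintZ; last exact: integD.
rewrite RintD//.
have -> : \int[(mu2 \x mu2)%E]_z a z = \int[mu2]_x (g x ^+ 2).
  rewrite -(fubini1 ai).2; apply: Rint_eq => x.
  by rewrite /a /= RintZ ?Rint_heat ?mulr1//; exact: integ_heat.
have -> : \int[(mu2 \x mu2)%E]_z b z = \int[mu2]_x (g x ^+ 2).
  rewrite -(fubini2 bi).2; apply: Rint_eq => y.
  rewrite /b /=; under eq_Rintegral => x _ do rewrite (heatC x y s0).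
  by rewrite RintZ ?Rint_heat ?mulr1//; exact: integ_heat.
by lra.
Qed.

(** The weight [gam2] makes the weighted Parseval formula available, [Rint_heat_le] bounds its right
    side uniformly in the weight, and Fatou's lemma lets the weight tend to 1. This gives only an
    inequality, which is all that is used. *)
Lemma plancherel_le g : integ mu2 g -> integ mu2 (fun x => g x ^+ 2) ->
  integ mu2 (fun xi => fc g xi ^+ 2 + fs g xi ^+ 2) /\
  \int[mu2]_xi (fc g xi ^+ 2 + fs g xi ^+ 2) <= \int[mu2]_x (g x ^+ 2).
Proof.
move=> gi g2i; have mg := integ_meas gi.
have mf : measurable_fun setT (fun xi => fc g xi ^+ 2 + fs g xi ^+ 2).
  by apply: measurable_funD; apply: measurable_funX; [exact: meas_fc|exact: meas_fs].
pose s_ (n : nat) : R := n.+1%:R^-1.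
have s0 n : 0 < s_ n by rewrite invr_gt0.
have f0 xi : 0 <= fc g xi ^+ 2 + fs g xi ^+ 2 by rewrite addr_ge0 ?sqr_ge0.
apply: (@Rint_fatou _ _ _ mu2
  (fun n xi => gam2 (s_ n) xi * (fc g xi ^+ 2 + fs g xi ^+ 2))) => //.
- move=> n; under eq_fun do rewrite mulrC.
  pose N := \int[mu2]_x `|g x|.
  apply: (integMb (M := N ^+ 2 + N ^+ 2) (integ_gam2 (s0 n)) mf) => xi.
  rewrite ger0_norm//; apply: lerD.
    by rewrite -[leLHS]real_normK ?num_real// lerXn2r// ?nnegrE ?fc_le ?Rint_ge0.
  by rewrite -[leLHS]real_normK ?num_real// lerXn2r// ?nnegrE ?fs_le ?Rint_ge0.
- by move=> n xi; rewrite mulr_ge0// ltW// gam2_gt0.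
- apply: nearW => xi; have h := cvgM (gam2_cvg1 xi)
    (cvg_cst (fc g xi ^+ 2 + fs g xi ^+ 2)).
  by rewrite mul1r in h; exact: h.
- move=> n; apply: le_trans (Rint_heat_le (s0 n) gi g2i).
  have := @weighted_parseval R g g (gam2 (s_ n)) 0 (fun x y => heat (s_ n) (x - y))
    gi gi (integ_gam2 (s0 n)).
  rewrite cos0 sin0 => <- => [|x y]; last by rewrite gam2_cos// cos0 mul1r.
  by rewrite le_eqVlt; apply/orP; left; apply/eqP; apply: Rint_eq => xi; ring.
Qed.

End Plane2.

(** * Test functions *)

Section Smooth.
Context {R : realType}.
Implicit Types V W : normedModType R.

(** Restriction to a line turns a directional derivative into a derivative at 0 on the reals, where
    the rules of one-variable calculus apply. *)
Lemma is_derive_line V (f : V -> R) (x v : V) (d : R) :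
  is_derive (0 : R) (1 : R) (fun h : R => f (h *: v + x)) d -> is_derive x v f d.
Proof.
move=> [df dE]; apply: DeriveDef; first exact/derivable1P.
rewrite -dE /derive; set g1 := fun h : R => h^-1 *: _; set g2 := fun h : R => h^-1 *: _.
suff -> : g1 = g2 by [].
by apply/funext => h; rewrite /g1 /g2 /= addr0 scale0r add0r [h *: 1]mulr1.
Qed.

Lemma derive_line V (f : V -> R) (x v : V) (d : R) :
  is_derive x v f d -> is_derive (0 : R) (1 : R) (fun h : R => f (h *: v + x)) d.
Proof.
move=> [df dE]; apply: DeriveDef; first exact: (derivable1P f x v).1 df.
rewrite -dE /derive; set g1 := fun h : R => h^-1 *: _; set g2 := fun h : R => h^-1 *: _.
suff -> : g1 = g2 by [].
by apply/funext => h; rewrite /g1 /g2 /= addr0 scale0r add0r [h *: 1]mulr1.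
Qed.

(** Replaces formulas for iterated derivatives by the choice of a class of functions that is closed
    under all directional derivatives. *)
Lemma smooth_coind V (C : (V -> R) -> Prop) :
  (forall f, C f -> [/\ continuous f, forall x v, derivable f x v &
    forall v, C ('D_v f)]) -> forall f, C f -> smooth f.
Proof.
move=> h f Cf s; suff : C (iter_derive s f) by case/h.
by elim: s => //= v s /h [_ _]; exact.
Qed.

Lemma smooth_derive V (f : V -> R) v : smooth f -> smooth ('D_v f).
Proof.
move=> sf s; rewrite (_ : iter_derive s ('D_v f) = iter_derive (s ++ [:: v]) f) //.
by elim: s => //= w s ->.
Qed.

Lemma smooth_cont V (f : V -> R) : smooth f -> continuous f.
Proof. by move=> /(_ [::]) []. Qed.

Lemma smooth_is_derive V (f : V -> R) x v : smooth f -> is_derive x v f ('D_v f x).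
Proof. by move=> /(_ [::]) [_ df]; apply/derivableP; exact: df. Qed.

(** Products of smooth functions are not a class closed under differentiation, since Leibniz' rule
    creates sums; the generated algebra is. *)
Inductive sgen V : (V -> R) -> Prop :=
| sgen_base f : smooth f -> sgen f
| sgen_add f g : sgen f -> sgen g -> sgen (fun x => f x + g x)
| sgen_mul f g : sgen f -> sgen g -> sgen (fun x => f x * g x).

Lemma sgen_smooth V (f : V -> R) : sgen f -> smooth f.
Proof.
apply: smooth_coind => {}f; elim=> {f} [f sf|f g _ [cf df Cf] _ [cg dg Cg]
  |f g sf [cf df Cf] sg [cg dg Cg]].
- split; [exact: smooth_cont|by case: (sf [::])|].
  by move=> v; apply: sgen_base; exact: smooth_derive.
- split; first by move=> x; apply: (@cvgD _ R^o); [exact: cf|exact: cg].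
    by move=> x v; exact: derivableD.
  move=> v; rewrite (_ : 'D_v _ = (fun x => 'D_v f x + 'D_v g x)).
    exact: sgen_add.
  by apply/funext => x; rewrite deriveD.
- split; first by move=> x; apply: cvgM; [exact: cf|exact: cg].
    by move=> x v; exact: derivableM.
  move=> v; rewrite (_ : 'D_v _ = (fun x => f x * 'D_v g x + g x * 'D_v f x)).
    by apply: sgen_add; exact: sgen_mul.
  by apply/funext => x; rewrite deriveM.
Qed.

Lemma smoothD V (f g : V -> R) : smooth f -> smooth g -> smooth (fun x => f x + g x).
Proof. by move=> sf sg; apply: sgen_smooth; apply: sgen_add; exact: sgen_base. Qed.

Lemma smoothM V (f g : V -> R) : smooth f -> smooth g -> smooth (fun x => f x * g x).
Proof. by move=> sf sg; apply: sgen_smooth; apply: sgen_mul; exact: sgen_base. Qed.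

Lemma smooth_cst V (c : R) : smooth ((fun=> c) : V -> R).
Proof.
apply: (smooth_coind (C := fun f => exists c, f = fun=> c)); last by exists c.
move=> _ [a ->]; split; [exact: cst_continuous|by move=> x v; exact: derivable_cst|].
by move=> v; exists 0; apply/funext => x; rewrite derive_cst.
Qed.

(** The equation says that l is affine with linear part L. The functions q o l with q smooth are
    closed under derivatives because D_v (q o l) = (D_{L v} q) o l. *)
Lemma smooth_comp V W (p : W -> R) (L l : V -> W) : continuous l ->
  (forall (h : R) v x, l (h *: v + x) = h *: L v + l x) ->
  smooth p -> smooth (fun x => p (l x)).
Proof.
move=> cl lE sp.
apply: (smooth_coind (C := fun f => exists2 p, smooth p & f = fun x => p (l x)));
  last by exists p.
move=> _ [q sq ->].
have dq x v : is_derive x v (fun x => q (l x)) ('D_(L v) q (l x)).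
  apply: is_derive_line; rewrite (_ : (fun h => _) = fun h : R => q (h *: L v + l x)).
    by apply: derive_line; exact: smooth_is_derive.
  by apply/funext => h; rewrite lE.
split.
- by move=> x; apply: continuous_comp; [exact: cl|exact: smooth_cont].
- by move=> x v; case: (dq x v).
- move=> v; exists ('D_(L v) q); first exact: smooth_derive.
  by apply/funext => x; case: (dq x v).
Qed.

Lemma derive_comp_line V W (p : W -> R) (L l : V -> W) x v :
  (forall (h : R) v x, l (h *: v + x) = h *: L v + l x) ->
  smooth p -> 'D_v (fun x => p (l x)) x = 'D_(L v) p (l x).
Proof.
move=> lE sp; suff [] : is_derive x v (fun x => p (l x)) ('D_(L v) p (l x)) by [].
apply: is_derive_line; rewrite (_ : (fun h => _) = fun h : R => p (h *: L v + l x)).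
  by apply: derive_line; exact: smooth_is_derive.
by apply/funext => h; rewrite lE.
Qed.

Lemma derive_supp V (f : V -> R) (r : R) v : (forall x, r < `|x| -> f x = 0) ->
  forall x, r < `|x| -> 'D_v f x = 0.
Proof.
move=> fr x rx; rewrite (near_eq_derive (g := cst 0)) ?derive_cst//.
near=> y; apply: fr; near: y.
have cn : {for x, continuous (fun y : V => `|y|)} by exact: norm_continuous.
exact: (cvgr_gt _ cn).
Unshelve. all: by end_near. Qed.

Lemma test_derive V (f : V -> R) v : test_function f -> test_function ('D_v f).
Proof.
move=> [sf [r fr]]; split; first exact: smooth_derive.
by exists r; exact: derive_supp fr.
Qed.

Lemma testD V (f g : V -> R) : test_function f -> test_function g ->
  test_function (fun x => f x + g x).
Proof.
move=> [sf [r fr]] [sg [s gs]]; split; first exact: smoothD.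
by exists (Num.max r s) => x; rewrite gt_max => /andP[/fr -> /gs ->]; rewrite addr0.
Qed.

Lemma test_smoothM V (f g : V -> R) : test_function f -> smooth g ->
  test_function (fun x => f x * g x).
Proof.
move=> [sf [r fr]] sg; split; first exact: smoothM.
by exists r => x /fr ->; rewrite mul0r.
Qed.

Lemma testZ V (c : R) (f : V -> R) : test_function f ->
  test_function (fun x => c * f x).
Proof.
move=> tf; under eq_fun do rewrite mulrC; apply: test_smoothM => //.
exact: smooth_cst.
Qed.

Lemma test_shift V (f : V -> R) (a : V) : test_function f ->
  test_function (fun x => f (x - a)).
Proof.
move=> [sf [r fr]]; split.
  apply: (smooth_comp (L := id)) sf => [x|h v x]; last by rewrite addrA.
  by apply: cvgB; [exact: cvg_id|exact: cvg_cst].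
exists (r + `|a|) => x rx; apply: fr.
by rewrite (lt_le_trans _ (lerB_dist _ _))// ltrBrDr.
Qed.

Lemma derive_shiftf V (f : V -> R) (a x v : V) : smooth f ->
  'D_v (fun x => f (x - a)) x = 'D_v f (x - a).
Proof.
move=> sf; rewrite (derive_comp_line (L := id) (l := fun x => x - a))//.
by move=> h w y; rewrite addrA.
Qed.

End Smooth.

(** * Smooth bump functions *)

Section Bump.
Context {R : realType}.

(** The classical flat function exp(-1 / x), with the negative powers of x that its derivatives
    bring in: every derivative of [flat n] is a linear combination of members of this family. *)
Definition flat (n : nat) (x : R) : R :=
  if 0 < x then x ^- n * expR (- x^-1) else 0.

Lemma flat_ge0 n x : 0 <= flat n x.
Proof.
rewrite /flat; case: ifPn => // x0.
by rewrite mulr_ge0 ?expR_ge0// invr_ge0 exprn_ge0// ltW.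
Qed.

(** Keeps one term of the exponential series of 1 / x. The quadratic bound yields the derivative 0
    at the origin. *)
Lemma flat_le n x : flat n x <= (n.+2)`!%:R * x ^+ 2.
Proof.
rewrite /flat; case: ifPn => [x0|_]; last by rewrite mulr_ge0 ?sqr_ge0.
have xi : 0 < x^-1 by rewrite invr_gt0.
have := @expR_ge1Dxn R x^-1 n.+1 (ltW xi).
rewrite expRN => h; rewrite ler_pdivrMr ?expR_gt0//.
have f0 : 0 < (n.+2)`!%:R :> R by rewrite ltr0n fact_gt0.
have : x^-1 ^+ n.+2 / n.+2`!%:R <= expR x^-1 by rewrite (le_trans _ h)// lerDr.
rewrite ler_pdivrMr// mulrC => {h} h.
rewrite [leRHS]mulrAC -(@ler_pdivrMr _ (x ^+ 2)) ?exprn_gt0//.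
by rewrite (le_trans _ h)// exprVn -invfM -exprD addn2.
Qed.

Lemma flat_le1 x : flat 0 x <= 1.
Proof.
rewrite /flat; case: ifPn => // x0; rewrite expr0 invr1 mul1r -expR0 ler_expR.
by rewrite oppr_le0 invr_ge0 ltW.
Qed.

Lemma flat_derive n (x : R) : is_derive x (1 : R) (flat n)
  (flat n.+2 x - n%:R * flat n.+1 x).
Proof.
have [x0|x0|<-] := ltgtP 0 x.
- have E : {near x, (fun x => x ^- n * expR (- x^-1)) =1 flat n}.
    by near=> y; rewrite /flat ifT//; near: y; exact: lt_nbhsr.
  have xn : x != 0 by rewrite gt_eqF.
  have d1 : is_derive x (1 : R) (fun x => x ^- n * expR (- x^-1))
      (flat n.+2 x - n%:R * flat n.+1 x).
    have dV : is_derive x (1 : R) (fun x : R => x^-1) (- x ^- 2).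
      have := @is_derive_id R R x 1.
      move=> h; apply: DeriveDef; first exact: derivableV.
      by rewrite deriveV// derive_id [_ *: _]mulr1.
    have dX : is_derive x (1 : R) (fun x : R => x ^- n) (- (n%:R * x ^- n.+1)).
      rewrite (_ : (fun x : R => x ^- n) = (fun x : R => x^-1 ^+ n)); last first.
        by apply/funext => y; rewrite exprVn.
      have := @is_deriveX R R _ n x 1 _ dV; rewrite /GRing.scale /=.
      rewrite exprfctE => h; apply: (is_derive_eq h).
      case: n h {E} => [|n] _; first by rewrite !mul0r oppr0.
      by rewrite /= mulrN -mulrA exprVn -invfM -exprD addn2.
    have dE : is_derive x (1 : R) (fun x : R => expR (- x^-1)) (x ^- 2 * expR (- x^-1)).
      have dN : is_derive x (1 : R) (fun x : R => - x^-1) (x ^- 2).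
        by have := is_deriveN dV; rewrite opprK.
      have := @is_derive1_comp R expR (fun x => - x^-1) x _ _ (is_derive_expR _) dN.
      by rewrite mulrC.
    have := is_deriveM dX dE; rewrite /GRing.scale /=.
    move=> h; apply: (is_derive_eq h); rewrite /flat x0 !exprSr; field.
    by rewrite xn expf_neq0.
  case: d1 => d1 d1E; apply: DeriveDef; first exact: near_eq_derivable E d1.
  by rewrite -(near_eq_derive _ E) d1E.
- have E : {near x, cst 0 =1 flat n}.
    near=> y; rewrite /flat ifF//; apply/negbTE; rewrite -leNgt.
    by apply/ltW; near: y; exact: lt_nbhsl.
  have F m : flat m x = 0 by rewrite /flat ifF//; apply/negbTE; rewrite -leNgt ltW.
  apply: DeriveDef; first exact: near_eq_derivable E (derivable_cst _ _ _).
  by rewrite -(near_eq_derive _ E) derive_cst !F mulr0 subr0.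
- have F m : flat m 0 = 0 by rewrite /flat ltxx.
  rewrite !F mulr0 subr0.
  have h : (fun h => h^-1 *: (flat n (h *: (1 : R) + 0) - flat n 0)) @ (0 : R)^' --> (0 : R).
    apply/cvgr0Pnorm_le => /= e e0; near=> h.
    rewrite F subr0 addr0 [h *: 1]mulr1 normrM normfV.
    have hn : h != 0 by near: h; exact: nbhs_dnbhs_neq.
    rewrite ler_pdivrMl ?normr_gt0// ger0_norm ?flat_ge0//.
    apply: (le_trans (flat_le n h)); rewrite -real_normK ?num_real// expr2 mulrCA.
    rewrite ler_wpM2l// mulrC -ler_pdivlMr ?ltr0n ?fact_gt0//.
    near: h; apply: dnbhs0_le; rewrite divr_gt0// ltr0n fact_gt0.
  apply: DeriveDef; first by apply/cvg_ex; exists 0; exact: h.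
  exact: cvg_lim h.
Unshelve. all: by end_near. Qed.

Inductive flatgen : (R -> R) -> Prop :=
| flatgen_base n : flatgen (flat n)
| flatgen_lin (a b : R) f g : flatgen f -> flatgen g ->
    flatgen (fun x => a * f x + b * g x).

Lemma is_derive_dir (f : R -> R) (x v d : R) :
  is_derive x (1 : R) f d -> is_derive x v f (v * d).
Proof.
move=> fd; apply: is_derive_line.
have dg : is_derive (0 : R) (1 : R) (fun h : R => h *: v + x) v.
  by apply: trigger_derive; rewrite /GRing.scale /=; ring.
have fd' : is_derive ((0 : R) *: v + x) (1 : R) f d by rewrite scale0r add0r.
by have := @is_derive1_comp R f (fun h : R => h *: v + x) 0 _ _ fd' dg; rewrite mulrC.
Qed.

Lemma flatgen_derive f : flatgen f -> exists2 g, flatgen g &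
  forall x : R, is_derive x (1 : R) f (g x).
Proof.
elim=> {f} [m|a b f g _ [f' Cf df] _ [g' Cg dg]].
  exists (fun x => 1 * flat m.+2 x + (- m%:R) * flat m.+1 x).
    by apply: flatgen_lin; exact: flatgen_base.
  by move=> x; rewrite mul1r mulNr; exact: flat_derive.
exists (fun x => a * f' x + b * g' x); first exact: flatgen_lin.
by move=> x; have h1 := df x; have h2 := dg x; apply: trigger_derive.
Qed.

Lemma flat_smooth n : smooth (flat n).
Proof.
apply: smooth_coind (flatgen_base n) => f /flatgen_derive [g Cg df].
have dv x v : is_derive x v f (v * g x) by apply: is_derive_dir.
split; first exact: derive_continuous df.
  by move=> x v; case: (dv x v).
move=> v; rewrite (_ : 'D_v f = fun x => v * g x + 0 * g x); first exact: flatgen_lin.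
by apply/funext => x; rewrite mul0r addr0; case: (dv x v).
Qed.

Definition bump (n a b x : R) : R := flat 0 (n * (x - a)) * flat 0 (n * (b - x)).

Lemma bump_ge0 n a b x : 0 <= bump n a b x.
Proof. by rewrite mulr_ge0 ?flat_ge0. Qed.

Lemma bump_le1 n a b x : bump n a b x <= 1.
Proof. by rewrite mulr_ile1 ?flat_ge0 ?flat_le1. Qed.

Lemma bump_out n a b x : 0 <= n -> x \notin `]a, b[ -> bump n a b x = 0.
Proof.
move=> n0; rewrite in_itv/= negb_and -!leNgt => /orP[h|h].
- by rewrite /bump {1}/flat ifF ?mul0r//; apply/negbTE; rewrite -leNgt mulr_ge0_le0// subr_le0.
- by rewrite /bump {2}/flat ifF ?mulr0//; apply/negbTE; rewrite -leNgt mulr_ge0_le0// subr_le0.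
Qed.

Lemma bump_gt0 n a b x : 0 < n -> x \in `]a, b[ -> 0 < bump n a b x.
Proof.
move=> n0; rewrite in_itv/= => /andP[ax xb].
have E y : 0 < y -> 0 < flat 0 y.
  by move=> y0; rewrite /flat y0 expr0 invr1 mul1r expR_gt0.
by rewrite mulr_gt0 ?E ?mulr_gt0 ?subr_gt0.
Qed.

Lemma bump_test n a b : 0 <= n -> test_function (bump n a b).
Proof.
move=> n0; split.
  apply: smoothM.
    apply: (smooth_comp (L := fun v : R => n * v)) (flat_smooth 0) => [x|h v x].
      apply: cvgM; first exact: cvg_cst.
      by apply: (@cvgB _ R^o); [exact: cvg_id|exact: cvg_cst].
    by rewrite /GRing.scale /=; ring.
  apply: (smooth_comp (L := fun v : R => - n * v)) (flat_smooth 0) => [x|h v x].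
    apply: cvgM; first exact: cvg_cst.
    by apply: (@cvgB _ R^o); [exact: cvg_cst|exact: cvg_id].
  by rewrite /GRing.scale /=; ring.
exists (Num.max `|a| `|b|) => x; rewrite gt_max => /andP[ax bx].
apply: bump_out => //; rewrite in_itv/=; apply/negP => /andP[h1 h2].
have [x0|x0] := leP 0 x.
  by move: bx; rewrite (ger0_norm x0) ltNge (le_trans (ltW h2))// ler_norm.
move: ax; rewrite (ltr0_norm x0) ltNge; apply/negP; rewrite negbK.
by rewrite lerNl (le_trans _ (ltW h1))// lerNl -normrN ler_norm.
Qed.

Lemma bump_cvg a b x :
  bump n%:R a b x @[n --> \oo] --> (\1_(`]a, b[%classic) x : R).
Proof.
rewrite indicE; case: (boolP (x \in _)) => [|]; last first.
  rewrite notin_setE/= => /negP xab; apply: cvg_near_cst; apply: nearW => n.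
  by rewrite bump_out.
rewrite inE/= in_itv/= => /andP[ax xb].
have E y : 0 < y -> flat 0 (n%:R * y) @[n --> \oo] --> (1 : R).
  move=> y0; rewrite -cvg_shiftS /=.
  have h : - (n.+1%:R^-1 * y^-1) @[n --> \oo] --> - (0 * y^-1 : R).
    by apply: cvgN; apply: cvgM; [exact: cvg_harmonic|exact: cvg_cst].
  have := cvg_comp _ _ h (@continuous_expR R _).
  rewrite mul0r oppr0 expR0; apply: cvg_trans; apply: near_eq_cvg.
  apply: nearW => n /=; rewrite /flat mulr_gt0// expr0 invr1 mul1r.
  by rewrite invfM.
have := cvgM (E (x - a) _) (E (b - x) _); rewrite !subr_gt0 mulr1.
by apply.
Qed.

End Bump.

(** * Test functions in the plane and in space-time *)

Section TestPlane.
Context {R : realType}.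
Notation mu1 := (@leb1 R).
Notation mu2 := (@leb2 R).
Notation R2 := (R * R)%type.
Notation R12 := (R * (R * R))%type.

Lemma continuous_pairl (V W : normedModType R) (y : W) :
  continuous (fun x : V => (x, y)).
Proof. by move=> x; apply: (cvg_pair (F := nbhs x)); [exact: cvg_id|exact: cvg_cst]. Qed.

Lemma continuous_pairr (V W : normedModType R) (x : V) :
  continuous (fun y : W => (x, y)).
Proof. by move=> y; apply: (cvg_pair (F := nbhs y)); [exact: cvg_cst|exact: cvg_id]. Qed.

(** The sigma-algebra on the plane is the product one, so measurability is deduced from continuity
    in one variable and measurability in the other. *)
Lemma cont_meas2 (f : R2 -> R) : continuous f -> measurable_fun setT f.
Proof.
move=> cf; apply: caratheodory_meas => [y x|x].
  exact: (cvg_comp _ f (@continuous_pairl _ _ y x) (cf (x, y))).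
apply: continuous_measurable_fun => y.
exact: (cvg_comp _ f (@continuous_pairr _ _ x y) (cf (x, y))).
Qed.

Lemma cont_meas12 (f : R12 -> R) : continuous f -> measurable_fun setT f.
Proof.
move=> cf; apply: caratheodory_meas => [y x|x].
  exact: (cvg_comp _ f (@continuous_pairl _ _ y x) (cf (x, y))).
apply: cont_meas2 => y.
exact: (cvg_comp _ f (@continuous_pairr _ _ x y) (cf (x, y))).
Qed.

Lemma cube2E (r : R) : [set x : R2 | `|x| <= r] = `[- r, r]%classic `*` `[- r, r]%classic.
Proof.
apply/seteqP; split => x /=; rewrite !in_itv/= -!ler_norml.
  by rewrite prod_normE ge_max => /andP[].
by move=> [h1 h2]; rewrite prod_normE ge_max h1.
Qed.

Lemma cube12E (r : R) : [set x : R12 | `|x| <= r] =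
  `[- r, r]%classic `*` [set x : R2 | `|x| <= r].
Proof.
apply/seteqP; split => x /=; rewrite !in_itv/= -!ler_norml.
  by rewrite {1}prod_normE ge_max => /andP[].
by move=> [h1 h2]; rewrite prod_normE ge_max h1.
Qed.

Lemma cube2_compact (r : R) : compact [set x : R2 | `|x| <= r].
Proof. by rewrite cube2E; apply: compact_setX; exact: segment_compact. Qed.

Lemma cube12_compact (r : R) : compact [set x : R12 | `|x| <= r].
Proof.
rewrite cube12E; apply: compact_setX; first exact: segment_compact.
exact: cube2_compact.
Qed.

Lemma compact_bound (V : normedModType R) (A : set V) (f : V -> R) : compact A ->
  continuous f -> exists2 M : R, 0 < M & forall x, A x -> `|f x| <= M.
Proof.
move=> cA cf; have [M [_ hM]] := compact_bounded
  (continuous_compact (@continuous_subspaceT _ _ A _ cf) cA).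
exists (Num.max M 0 + 1); first by rewrite ltr_wpDl// le_max lexx orbT.
move=> x Ax; apply: hM; first by rewrite ltr_pwDr// le_max lexx.
by exists x.
Qed.

Lemma csupp_bound (V : normedModType R) (r : R) (f : V -> R) :
  compact [set x : V | `|x| <= r] -> continuous f -> (forall x, r < `|x| -> f x = 0) ->
  exists2 M : R, 0 < M & forall x, `|f x| <= M.
Proof.
move=> cr cf fr; have [M M0 fM] := compact_bound cr cf; exists M => // x.
have [xr|xr] := leP `|x| r; first exact: fM.
by rewrite fr// normr0 ltW.
Qed.

Lemma test2_bound (p : R2 -> R) : test_function p ->
  exists2 M : R, 0 < M & forall x, `|p x| <= M.
Proof.
move=> [sp [r pr]]; apply: csupp_bound pr; first exact: cube2_compact.
exact: smooth_cont.
Qed.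

Lemma test2_meas (p : R2 -> R) : test_function p -> measurable_fun setT p.
Proof. by move=> [sp _]; apply: cont_meas2; exact: smooth_cont. Qed.

Lemma measurable_cube2 (r : R) : measurable [set x : measurableTypeR R * measurableTypeR R | `|x : R2| <= r].
Proof. by rewrite cube2E; apply: measurableX; exact: measurable_itv. Qed.

Definition cube2 (r : R) (x : R2) : R := \1_[set x : R2 | `|x| <= r] x.

Lemma integ_cube2 (r : R) : integ mu2 (cube2 r).
Proof.
rewrite (_ : cube2 r = fun x => \1_(`[- r, r]%classic) x.1 * \1_(`[- r, r]%classic) x.2).
  exact: (Rint_tensor (m1 := mu1) (m2 := mu1)
    (integ_indic_itv _ _ _ _) (integ_indic_itv _ _ _ _)).1.
apply/funext => x; rewrite /cube2 cube2E !indicE in_setX.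
by case: (_ \in _); rewrite ?mul1r ?mul0r.
Qed.

Lemma test2_integ (p : R2 -> R) : test_function p -> integ mu2 p.
Proof.
move=> tp; have [M M0 pM] := test2_bound tp.
case: (tp) => sp [r pr].
apply: (le_integ (integZ M (integ_cube2 r))); first exact: test2_meas.
move=> x; rewrite /cube2 indicE; have [xr|xr] := leP `|x : R2| r.
  by rewrite mem_set// mulr1.
by rewrite memNset/= ?pr ?normr0 ?mulr0//; apply/negP; rewrite -ltNge.
Qed.

Lemma test_tensor2 (f g : R -> R) : test_function f -> test_function g ->
  test_function (fun x : R2 => f x.1 * g x.2).
Proof.
move=> [sf [r fr]] [sg [s gs]]; split.
  apply: smoothM.
    by apply: (smooth_comp (L := fst)) sf => // x; exact: cvg_fst.
  by apply: (smooth_comp (L := snd)) sg => // x; exact: cvg_snd.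
exists (Num.max r s) => x; rewrite prod_normE lt_max !gt_max.
by move=> /orP[/andP[/fr -> _]|/andP[_ /gs ->]]; rewrite ?mul0r ?mulr0.
Qed.

Lemma test_tensor12 (f : R -> R) (g : R2 -> R) : test_function f -> test_function g ->
  test_function (fun x : R12 => f x.1 * g x.2).
Proof.
move=> [sf [r fr]] [sg [s gs]]; split.
  apply: smoothM.
    by apply: (smooth_comp (L := fst)) sf => // x; exact: cvg_fst.
  by apply: (smooth_comp (L := snd)) sg => // x; exact: cvg_snd.
exists (Num.max r s) => x; rewrite {1}prod_normE lt_max !gt_max.
by move=> /orP[/andP[/fr -> _]|/andP[_ /gs ->]]; rewrite ?mul0r ?mulr0.
Qed.

End TestPlane.

(** * Fourier transforms of test functions *)

Section TestFourier.
Context {R : realType}.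
Notation mu1 := (@leb1 R).
Notation mu2 := (@leb2 R).
Notation R2 := (R * R)%type.
Implicit Types (x y z xi : R2) (f g h p q w : R2 -> R) (s : R).

Lemma d1_is_derive p (a b : R) : smooth p ->
  is_derive a (1 : R) (fun t : R => p (t, b)) (d1 p (a, b)).
Proof.
move=> sp; have := derive_line (smooth_is_derive (a, b) ((1, 0) : R2) sp).
move=> h; rewrite (_ : (fun t => _) = (fun h : R => p (h *: ((1, 0) : R2) + (a, b)))
    \o (fun t : R => t - a)); last first.
  apply/funext => t /=; congr (p (_, _)).
    by change (t = (t - a) * 1 + a); ring.
  by change (b = (t - a) * 0 + b); ring.
have dg : is_derive a (1 : R) (fun t : R => t - a) (1 : R).
  by apply: trigger_derive; rewrite subr0.
have h' : is_derive (a - a) (1 : R) (fun h : R => p (h *: ((1, 0) : R2) + (a, b))) (d1 p (a, b)).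
  by rewrite subrr.
by have := @is_derive1_comp R _ _ a _ _ h' dg; rewrite mulr1.
Qed.

Lemma d2_is_derive p (a b : R) : smooth p ->
  is_derive b (1 : R) (fun t : R => p (a, t)) (d2 p (a, b)).
Proof.
move=> sp; have := derive_line (smooth_is_derive (a, b) ((0, 1) : R2) sp).
move=> h; rewrite (_ : (fun t => _) = (fun h : R => p (h *: ((0, 1) : R2) + (a, b)))
    \o (fun t : R => t - b)); last first.
  apply/funext => t /=; congr (p (_, _)).
    by change (a = (t - b) * 0 + a); ring.
  by change (t = (t - b) * 1 + b); ring.
have dg : is_derive b (1 : R) (fun t : R => t - b) (1 : R).
  by apply: trigger_derive; rewrite subr0.
have h' : is_derive (b - b) (1 : R) (fun h : R => p (h *: ((0, 1) : R2) + (a, b))) (d2 p (a, b)).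
  by rewrite subrr.
by have := @is_derive1_comp R _ _ b _ _ h' dg; rewrite mulr1.
Qed.

Lemma test_d1 p : test_function p -> test_function (d1 p).
Proof. exact: test_derive. Qed.

Lemma test_d2 p : test_function p -> test_function (d2 p).
Proof. exact: test_derive. Qed.

Lemma normx1 x : `|x.1| <= `|x|. Proof. by rewrite prod_normE le_max lexx. Qed.
Lemma normx2 x : `|x.2| <= `|x|. Proof. by rewrite prod_normE le_max lexx orbT. Qed.

Lemma Rint_d1 p : test_function p -> \int[mu2]_x d1 p x = 0.
Proof.
move=> tp; have [sp [r pr]] := tp; have ti := test2_integ (test_d1 tp).
rewrite -(fubini2 ti).2 -(@Rint0 _ _ _ mu1); apply: Rint_eq => b.
apply: (RintT_derive_csupp (r := r) _ (fun a => d1_is_derive a b sp)) => [a|a ra].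
  have cp : continuous (d1 p) by exact: smooth_cont (smooth_derive _ sp).
  exact: (cvg_comp _ (d1 p) (@continuous_pairl R R R b a) (cp (a, b))).
by apply: pr; rewrite (lt_le_trans ra)// (normx1 (a, b)).
Qed.

Lemma Rint_d2 p : test_function p -> \int[mu2]_x d2 p x = 0.
Proof.
move=> tp; have [sp [r pr]] := tp; have ti := test2_integ (test_d2 tp).
rewrite -(fubini1 ti).2 -(@Rint0 _ _ _ mu1); apply: Rint_eq => a.
apply: (RintT_derive_csupp (r := r) _ (fun b => d2_is_derive a b sp)) => [b|b rb].
  have cp : continuous (d2 p) by exact: smooth_cont (smooth_derive _ sp).
  exact: (cvg_comp _ (d2 p) (@continuous_pairr R R R a b) (cp (a, b))).
by apply: pr; rewrite (lt_le_trans rb)// (normx2 (a, b)).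
Qed.

Lemma smooth_cs : smooth (@cos R) /\ smooth (@sin R).
Proof.
pose C (f : R -> R) := exists a b, f = fun x : R => a * cos x + b * sin x.
suff h (f : R -> R) : C f -> smooth f.
  split; apply: h.
    by exists 1, 0; apply/funext => x; rewrite mul1r mul0r addr0.
  by exists 0, 1; apply/funext => x; rewrite mul1r mul0r add0r.
apply: smooth_coind => {}f [a [b ->]].
have df (x : R) : is_derive x (1 : R) (fun x : R => a * cos x + b * sin x)
    (b * cos x + (- a) * sin x).
  by apply: trigger_derive; rewrite /GRing.scale /=; ring.
split; first exact: derive_continuous df.
  by move=> x v; case: (is_derive_dir v (df x)).
move=> v; exists (v * b), (v * - a); apply/funext => x /=.
by case: (is_derive_dir v (df x)) => _ ->; ring.
Qed.

Lemma continuous_ph xi : continuous (ph ^~ xi).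
Proof.
move=> x; rewrite /ph /dot; apply: cvgM; first exact: cvg_cst.
apply: (@cvgD _ R^o); apply: cvgM; try exact: cvg_cst.
  exact: cvg_fst.
exact: cvg_snd.
Qed.

Lemma phZ xi (h : R) (v x : R2) : ph (h *: v + x) xi = h *: ph v xi + ph x xi.
Proof.
change (2 * pi * ((h * v.1 + x.1) * xi.1 + (h * v.2 + x.2) * xi.2) =
  h * ph v xi + ph x xi).
by rewrite /ph /dot; ring.
Qed.

Lemma smooth_cosph xi : smooth (fun x => cos (ph x xi)).
Proof.
apply: (smooth_comp (L := ph ^~ xi)) smooth_cs.1; first exact: continuous_ph.
by move=> h v x; exact: phZ.
Qed.

Lemma smooth_sinph xi : smooth (fun x => sin (ph x xi)).
Proof.
apply: (smooth_comp (L := ph ^~ xi)) smooth_cs.2; first exact: continuous_ph.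
by move=> h v x; exact: phZ.
Qed.

Lemma derive_cosph xi x v : 'D_v (fun x => cos (ph x xi)) x = - (ph v xi * sin (ph x xi)).
Proof.
rewrite (derive_comp_line (L := ph ^~ xi)) ?smooth_cs.1//; last first.
- exact: smooth_cs.1.
- by move=> h w y; exact: phZ.
by case: (is_derive_dir (ph v xi) (is_derive_cos (ph x xi))) => _ ->; ring.
Qed.

Lemma derive_sinph xi x v : 'D_v (fun x => sin (ph x xi)) x = ph v xi * cos (ph x xi).
Proof.
rewrite (derive_comp_line (L := ph ^~ xi)); last first.
- exact: smooth_cs.2.
- by move=> h w y; exact: phZ.
by case: (is_derive_dir (ph v xi) (is_derive_sin (ph x xi))) => _ ->.
Qed.

(** The integral of D_v (p cos) is 0. That fact is a hypothesis, [int0], so that one proof serves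
    both coordinate directions. *)
Lemma fc_derive p xi v : (forall q, test_function q -> \int[mu2]_x 'D_v q x = 0) ->
  test_function p -> fc ('D_v p) xi = ph v xi * fs p xi.
Proof.
move=> int0 tp; have tq := test_smoothM tp (smooth_cosph xi).
have := int0 _ tq.
rewrite (Rint_eq mu2 (g := fun x => 'D_v p x * cos (ph x xi) -
    ph v xi * (p x * sin (ph x xi)))).
  have i1 := integ_cos xi (test2_integ (test_derive v tp)).
  have i2 := integ_sin xi (test2_integ tp).
  by rewrite RintB ?RintZ//; [move/eqP; rewrite subr_eq0 => /eqP|exact: integZ].
move=> x; rewrite deriveM; last 2 first.
- by case: tp => sp _; case: (smooth_is_derive x v sp).
- by case: (smooth_is_derive x v (smooth_cosph xi)).
by rewrite derive_cosph /GRing.scale /=; ring.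
Qed.

Lemma fs_derive p xi v : (forall q, test_function q -> \int[mu2]_x 'D_v q x = 0) ->
  test_function p -> fs ('D_v p) xi = - (ph v xi * fc p xi).
Proof.
move=> int0 tp; have tq := test_smoothM tp (smooth_sinph xi).
have := int0 _ tq.
rewrite (Rint_eq mu2 (g := fun x => 'D_v p x * sin (ph x xi) +
    ph v xi * (p x * cos (ph x xi)))).
  have i1 := integ_sin xi (test2_integ (test_derive v tp)).
  have i2 := integ_cos xi (test2_integ tp).
  by rewrite RintD ?RintZ//; [move/eqP; rewrite addr_eq0 => /eqP|exact: integZ].
move=> x; rewrite deriveM; last 2 first.
- by case: tp => sp _; case: (smooth_is_derive x v sp).
- by case: (smooth_is_derive x v (smooth_sinph xi)).
by rewrite derive_sinph /GRing.scale /=; ring.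
Qed.

Definition lap p : R2 -> R := fun x => d1 (d1 p) x + d2 (d2 p) x.
Definition om xi : R := 2 * pi * Num.sqrt (dot xi xi).

Lemma dot_ge0 xi : 0 <= dot xi xi.
Proof. by rewrite /dot addr_ge0// -expr2 sqr_ge0. Qed.

Lemma om_ge0 xi : 0 <= om xi.
Proof. by rewrite /om !mulr_ge0 ?sqrtr_ge0// pi_ge0. Qed.

Lemma om_sqr xi : om xi ^+ 2 = (2 * pi) ^+ 2 * dot xi xi.
Proof. by rewrite /om exprMn sqr_sqrtr ?dot_ge0. Qed.

Lemma meas_om : measurable_fun setT om.
Proof.
apply: measurable_funM => //; apply: (meas_comp (f := @Num.sqrt R)).
  by apply: continuous_measurable_fun; exact: sqrt_continuous.
by apply: measurable_funD; apply: measurable_funM; do ?[exact: measurable_fst|exact: measurable_snd].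
Qed.

Lemma test_lap p : test_function p -> test_function (lap p).
Proof. by move=> tp; apply: testD; do 2 apply: test_derive. Qed.

Lemma fcD f g xi : integ mu2 f -> integ mu2 g ->
  fc (fun x => f x + g x) xi = fc f xi + fc g xi.
Proof.
move=> fi gi; rewrite -RintD; [|exact: integ_cos|exact: integ_cos].
by apply: Rint_eq => x; rewrite mulrDl.
Qed.

Lemma fsD f g xi : integ mu2 f -> integ mu2 g ->
  fs (fun x => f x + g x) xi = fs f xi + fs g xi.
Proof.
move=> fi gi; rewrite -RintD; [|exact: integ_sin|exact: integ_sin].
by apply: Rint_eq => x; rewrite mulrDl.
Qed.

Lemma fc_d1 p xi : test_function p -> fc (d1 p) xi = 2 * pi * xi.1 * fs p xi.
Proof.
move=> tp; have -> : 2 * pi * xi.1 = ph (1, 0) xi by rewrite /ph /dot /=; ring.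
exact: (@fc_derive p xi ((1, 0) : R2) Rint_d1 tp).
Qed.

Lemma fs_d1 p xi : test_function p -> fs (d1 p) xi = - (2 * pi * xi.1 * fc p xi).
Proof.
move=> tp; have -> : 2 * pi * xi.1 = ph (1, 0) xi by rewrite /ph /dot /=; ring.
exact: (@fs_derive p xi ((1, 0) : R2) Rint_d1 tp).
Qed.

Lemma fc_d2 p xi : test_function p -> fc (d2 p) xi = 2 * pi * xi.2 * fs p xi.
Proof.
move=> tp; have -> : 2 * pi * xi.2 = ph (0, 1) xi by rewrite /ph /dot /=; ring.
exact: (@fc_derive p xi ((0, 1) : R2) Rint_d2 tp).
Qed.

Lemma fs_d2 p xi : test_function p -> fs (d2 p) xi = - (2 * pi * xi.2 * fc p xi).
Proof.
move=> tp; have -> : 2 * pi * xi.2 = ph (0, 1) xi by rewrite /ph /dot /=; ring.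
exact: (@fs_derive p xi ((0, 1) : R2) Rint_d2 tp).
Qed.

Lemma om_sqrE xi : om xi ^+ 2 = (2 * pi * xi.1) ^+ 2 + (2 * pi * xi.2) ^+ 2.
Proof. by rewrite om_sqr /dot; ring. Qed.

Lemma fc_lap p xi : test_function p -> fc (lap p) xi = - (om xi ^+ 2 * fc p xi).
Proof.
have alg (A1 A2 B1 B2 C a b : R) : A1 = a * B1 -> A2 = b * B2 -> B1 = - (a * C) ->
    B2 = - (b * C) -> A1 + A2 = - ((a ^+ 2 + b ^+ 2) * C) by move=> -> -> -> ->; ring.
move=> tp; have t1 := test_d1 tp; have t2 := test_d2 tp.
rewrite om_sqrE -(alg _ _ _ _ _ _ _ (fc_d1 xi t1) (fc_d2 xi t2) (fs_d1 xi tp) (fs_d2 xi tp)).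
by apply: fcD; apply: test2_integ; exact: test_derive.
Qed.

Lemma fs_lap p xi : test_function p -> fs (lap p) xi = - (om xi ^+ 2 * fs p xi).
Proof.
have alg (A1 A2 B1 B2 C a b : R) : A1 = - (a * B1) -> A2 = - (b * B2) -> B1 = a * C ->
    B2 = b * C -> A1 + A2 = - ((a ^+ 2 + b ^+ 2) * C) by move=> -> -> -> ->; ring.
move=> tp; have t1 := test_d1 tp; have t2 := test_d2 tp.
rewrite om_sqrE -(alg _ _ _ _ _ _ _ (fs_d1 xi t1) (fs_d2 xi t2) (fc_d1 xi tp) (fc_d2 xi tp)).
by apply: fsD; apply: test2_integ; exact: test_derive.
Qed.

Lemma test2_sqr p : test_function p -> integ mu2 (fun x => p x ^+ 2).
Proof. by move=> tp; apply: test2_integ; apply: test_smoothM tp tp.1. Qed.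

Lemma fc_sqr_integ g : integ mu2 g -> integ mu2 (fun x => g x ^+ 2) ->
  integ mu2 (fun xi => fc g xi ^+ 2).
Proof.
move=> gi g2; apply: (le_integ (plancherel_le gi g2).1).
  by apply: measurable_funX; exact: meas_fc (integ_meas gi).
by move=> xi; rewrite ger0_norm ?sqr_ge0// lerDl sqr_ge0.
Qed.

Lemma fs_sqr_integ g : integ mu2 g -> integ mu2 (fun x => g x ^+ 2) ->
  integ mu2 (fun xi => fs g xi ^+ 2).
Proof.
move=> gi g2; apply: (le_integ (plancherel_le gi g2).1).
  by apply: measurable_funX; exact: meas_fs (integ_meas gi).
by move=> xi; rewrite ger0_norm ?sqr_ge0// lerDr sqr_ge0.
Qed.

Lemma test_lipschitz p : test_function p -> exists2 L : R, 0 < L &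
  forall x y, `|p y - p x| <= L * (`|y.1 - x.1| + `|y.2 - x.2|).
Proof.
move=> tp; have [M1 M10 h1] := test2_bound (test_d1 tp).
have [M2 M20 h2] := test2_bound (test_d2 tp).
have lip (f df : R -> R) (M a b : R) : 0 < M ->
    (forall x : R, is_derive x (1 : R) f (df x)) ->
    (forall x : R, `|df x| <= M) -> `|f b - f a| <= M * `|b - a|.
  move=> M0 fd dM; wlog ab : a b / a <= b.
    move=> H; have [|/ltW] := leP a b; first exact: H.
    by move=> /H; rewrite distrC [`|a - b|]distrC.
  have [c _ ->] := MVT_segment ab (fun (t : R) _ => fd t)
    (continuous_subspaceT (derive_continuous fd)).
  by rewrite normrM ler_wpM2r.
exists (M1 + M2); first exact: addr_gt0.
move=> [x1 x2] [y1 y2] /=.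
rewrite (_ : _ - _ = (p (y1, y2) - p (x1, y2)) + (p (x1, y2) - p (x1, x2))); last by ring.
have H1 : `|p (y1, y2) - p (x1, y2)| <= M1 * `|y1 - x1|.
  exact: (lip (fun t => p (t, y2)) (fun t => d1 p (t, y2)) M1 x1 y1 M10
    (fun t => d1_is_derive t y2 tp.1)).
have H2 : `|p (x1, y2) - p (x1, x2)| <= M2 * `|y2 - x2|.
  exact: (lip (fun t => p (x1, t)) (fun t => d2 p (x1, t)) M2 x2 y2 M20
    (fun t => d2_is_derive x1 t tp.1)).
rewrite (le_trans (ler_normD _ _))//.
have := normr_ge0 (y1 - x1); have := normr_ge0 (y2 - x2).
move: H1 H2 M10 M20; move: `|y1 - x1| `|y2 - x2| => a b; nra.
Qed.

(** Half of the exponent absorbs |z|, because |z| exp(- z^2 / (4 s^2)) <= s by (|z| / 2 - s)^2 >= 0.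
    What remains is a normal density wider by the factor sqrt 2, so first moments reduce to total
    masses. *)
Lemma normal_absM s (z : R) : 0 < s ->
  `|z| * normal_pdf 0 s z <= 2 * s * normal_pdf 0 (Num.sqrt 2 * s) z.
Proof.
move=> s0; have q0 : 0 < Num.sqrt 2 * s by rewrite mulr_gt0// sqrtr_gt0.
rewrite !normal_pdfE ?gt_eqF// /normal_fun !subr0 exprMn sqr_sqrtr//.
have -> : normal_peak s = Num.sqrt 2 * normal_peak (Num.sqrt 2 * s).
  rewrite /normal_peak exprMn sqr_sqrtr//.
  have -> : 2 * s ^+ 2 * pi *+ 2 = 2 * (s ^+ 2 * pi *+ 2) :> R by ring.
  by rewrite sqrtrM// invfM mulrA divff ?mul1r// gt_eqF// sqrtr_gt0.
set P := normal_peak _; have P0 : 0 <= P by exact: normal_peak_ge0.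
set E := expR (- z ^+ 2 / (2 * s ^+ 2 *+ 2)).
have -> : expR (- z ^+ 2 / (s ^+ 2 *+ 2)) = E * E.
  rewrite /E -expRD; congr expR; field; rewrite gt_eqF//.
have E0 : 0 < E by exact: expR_gt0.
have zE : `|z| * E <= s.
  have := @expR_ge1Dx R (z ^+ 2 / (4 * s ^+ 2)).
  rewrite /E (_ : - z ^+ 2 / _ = - (z ^+ 2 / (4 * s ^+ 2))); last first.
    by field; rewrite gt_eqF.
  rewrite expRN ler_pdivrMr ?expR_gt0// => h.
  apply: (le_trans _ (ler_wpM2l (ltW s0) h)).
  rewrite -[z ^+ 2]real_normK ?num_real//; move: `|z| => a.
  rewrite (_ : s * _ = s + a ^+ 2 / (4 * s)); last by field; rewrite gt_eqF.
  have : 0 <= (a / 2 - s) ^+ 2 / s by rewrite divr_ge0 ?sqr_ge0 ?ltW.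
  rewrite (_ : _ / s = s + a ^+ 2 / (4 * s) - a); last by field; rewrite gt_eqF.
  by lra.
rewrite (_ : `|z| * _ = Num.sqrt 2 * ((`|z| * E) * (P * E))); last by ring.
have PE : 0 <= P * E by rewrite mulr_ge0// ltW.
have s2 : Num.sqrt 2 <= 2 :> R.
  by rewrite -[leRHS]ger0_norm// -sqrtr_sqr ler_sqrt//; lra.
have zE0 : 0 <= `|z| * E by rewrite mulr_ge0// ltW.
rewrite -[leRHS]mulrA; apply: ler_pM => //; first exact: mulr_ge0.
exact: ler_wpM2r.
Qed.

(** The error is at most L times the first moments of the kernel. In [k1] and [k2] the linear factor
    has been absorbed by widening one Gaussian; each has mass 1 and carries the factor 2 s, hence 4
    L s. *)
Lemma heat_lipschitz p (L s : R) x : 0 < s -> integ mu2 p -> 0 <= L ->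
  (forall y, `|p y - p x| <= L * (`|y.1 - x.1| + `|y.2 - x.2|)) ->
  `|\int[mu2]_y (p y * heat s (x - y)) - p x| <= 4 * L * s.
Proof.
move=> s0 ip L0 lip; set r := Num.sqrt 2 * s.
have r0 : 0 < r by rewrite mulr_gt0// sqrtr_gt0.
pose k1 y := normal_pdf x.1 r y.1 * normal_pdf x.2 s y.2.
pose k2 y := normal_pdf x.1 s y.1 * normal_pdf x.2 r y.2.
have K (a b : R) : integ mu2 (fun y => normal_pdf x.1 a y.1 * normal_pdf x.2 b y.2) /\
    \int[mu2]_y (normal_pdf x.1 a y.1 * normal_pdf x.2 b y.2) = 1.
  have := Rint_tensor (m1 := mu1) (m2 := mu1)
    (integrable_normal_pdf x.1 a) (integrable_normal_pdf x.2 b).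
  by rewrite !Rint_normal mulr1.
have [k1i k1E] : integ mu2 k1 /\ \int[mu2]_y k1 y = 1 := K r s.
have [k2i k2E] : integ mu2 k2 /\ \int[mu2]_y k2 y = 1 := K s r.
have hi := integ_heat x s0.
have phi : integ mu2 (fun y => p y * heat s (x - y)).
  under eq_fun do rewrite mulrC.
  apply: (integMb ip (M := normal_peak s * normal_peak s)); first exact: integ_meas hi.
  move=> y; rewrite ger0_norm ?heat_ge0// /heat.
  by rewrite ler_pM ?normal_pdf_ge0// normal_pdf_ub// gt_eqF.
have -> : \int[mu2]_y (p y * heat s (x - y)) - p x =
    \int[mu2]_y ((p y - p x) * heat s (x - y)).
  rewrite -[X in _ - X]mulr1 -(Rint_heat x s0) -RintZ// -RintB//; last exact: integZ.
  by apply: Rint_eq => y; rewrite mulrBl.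
apply: (@le_trans _ _ (\int[mu2]_y (L * (2 * s) * (k1 y + k2 y)))).
  apply: Rint_norm_le.
  - apply: measurable_funM; last exact: integ_meas hi.
    by apply: measurable_funB => //; exact: integ_meas ip.
  - by apply: integZ; exact: integD.
  - move=> y; rewrite normrM (ger0_norm (heat_ge0 _ _)).
    apply: (le_trans (ler_wpM2r (heat_ge0 _ _) (lip y))).
    have rn := lt0r_neq0 r0; have sn := lt0r_neq0 s0.
    rewrite /k1 /k2 -(normal_shift x.1 y.1 rn) -(normal_shift x.1 y.1 sn).
    rewrite -(normal_shift x.2 y.2 rn) -(normal_shift x.2 y.2 sn).
    rewrite -[leLHS]mulrA -[leRHS]mulrA ler_wpM2l// /heat /=.
    have A1 := normal_absM (x.1 - y.1) s0; have A2 := normal_absM (x.2 - y.2) s0.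
    rewrite [`|y.1 - _|]distrC [`|y.2 - _|]distrC.
    move: A1 A2; rewrite -/r; have := normal_pdf_ge0 0 s (x.1 - y.1).
    have := normal_pdf_ge0 0 s (x.2 - y.2).
    move: (normal_pdf 0 s (x.1 - y.1)) (normal_pdf 0 s (x.2 - y.2)).
    move: (normal_pdf 0 r (x.1 - y.1)) (normal_pdf 0 r (x.2 - y.2)).
    move=> b1 b2 a1 a2 a20 a10 A1 A2.
    have B1 := ler_wpM2r a20 A1; have B2 := ler_wpM2r a10 A2.
    move: B1 B2; clear; lra.
rewrite RintZ; last exact: integD.
by rewrite RintD// k1E k2E (_ : _ * _ = 4 * L * s)//; ring.
Qed.

Lemma heat_cvg p x : test_function p ->
  \int[mu2]_y (p y * heat n.+1%:R^-1 (x - y)) @[n --> \oo] --> p x.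
Proof.
move=> tp; have [L L0 lip] := test_lipschitz tp.
apply/cvgrPdist_le => /= e e0.
have h : (n.+1%:R : R)^-1 @[n --> \oo] --> 0 by exact: cvg_harmonic.
have e1 : 0 < e / (4 * L) by rewrite divr_gt0// mulr_gt0.
move/cvgr0Pnorm_le : h => /(_ _ e1); apply: filterS => n hn.
have s0 : 0 < (n.+1%:R : R)^-1 by rewrite invr_gt0.
rewrite distrC (le_trans (heat_lipschitz s0 (test2_integ tp) (ltW L0) (lip x)))//.
rewrite ger0_norm in hn; last exact: ltW.
by rewrite -ler_pdivlMl ?mulr_gt0// mulrC.
Qed.

(* Parseval's formula, for a transform that need not be integrable *)
Lemma parseval g p : integ mu2 g -> test_function p ->
  integ mu2 (fun xi => fc g xi * fc p xi) -> integ mu2 (fun xi => fs g xi * fs p xi) ->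
  integ mu2 (fun xi => fc g xi * fs p xi) -> integ mu2 (fun xi => fs g xi * fc p xi) ->
  \int[mu2]_xi (fc g xi * fc p xi + fs g xi * fs p xi) = \int[mu2]_x (g x * p x) /\
  \int[mu2]_xi (fs g xi * fc p xi - fc g xi * fs p xi) = 0.
Proof.
move=> gi tp cc ss cs sc; have ip := test2_integ tp.
have [M M0 pM] := test2_bound tp.
pose s_ (n : nat) : R := n.+1%:R^-1.
have s0 n : 0 < s_ n by rewrite invr_gt0.
pose A xi := fc g xi * fc p xi + fs g xi * fs p xi.
pose B xi := fs g xi * fc p xi - fc g xi * fs p xi.
have Ai : integ mu2 A by exact: integD.
have Bi : integ mu2 B by exact: integB.
have H (F : R2 -> R) : integ mu2 F ->
    \int[mu2]_xi (gam2 (s_ n) xi * F xi) @[n --> \oo] --> \int[mu2]_xi F xi.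
  move=> iF; apply: (Rint_lim (integ_norm iF)).
  - move=> n; apply: measurable_funM; last exact: integ_meas iF.
    exact: integ_meas (integ_gam2 (s0 n)).
  - exact: integ_meas iF.
  - apply: nearW => xi; have h := cvgM (gam2_cvg1 xi) (cvg_cst (F xi)).
    by rewrite mul1r in h; exact: h.
  - move=> n xi; rewrite normrM ler_piMl// ger0_norm ?gam2_le1// ltW// gam2_gt0//.
have P n c := @weighted_parseval R g p (gam2 (s_ n)) c
  (fun x y => cos c * heat (s_ n) (x - y)) gi ip (integ_gam2 (s0 n))
  (fun x y => gam2_cos (x - y) c (s0 n)).
split.
- apply: (cvg_unique _ (H _ Ai)) => //.
  have Q : \int[mu2]_x (g x * \int[mu2]_y (p y * heat (s_ n) (x - y))) @[n --> \oo] -->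
      \int[mu2]_x (g x * p x).
    apply: (Rint_lim (integZ M (integ_norm gi))).
    + move=> n; apply: measurable_funM; first exact: integ_meas gi.
      apply: (meas_Rint1 mu2 (f := fun z : R2 * R2 => p z.2 * heat (s_ n) (z.1 - z.2))).
      apply: measurable_funM; last exact: meas_heat.
      exact: meas_comp (integ_meas ip) (@measurable_snd _ _ _ _).
    + by apply: measurable_funM; [exact: integ_meas gi|exact: integ_meas ip].
    + apply: nearW => x; apply: cvgM; first exact: cvg_cst.
      exact: heat_cvg.
    + move=> n x; rewrite normrM mulrC ler_wpM2r//.
      rewrite -[M]mulr1 -(Rint_heat x (s0 n)) -RintZ; last exact: integ_heat.
      apply: Rint_norm_le; last 1 first.
      * by move=> y; rewrite normrM (ger0_norm (heat_ge0 _ _)) ler_wpM2r// heat_ge0.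
      * apply: measurable_funM; first exact: integ_meas ip.
        exact: integ_meas (integ_heat x (s0 n)).
      * by apply: integZ; exact: integ_heat.
  apply: cvg_trans Q; apply: near_eq_cvg; apply: nearW => n.
  have := P n 0; rewrite cos0 sin0 => E; rewrite (Rint_eq mu2 (g := fun x =>
    g x * \int[mu2]_y (p y * (1 * heat (s_ n) (x - y))))); last first.
    by move=> x; congr (_ * _); apply: Rint_eq => y; rewrite mul1r.
  by rewrite -E; apply: Rint_eq => xi; rewrite /A; ring.
- apply: (cvg_unique _ (H _ Bi)) => //; apply: cvg_near_cst; apply: nearW => n.
  (* With the phase - pi / 2 the weighted formula becomes its imaginary part, and the kernel cos c *
     heat vanishes. *)
  have := P n (- (pi / 2)); rewrite cosN sinN cos_pihalf sin_pihalf => E.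
  rewrite (Rint_eq mu2 (g := fun xi => gam2 (s_ n) xi *
    (0 * (fc g xi * fc p xi + fs g xi * fs p xi) -
     -1 * (fs g xi * fc p xi - fc g xi * fs p xi)))).
    rewrite E -[RHS](@Rint0 _ _ _ mu2); apply: Rint_eq => x.
    under eq_Rintegral do rewrite mul0r mulr0.
    by rewrite Rint0 mulr0.
  by move=> xi; rewrite /B; ring.
Qed.

End TestFourier.

Section MeasInv.
Context {R : realType}.

Lemma ae_impl d (T : measurableType d) (mu : {measure set T -> \bar R})
  (P Q : T -> Prop) : (forall x, P x -> Q x) ->
  {ae mu, forall x, P x} -> {ae mu, forall x, Q x}.
Proof. by move=> PQ; apply: filterS. Qed.

Lemma meas_inv : measurable_fun setT (fun x : R => x^-1).
Proof.
rewrite (_ : [set: R] = [set 0] `|` ~` [set 0]); last by rewrite setUv.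
apply/measurable_funU => //; first exact: measurableC.
split; first exact: measurable_fun_set1.
apply: open_continuous_measurable_fun; first exact/closed_openC/closed_eq.
by move=> x; rewrite inE/= => /eqP x0; exact: inv_continuous.
Qed.

End MeasInv.

(** * Divergence-free integrable fields *)

Section SingularKernel.
Context {R : realType}.
Notation mu := (@leb1 R).
Variables (s s' : R) (s0 : 0 < s) (ss : s < s').

Let s'0 : 0 < s'. Proof. exact: lt_trans ss. Qed.

(** A cutoff in [0, 1] away from both 0 and infinity: it vanishes at x = 0, decays at infinity, and
    tends to 1 at every x != 0 when s tends to 0 and s' to infinity. Thus [skern] is an integrable
    truncation of the principal value of 1 / x. *)
Definition band (s s' x : R) : R := gam s x - gam s' x.
Definition skern (s s' x : R) : R := band s s' x * x^-1.

Lemma band_ge0 x : 0 <= band s s' x.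
Proof.
rewrite /band subr_ge0 /gam /gss ler_expR lerN2 ler_wpM2r ?sqr_ge0//.
rewrite ler_wpM2l ?mulr_ge0 ?sqr_ge0 ?pi_ge0//.
by rewrite lerXn2r// ?nnegrE ltW.
Qed.

Lemma meas_band : measurable_fun setT (band s s').
Proof. by apply: measurable_funB; exact: integ_meas (integ_gam _). Qed.

Lemma meas_skern : measurable_fun setT (skern s s').
Proof. by apply: measurable_funM; [exact: meas_band|exact: meas_inv]. Qed.

(** Near 0 the quotient is tamed by 1 - exp(-y) <= y: with t' = 2 pi^2 s'^2 the band is at most t'
    x^2 [gam s x], so the kernel is dominated by a multiple of |x| [gam s x]. *)
Lemma integ_skern : integ mu (skern s s').
Proof.
pose t := 2 * pi ^+ 2 * s ^+ 2; pose t' := 2 * pi ^+ 2 * s' ^+ 2 : R.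
have t0 : 0 < t by rewrite !mulr_gt0 ?exprn_gt0 ?pi_gt0.
have H := integZ t' (integ_norm (integ_xgss t0)).
apply: (le_integ H); first exact: meas_skern.
move=> /= x; have [->|x0] := eqVneq (x : R) 0.
  by rewrite /skern invr0 mulr0 normr0 mul0r normr0 mulr0.
rewrite /skern normrM (ger0_norm (band_ge0 x)) normfV ler_pdivrMr ?normr_gt0//.
rewrite normrM (gtr0_norm (gss_gt0 _ _)).
have -> : t' * (`|x| * gss t x) * `|x| = t' * x ^+ 2 * gss t x.
  by rewrite -[x ^+ 2]real_normK ?num_real//; ring.
rewrite /band -/(gam s x) -/t; have [tx|tx] := leP (t' * x ^+ 2) 1; last first.
  have h1 : 0 < gam s x by exact: gam_gt0.
  have h2 : 0 < gam s' x by exact: gam_gt0.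
  have h3 := ler_wpM2r (ltW h1) (ltW tx).
  by rewrite mul1r in h3; move: h2 h3; clear; lra.
have h := @expR_ge1Dx R (- (t' * x ^+ 2)).
rewrite -/(gss t' x) -/(gam s' x) in h.
have h1 := gam_le1 s0 x; have h2 : 0 < gam s x by exact: gam_gt0.
have h4 : gam s x * (1 - t' * x ^+ 2) <= gam s' x.
  by apply: (le_trans _ h); rewrite ler_piMl// subr_ge0.
by rewrite mulrBr mulr1 in h4; rewrite lerBlDr addrC -lerBlDr [t' * _ * _]mulrC.
Qed.

Lemma Rint_skern : \int[mu]_x skern s s' x = 0.
Proof.
have h := Rint_oppr meas_skern.
have : \int[mu]_x skern s s' (- x) = - \int[mu]_x skern s s' x.
  rewrite -RintN; last exact: integ_skern.
  apply: Rint_eq => x; rewrite /skern invrN mulrN; congr (- (_ * _)).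
  by rewrite /band /gam /gss sqrrN.
by rewrite h => /eqP; rewrite -addr_eq0 -mulr2n mulrn_eq0 => /eqP.
Qed.

(** The sine transform of [skern s s'], a regularised version of pi sgn(a), which is the sine
    transform of 1 / x. *)
Definition sgker (s s' a : R) : R :=
  2 * pi * oint (fun y => normal_pdf 0 s y - normal_pdf 0 s' y) a.

(** Differentiation in a cancels the factor 1 / x and leaves a difference of two normal densities;
    the value at a = 0 vanishes because [skern] is odd. *)
Lemma skern_cos (a c : R) :
  \int[mu]_x (cos (2 * pi * a * x + c) * skern s s' x) = - (sin c * sgker s s' a).
Proof.
pose J a := \int[mu]_x (cos (2 * pi * a * x + c) * skern s s' x).
have mcos (b e : R) : measurable_fun setT (fun x : R => cos (b * x + e)).
  by apply: continuous_measurable_fun; exact: continuous_cosl.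
have msin (b e : R) : measurable_fun setT (fun x : R => sin (b * x + e)).
  by apply: continuous_measurable_fun; exact: continuous_sinl.
have ig := integ_gam s0; have ig' := integ_gam s'0.
have iband : integ mu (band s s') by exact: integB.
have dN (b : R) : \int[mu]_x (sin (2 * pi * b * x + c) * band s s' x) =
    sin c * (normal_pdf 0 s b - normal_pdf 0 s' b).
  have E t : sin (2 * pi * b * t + c) = cos (2 * pi * b * t + (c - pi / 2)).
    by rewrite addrA cosB cos_pihalf sin_pihalf; ring.
  have Ec : sin c = cos (c - pi / 2) by rewrite cosB cos_pihalf sin_pihalf; ring.
  rewrite (Rint_eq mu (g := fun x => cos (2 * pi * b * x + (c - pi / 2)) * gam s x -
      cos (2 * pi * b * x + (c - pi / 2)) * gam s' x)); last first.
    by move=> x; rewrite E /band mulrBr.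
  rewrite RintB; last 2 first.
  - exact: (integMb ig (mcos _ _) (fun=> cos_max _)).
  - exact: (integMb ig' (mcos _ _) (fun=> cos_max _)).
  by rewrite !gam_cos// -Ec mulrBr.
have dJ (b : R) : is_derive b (1 : R) J
    (- (2 * pi) * (sin c * (normal_pdf 0 s b - normal_pdf 0 s' b))).
  rewrite -dN -RintZ; last exact: (integMb iband (msin _ _) (fun=> sin_max _)).
  apply: (@Rint_derive _ _ _ mu _ _ (integZ (2 * pi) iband)
    (fun b x => - (2 * pi) * (sin (2 * pi * b * x + c) * band s s' x))) => [{}b|{}b x|{}b x].
  - exact: (integMb integ_skern (mcos _ _) (fun=> cos_max _)).
  - have [->|x0] := eqVneq (x : R) 0.
      rewrite /skern invr0 mulr0 /band /gam /gss expr0n/= !mulr0 subrr mulr0 mulr0.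
      by under eq_fun do rewrite mulr0; exact: is_derive_cst.
    have h : is_derive b (1 : R) (fun b => cos (2 * pi * b * x + c))
        (- (2 * pi * x * sin (2 * pi * b * x + c))).
      by move: (pi : R) => p; apply: trigger_derive; rewrite /GRing.scale /=; ring.
    have := @is_deriveM R R _ _ b 1 _ _ h (is_derive_cst (skern s s' x) b 1).
    rewrite scaler0 add0r => h'; apply: (is_derive_eq h').
    rewrite /GRing.scale /= /skern; move: (pi : R) (sin _) (band _ _ _) => p S B.
    by field.
  - rewrite normrM normrN (ger0_norm (mulr_ge0 _ (pi_ge0 R)))// ler_wpM2l ?mulr_ge0 ?pi_ge0//.
    by rewrite normrM (ger0_norm (band_ge0 x)) ler_piMl ?band_ge0// sin_max.
have cN (r : R) : 0 < r -> continuous (normal_pdf 0 r).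
  by move=> r0; apply: continuous_normal_pdf; rewrite gt_eqF.
have cD : continuous (fun y : R => normal_pdf 0 s y - normal_pdf 0 s' y).
  by move=> x; apply: (@cvgB _ R^o); exact: cN.
have dS (b : R) : is_derive b (1 : R) (fun b => J b + sin c * sgker s s' b) 0.
  have h1 := dJ b; have h2 := oint_derive b cD.
  rewrite /sgker; apply: trigger_derive; rewrite /GRing.scale /=.
  by move: (pi : R) (sin c) => p S; ring.
have := is_derive_0_is_cst a 0 dS.
rewrite {2}/sgker oint0 !mulr0 addr0 => /eqP; rewrite -/(J a) addrC.
have -> : J 0 = 0.
  rewrite /J (Rint_eq mu (g := fun x => cos c * skern s s' x)).
    by rewrite RintZ ?Rint_skern ?mulr0//; exact: integ_skern.
  by move=> x; rewrite mulr0 mul0r add0r.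
by rewrite addr_eq0 => /eqP ->; rewrite opprK.
Qed.

Lemma meas_sgker : measurable_fun setT (sgker s s').
Proof.
have cN (r : R) : 0 < r -> continuous (normal_pdf 0 r).
  by move=> r0; apply: continuous_normal_pdf; rewrite gt_eqF.
have cD : continuous (fun y : R => normal_pdf 0 s y - normal_pdf 0 s' y).
  by move=> x; apply: (@cvgB _ R^o); exact: cN.
apply: measurable_funM => //; apply: continuous_measurable_fun => x.
exact: (derive_continuous (fun y => oint_derive y cD)).
Qed.

(** The two densities have total mass 2, uniformly in s and s'. This crude bound is the source of
    the constant 4 = (4 pi)^2 / (2 pi)^2 in [divfree_energy]. *)
Lemma sgker_le a : `|sgker s s' a| <= 4 * pi.
Proof.
have I r : integ mu (normal_pdf 0 r) by exact: integrable_normal_pdf.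
have h : `|oint (fun y => normal_pdf 0 s y - normal_pdf 0 s' y) a| <= 2.
  have -> : 2 = \int[mu]_y (normal_pdf 0 s y + normal_pdf 0 s' y) :> R.
    by rewrite RintD// !Rint_normal.
  apply: Rint_norm_le.
  - apply: measurable_funM; first exact: measurable_sgi.
    by apply: measurable_funB; exact: measurable_normal_pdf.
  - exact: integD.
  - move=> y; rewrite normrM (le_trans (_ : _ <= 1 * `|normal_pdf 0 s y - normal_pdf 0 s' y|))//.
      by rewrite ler_wpM2r// sgi_le1.
    by rewrite mul1r (le_trans (ler_normB _ _))// !ger0_norm ?normal_pdf_ge0.
rewrite /sgker normrM (ger0_norm (mulr_ge0 _ (pi_ge0 R)))//.
apply: (le_trans (ler_wpM2l _ h)); first by rewrite mulr_ge0 ?pi_ge0.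
by move: (pi : R) => p; lra.
Qed.

End SingularKernel.

(** * Square integrability of the transform divided by the frequency *)

Section DivFree.
Context {R : realType}.
Notation mu1 := (@leb1 R).
Notation mu2 := (@leb2 R).
Notation R2 := (R * R)%type.
Implicit Types (xi : R2) (g : R2 -> R).

(** The integral over the second coordinate, with phase 2 pi z1 a, produces a sine in a; written as
    a cosine of phase pi / 2, it is again covered by [skern_cos]. *)
Lemma skern2_cos (s s' : R) (z : R2) : 0 < s -> s < s' ->
  integ mu2 (fun xi : R2 => skern s s' xi.1 * skern s s' xi.2) /\
  \int[mu2]_xi (cos (ph z xi + 0) * (skern s s' xi.1 * skern s s' xi.2)) =
  - (sgker s s' z.1 * sgker s s' z.2).
Proof.
move=> s0 ss; have ik := integ_skern s0 ss.
have i2 : integ mu2 (fun xi : R2 => skern s s' xi.1 * skern s s' xi.2).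
  exact: (Rint_tensor (m1 := mu1) (m2 := mu1) ik ik).1.
split => //.
have mi : integ mu2 (fun xi : R2 => cos (ph z xi + 0) * (skern s s' xi.1 * skern s s' xi.2)).
  apply: (integMb i2) => [|xi]; last exact: cos_max.
  by apply: meas_cos; apply: measurable_funD => //; exact: meas_phr.
have mcos (b e : R) : measurable_fun setT (fun x : R => cos (b * x + e)).
  by apply: continuous_measurable_fun; exact: continuous_cosl.
rewrite -(fubini1 mi).2 /=.
transitivity (\int[mu1]_a ((cos (2 * pi * z.1 * a + pi / 2) * skern s s' a) * sgker s s' z.2)).
  apply: Rint_eq => a.
  have -> : cos (2 * pi * z.1 * a + pi / 2) = - sin (2 * pi * z.1 * a).
    by rewrite cosD cos_pihalf sin_pihalf; ring.
  rewrite mulrAC mulNr -(skern_cos s0 ss z.2 (2 * pi * z.1 * a)) -RintZr; last first.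
    exact: (integMb ik (mcos _ _) (fun=> cos_max _)).
  apply: Rint_eq => b; rewrite /ph /dot /= addr0.
  rewrite (_ : 2 * pi * (z.1 * a + z.2 * b) = 2 * pi * z.2 * b + 2 * pi * z.1 * a); last by ring.
  by ring.
rewrite RintZr; last exact: (integMb ik (mcos _ _) (fun=> cos_max _)).
by rewrite skern_cos// sin_pihalf mul1r mulNr.
Qed.

Lemma ae_coord0 : {ae mu2, forall xi : R2, xi.1 != 0 /\ xi.2 != 0}.
Proof.
exists ([set 0 : R] `*` setT `|` setT `*` [set 0 : R]); split.
- by apply: measurableU; apply: measurableX.
- have Z (A B : set R) : measurable A -> measurable B -> (leb1 A * leb1 B = 0)%E ->
      mu2 (A `*` B) = 0%E by move=> mA mB h; rewrite /leb2 product_measure1E.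
  have z : @leb1 R [set 0] = 0%E by exact: lebesgue_measure_set1.
  rewrite null_set_setU//; try exact: measurableX.
    by apply: Z => //; rewrite z mul0e.
  by apply: Z => //; rewrite z mule0.
- move=> [a b] /= h; have [->|a0] := eqVneq a 0; first by left.
  by right; split => //; have [//|b0] := eqVneq b 0; case: h.
Qed.

Lemma band_cvg (x : R) : x != 0 -> band n.+2%:R^-1 n.+2%:R x @[n --> \oo] --> (1 : R).
Proof.
move=> x0.
have h1 : gam n.+2%:R^-1 x @[n --> \oo] --> (1 : R).
  by have := @gam_cvg1 R x; rewrite -(cvg_shiftS (fun n => gam n.+1%:R^-1 x)).
have h2 : gam n.+2%:R x @[n --> \oo] --> (0 : R).
  have h : (2 * pi ^+ 2 * x ^+ 2)^-1 * n.+2%:R^-1 @[n --> \oo] --> (2 * pi ^+ 2 * x ^+ 2)^-1 * 0.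
    apply: cvgM; first exact: cvg_cst.
    by have := @cvg_harmonic R; rewrite -cvg_shiftS.
  rewrite mulr0 in h; apply: squeeze_cvgr h; last exact: cvg_cst.
  apply: nearW => n; rewrite ltW ?gam_gt0//= /gam /gss expRN.
  have p0 : 0 < 2 * pi ^+ 2 * x ^+ 2 :> R.
    have h0 : 0 < x ^+ 2 by rewrite exprn_even_gt0.
    by apply: (mulr_gt0 _ h0); rewrite mulr_gt0 ?exprn_gt0 ?pi_gt0.
  rewrite -invfM lef_pV2 ?posrE ?expR_gt0//; last by rewrite mulr_gt0// ltr0n.
  apply: le_trans (expR_ge1Dx _).
  rewrite [2 * pi ^+ 2 * n.+2%:R ^+ 2 * x ^+ 2](_ : _ =
    (2 * pi ^+ 2 * x ^+ 2) * n.+2%:R * n.+2%:R); last by ring.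
  have : (1 : R) <= n.+2%:R by rewrite ler1n.
  have : 0 < (2 * pi ^+ 2 * x ^+ 2) * n.+2%:R by rewrite (mulr_gt0 p0)// ltr0n.
  move: (n.+2%:R : R) => b; move: (2 * pi ^+ 2 * x ^+ 2 * b) => a; clear; nra.
by have := cvgB h1 h2; rewrite subr0; exact.
Qed.

(* With |m|^2 = |g1^|^2 / xi2^2 = - Re (g1^ conj g2^) / (xi1 xi2), the weight
   1 / (xi1 xi2) has a bounded Fourier transform. *)
Lemma divfree_energy (g1 g2 : R2 -> R) : integ mu2 g1 -> integ mu2 g2 ->
  (forall xi, xi.1 * fc g1 xi + xi.2 * fc g2 xi = 0) ->
  (forall xi, xi.1 * fs g1 xi + xi.2 * fs g2 xi = 0) ->
  let E xi := (fc g1 xi ^+ 2 + fs g1 xi ^+ 2 + (fc g2 xi ^+ 2 + fs g2 xi ^+ 2)) / om xi ^+ 2 in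
  integ mu2 E /\ \int[mu2]_xi E xi <= 4 * (\int[mu2]_x `|g1 x| * \int[mu2]_x `|g2 x|).
Proof.
move=> i1 i2 hc hs E.
(* The shift by 2 makes s_ n < 1 < s'_ n strict from n = 0 on. *)
pose s_ (n : nat) : R := n.+2%:R^-1; pose s'_ (n : nat) : R := n.+2%:R.
have s0 n : 0 < s_ n by rewrite invr_gt0.
have ss n : s_ n < s'_ n by rewrite (@lt_le_trans _ _ 1) ?ler1n// invf_lt1// ltr1n.
pose w n (xi : R2) := skern (s_ n) (s'_ n) xi.1 * skern (s_ n) (s'_ n) xi.2.
have wi n : integ mu2 (w n) by have [] := skern2_cos 0 (s0 n) (ss n).
pose Q xi := fc g1 xi * fc g2 xi + fs g1 xi * fs g2 xi.
have q0 : 0 < (2 * pi) ^- 2 :> R by rewrite invr_gt0 exprn_gt0// mulr_gt0 ?pi_gt0.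
have QE n xi : xi.1 != 0 -> xi.2 != 0 -> (2 * pi) ^- 2 * - (w n xi * Q xi) =
    (band (s_ n) (s'_ n) xi.1 * band (s_ n) (s'_ n) xi.2) * E xi.
  move=> x1 x2; have c2 : fc g2 xi = - (xi.1 * fc g1 xi) / xi.2.
    apply: (mulfI x2); rewrite mulrCA divff// mulr1; apply/eqP.
    by rewrite -addr_eq0 addrC hc.
  have e2 : fs g2 xi = - (xi.1 * fs g1 xi) / xi.2.
    apply: (mulfI x2); rewrite mulrCA divff// mulr1; apply/eqP.
    by rewrite -addr_eq0 addrC hs.
  have p0 : (pi : R) != 0 by rewrite gt_eqF ?pi_gt0.
  have d0 : xi.1 ^+ 2 + xi.2 ^+ 2 != 0.
    by rewrite gt_eqF// addr_gt0// exprn_even_gt0.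
  rewrite /Q /E /w /skern om_sqr /dot c2 e2.
  move: (fc g1 xi) (fs g1 xi) (band _ _ xi.1) (band _ _ xi.2) => C S b1 b2.
  move: p0 x1 x2 d0; move: (pi : R) xi.1 xi.2 => p a b p0 a0 b0 d0.
  rewrite !expr2 in d0; field.
  by rewrite p0 a0 b0 d0.
have E0 xi : 0 <= E xi by rewrite divr_ge0 ?sqr_ge0// !addr_ge0 ?sqr_ge0.
have mE : measurable_fun setT E.
  apply: measurable_funM.
    by apply: measurable_funD; apply: measurable_funD; apply: measurable_funX;
      [exact: meas_fc (integ_meas i1)|exact: meas_fs (integ_meas i1)|
       exact: meas_fc (integ_meas i2)|exact: meas_fs (integ_meas i2)].
  apply: (meas_comp meas_inv); apply: measurable_funX; exact: meas_om.
have wQi n : integ mu2 (fun xi => w n xi * Q xi).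
  rewrite /Q; under eq_fun do rewrite mulrDr !mulrA.
  have mul2 (F G : R2 -> R) (M : R) : integ mu2 F -> measurable_fun setT G ->
    (forall xi, `|G xi| <= M) -> integ mu2 (fun xi => F xi * G xi).
    by move=> iF mG GM; under eq_fun do rewrite mulrC; apply: (integMb iF mG GM).
  apply: integD.
    apply: (mul2 _ _ (\int[mu2]_x `|g2 x|)); [exact: integ_fcM|exact: meas_fc (integ_meas i2)|].
    by move=> xi; exact: fc_le.
  apply: (mul2 _ _ (\int[mu2]_x `|g2 x|)); [exact: integ_fsM|exact: meas_fs (integ_meas i2)|].
  by move=> xi; exact: fs_le.
apply: (@Rint_fatou _ _ _ mu2 (fun n xi => (2 * pi) ^- 2 * - (w n xi * Q xi))).
- by move=> n; apply: integZ; apply: integN.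
(* On the coordinate axes the weight is 0, the inverse of 0 being 0; elsewhere [QE] exhibits a
   nonnegative expression. *)
- move=> n xi; have [x1|x1] := eqVneq xi.1 0.
    by rewrite /w x1 /skern invr0 mulr0 !mul0r oppr0 mulr0.
  have [x2|x2] := eqVneq xi.2 0.
    by rewrite /w x2 /skern invr0 !mulr0 !mul0r oppr0 mulr0.
  by rewrite QE// mulr_ge0 ?E0// mulr_ge0 ?band_ge0.
- exact: mE.
- exact: E0.
- apply: ae_impl ae_coord0 => xi [x1 x2].
  have h : (fun n => band (s_ n) (s'_ n) xi.1 * band (s_ n) (s'_ n) xi.2 * E xi) @ \oo
      --> 1 * 1 * E xi.
    by apply: cvgM; [apply: cvgM; exact: band_cvg|exact: cvg_cst].
  rewrite !mul1r in h; under eq_fun do rewrite QE//.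
  exact: h.
- move=> n.
  have P := @weighted_parseval R g1 g2 (w n) 0
    (fun x y => - (sgker (s_ n) (s'_ n) (x - y).1 * sgker (s_ n) (s'_ n) (x - y).2))
    i1 i2 (wi n) (fun x y => (skern2_cos (x - y) (s0 n) (ss n)).2).
  rewrite RintZ; last exact: integN.
  rewrite RintN//.
  rewrite (Rint_eq mu2 (g := fun xi => w n xi * (cos 0 * (fc g1 xi * fc g2 xi + fs g1 xi * fs g2 xi)
    - sin 0 * (fs g1 xi * fc g2 xi - fc g1 xi * fs g2 xi)))); last first.
    by move=> xi; rewrite /Q cos0 sin0 mul1r mul0r subr0.
  rewrite P; set I := Rintegral _ _ _.
  have K y x : `|sgker (s_ n) (s'_ n) (x - y).1 * sgker (s_ n) (s'_ n) (x - y).2| <= (4 * pi) ^+ 2.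
    by rewrite normrM expr2 ler_pM ?sgker_le.
  have B : `|I| <= \int[mu2]_x (`|g1 x| * ((4 * pi) ^+ 2 * \int[mu2]_y `|g2 y|)).
    apply: Rint_norm_le.
    - apply: measurable_funM; first exact: integ_meas i1.
      apply: (@meas_Rint1 _ _ _ _ _ mu2 (fun z : R2 * R2 => g2 z.2 *
        - (sgker (s_ n) (s'_ n) (z.1 - z.2).1 * sgker (s_ n) (s'_ n) (z.1 - z.2).2))).
      have m2 : measurable_fun setT (fun z : R2 * R2 => g2 z.2).
        by apply: (meas_comp (integ_meas i2)); exact: measurable_snd.
      apply: measurable_funM => //; apply: measurableT_comp => //.
      by apply: measurable_funM; apply: (meas_comp (meas_sgker (s0 n) (ss n)));
        apply: measurable_funB;
        do ?[exact: (meas_fst measurable_fst)|exact: (meas_fst measurable_snd)|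
             exact: (meas_snd measurable_fst)|exact: (meas_snd measurable_snd)].
    - by apply: integZr; exact: integ_norm.
    - move=> x; rewrite normrM ler_wpM2l//.
      rewrite -RintZ; last exact: integ_norm.
      have msg z : measurable_fun setT (fun y : R2 =>
        - (sgker (s_ n) (s'_ n) (z - y).1 * sgker (s_ n) (s'_ n) (z - y).2)).
        apply: measurableT_comp => //.
        by apply: measurable_funM; apply: (meas_comp (meas_sgker (s0 n) (ss n)));
          apply: measurable_funB.
      apply: Rint_norm_le.
      + exact: measurable_funM (integ_meas i2) (msg x).
      + by apply: integZ; exact: integ_norm.
      + by move=> y; rewrite normrM normrN mulrC ler_wpM2r.
  rewrite RintZr in B; last exact: integ_norm.
  have h : - I <= `|I| by rewrite ler_normr lexx orbT.
  apply: (le_trans (ler_wpM2l (ltW q0) (le_trans h B))).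
  have p0 : (pi : R) != 0 by rewrite gt_eqF ?pi_gt0.
  move: (pi : R) p0 (\int[mu2]_x `|g1 x|) (\int[mu2]_x `|g2 x|) => p p0 A C.
  by rewrite le_eqVlt; apply/orP; left; apply/eqP; field.
Qed.

End DivFree.

(** * The divergence condition in Fourier variables *)

Section Cutoff.
Context {R : realType}.
Notation mu2 := (@leb2 R).
Notation R2 := (R * R)%type.
Implicit Types (xi : R2).

Lemma deriveE (V W : normedModType R) (f : V -> W) x v d :
  is_derive x v f d -> 'D_v f x = d.
Proof. by case. Qed.

Definition beta (t : R) : R := bump 1 (-1) 1 t.

Lemma beta_test : test_function beta. Proof. exact: bump_test. Qed.

Lemma beta0_gt0 : 0 < beta 0.
Proof. by apply: bump_gt0 => //; rewrite in_itv/= ltr01 ltrN10. Qed.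

Lemma beta_out t : 1 < `|t| -> beta t = 0.
Proof.
move=> t1; apply: bump_out => //; rewrite in_itv/= negb_and -!leNgt.
by move: t1; rewrite lter_normr => /orP[/ltW ->|]; rewrite ?orbT// ltrNr => /ltW ->.
Qed.

Definition cut (k : R) (x : R2) : R := beta (k * x.1) * beta (k * x.2).

Lemma beta_scale_test (k : R) : 0 < k -> test_function (fun t => beta (k * t)).
Proof.
move=> k0; split.
  apply: (@smooth_comp _ _ _ beta (fun t => k * t) (fun t => k * t)).
  - exact: mulrl_continuous.
  - by move=> h v x; rewrite /GRing.scale /= mulrDr mulrCA.
  - by have [] := beta_test.
exists k^-1 => t kt; rewrite beta_out// normrM gtr0_norm//.
by rewrite mulrC -ltr_pdivrMr// mul1r.
Qed.

Lemma cut_test (k : R) : 0 < k -> test_function (cut k).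
Proof. by move=> k0; exact: (test_tensor2 (beta_scale_test k0) (beta_scale_test k0)). Qed.

Lemma cut_ge0 (k : R) x : 0 <= cut k x.
Proof. by rewrite mulr_ge0 ?bump_ge0. Qed.

Lemma cut_le1 (k : R) x : cut k x <= 1.
Proof. by rewrite mulr_ile1 ?bump_ge0 ?bump_le1. Qed.

Lemma cut_derive_le : exists2 M : R, 0 < M & forall (k : R) x, 0 < k ->
  `|d1 (cut k) x| <= M * k /\ `|d2 (cut k) x| <= M * k.
Proof.
have [sb _] := beta_test.
have bd t : is_derive t (1 : R) beta ('D_1 beta t) by exact: smooth_is_derive.
have cd : continuous ('D_(1 : R) beta) by apply: smooth_cont; exact: smooth_derive.
have [M M0 bM] := cont_itv_bounded 1 cd.
have {}bM t : `|'D_(1 : R) beta t| <= M.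
  have [/bM//|t1] := leP `|t| 1.
  by rewrite (derive_csupp bd beta_out t1) normr0 ltW.
have bd2 (k t : R) : is_derive t (1 : R) (fun t => beta (k * t)) (k * 'D_1 beta (k * t)).
  have h1 : is_derive t (1 : R) (fun t => k * t) k.
    by apply: trigger_derive; rewrite /GRing.scale /=; ring.
  have := @is_derive1_comp _ beta (fun t => k * t) t _ _ (bd (k * t)) h1.
  by rewrite mulrC; exact.
exists M => // k [a b] k0; have [sc _] := cut_test k0.
have b1 t : `|beta t| <= 1 by rewrite ger0_norm ?bump_ge0// bump_le1.
have H (x y : R) : `|x| <= M -> `|y| <= 1 -> `|k * x * y| <= M * k.
  move=> xM y1; rewrite !normrM (gtr0_norm k0) -mulrA mulrC ler_wpM2r ?(ltW k0)//.
  by rewrite -[leRHS]mulr1 ler_pM.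
split.
- have h1 := d1_is_derive a b sc.
  have h2 : is_derive a (1 : R) (fun t : R => cut k (t, b)) (k * 'D_1 beta (k * a) * beta (k * b)).
    have := @is_deriveM R R _ _ a 1 _ _ (bd2 k a) (is_derive_cst (beta (k * b)) a 1).
    by rewrite scaler0 add0r /GRing.scale /= [_ * (k * _)]mulrC.
  rewrite -(deriveE h1) (deriveE h2).
  exact: H.
- have h1 := d2_is_derive a b sc.
  have h2 : is_derive b (1 : R) (fun t : R => cut k (a, t)) (beta (k * a) * (k * 'D_1 beta (k * b))).
    have := @is_deriveM R R _ _ b 1 _ _ (is_derive_cst (beta (k * a)) b 1) (bd2 k b).
    by rewrite scaler0 addr0.
  rewrite -(deriveE h1) (deriveE h2).
  by rewrite mulrC; exact: H.
Qed.

Lemma cut_cvg x : cut n.+1%:R^-1 x @[n --> \oo] --> beta 0 ^+ 2.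
Proof.
have h (t : R) : beta (n.+1%:R^-1 * t) @[n --> \oo] --> beta 0.
  have h0 : n.+1%:R^-1 * t @[n --> \oo] --> 0 * t.
    by apply: cvgM; [exact: cvg_harmonic|exact: cvg_cst].
  rewrite mul0r in h0.
  by have [/smooth_cont cb _] := beta_test; exact: (cvg_comp _ _ h0 (cb 0)).
by rewrite expr2; apply: cvgM; exact: h.
Qed.

(** Sines and cosines are not compactly supported, so they have to be cut off. The gradient of
    [cut k] is O(k) and disappears in the limit k -> 0 against integrable g1 and g2, while [cut k]
    itself tends to the positive constant [beta 0 ^+ 2], which is divided out. *)
Lemma divfree_ext (g1 g2 phi : R2 -> R) (M : R) : integ mu2 g1 -> integ mu2 g2 ->
  (forall p, test_function p -> \int[mu2]_x (g1 x * d1 p x + g2 x * d2 p x) = 0) ->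
  smooth phi -> (forall x, `|phi x| <= 1) ->
  (forall x, `|d1 phi x| <= M) -> (forall x, `|d2 phi x| <= M) ->
  \int[mu2]_x (g1 x * d1 phi x + g2 x * d2 phi x) = 0.
Proof.
move=> i1 i2 df sp p1 pd1 pd2.
have [K K0 cK] := cut_derive_le.
have M0 : 0 <= M by exact: le_trans (pd1 0).
pose k n : R := n.+1%:R^-1; have k0 n : 0 < k n by rewrite invr_gt0.
have k1 n : k n <= 1 by rewrite invf_le1// ler1n.
pose psi n x := cut (k n) x * phi x.
have tp n : test_function (psi n) by exact: (test_smoothM (cut_test (k0 n)) sp).
have sM n x v : 'D_v (psi n) x = 'D_v (cut (k n)) x * phi x + cut (k n) x * 'D_v phi x.
  have [sc _] := cut_test (k0 n).
  have h := is_deriveM (smooth_is_derive x v sc) (smooth_is_derive x v sp).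
  by rewrite /psi (deriveE h) /GRing.scale /= addrC mulrC [X in _ + X]mulrC mulrC.
have mphi := cont_meas2 (smooth_cont sp).
have mcut n : measurable_fun setT (cut (k n)) by apply: test2_meas; exact: cut_test.
have mD v f : smooth f -> measurable_fun setT ('D_v f : R2 -> R).
  by move=> sf; apply: cont_meas2; apply: smooth_cont; exact: smooth_derive.
have bD (n : nat) x v : `|'D_v (cut (k n)) x| <= K * k n -> `|'D_v phi x| <= M ->
    `|'D_v (psi n) x| <= K + M.
  move=> h1 h2; rewrite sM (le_trans (ler_normD _ _))// lerD// normrM.
    rewrite -[leRHS]mulr1 ler_pM// (le_trans h1)// -[leRHS]mulr1 ler_wpM2l//.
    exact: ltW.
  by rewrite -[leRHS]mul1r ler_pM// ger0_norm ?cut_ge0 ?cut_le1.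
have cD x v : (forall n, `|'D_v (cut (k n)) x| <= K * k n) ->
    'D_v (psi n) x @[n --> \oo] --> beta 0 ^+ 2 * 'D_v phi x.
  move=> h; under eq_fun do rewrite sM.
  have h1 : cut (k n) x * 'D_v phi x @[n --> \oo] --> beta 0 ^+ 2 * 'D_v phi x.
    by apply: cvgM; [exact: cut_cvg|exact: cvg_cst].
  suff h2 : 'D_v (cut (k n)) x * phi x @[n --> \oo] --> (0 : R).
    by have := cvgD h2 h1; rewrite add0r; exact.
  have h0 : K * k n @[n --> \oo] --> K * 0.
    by apply: cvgM; [exact: cvg_cst|exact: cvg_harmonic].
  rewrite mulr0 in h0; apply/cvgr0Pnorm_le => e e0.
  move/cvgrPdist_le : h0 => /(_ e e0); apply: filterS => n; rewrite sub0r normrN => hn.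
  have Kk0 : 0 <= K * k n by rewrite mulr_ge0 ?ltW.
  rewrite ger0_norm// in hn; apply: le_trans hn.
  by rewrite normrM -[leRHS]mulr1 ler_pM.
have sc n : smooth (cut (k n)) by have [] := cut_test (k0 n).
have L : \int[mu2]_x (g1 x * d1 (psi n) x + g2 x * d2 (psi n) x) @[n --> \oo] -->
    \int[mu2]_x (g1 x * (beta 0 ^+ 2 * d1 phi x) + g2 x * (beta 0 ^+ 2 * d2 phi x)).
  apply: (Rint_lim (integZ (K + M) (integD (integ_norm i1) (integ_norm i2)))).
  - move=> n; apply: measurable_funD; apply: measurable_funM;
      do ?[exact: integ_meas i1|exact: integ_meas i2];
      by apply: mD; have [] := tp n.
  - apply: measurable_funD; apply: measurable_funM;
      do ?[exact: integ_meas i1|exact: integ_meas i2];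
      by apply: measurable_funM => //; exact: mD.
  - apply: (ae_impl (P := fun=> True)); last by apply/aeW.
    move=> x _.
    have c1 : d1 (psi n) x @[n --> \oo] --> beta 0 ^+ 2 * d1 phi x.
      by apply: cD => n; exact: (cK _ x (k0 n)).1.
    have c2 : d2 (psi n) x @[n --> \oo] --> beta 0 ^+ 2 * d2 phi x.
      by apply: cD => n; exact: (cK _ x (k0 n)).2.
    by apply: cvgD; (apply: cvgM; first exact: cvg_cst); [exact: c1|exact: c2].
  - move=> n x.
    have b1 : `|d1 (psi n) x| <= K + M by apply: bD; [exact: (cK _ x (k0 n)).1|exact: pd1].
    have b2 : `|d2 (psi n) x| <= K + M by apply: bD; [exact: (cK _ x (k0 n)).2|exact: pd2].
    rewrite mulrDr; apply: (le_trans (ler_normD _ _)).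
    by rewrite lerD// normrM mulrC ler_wpM2r.
have L0 : \int[mu2]_x (g1 x * (beta 0 ^+ 2 * d1 phi x) + g2 x * (beta 0 ^+ 2 * d2 phi x)) = 0.
  apply: (cvg_unique _ L) => //.
  rewrite (_ : (fun n => _) = (fun=> 0)); first exact: cvg_cst.
  by apply/funext => n; exact: df.
move: L0; rewrite (Rint_eq mu2 (g := fun x => beta 0 ^+ 2 * (g1 x * d1 phi x + g2 x * d2 phi x))); last first.
  by move=> x; ring.
rewrite RintZ; last first.
  apply: integD.
    by under eq_fun do rewrite mulrC; exact: (integMb i1 (mD _ _ sp) pd1).
  by under eq_fun do rewrite mulrC; exact: (integMb i2 (mD _ _ sp) pd2).
by move/eqP; rewrite mulf_eq0 expf_eq0/= gt_eqF ?beta0_gt0//= => /eqP.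
Qed.

(** The sine as test function yields the identity for cosine transforms, and the cosine that for
    sine transforms. *)
Lemma divfree_fourier (g1 g2 : R2 -> R) : integ mu2 g1 -> integ mu2 g2 ->
  (forall p, test_function p -> \int[mu2]_x (g1 x * d1 p x + g2 x * d2 p x) = 0) ->
  forall xi, xi.1 * fc g1 xi + xi.2 * fc g2 xi = 0 /\
             xi.1 * fs g1 xi + xi.2 * fs g2 xi = 0.
Proof.
move=> i1 i2 df xi.
have p0 : 2 * pi != 0 :> R by rewrite mulf_neq0// gt_eqF// pi_gt0.
have E1 : ph (1, 0) xi = 2 * pi * xi.1 :> R by rewrite /ph /dot /= mul1r mul0r addr0.
have E2 : ph (0, 1) xi = 2 * pi * xi.2 :> R by rewrite /ph /dot /= mul1r mul0r add0r.
have B (a b : R) : `|b| <= 1 -> `|2 * pi * a * b| <= `|2 * pi * a|.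
  by move=> b1; rewrite normrM ler_piMr.
pose M := `|2 * pi * xi.1| + `|2 * pi * xi.2|.
have ic1 := integ_cos xi i1; have ic2 := integ_cos xi i2.
have is1 := integ_sin xi i1; have is2 := integ_sin xi i2.
split; apply: (mulfI p0); rewrite mulr0.
- transitivity (\int[mu2]_x (g1 x * d1 (fun x => sin (ph x xi)) x + g2 x * d2 (fun x => sin (ph x xi)) x)).
    rewrite (Rint_eq mu2 (g := fun x => 2 * pi * xi.1 * (g1 x * cos (ph x xi)) +
        2 * pi * xi.2 * (g2 x * cos (ph x xi)))); last first.
      by move=> x; rewrite /d1 /d2 !derive_sinph E1 E2; ring.
    rewrite RintD ?RintZ//; do ?exact: integZ.
    by rewrite mulrDr !mulrA.
  apply: (divfree_ext (M := M) i1 i2 df (smooth_sinph xi) (fun=> sin_max _)) => x.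
    by rewrite /d1 derive_sinph E1 (le_trans (B _ _ (cos_max _)))// lerDl.
  by rewrite /d2 derive_sinph E2 (le_trans (B _ _ (cos_max _)))// lerDr.
- transitivity (- \int[mu2]_x (g1 x * d1 (fun x => cos (ph x xi)) x + g2 x * d2 (fun x => cos (ph x xi)) x)).
    rewrite (Rint_eq mu2 (g := fun x => - (2 * pi * xi.1 * (g1 x * sin (ph x xi)) +
        2 * pi * xi.2 * (g2 x * sin (ph x xi))))); last first.
      by move=> x; rewrite /d1 /d2 !derive_cosph E1 E2; ring.
    rewrite RintN ?opprK; last by apply: integD; exact: integZ.
    rewrite RintD ?RintZ//; do ?exact: integZ.
    by rewrite mulrDr !mulrA.
  rewrite (divfree_ext (M := M) i1 i2 df (smooth_cosph xi) (fun=> cos_max _)) ?oppr0// => x.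
    by rewrite /d1 derive_cosph E1 normrN (le_trans (B _ _ (sin_max _)))// lerDl.
  by rewrite /d2 derive_cosph E2 normrN (le_trans (B _ _ (sin_max _)))// lerDr.
Qed.

End Cutoff.

(** * Fourier transforms of square integrable functions *)

Section SquareComplete.
Context {R : realType} d (T : measurableType d).
Variable mu : {measure set T -> \bar R}.
Implicit Types f g h : T -> R.

Lemma lim_le (u : nat -> R) (l c : R) : u @ \oo --> l -> (forall n, u n <= c) -> l <= c.
Proof.
move=> ul uc; rewrite -(cvg_lim (@Rhausdorff R) ul).
by apply: limr_le; [exact: cvgP ul|exact: nearW].
Qed.

Lemma lim_uniq (u : nat -> R) (l m : R) : u @ \oo --> l -> u @ \oo --> m -> l = m.
Proof. by move=> ul um; exact: (cvg_unique _ ul um). Qed.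

Lemma geo_le2 k : \sum_(0 <= j < k) 2^-1 ^+ j <= 2 :> R.
Proof.
suff -> : \sum_(0 <= j < k) 2^-1 ^+ j = 2 - 2 * 2^-1 ^+ k :> R.
  by rewrite lerBlDr lerDl mulr_ge0// exprn_ge0// invr_ge0.
elim: k => [|k IH]; first by rewrite big_geq// expr0; ring.
by rewrite big_nat_recr//= IH exprS; field.
Qed.

Lemma geo_cauchy (u : nat -> R) (c : R) : 0 <= c ->
  (forall k, `|u k.+1 - u k| <= c * 2^-1 ^+ k) ->
  cvgn u /\ forall k, `|u k| <= `|u 0%N| + 2 * c.
Proof.
move=> c0 uc; split.
  have -> : u = (fun n => u 0%N + series (telescope u) n).
    by apply/funext => n; rewrite -eq_sum_telescope.
  apply: is_cvgD; first exact: is_cvg_cst.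
  apply: normed_cvg; apply: (@series_le_cvg _ _ (geometric c 2^-1)) => //.
  - by move=> n; rewrite /= normr_ge0.
  - by move=> n; rewrite /geometric /= mulr_ge0// exprn_ge0.
  - by apply: is_cvg_geometric_series; rewrite ger0_norm ?invr_ge0// invf_lt1// ltr1n.
move=> k; rewrite (eq_sum_telescope u) seriesEnat/=.
apply: (le_trans (ler_normD _ _)); rewrite lerD//.
apply: (le_trans (ler_norm_sum _ _ _)).
apply: (@le_trans _ _ (\sum_(0 <= j < k) c * 2^-1 ^+ j)).
  by apply: ler_sum => j _; exact: uc.
by rewrite -mulr_sumr mulrC ler_wpM2r// geo_le2.
Qed.

(** The Riesz-Fischer argument: rapidly decreasing differences give almost everywhere convergence
    together with a square integrable majorant. [h'] is h set to 0 on the null set where the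
    majorant is infinite. *)
Lemma square_complete (h : nat -> T -> R) : (forall k, measurable_fun setT (h k)) ->
  (forall k, integ mu (fun x => h k x ^+ 2)) ->
  (forall k, \int[mu]_x ((h k.+1 x - h k x) ^+ 2) <= (16%:R^-1) ^+ k) ->
  exists (a N : T -> R) (h' : nat -> T -> R),
    [/\ measurable_fun setT a /\ measurable_fun setT N, integ mu (fun x => N x ^+ 2),
      (forall k, measurable_fun setT (h' k) /\ {ae mu, forall x, h k x = h' k x}),
      (forall k x, `|h' k x| <= N x) & forall x, h' ^~ x @ \oo --> a x].
Proof.
move=> mh h2 hd.
have d2 k : integ mu (fun x => (h k.+1 x - h k x) ^+ 2).
  apply: (le_integ (integZ 2 (integD (h2 k.+1) (h2 k)))).
    by apply: measurable_funX; exact: measurable_funB.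
  move=> x; rewrite ger0_norm ?sqr_ge0//.
  by have := sqr_ge0 (h k.+1 x + h k x); move: (h k.+1 x) (h k x) => a b; lra.
(* The weight 4^k leaves summable integrals, 4^k / 16^k <= 2^-k, and turns finiteness of the sum S
   into |h k.+1 x - h k x| <= sqrt (S x) 2^-k. *)
pose e k x : \bar R := (4 ^+ k * (h k.+1 x - h k x) ^+ 2)%:E.
have e0 k x : (0 <= e k x)%E by rewrite lee_fin mulr_ge0 ?sqr_ge0// exprn_ge0.
have me k : measurable_fun setT (e k).
  by apply/measurable_EFinP; exact: integ_meas (integZ _ (d2 k)).
pose S x : \bar R := (\sum_(k <oo) e k x)%E.
have mS : measurable_fun setT S by exact: ge0_emeasurable_sum.
have S0 x : (0 <= S x)%E by apply: nneseries_ge0 => n _ _.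
have IS : (\int[mu]_x S x <= 2%:E)%E.
  rewrite integral_nneseries//.
  apply: lime_le; first by apply: is_cvg_nneseries => n _ _; exact: integral_ge0.
  apply: nearW => n; apply: (@le_trans _ _ (\sum_(0 <= k < n) (2^-1 ^+ k)%:E)%E).
    apply: lee_sum => k _; rewrite -EFin_Rint; last exact: integZ.
    rewrite lee_fin RintZ// (le_trans (ler_wpM2l _ (hd k))) ?exprn_ge0//.
    rewrite -exprMn lerXn2r// ?nnegrE ?divr_ge0//.
    by lra.
  by rewrite sumEFin lee_fin geo_le2.
have iS : mu.-integrable setT S.
  apply/integrableP; split => //; under eq_integral do rewrite gee0_abs//.
  exact: le_lt_trans IS (ltry _).
have [is_ _] := fine_ae_integ iS.
pose s x := fine (S x).
have s0 x : 0 <= s x by exact: fine_ge0.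
pose E := [set x | S x \is a fin_num].
have mE : measurable E by rewrite -[E]setTI; exact: emeasurable_fin_num.
pose h' k x := \1_E x * h k x.
have mh' k : measurable_fun setT (h' k) by exact: measurable_funM.
have aeE : {ae mu, forall x, E x}.
  by apply: ae_impl (integrable_ae measurableT iS) => x; exact.
have hd' k x : `|h' k.+1 x - h' k x| <= Num.sqrt (s x) * 2^-1 ^+ k.
  rewrite /h' -mulrBr normrM indicE; have [xE|xE] := boolP (x \in E); last first.
    by rewrite normr0 mul0r mulr_ge0 ?sqrtr_ge0// exprn_ge0.
  rewrite normr1 mul1r -(ler_pXn2r (n := 2))// ?nnegrE ?mulr_ge0 ?sqrtr_ge0 ?exprn_ge0//.
  rewrite exprMn sqr_sqrtr// real_normK ?num_real//.
  have h4 : e k x = (fine (e k x))%:E by [].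
  have : (e k x <= S x)%E.
    apply: (@le_trans _ _ (\sum_(0 <= j < k.+1) e j x)%E); last exact: nneseries_lim_ge.
    by rewrite big_nat_recr//= leeDr// sume_ge0.
  rewrite inE in xE; rewrite -(fineK xE) lee_fin -/(s x) => h5.
  have -> : (2^-1 ^+ k) ^+ 2 = (4 ^+ k)^-1 :> R.
    by rewrite -exprM mulnC exprM -exprVn; congr (_ ^+ k); field.
  by rewrite ler_pdivlMr ?exprn_gt0// mulrC.
have G x := geo_cauchy (sqrtr_ge0 (s x)) (fun k => hd' k x).
pose a x := limn (fun k => h' k x).
have ca x : h' ^~ x @ \oo --> a x by exact: (G x).1.
exists a, (fun x => `|h 0%N x| + 2 * Num.sqrt (s x)), h'; split.
- split; first exact: (measurable_fun_cvg mh' (fun x _ => ca x)).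
  apply: measurable_funD; first exact: measurableT_comp.
  apply: measurable_funM => //; apply: measurableT_comp; last exact: integ_meas is_.
  by apply: continuous_measurable_fun; exact: sqrt_continuous.
- apply: (le_integ (integD (integZ 2 (h2 0%N)) (integZ 8 is_))).
    apply: measurable_funX; apply: measurable_funD; first exact: measurableT_comp.
    apply: measurable_funM => //; apply: measurableT_comp; last exact: integ_meas is_.
    by apply: continuous_measurable_fun; exact: sqrt_continuous.
  move=> x; rewrite ger0_norm ?sqr_ge0//.
  have h3 : Num.sqrt (s x) ^+ 2 = s x by exact: sqr_sqrtr.
  have h4 := real_normK (num_real (h 0%N x)).
  rewrite -/(s x) -h4; have := sqr_ge0 (`|h 0%N x| - 2 * Num.sqrt (s x)).
  by move: h3; move: `|h 0%N x| (Num.sqrt (s x)) => p q <-; clear; lra.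
- move=> k; split => //; apply: ae_impl aeE => x xE.
  by rewrite /h' indicE mem_set// mul1r.
- move=> k x; apply: (le_trans ((G x).2 k)); rewrite lerD2r.
  by rewrite /h' normrM ler_piMl// indicE; case: (x \in E); rewrite ?normr1 ?normr0.
- exact: ca.
Qed.

Lemma square_weak_complete (h : nat -> T -> R) : (forall k, measurable_fun setT (h k)) ->
  (forall k, integ mu (fun x => h k x ^+ 2)) ->
  (forall k, \int[mu]_x ((h k.+1 x - h k x) ^+ 2) <= (16%:R^-1) ^+ k) ->
  exists a : T -> R, [/\ measurable_fun setT a, integ mu (fun x => a x ^+ 2) &
    forall w : T -> R, measurable_fun setT w -> integ mu (fun x => w x ^+ 2) ->
      \int[mu]_x (h k x * w x) @[k --> \oo] --> \int[mu]_x (a x * w x)].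
Proof.
move=> mh h2 hd; have [a [N [h' [[ma mN] N2 hh' hN ca]]]] := square_complete mh h2 hd.
have aN x : `|a x| <= N x.
  by apply: (lim_le (u := fun k => `|h' k x|)) => [|k]; [exact: cvg_norm|exact: hN].
have N0 x : 0 <= N x by exact: le_trans (aN x).
exists a; split => //.
  apply: (le_integ N2); first exact: measurable_funX.
  by move=> x; rewrite normrX lerXn2r ?nnegrE.
move=> w mw w2.
have iw : integ mu (fun x => N x * `|w x|).
  apply: integ_sqM => //; first exact: measurableT_comp.
  by apply: (eq_integ _ w2) => x; rewrite real_normK ?num_real.
rewrite (_ : (fun k => _) = fun k => \int[mu]_x (h' k x * w x)).
  apply: (Rint_lim iw).
  - by move=> k; apply: measurable_funM => //; exact: (hh' k).1.
  - exact: measurable_funM.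
  - apply: (ae_impl (P := fun=> True)); last exact: aeW.
    by move=> x _; apply: cvgM; [exact: ca|exact: cvg_cst].
  - by move=> k x; rewrite normrM ler_wpM2r.
apply/funext => k; apply: ae_eq_Rint.
- exact: measurable_funM.
- by apply: measurable_funM => //; exact: (hh' k).1.
- by apply: ae_impl (hh' k).2 => x ->.
Qed.

End SquareComplete.

Section SquareFourier.
Context {R : realType}.
Notation mu2 := (@leb2 R).
Notation R2 := (R * R)%type.
Implicit Types (g p : R2 -> R).

Lemma fcB f g xi : integ mu2 f -> integ mu2 g ->
  fc (fun x => f x - g x) xi = fc f xi - fc g xi.
Proof.
move=> fi gi; rewrite /fc -RintB; [|exact: integ_cos|exact: integ_cos].
by apply: Rint_eq => x; rewrite mulrBl.
Qed.

Lemma fsB f g xi : integ mu2 f -> integ mu2 g ->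
  fs (fun x => f x - g x) xi = fs f xi - fs g xi.
Proof.
move=> fi gi; rewrite /fs -RintB; [|exact: integ_sin|exact: integ_sin].
by apply: Rint_eq => x; rewrite mulrBl.
Qed.

Lemma integ_sqM2 (f g : R2 -> R) : measurable_fun setT f -> measurable_fun setT g ->
  integ mu2 (fun x => f x ^+ 2) -> integ mu2 (fun x => g x ^+ 2) ->
  integ mu2 (fun x => f x * g x).
Proof. by move=> mf mg f2 g2; apply: (@integ_sqM R _ _ mu2 f g mf mg f2 g2). Qed.

Definition trunc g (n : nat) (x : R2) : R := cube2 n%:R x * g x.

Lemma cube2_01 (r : R) x : cube2 r x = 0 \/ cube2 r x = 1.
Proof. by rewrite /cube2 indicE; case: (_ \in _); [right|left]. Qed.

Lemma meas_cube2 (r : R) : measurable_fun setT (@cube2 R r).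
Proof. exact: integ_meas (integ_cube2 r). Qed.

Lemma cube2_cvg (n_ : nat -> nat) (x : R2) : (forall k, (k <= n_ k)%N) ->
  \forall k \near \oo, cube2 (n_ k)%:R x = 1.
Proof.
move=> nk; near=> k; rewrite /cube2 indicE mem_set//=.
have : `|x| <= k%:R by near: k; exact: nbhs_infty_ger.
by move/le_trans; apply; rewrite ler_nat.
Unshelve. all: by end_near. Qed.

Lemma trunc_integ g n : measurable_fun setT g -> integ mu2 (fun x => g x ^+ 2) ->
  [/\ measurable_fun setT (trunc g n), integ mu2 (trunc g n) &
      integ mu2 (fun x => trunc g n x ^+ 2)].
Proof.
move=> mg g2; have mt : measurable_fun setT (trunc g n).
  by apply: measurable_funM => //; exact: meas_cube2.
split => //.
  apply: (le_integ (integD g2 (integ_cube2 n%:R)) mt) => x.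
  rewrite /trunc; case: (cube2_01 n%:R x) => ->; rewrite ?mul0r ?normr0 ?addr0 ?sqr_ge0// mul1r.
  by rewrite -(real_normK (num_real (g x))); have := sqr_ge0 (`|g x| - 2^-1); lra.
apply: (le_integ g2); first exact: measurable_funX.
move=> x; rewrite ger0_norm ?sqr_ge0// /trunc.
by case: (cube2_01 n%:R x) => ->; rewrite ?mul0r ?expr0n ?sqr_ge0 ?mul1r.
Qed.

Lemma trunc_cvg g w (n_ : nat -> nat) : measurable_fun setT g -> measurable_fun setT w ->
  (forall k, (k <= n_ k)%N) -> integ mu2 (fun x => g x * w x) ->
  \int[mu2]_x (trunc g (n_ k) x * w x) @[k --> \oo] --> \int[mu2]_x (g x * w x).
Proof.
move=> mg mw nk gw; apply: (Rint_lim (integ_norm gw)).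
- move=> k; apply: measurable_funM => //; apply: measurable_funM => //; exact: meas_cube2.
- exact: measurable_funM.
- apply: (ae_impl (P := fun=> True)); last exact: aeW.
  move=> x _; apply: cvg_near_cst.
  by apply: filterS (cube2_cvg x nk) => k h; rewrite /trunc h mul1r.
- move=> k x; rewrite /trunc.
  by case: (cube2_01 (n_ k)%:R x) => ->; rewrite ?mul0r ?normr0 ?mul1r.
Qed.

Lemma trunc_tail g : measurable_fun setT g -> integ mu2 (fun x => g x ^+ 2) ->
  \int[mu2]_x ((g x - trunc g n x) ^+ 2) @[n --> \oo] --> (0 : R).
Proof.
move=> mg g2; rewrite -[X in _ --> X](Rint0 mu2); apply: (Rint_lim g2).
- move=> k; apply: measurable_funX; apply: measurable_funB => //.
  by apply: measurable_funM => //; exact: meas_cube2.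
- exact: measurable_cst.
- apply: (ae_impl (P := fun=> True)); last exact: aeW.
  move=> x _; apply: cvg_near_cst.
  apply: filterS (@cube2_cvg id x (fun=> leqnn _)) => k h.
  by rewrite /trunc h mul1r subrr expr0n.
- move=> k x; rewrite ger0_norm ?sqr_ge0// /trunc.
  by case: (cube2_01 k%:R x) => ->; rewrite ?mul0r ?subr0 ?mul1r ?subrr ?expr0n ?sqr_ge0.
Qed.

(** g need not be integrable. Its cosine and sine transforms a and b are the L^2 limits of those of
    its truncations to cubes, along indices that grow fast enough for [square_complete]. All
    identities are limits of those for truncations. *)
Lemma square_fourier g : measurable_fun setT g -> integ mu2 (fun x => g x ^+ 2) ->
  exists a b : R2 -> R,
  [/\ measurable_fun setT a /\ measurable_fun setT b,
      integ mu2 (fun x => a x ^+ 2) /\ integ mu2 (fun x => b x ^+ 2),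
      \int[mu2]_x (a x ^+ 2) + \int[mu2]_x (b x ^+ 2) <= \int[mu2]_x (g x ^+ 2) &
      forall p, test_function p ->
      [/\ \int[mu2]_x (g x * fc p x) = \int[mu2]_x (a x * p x),
          \int[mu2]_x (g x * fs p x) = \int[mu2]_x (b x * p x),
          \int[mu2]_x (a x * fc p x) + \int[mu2]_x (b x * fs p x) = \int[mu2]_x (g x * p x) &
          \int[mu2]_x (a x * fs p x) = \int[mu2]_x (b x * fc p x)]].
Proof.
move=> mg g2.
(* The factor 2^-1 makes two consecutive tails add up to at most 16^-k. *)
have /choice[n_ nP] k : exists n, (k <= n)%N /\
    \int[mu2]_x ((g x - trunc g n x) ^+ 2) <= 2^-1 * (16%:R^-1) ^+ k.
  have e0 : 0 < 2^-1 * (16%:R^-1) ^+ k :> R by rewrite mulr_gt0// exprn_gt0.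
  have /cvgrPdist_le /(_ _ e0)[N _ hN] := trunc_tail mg g2.
  exists (maxn N k); split; first exact: leq_maxr.
  have := hN (maxn N k) (leq_maxl _ _); rewrite /= sub0r normrN; apply: le_trans.
  exact: ler_norm.
pose G k := trunc g (n_ k).
have mG k : measurable_fun setT (G k) by have [] := trunc_integ (n_ k) mg g2.
have iG k : integ mu2 (G k) by have [] := trunc_integ (n_ k) mg g2.
have iG2 k : integ mu2 (fun x => G k x ^+ 2) by have [] := trunc_integ (n_ k) mg g2.
have iD k : integ mu2 (fun x => G k.+1 x - G k x) by exact: integB.
have tail2 k : integ mu2 (fun x => (g x - G k x) ^+ 2).
  apply: (le_integ g2).
    exact: (measurable_funX 2 (measurable_funB mg (mG k))).
  move=> x; rewrite ger0_norm ?sqr_ge0// /G /trunc.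
  by case: (cube2_01 (n_ k)%:R x) => ->; rewrite ?mul0r ?subr0 ?mul1r ?subrr ?expr0n ?sqr_ge0.
have iD2 k : integ mu2 (fun x => (G k.+1 x - G k x) ^+ 2) /\
    \int[mu2]_x ((G k.+1 x - G k x) ^+ 2) <= (16%:R^-1) ^+ k.
  have D x : (G k.+1 x - G k x) ^+ 2 <= (g x - G k.+1 x) ^+ 2 + (g x - G k x) ^+ 2.
    rewrite /G /trunc; have h0 := sqr_ge0 (g x).
    by case: (cube2_01 (n_ k)%:R x) => ->; case: (cube2_01 (n_ k.+1)%:R x) => ->;
      rewrite ?mul0r ?mul1r ?subr0 ?subrr ?sub0r ?sqrrN ?expr0n/= ?addr0 ?add0r; lra.
  have iT := integD (tail2 k.+1) (tail2 k).
  have i2 : integ mu2 (fun x => (G k.+1 x - G k x) ^+ 2).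
    apply: (le_integ iT).
      exact: (measurable_funX 2 (measurable_funB (mG k.+1) (mG k))).
    by move=> x; rewrite ger0_norm ?sqr_ge0.
  split => //; apply: (le_trans (Rint_le i2 iT D)); rewrite RintD//.
  apply: (le_trans (lerD (nP k.+1).2 (nP k).2)); rewrite exprS.
  by have : 0 <= (16%:R^-1) ^+ k :> R by [rewrite exprn_ge0]; lra.
have P k := plancherel_le (iD k) (iD2 k).1.
have dc k : \int[mu2]_xi ((fc (G k.+1) xi - fc (G k) xi) ^+ 2) <= (16%:R^-1) ^+ k.
  apply: le_trans (iD2 k).2; apply: le_trans (P k).2.
  apply: Rint_le => [||xi]; last by rewrite fcB// lerDl sqr_ge0.
    apply: (eq_integ _ (fc_sqr_integ (iD k) (iD2 k).1)) => xi; by rewrite fcB.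
  exact: (P k).1.
have ds k : \int[mu2]_xi ((fs (G k.+1) xi - fs (G k) xi) ^+ 2) <= (16%:R^-1) ^+ k.
  apply: le_trans (iD2 k).2; apply: le_trans (P k).2.
  apply: Rint_le => [||xi]; last by rewrite fsB// lerDr sqr_ge0.
    apply: (eq_integ _ (fs_sqr_integ (iD k) (iD2 k).1)) => xi; by rewrite fsB.
  exact: (P k).1.
have mc k : measurable_fun setT (fc (G k)) by exact: meas_fc.
have ms k : measurable_fun setT (fs (G k)) by exact: meas_fs.
have ic k := fc_sqr_integ (iG k) (iG2 k).
have is_ k := fs_sqr_integ (iG k) (iG2 k).
have [a [ma a2 aw]] := @square_weak_complete R _ _ mu2 (fun k => fc (G k)) mc ic dc.
have [b [mb b2 bw]] := @square_weak_complete R _ _ mu2 (fun k => fs (G k)) ms is_ ds.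
exists a, b; split; [by split|by split| |].
  have L : \int[mu2]_x (fc (G k) x * a x) + \int[mu2]_x (fs (G k) x * b x) @[k --> \oo] -->
    \int[mu2]_x (a x * a x) + \int[mu2]_x (b x * b x) by exact: cvgD (aw _ ma a2) (bw _ mb b2).
  (* The norm of a weak limit is bounded through 2 <V_k, V> <= |V_k|^2 + |V|^2; once k tends to
     infinity, the second square is absorbed by the left side. *)
  have B : \int[mu2]_x (a x * a x) + \int[mu2]_x (b x * b x) <=
    2^-1 * \int[mu2]_x (g x ^+ 2) + 2^-1 * (\int[mu2]_x (a x ^+ 2) + \int[mu2]_x (b x ^+ 2)).
    apply: (lim_le L) => k.
    have [i1 l1] := plancherel_le (iG k) (iG2 k).
    have l2 : \int[mu2]_x (G k x ^+ 2) <= \int[mu2]_x (g x ^+ 2).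
      apply: Rint_le => // x; rewrite /G /trunc.
      by case: (cube2_01 (n_ k)%:R x) => ->; rewrite ?mul0r ?mul1r ?expr0n ?sqr_ge0.
    have ica := integ_sqM2 (mc k) ma (ic k) a2; have isb := integ_sqM2 (ms k) mb (is_ k) b2.
    have i3 := integD ica isb.
    have i4 := integD (integZ 2^-1 i1) (integZ 2^-1 (integD a2 b2)).
    rewrite -(RintD ica isb).
    apply: (@le_trans _ _ (\int[mu2]_x (2^-1 * (fc (G k) x ^+ 2 + fs (G k) x ^+ 2) +
      2^-1 * (a x ^+ 2 + b x ^+ 2)))).
      apply: (Rint_le i3 i4) => x.
      have := sqr_ge0 (fc (G k) x - a x); have := sqr_ge0 (fs (G k) x - b x).
      by move: (fc (G k) x) (fs (G k) x) (a x) (b x) => p q r s; clear; lra.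
    rewrite (RintD (integZ 2^-1 i1) (integZ 2^-1 (integD a2 b2))).
    rewrite (RintZ _ i1) (RintZ _ (integD a2 b2)) (RintD a2 b2) lerD2r ler_wpM2l//.
    exact: le_trans l2.
  have Ea : \int[mu2]_x (a x * a x) = \int[mu2]_x (a x ^+ 2) by exact: Rint_eq.
  have Eb : \int[mu2]_x (b x * b x) = \int[mu2]_x (b x ^+ 2) by exact: Rint_eq.
  by move: B; rewrite Ea Eb; lra.
move=> p tp.
have mp := test2_meas tp; have p2 := test2_sqr tp; have ip := test2_integ tp.
have mpc := meas_fc mp; have mps := meas_fs mp.
have pc2 := fc_sqr_integ ip p2; have ps2 := fs_sqr_integ ip p2.
have nk k := (nP k).1.
have gpc := integ_sqM2 mg mpc g2 pc2; have gps := integ_sqM2 mg mps g2 ps2.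
have gp := integ_sqM2 mg mp g2 p2.
split.
- apply: (cvg_unique _ (trunc_cvg mg mpc nk gpc)) => //.
  rewrite (_ : (fun k => _) = fun k => \int[mu2]_x (fc (G k) x * p x)); first exact: aw.
  apply/funext => k; rewrite -/(G k) [RHS](Rint_eq mu2 (g := fun x => p x * fc (G k) x)).
    by rewrite Rint_fcM//; apply: Rint_eq => x; rewrite mulrC.
  by move=> x; rewrite mulrC.
- apply: (cvg_unique _ (trunc_cvg mg mps nk gps)) => //.
  rewrite (_ : (fun k => _) = fun k => \int[mu2]_x (fs (G k) x * p x)); first exact: bw.
  apply/funext => k; rewrite -/(G k) [RHS](Rint_eq mu2 (g := fun x => p x * fs (G k) x)).
    by rewrite Rint_fsM//; apply: Rint_eq => x; rewrite mulrC.
  by move=> x; rewrite mulrC.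
- have L : \int[mu2]_x (fc (G k) x * fc p x) + \int[mu2]_x (fs (G k) x * fs p x) @[k --> \oo] -->
    \int[mu2]_x (a x * fc p x) + \int[mu2]_x (b x * fs p x).
    exact: cvgD (aw _ mpc pc2) (bw _ mps ps2).
  apply: (cvg_unique _ L) => //.
  rewrite (_ : (fun k => _) = fun k => \int[mu2]_x (G k x * p x)); first exact: trunc_cvg.
  apply/funext => k; have [<- _] := parseval (iG k) tp
    (integ_sqM2 (mc k) mpc (ic k) pc2) (integ_sqM2 (ms k) mps (is_ k) ps2)
    (integ_sqM2 (mc k) mps (ic k) ps2) (integ_sqM2 (ms k) mpc (is_ k) pc2).
  by rewrite RintD//; exact: integ_sqM2.
- have L := aw _ mps ps2.
  have E k : \int[mu2]_x (fc (G k) x * fs p x) = \int[mu2]_x (fs (G k) x * fc p x).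
    have [_ /eqP] := parseval (iG k) tp
      (integ_sqM2 (mc k) mpc (ic k) pc2) (integ_sqM2 (ms k) mps (is_ k) ps2)
      (integ_sqM2 (mc k) mps (ic k) ps2) (integ_sqM2 (ms k) mpc (is_ k) pc2).
    rewrite (RintB (integ_sqM2 (ms k) mpc (is_ k) pc2) (integ_sqM2 (mc k) mps (ic k) ps2)).
    by rewrite subr_eq0 => /eqP ->.
  have M := bw _ mpc pc2; rewrite (funext E) in L.
  exact: (lim_uniq L M).
Qed.

End SquareFourier.

(** * Differentiation criteria and integrals of derivatives *)

Section Calculus.
Context {R : realType}.
Notation mu1 := (@leb1 R).
Notation mu2 := (@leb2 R).
Notation R2 := (R * R)%type.

Lemma is_derive_quad (f : R -> R) (x d K : R) : 0 <= K ->
  (forall h : R, `|h| <= 1 -> `|f (x + h) - f x - h * d| <= K * h ^+ 2) ->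
  is_derive x (1 : R) f d.
Proof.
move=> K0 fq.
have C : (fun h => h^-1 *: ((f \o shift x) (h *: (1 : R)) - f x)) @ 0^' --> d.
  apply/cvgrPdist_le => e e0; near=> h.
  have h0 : h != 0 by near: h; exact: nbhs_dnbhs_neq.
  have h1 : `|h| <= 1.
    by near: h; apply: dnbhs0_le.
  have hK : `|h| <= e / (K + 1).
    by near: h; apply: dnbhs0_le; rewrite divr_gt0// ltr_wpDl.
  rewrite /GRing.scale /= mulr1 [h + x]addrC.
  have -> : d - h^-1 * (f (x + h) - f x) = - (h^-1 * (f (x + h) - f x - h * d)).
    by move: (f (x + h) - f x) => D; field.
  rewrite normrN normrM normfV ler_pdivrMl ?normr_gt0//.
  apply: (le_trans (fq _ h1)); rewrite -(real_normK (num_real h)) expr2 mulrCA.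
  rewrite ler_wpM2l//; rewrite ler_pdivlMr ?ltr_wpDl// in hK.
  by apply: le_trans hK; rewrite mulrC ler_wpM2l// lerDl.
apply: DeriveDef; first exact: cvgP C.
by rewrite /derive; exact: cvg_lim C.
Unshelve. all: by end_near. Qed.

(** Unlike the positive part, its square is continuously differentiable, which allows a cone weight
    to be differentiated. *)
Definition kap (s : R) : R := Num.max s 0 ^+ 2.

Lemma kap_derive (s : R) : is_derive s (1 : R) kap (2 * Num.max s 0).
Proof.
apply: (@is_derive_quad _ _ _ 1) => // h _; rewrite mul1r /kap.
rewrite ler_norml; case: (leP s 0) => s0; case: (leP (s + h) 0) => sh; nra.
Qed.

Lemma kap_continuous : continuous kap.
Proof. exact: derive_continuous kap_derive. Qed.

Lemma Rint_derive_loc d (Y : measurableType d) (mu : {measure set Y -> \bar R})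
    (f df : R -> Y -> R) (G : Y -> R) (u v x : R) : integ mu G -> u < x < v ->
  (forall z : R, u < z < v -> integ mu (f z)) ->
  (forall (z : R) y, u < z < v -> is_derive z (1 : R) (f ^~ y) (df z y)) ->
  (forall (z : R) y, u < z < v -> `|df z y| <= G y) ->
  is_derive x (1 : R) (fun x => \int[mu]_y f x y) (\int[mu]_y df x y).
Proof.
move=> Gi xuv fi fd fG.
have inE' z : `]u, v[%classic z -> u < z < v by rewrite /= in_itv.
have G0 y : 0 <= G y by rewrite (le_trans _ (fG x y xuv)).
have p1E z y : u < z < v -> partial1of2 f z y = df z y.
  by move=> zuv; rewrite partial1of2E; have [_ ->] := fd z y zuv.
have Ix : `]u, v[%classic x by rewrite /= in_itv.
have d1 : forall z y, `]u, v[%classic z -> [set: Y] y ->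
    derivable (f ^~ y) z 1 by move=> z y /inE' zuv _; have [] := fd z y zuv.
have ub : forall z y, `]u, v[%classic z -> [set: Y] y ->
    `|partial1of2 f z y| <= G y by move=> z y /inE' zuv _; rewrite p1E// fG.
have di := @derivable_under_integral R _ Y mu f setT measurableT x u v
  Ix (fun z zi => fi z (inE' z zi)) d1 G G0 Gi ub.
have dv := @differentiation_under_integral R _ Y mu f setT measurableT x u v
  Ix (fun z zi => fi z (inE' z zi)) d1 G G0 Gi ub.
apply: DeriveDef; first exact: di.
by rewrite -derive1E dv; apply: Rint_eq => y; rewrite p1E.
Qed.

Lemma Rint_divergence1 (F dF : R2 -> R) (r : R) : continuous dF -> integ mu2 dF ->
  (forall a b : R, is_derive a (1 : R) (fun a => F (a, b)) (dF (a, b))) ->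
  (forall x, r < `|x| -> F x = 0) -> \int[mu2]_x dF x = 0.
Proof.
move=> cd di dF_ F0; rewrite -(fubini2 di).2 -(@Rint0 _ _ _ mu1); apply: Rint_eq => b.
apply: (RintT_derive_csupp (r := r) _ (fun a => dF_ a b)) => [a|a ra].
  exact: (cvg_comp _ dF (@continuous_pairl R R R b a) (cd (a, b))).
by apply: F0; rewrite (lt_le_trans ra)// (normx1 (a, b)).
Qed.

Lemma Rint_divergence2 (F dF : R2 -> R) (r : R) : continuous dF -> integ mu2 dF ->
  (forall a b : R, is_derive b (1 : R) (fun b => F (a, b)) (dF (a, b))) ->
  (forall x, r < `|x| -> F x = 0) -> \int[mu2]_x dF x = 0.
Proof.
move=> cd di dF_ F0; rewrite -(fubini1 di).2 -(@Rint0 _ _ _ mu1); apply: Rint_eq => a.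
apply: (RintT_derive_csupp (r := r) _ (fun b => dF_ a b)) => [b|b rb].
  exact: (cvg_comp _ dF (@continuous_pairr R R R a b) (cd (a, b))).
by apply: F0; rewrite (lt_le_trans rb)// (normx2 (a, b)).
Qed.

Lemma Rint_cube2_gt0 (r : R) : 0 < r -> 0 < \int[mu2]_x cube2 r x.
Proof.
move=> r0; have I := integ_indic_itv (- r) r true false.
rewrite (Rint_eq mu2 (g := fun x => \1_(`[- r, r]%classic) x.1 * \1_(`[- r, r]%classic) x.2)).
  rewrite (Rint_tensor I I).2; suff h : 0 < \int[mu1]_x \1_(`[- r, r]%classic) x.
    by rewrite mulr_gt0.
  rewrite -lte_fin EFin_Rint// integral_indic// setIT.
  have h : (0%:E < lebesgue_measure [set` Interval (BLeft (- r)%R) (BRight r)])%E.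
    by rewrite lebesgue_measure_itv/= lte_fin gtrN// lte_fin opprK addr_gt0.
  exact: h.
move=> x; rewrite /cube2 cube2E !indicE in_setX.
by case: (_ \in _); rewrite ?mul1r ?mul0r.
Qed.

Lemma Rint_le0_cont (g : R2 -> R) (x : R2) : continuous g -> integ mu2 g ->
  (forall x, 0 <= g x) -> \int[mu2]_x g x <= 0 -> g 0 = 0.
Proof.
move=> cg gi g0 Ig; apply/eqP; rewrite eq_le g0 andbT leNgt; apply/negP => gx.
have e0 : 0 < g 0 / 2 by rewrite divr_gt0.
have /cvgrPdist_le /(_ _ e0) /nbhs_ballP[e /= e1 he] := cg 0.
have h y : g 0 / 2 * cube2 (e / 2) y <= g y.
  rewrite /cube2 indicE; have [ye|_] := boolP (_ \in _); last by rewrite mulr0.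
  rewrite mulr1; rewrite inE/= in ye.
  have : ball (0 : R2) e y.
    rewrite -ball_normE /ball_ /= sub0r normrN (le_lt_trans ye)//.
    by rewrite ltr_pdivrMr// mulr2n mulrDr mulr1 ltrDl.
  by move/he; rewrite ler_norml => /andP[_]; move: (g 0) (g y) => p q; clear; lra.
have := Rint_le (integZ (g 0 / 2) (integ_cube2 (e / 2))) gi h.
rewrite RintZ; last exact: integ_cube2.
have p1 : 0 < g 0 / 2 * \int[mu2]_x cube2 (e / 2) x.
  by rewrite mulr_gt0// Rint_cube2_gt0// divr_gt0.
by move/(lt_le_trans p1)/lt_le_trans => /(_ _ Ig); rewrite ltxx.
Qed.

End Calculus.

(** * Uniqueness for the wave equation *)

Section Energy.
Context {R : realType}.
Notation mu2 := (@leb2 R).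
Notation R2 := (R * R)%type.

Lemma contD (f g : R2 -> R) : continuous f -> continuous g -> continuous (fun x => f x + g x).
Proof. by move=> cf cg x; apply: (@cvgD _ R^o); [exact: cf|exact: cg]. Qed.

Lemma contM (f g : R2 -> R) : continuous f -> continuous g -> continuous (fun x => f x * g x).
Proof. by move=> cf cg x; apply: cvgM; [exact: cf|exact: cg]. Qed.

Lemma contc (c : R) : continuous (fun _ : R2 => c).
Proof. by move=> x; exact: cvg_cst. Qed.

Lemma cont1 : continuous (fun x : R2 => x.1). Proof. by move=> x; exact: cvg_fst. Qed.
Lemma cont2 : continuous (fun x : R2 => x.2). Proof. by move=> x; exact: cvg_snd. Qed.

Lemma cont_csupp_integ (F : R2 -> R) (r : R) : continuous F ->
  (forall x, r < `|x| -> F x = 0) -> integ mu2 F.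
Proof.
move=> cF F0; have [M M0 FM] := csupp_bound (@cube2_compact R r) cF F0.
apply: (le_integ (integZ M (integ_cube2 r))); first exact: cont_meas2.
move=> x; rewrite /cube2 indicE; case: (leP `|x| r) => xr.
  by rewrite mem_set// mulr1; exact: FM.
by rewrite F0// normr0 mulr_ge0 ?(ltW M0)// ler0n.
Qed.

(** Continuity in space at each time, with bounds on bounded sets of space-time: enough to
    differentiate in time under an integral over a fixed cube, without joint continuity. *)
Definition locb (F : R -> R2 -> R) := (forall t, continuous (F t)) /\
  forall T r : R, exists2 M : R, 0 < M & forall t x, `|t| <= T -> `|x| <= r -> `|F t x| <= M.

(** The wave equation as a first-order system: a stands for the time derivative of a solution and
    (w1, w2) for its gradient; the other functions are the spatial derivatives that enter the
    system. *)
Variables a w1 w2 a1 a2 w11 w22 : R -> R2 -> R.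
Hypothesis ba : locb a. Hypothesis bw1 : locb w1. Hypothesis bw2 : locb w2.
Hypothesis ba1 : locb a1. Hypothesis ba2 : locb a2.
Hypothesis bw11 : locb w11. Hypothesis bw22 : locb w22.
Hypothesis dta : forall (t : R) x, is_derive t (1 : R) (a ^~ x) (w11 t x + w22 t x).
Hypothesis dtw1 : forall (t : R) x, is_derive t (1 : R) (w1 ^~ x) (a1 t x).
Hypothesis dtw2 : forall (t : R) x, is_derive t (1 : R) (w2 ^~ x) (a2 t x).
Hypothesis dxa1 : forall t (x y : R), is_derive x (1 : R) (fun x => a t (x, y)) (a1 t (x, y)).
Hypothesis dxa2 : forall t (x y : R), is_derive y (1 : R) (fun y => a t (x, y)) (a2 t (x, y)).
Hypothesis dxw1 : forall t (x y : R), is_derive x (1 : R) (fun x => w1 t (x, y)) (w11 t (x, y)).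
Hypothesis dxw2 : forall t (x y : R), is_derive y (1 : R) (fun y => w2 t (x, y)) (w22 t (x, y)).
Hypothesis zero : forall x, [/\ a 0 x = 0, w1 0 x = 0 & w2 0 x = 0].

(** For t < S this is positive exactly inside the backward light cone with apex at time S above the
    origin. The weight [phi] replaces the indicator of the cone, so that no boundary integral
    appears. *)
Let g (S t : R) (x : R2) : R := (S - t) ^+ 2 - (x.1 * x.1 + x.2 * x.2).
Let phi S t x := kap (g S t x).
Let k1 S t x : R := 2 * Num.max (g S t x) 0.
Let e t x := a t x ^+ 2 + w1 t x ^+ 2 + w2 t x ^+ 2.

Let cg S t : continuous (g S t).
Proof.
have h : continuous (fun x : R2 => (S - t) ^+ 2 + (- (1) * (x.1 * x.1 + x.2 * x.2))).
  apply: contD; first exact: contc.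
  apply: contM; first exact: contc.
  by apply: contD; apply: contM; (exact: cont1 || exact: cont2).
have E : (fun x : R2 => (S - t) ^+ 2 + (- (1) * (x.1 * x.1 + x.2 * x.2))) = g S t.
  by apply/funext => x; rewrite /g mulN1r.
by rewrite E in h.
Qed.

Let cphi S t : continuous (phi S t).
Proof. by move=> x; apply: (cvg_comp _ kap (@cg S t x)); exact: kap_continuous. Qed.

Let ck1 S t : continuous (k1 S t).
Proof.
apply: contM; first exact: contc.
have E : (fun x : R2 => 2^-1 * (g S t x + `|g S t x|)) = (fun x => Num.max (g S t x) 0).
  apply/funext => x; case: (leP (g S t x) 0) => h.
    by rewrite ler0_norm// subrr mulr0.
  by rewrite gtr0_norm//; move: (g S t x) => z; field.
rewrite -E; apply: contM; first exact: contc.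
by apply: contD; first exact: cg; move=> x; apply: cvg_norm; exact: cg.
Qed.

(** The time interval begins at -1 and not at 0, so that the energy is differentiable at the initial
    time. There S - t < S + 1, hence points of norm larger than S + 1 lie outside the cone. *)
Let g_supp S t x : -1 < t < S -> S + 1 < `|x| -> g S t x < 0.
Proof.
move=> /andP[t1 t2] Sx; rewrite /g subr_lt0.
have h1 := normx1 x; have h2 := normx2 x.
have : `|x| = `|x.1| \/ `|x| = `|x.2|.
  by rewrite prod_normE; case: (leP `|x.1| `|x.2|); [right|left].
have n1 := real_normK (num_real x.1); have n2 := real_normK (num_real x.2).
have p1 := sqr_ge0 x.1; have p2 := sqr_ge0 x.2.
rewrite -!expr2 -n1 -n2 => -[h|h]; rewrite h in Sx.
  by rewrite n2; move: (`|x.1|) Sx (x.2 ^+ 2) p2 => q Sq z z0; nra.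
by rewrite n1; move: (`|x.2|) Sx (x.1 ^+ 2) p1 => q Sq z z0; nra.
Qed.

Let phi_supp S t x : -1 < t < S -> S + 1 < `|x| -> phi S t x = 0.
Proof.
by move=> h1 h2; rewrite /phi /kap max_r ?expr0n// ltW// g_supp.
Qed.

Let k1_supp S t x : -1 < t < S -> S + 1 < `|x| -> k1 S t x = 0.
Proof.
by move=> h1 h2; rewrite /k1 max_r ?mulr0// ltW// g_supp.
Qed.

Let dg_t S t x : is_derive t (1 : R) (fun t => phi S t x) (- (2 * (S - t) * k1 S t x)).
Proof.
have h : is_derive t (1 : R) (fun t => g S t x) (- (2 * (S - t))).
  by rewrite /g; apply: trigger_derive; rewrite /GRing.scale /=; ring.
have := @is_derive1_comp _ kap (fun t => g S t x) t _ _ (kap_derive _) h.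
by rewrite /k1 mulrC mulNr.
Qed.

Let dg_1 S t (x y : R) : is_derive x (1 : R) (fun x => phi S t (x, y)) (- (2 * x * k1 S t (x, y))).
Proof.
have h : is_derive x (1 : R) (fun x => g S t (x, y)) (- (2 * x)).
  by rewrite /g /=; apply: trigger_derive; rewrite /GRing.scale /=; ring.
have := @is_derive1_comp _ kap (fun x => g S t (x, y)) x _ _ (kap_derive _) h.
by rewrite /k1 mulrC mulNr.
Qed.

Let dg_2 S t (x y : R) : is_derive y (1 : R) (fun y => phi S t (x, y)) (- (2 * y * k1 S t (x, y))).
Proof.
have h : is_derive y (1 : R) (fun y => g S t (x, y)) (- (2 * y)).
  by rewrite /g /=; apply: trigger_derive; rewrite /GRing.scale /=; ring.
have := @is_derive1_comp _ kap (fun y => g S t (x, y)) y _ _ (kap_derive _) h.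
by rewrite /k1 mulrC mulNr.
Qed.

(** The time derivative of [phi S t x * e t x], with the time derivatives of a, w1, w2 replaced
    according to the system. *)
Let df S t x := - (2 * (S - t) * k1 S t x) * e t x +
  2 * phi S t x * (a t x * (w11 t x + w22 t x) + w1 t x * a1 t x + w2 t x * a2 t x).

Let df_bound S : 0 < S -> exists2 M, 0 < M & forall t x, -1 < t < S ->
  `|df S t x| <= M * cube2 (S + 1) x.
Proof.
move=> S0; have [m1 m10 b1] := ba.2 (S + 1) (S + 1).
have [m2 m20 b2] := bw1.2 (S + 1) (S + 1); have [m3 m30 b3] := bw2.2 (S + 1) (S + 1).
have [m4 m40 b4] := ba1.2 (S + 1) (S + 1); have [m5 m50 b5] := ba2.2 (S + 1) (S + 1).
have [m6 m60 b6] := bw11.2 (S + 1) (S + 1); have [m7 m70 b7] := bw22.2 (S + 1) (S + 1).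
pose m := m1 + m2 + m3 + m4 + m5 + m6 + m7.
pose Z := S + 1; have Z0 : 0 < Z by rewrite addr_gt0.
have m0 : 0 < m by rewrite !addr_gt0.
exists (2 * Z * (2 * Z ^+ 2) * (3 * m ^+ 2) + 2 * Z ^+ 4 * (4 * m ^+ 2)).
  by rewrite addr_gt0// !mulr_gt0 ?exprn_gt0.
move=> t x tS; have [Sx|xS] := ltP (S + 1) `|x|.
  rewrite /df phi_supp// k1_supp// !mulr0 mul0r oppr0 !mul0r add0r normr0.
  by rewrite mulr_ge0// ltW// addr_gt0// !mulr_gt0 ?exprn_gt0.
rewrite /cube2 indicE mem_set// mulr1.
have tT : `|t| <= S + 1.
  by move: tS => /andP[h1 h2]; rewrite ler_norml; apply/andP; split; lra.
have {}b1 : `|a t x| <= m by apply: (le_trans (b1 _ _ tT xS)); rewrite /m; lra.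
have {}b2 : `|w1 t x| <= m by apply: (le_trans (b2 _ _ tT xS)); rewrite /m; lra.
have {}b3 : `|w2 t x| <= m by apply: (le_trans (b3 _ _ tT xS)); rewrite /m; lra.
have {}b4 : `|a1 t x| <= m by apply: (le_trans (b4 _ _ tT xS)); rewrite /m; lra.
have {}b5 : `|a2 t x| <= m by apply: (le_trans (b5 _ _ tT xS)); rewrite /m; lra.
have {}b6 : `|w11 t x| <= m by apply: (le_trans (b6 _ _ tT xS)); rewrite /m; lra.
have {}b7 : `|w22 t x| <= m by apply: (le_trans (b7 _ _ tT xS)); rewrite /m; lra.
have Zt : 0 <= S - t <= Z by move: tS => /andP[h1 h2]; rewrite /Z; apply/andP; split; lra.
have gZ : g S t x <= Z ^+ 2.
  rewrite /g; have h1 := sqr_ge0 x.1; have h2 := sqr_ge0 x.2; rewrite !expr2 in h1 h2 *.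
  by move: Zt => /andP[h3 h4]; nra.
have mx : 0 <= Num.max (g S t x) 0 <= Z ^+ 2.
  by rewrite le_max lexx orbT ge_max gZ/= sqr_ge0.
have P (p q : R) : `|p| <= m -> `|q| <= m -> `|p * q| <= m ^+ 2.
  by move=> h1 h2; rewrite normrM expr2 ler_pM.
apply: (le_trans (ler_normD _ _)); apply: lerD.
  rewrite mulNr normrN normrM; apply: ler_pM => //.
    rewrite normrM (ger0_norm (x := 2 * _)) ?mulr_ge0//; last by case/andP: Zt.
    rewrite /k1 ger0_norm ?mulr_ge0//; last by case/andP: mx.
    apply: ler_pM; rewrite ?mulr_ge0//; do ?[by case/andP: Zt|by case/andP: mx].
      by rewrite ler_wpM2l//; case/andP: Zt.
    by rewrite ler_wpM2l//; case/andP: mx.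
  rewrite /e !expr2; have p1 := P _ _ b1 b1; have p2 := P _ _ b2 b2; have p3 := P _ _ b3 b3.
  apply: (le_trans (ler_normD _ _)); have h := ler_normD (a t x * a t x) (w1 t x * w1 t x).
  by move: p1 p2 p3 h; rewrite !expr2; lra.
rewrite normrM; apply: ler_pM => //.
  have p0 : 0 <= phi S t x by exact: sqr_ge0.
  rewrite normrM (ger0_norm p0) ger0_norm// ler_wpM2l// /phi /kap.
  rewrite (_ : Z ^+ 4 = (Z ^+ 2) ^+ 2); last by rewrite -exprM.
  by case/andP: mx => h1 h2; rewrite lerXn2r// ?nnegrE ?sqr_ge0.
rewrite mulrDr; have p1 := P _ _ b1 b6; have p2 := P _ _ b1 b7.
have p3 := P _ _ b2 b4; have p4 := P _ _ b3 b5.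
apply: (le_trans (ler_normD _ _)); have h1 := ler_normD (a t x * w11 t x + a t x * w22 t x) (w1 t x * a1 t x).
have h2 := ler_normD (a t x * w11 t x) (a t x * w22 t x).
by move: p1 p2 p3 p4 h1 h2; lra.
Qed.

Lemma energy_zero (t : R) : 0 <= t -> a t 0 = 0.
Proof.
(* The apex is one unit of time above t, so that [phi S t 0] equals 1. *)
move=> t0; pose S := t + 1; have S0 : 0 < S by rewrite ltr_wpDl.
have [M M0 dfM] := df_bound S0.
pose E s := \int[mu2]_x (phi S s x * e s x).
have ce s : continuous (e s).
  by apply: contD; [apply: contD|]; apply: contM; (exact: ba.1 || exact: bw1.1 || exact: bw2.1).
have ie s : -1 < s < S -> integ mu2 (fun x => phi S s x * e s x).
  move=> sS; apply: (@cont_csupp_integ _ (S + 1)); first exact: contM.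
  by move=> x Sx; rewrite phi_supp// mul0r.
have dE s : -1 < s < S -> is_derive s (1 : R) E (\int[mu2]_x df S s x).
  move=> sS; apply: (@Rint_derive_loc _ _ _ mu2 _ (df S) _ (-1) S s (integZ M (integ_cube2 (S + 1)))) => //.
  move=> z y zS; have h1 := dg_t S z y; have h2 := dta z y; have h3 := dtw1 z y; have h4 := dtw2 z y.
  by rewrite /e /df; apply: trigger_derive; rewrite /GRing.scale /= /e; ring.
have dE0 s : 0 <= s < S -> \int[mu2]_x df S s x <= 0.
  move=> /andP[s0 sS]; have sS' : -1 < s < S by rewrite sS (lt_le_trans _ s0).
  (* [df] is [dF1 + dF2 + q]: the first two are the partial derivatives of 2 phi a w1 and 2 phi a
     w2, of integral 0, and q is the flux through the cone, which is nonpositive. *)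
  pose dF1 x : R := - (4 * x.1 * k1 S s x) * (a s x * w1 s x) +
    2 * phi S s x * (a1 s x * w1 s x + a s x * w11 s x).
  pose dF2 x : R := - (4 * x.2 * k1 S s x) * (a s x * w2 s x) +
    2 * phi S s x * (a2 s x * w2 s x + a s x * w22 s x).
  pose q x : R := - (2 * k1 S s x) * ((S - s) * e s x - 2 * a s x * (x.1 * w1 s x + x.2 * w2 s x)).
  have ca := ba.1 s; have cw1 := bw1.1 s; have cw2 := bw2.1 s.
  have ca1 := ba1.1 s; have ca2 := ba2.1 s; have cw11 := bw11.1 s; have cw22 := bw22.1 s.
  have cN (f : R2 -> R) : continuous f -> continuous (fun x => - f x).
    by move=> cf x; apply: (@cvgN _ R^o); exact: cf.
  have c4 (f : R2 -> R) : continuous f -> continuous (fun x => 4 * f x * k1 S s x).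
    by move=> cf; apply: contM => //; apply: contM => //; exact: contc.
  have cp2 : continuous (fun x => 2 * phi S s x) by apply: contM => //; exact: contc.
  have cF1 : continuous dF1.
    apply: contD; apply: contM.
    - by apply: cN; apply: c4; exact: cont1.
    - exact: contM.
    - exact: cp2.
    - by apply: contD; exact: contM.
  have cF2 : continuous dF2.
    apply: contD; apply: contM.
    - by apply: cN; apply: c4; exact: cont2.
    - exact: contM.
    - exact: cp2.
    - by apply: contD; exact: contM.
  have cq : continuous q.
    apply: contM; first by apply: cN; apply: contM => //; exact: contc.
    apply: contD; first by apply: contM => //; exact: contc.
    apply: cN; apply: contM; first by apply: contM => //; exact: contc.
    by apply: contD; apply: contM => //; (exact: cont1 || exact: cont2).
  have sF1 x : S + 1 < `|x| -> dF1 x = 0.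
    by move=> Sx; rewrite /dF1 phi_supp// k1_supp// !mulr0 oppr0 !mul0r addr0.
  have sF2 x : S + 1 < `|x| -> dF2 x = 0.
    by move=> Sx; rewrite /dF2 phi_supp// k1_supp// !mulr0 oppr0 !mul0r addr0.
  have sq x : S + 1 < `|x| -> q x = 0.
    by move=> Sx; rewrite /q k1_supp// mulr0 oppr0 mul0r.
  have iF1 := cont_csupp_integ cF1 sF1; have iF2 := cont_csupp_integ cF2 sF2.
  have iq := cont_csupp_integ cq sq.
  have z1 : \int[mu2]_x dF1 x = 0.
    apply: (@Rint_divergence1 _ (fun x => 2 * phi S s x * (a s x * w1 s x)) dF1 (S + 1)) => //.
    - move=> x y; have h1 := dg_1 S s x y; have h2 := dxa1 s x y; have h3 := dxw1 s x y.
      by rewrite /dF1; apply: trigger_derive; rewrite /GRing.scale /=; ring.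
    - by move=> x Sx; rewrite phi_supp// mulr0 mul0r.
  have z2 : \int[mu2]_x dF2 x = 0.
    apply: (@Rint_divergence2 _ (fun x => 2 * phi S s x * (a s x * w2 s x)) dF2 (S + 1)) => //.
    - move=> x y; have h1 := dg_2 S s x y; have h2 := dxa2 s x y; have h3 := dxw2 s x y.
      by rewrite /dF2; apply: trigger_derive; rewrite /GRing.scale /=; ring.
    - by move=> x Sx; rewrite phi_supp// mulr0 mul0r.
  rewrite (Rint_eq mu2 (g := fun x => dF1 x + dF2 x + q x)); last first.
    by move=> x; rewrite /df /dF1 /dF2 /q /e; ring.
  rewrite (RintD (integD iF1 iF2) iq) (RintD iF1 iF2) z1 z2 !add0r.
  rewrite -(@Rint0 _ _ _ mu2); apply: (Rint_le iq (integ0 mu2)) => x.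
  rewrite /q mulNr oppr_le0 /k1; case: (leP (g S s x) 0) => gx.
    by rewrite !mulr0 mul0r.
  apply: mulr_ge0; first by rewrite !mulr_ge0// ltW.
  have Ss : 0 < S - s by rewrite subr_gt0.
  rewrite -(pmulr_rge0 _ Ss) /e; rewrite /g in gx.
  move: Ss gx; move: (S - s) (a s x) (w1 s x) (w2 s x) x.1 x.2 => r p p1 p2 x1 x2 r0 gx.
  (* With r = S - s, Lagrange's identity (x . w)^2 + (x1 w2 - x2 w1)^2 = |x|^2 |w|^2 displays the
     flux density as a sum of nonnegative terms inside the cone |x| < r. *)
  have -> : r * (r * (p ^+ 2 + p1 ^+ 2 + p2 ^+ 2) - 2 * p * (x1 * p1 + x2 * p2)) =
    (r * p - (x1 * p1 + x2 * p2)) ^+ 2 + (x1 * p2 - x2 * p1) ^+ 2 +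
    (r ^+ 2 - (x1 * x1 + x2 * x2)) * (p1 ^+ 2 + p2 ^+ 2) by ring.
  apply: addr_ge0; first by apply: addr_ge0; exact: sqr_ge0.
  by apply: mulr_ge0; [exact: ltW|apply: addr_ge0; exact: sqr_ge0].
have E0 : E 0 = 0.
  rewrite /E (Rint_eq mu2 (g := fun=> 0)) ?Rint0// => x.
  by rewrite /e; have [-> -> ->] := zero x; rewrite expr0n/= !addr0 mulr0.
have Et : E t <= 0.
  have tS (x : R) : x \in `[0, t] -> 0 <= x < S.
    by rewrite in_itv/= /S => /andP[-> h]; rewrite (le_lt_trans h)// ltrDl.
  have tS' (x : R) : 0 <= x < S -> -1 < x < S.
    by case/andP => h ->; rewrite (lt_le_trans _ h).
  have [||c ct h] := @MVT_segment R E (fun s => \int[mu2]_x df S s x) 0 t t0.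
  - move=> x xt; apply: dE; apply: tS'; apply: tS; move: xt; rewrite !in_itv/=.
    by case/andP => /ltW -> /ltW ->.
  - apply: derivable_within_continuous => x xt.
    by have [] := dE x (tS' x (tS x xt)).
  move: h; rewrite E0 subr0 => ->; rewrite subr0 mulr_le0_ge0//.
  by apply: dE0; exact: tS.
have tS : -1 < t < S by rewrite (lt_le_trans _ t0)//= ltrDl.
have e0 x : 0 <= e t x by rewrite !addr_ge0 ?sqr_ge0.
have h := @Rint_le0_cont R (fun x => phi S t x * e t x) 0 (contM (@cphi S t) (ce t)) (ie t tS)
  (fun x => mulr_ge0 (sqr_ge0 _) (e0 x)) Et.
have p1 : phi S t 0 = 1.
  rewrite /phi /g /= mulr0 addr0 subr0 /S addrC addKr expr1n /kap max_l// expr1n//.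
move: h; rewrite p1 mul1r /e => h.
have := sqr_ge0 (a t 0); have := sqr_ge0 (w1 t 0); have := sqr_ge0 (w2 t 0) => h1 h2 h3.
by apply/eqP; rewrite -sqrf_eq0; apply/eqP; lra.
Qed.

End Energy.

(** * Functionals evaluated on translates of a test function *)

Section Functionals.
Context {R : realType}.
Notation mu1 := (@leb1 R).
Notation mu2 := (@leb2 R).
Notation R2 := (R * R)%type.
Implicit Types (p q : R2 -> R).

Lemma cont_dist (V : normedModType R) (f : V -> R) :
  (forall x e, 0 < e -> exists2 d : R, 0 < d & forall y, `|y - x| < d -> `|f x - f y| <= e) ->
  continuous f.
Proof.
move=> h x; apply/cvgrPdist_le => e e0; apply/nbhs_ballP.
have [d d0 hd] := h x e e0; exists d => // y.
by rewrite -ball_normE /ball_ /= distrC; exact: hd.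
Qed.

Lemma taylor_quad (f f' : R -> R) (L : R) :
  (forall x : R, is_derive x (1 : R) f (f' x)) ->
  (forall x y, `|f' y - f' x| <= L * `|y - x|) ->
  forall a h, `|f (a + h) - f a - h * f' a| <= L * h ^+ 2.
Proof.
move=> fd fL a h.
have cf : continuous f by exact: derive_continuous fd.
have [c ch ->] : exists2 c, `|c - a| <= `|h| & f (a + h) - f a = f' c * h.
  have [h0|h0] := leP 0 h.
    have ah : a <= a + h by rewrite lerDl.
    have [c] := @MVT_segment R f f' a (a + h) ah (fun x _ => fd x) (continuous_subspaceT cf).
    rewrite in_itv/= => /andP[c1 c2] ->; rewrite addrAC subrr add0r.
    by exists c => //; rewrite !ger0_norm ?subr_ge0// lerBlDl.
  have ah : a + h <= a by rewrite gerDl ltW.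
  have [c] := @MVT_segment R f f' (a + h) a ah (fun x _ => fd x) (continuous_subspaceT cf).
  rewrite in_itv/= => /andP[c1 c2] E; exists c; last first.
    by rewrite -opprB E; ring.
  by rewrite ler0_norm ?subr_le0// ltr0_norm//; move: c1; clear; lra.
rewrite (_ : f' c * h - h * f' a = (f' c - f' a) * h); last by ring.
have L0 : 0 <= L.
  by have := fL 0 1; rewrite subr0 normr1 mulr1; exact: le_trans.
rewrite normrM -(real_normK (num_real h)) expr2 mulrA ler_wpM2r//.
by apply: (le_trans (fL _ _)); rewrite ler_wpM2l.
Qed.

Lemma test_taylor1 q : test_function q -> exists2 L : R, 0 < L &
  forall a b h : R, `|q (a + h, b) - q (a, b) - h * d1 q (a, b)| <= L * h ^+ 2.
Proof.
move=> tq; have [L L0 hL] := test_lipschitz (test_d1 tq).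
exists L => // a b h; apply: (@taylor_quad (fun a => q (a, b)) (fun a => d1 q (a, b)) L).
  by move=> x; apply: d1_is_derive; exact: tq.1.
by move=> x y; have := hL (x, b) (y, b); rewrite /= subrr normr0 addr0.
Qed.

Lemma test_taylor2 q : test_function q -> exists2 L : R, 0 < L &
  forall a b h : R, `|q (a, b + h) - q (a, b) - h * d2 q (a, b)| <= L * h ^+ 2.
Proof.
move=> tq; have [L L0 hL] := test_lipschitz (test_d2 tq).
exists L => // a b h; apply: (@taylor_quad (fun b => q (a, b)) (fun b => d2 q (a, b)) L).
  by move=> x; apply: d2_is_derive; exact: tq.1.
by move=> x y; have := hL (a, x) (a, y); rewrite /= subrr normr0 add0r.
Qed.

Definition sh (x : R2) q : R2 -> R := fun y => q (y - x).

Lemma test_sh x q : test_function q -> test_function (sh x q).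
Proof. exact: test_shift. Qed.

Lemma sh_supp (r r' : R) x q : (forall y, r < `|y| -> q y = 0) -> `|x| <= r' ->
  forall y, r + r' < `|y| -> sh x q y = 0.
Proof.
move=> q0 xr y hy; apply: q0; rewrite -(ltrD2r r') (lt_le_trans hy)//.
by rewrite -{1}[y](subrK x) (le_trans (ler_normD _ _))// lerD2l.
Qed.

(** A family of distributions in p, of order 0 locally uniformly in t. Evaluation on translates
    makes it a function of (t, x) whose space regularity comes from that of the test function. *)
Variable l : (R2 -> R) -> R -> R.
Hypothesis lD : forall (c : R) p q t, test_function p -> test_function q ->
  l (fun x => c * p x + q x) t = c * l p t + l q t.
Hypothesis lB : forall r T : R, exists2 C : R, 0 < C & forall p (M t : R), test_function p ->
  (forall x, r < `|x| -> p x = 0) -> (forall x, `|p x| <= M) -> `|t| <= T -> `|l p t| <= C * M.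

Lemma functional_sub p q t : test_function p -> test_function q ->
  l p t - l q t = l (fun x => -1 * q x + p x) t.
Proof. by move=> tp tq; rewrite lD// mulN1r addrC. Qed.

Lemma functional_locb q : test_function q -> locb (fun t x => l (sh x q) t).
Proof.
move=> tq; have [sq [r0 qr0]] := tq; have [M M0 qM] := test2_bound tq; split.
  move=> t; apply: (@cont_dist _ (fun x => l (sh x q) t)) => x e e0.
  have [C C0 lC] := lB (r0 + (`|x| + 1)) `|t|.
  have [L L0 qL] := test_lipschitz tq.
  exists (Num.min 1 (e / (C * L * 2))).
    by rewrite lt_min ltr01 divr_gt0// !mulr_gt0.
  move=> y; rewrite lt_min => /andP[/ltW xy1 /ltW xy].
  rewrite functional_sub; do ?exact: test_sh.
  apply: (@le_trans _ _ (C * (L * (2 * `|y - x|)))); last first.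
    by rewrite ler_pdivlMr ?mulr_gt0// in xy; apply: le_trans xy; rewrite le_eqVlt; apply/orP; left; apply/eqP; ring.
  apply: lC; last exact: lexx.
  - by apply: testD; [apply: testZ|]; exact: test_sh.
  - move=> z hz; rewrite !(sh_supp qr0 _ hz) ?mulr0 ?addr0//.
      by rewrite lerDl.
    by rewrite -[y](subrK x) (le_trans (ler_normD _ _))// addrC lerD2l.
  - move=> z; rewrite mulN1r addrC; apply: (le_trans (qL (z - y) (z - x))).
    rewrite ler_wpM2l ?(ltW L0)// mulr2n mulrDl !mul1r; apply: lerD.
      by rewrite (_ : _ - _ = (y - x).1) ?normx1//=; ring.
    by rewrite (_ : _ - _ = (y - x).2) ?normx2//=; ring.
move=> T r; have [C C0 lC] := lB (r0 + r) T.
exists (C * M); first by rewrite mulr_gt0.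
move=> t x tT xr; apply: (lC _ _ _ (test_sh x tq) (sh_supp qr0 xr) _ tT) => y.
exact: qM.
Qed.

(** Taylor's formula for q has a quadratic remainder uniform in space, and for |h| <= 1 all supports
    stay in one cube, where l is controlled by the supremum. The sign comes from
    [sh x q y = q (y - x)]. *)
Lemma functional_derive1 q t (x y : R) : test_function q ->
  is_derive x (1 : R) (fun x => l (sh (x, y) q) t) (- l (sh (x, y) (d1 q)) t).
Proof.
move=> tq; have [sq [r0 qr0]] := tq.
have qr1 : forall x, r0 < `|x| -> d1 q x = 0 by exact: derive_supp.
have [L L0 qL] := test_taylor1 tq.
have [C C0 lC] := lB (r0 + (`|(x, y) : R2| + 1)) `|t|.
apply: (@is_derive_quad _ _ _ _ (C * L)); first by rewrite mulr_ge0 ?ltW.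
move=> h h1; have td := test_d1 tq.
rewrite mulrN opprK addrC functional_sub; do ?exact: test_sh.
rewrite -lD; [|exact: test_sh|by apply: testD; [apply: testZ|]; exact: test_sh].
rewrite -mulrA; apply: lC; last exact: lexx.
- apply: testD; first by apply: testZ; exact: test_sh.
  by apply: testD; [apply: testZ|]; exact: test_sh.
- have xh : `|((x + h, y) : R2) - (x, y)| <= 1.
    rewrite prod_normE ge_max; change ((`|x + h - x| <= 1) && (`|y - y| <= 1)).
    by rewrite [x + h]addrC addrK h1 subrr normr0 ler01.
  move=> z hz; rewrite !(sh_supp qr0 _ hz) ?(sh_supp qr1 _ hz) ?mulr0 ?addr0// ?lerDl//.
  by rewrite -[(x + h, y)](subrK ((x, y) : R2)) (le_trans (ler_normD _ _))// addrC lerD2l.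
- move=> [z1 z2]; have := qL (z1 - x) (z2 - y) (- h); rewrite sqrrN; apply: le_trans.
  rewrite le_eqVlt; apply/orP; left; apply/eqP; congr (`|_|).
  rewrite /sh (_ : (z1, z2) - (x + h, y) = (z1 - x - h, z2 - y) :> R2); last first.
    by congr (_, _); change (z1 - (x + h) = z1 - x - h); ring.
  change (h * d1 q (z1 - x, z2 - y) + (-1 * q (z1 - x, z2 - y) + q (z1 - x - h, z2 - y)) =
    q (z1 - x - h, z2 - y) - q (z1 - x, z2 - y) - (- h) * d1 q (z1 - x, z2 - y)).
  by ring.
Qed.

Lemma functional_derive2 q t (x y : R) : test_function q ->
  is_derive y (1 : R) (fun y => l (sh (x, y) q) t) (- l (sh (x, y) (d2 q)) t).
Proof.
move=> tq; have [sq [r0 qr0]] := tq.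
have qr1 : forall x, r0 < `|x| -> d2 q x = 0 by exact: derive_supp.
have [L L0 qL] := test_taylor2 tq.
have [C C0 lC] := lB (r0 + (`|(x, y) : R2| + 1)) `|t|.
apply: (@is_derive_quad _ _ _ _ (C * L)); first by rewrite mulr_ge0 ?ltW.
move=> h h1; have td := test_d2 tq.
rewrite mulrN opprK addrC functional_sub; do ?exact: test_sh.
rewrite -lD; [|exact: test_sh|by apply: testD; [apply: testZ|]; exact: test_sh].
rewrite -mulrA; apply: lC; last exact: lexx.
- apply: testD; first by apply: testZ; exact: test_sh.
  by apply: testD; [apply: testZ|]; exact: test_sh.
- have xh : `|((x, y + h) : R2) - (x, y)| <= 1.
    rewrite prod_normE ge_max; change ((`|x - x| <= 1) && (`|y + h - y| <= 1)).
    by rewrite [y + h]addrC addrK h1 subrr normr0 ler01.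
  move=> z hz; rewrite !(sh_supp qr0 _ hz) ?(sh_supp qr1 _ hz) ?mulr0 ?addr0// ?lerDl//.
  by rewrite -[(x, y + h)](subrK ((x, y) : R2)) (le_trans (ler_normD _ _))// addrC lerD2l.
- move=> [z1 z2]; have := qL (z1 - x) (z2 - y) (- h); rewrite sqrrN; apply: le_trans.
  rewrite le_eqVlt; apply/orP; left; apply/eqP; congr (`|_|).
  rewrite /sh (_ : (z1, z2) - (x, y + h) = (z1 - x, z2 - y - h) :> R2); last first.
    by congr (_, _); change (z2 - (y + h) = z2 - y - h); ring.
  change (h * d2 q (z1 - x, z2 - y) + (-1 * q (z1 - x, z2 - y) + q (z1 - x, z2 - y - h)) =
    q (z1 - x, z2 - y - h) - q (z1 - x, z2 - y) - (- h) * d2 q (z1 - x, z2 - y)).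
  by ring.
Qed.

End Functionals.

(** * Vanishing of solutions of the homogeneous equation with zero data *)

Section Uniqueness.
Context {R : realType}.
Notation mu1 := (@leb1 R).
Notation R2 := (R * R)%type.
Implicit Types (p q : R2 -> R).
(** [k p t] is the pairing with p, at time t, of a solution with zero initial data, and [kE] is the
    equation integrated twice in time. [kB] bounds time integrals only, all that local integrability
    in space-time provides; pointwise bounds are recovered for the primitives [A] and [B]. *)
Variable k : (R2 -> R) -> R -> R.
Hypothesis kD : forall (c : R) p q t, test_function p -> test_function q ->
  k (fun x => c * p x + q x) t = c * k p t + k q t.
Hypothesis kc : forall p, test_function p -> continuous (k p).
Hypothesis kB : forall r T : R, exists2 C : R, 0 < C & forall p (M : R), test_function p ->
  (forall x, r < `|x| -> p x = 0) -> (forall x, `|p x| <= M) ->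
  \int[mu1]_s (\1_(`[- T, T]%classic) s * `|k p s|) <= C * M.
Hypothesis kE : forall p t, test_function p ->
  k p t = \int[mu1]_s (sgi t s * ((t - s) * k (lap p) s)).

Let A p t := oint (k p) t.
(** By Cauchy's formula this is the second primitive of [k p], so [kE] reads k p = B (lap p). *)
Let B p t := \int[mu1]_s (sgi t s * ((t - s) * k p s)).

Let ctk p t : test_function p -> continuous (fun s : R => (t - s) * k p s).
Proof.
move=> tp s; apply: cvgM; last exact: kc.
by apply: (@cvgB _ R^o); [exact: cvg_cst|exact: cvg_id].
Qed.

Let csk p : test_function p -> continuous (fun s : R => s * k p s).
Proof. by move=> tp s; apply: cvgM; [exact: cvg_id|exact: kc]. Qed.

Let dA p (t : R) : test_function p -> is_derive t (1 : R) (A p) (k p t).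
Proof. by move=> tp; apply: oint_derive; exact: kc. Qed.

Let BE p t : test_function p -> B p t = t * A p t - oint (fun s => s * k p s) t.
Proof.
move=> tp; rewrite /A /oint -RintZ; last exact: integ_sgi (kc tp).
rewrite -RintB; last exact: integ_sgi (csk tp).
  by apply: Rint_eq => s; ring.
by apply: integZ; exact: integ_sgi (kc tp).
Qed.

Let dB p (t : R) : test_function p -> is_derive t (1 : R) (B p) (A p t).
Proof.
move=> tp; rewrite (_ : B p = fun t => t * A p t - oint (fun s => s * k p s) t).
  have h1 := dA t tp; have h2 := oint_derive t (csk tp).
  by apply: trigger_derive; rewrite /GRing.scale /=; ring.
by apply/funext => s; exact: BE.
Qed.

Let AD (c : R) p q t : test_function p -> test_function q ->
  A (fun x => c * p x + q x) t = c * A p t + A q t.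
Proof.
move=> tp tq; rewrite /A /oint -RintZ; last exact: integ_sgi (kc tp).
rewrite -RintD; [|apply: integZ; exact: integ_sgi (kc tp)|exact: integ_sgi (kc tq)].
by apply: Rint_eq => s; rewrite kD//; ring.
Qed.

Let BD (c : R) p q t : test_function p -> test_function q ->
  B (fun x => c * p x + q x) t = c * B p t + B q t.
Proof.
move=> tp tq; rewrite /B -(RintZ c (integ_sgi t (@ctk p t tp))).
rewrite -(RintD (integZ c (integ_sgi t (@ctk p t tp))) (integ_sgi t (@ctk q t tq))).
by apply: Rint_eq => s; rewrite kD//; ring.
Qed.

Let sgi_itv (t T s : R) : `|t| <= T -> `|sgi t s| <= \1_(`[- T, T]%classic) s.
Proof.
move=> tT; rewrite indicE; have [sT|sT] := boolP (_ \in _); first exact: sgi_le1.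
rewrite sgi_eq0 ?normr0// (le_lt_trans tT)// ltNge; apply: contra sT => sT.
by rewrite inE/= in_itv/= -ler_norml.
Qed.

Let ik p (T : R) : test_function p -> integ mu1 (fun s => \1_(`[- T, T]%classic) s * `|k p s|).
Proof.
move=> tp; have [M M0 kM] := cont_itv_bounded T (kc tp).
have mk : measurable_fun setT (k p) by apply: continuous_measurable_fun; exact: kc.
have iI := integ_indic_itv (- T) T true false.
apply: (le_integ (integZ M iI)).
  apply: measurable_funM; first exact: integ_meas iI.
  exact: measurableT_comp.
move=> s; rewrite indicE; have [|_] := boolP (_ \in _); last first.
  by rewrite mul0r mulr0 normr0.
by rewrite inE/= in_itv/= -ler_norml => sT; rewrite mul1r mulr1 normr_id kM.
Qed.

Let AB (r T : R) : exists2 C : R, 0 < C & forall p (M t : R), test_function p ->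
  (forall x, r < `|x| -> p x = 0) -> (forall x, `|p x| <= M) -> `|t| <= T -> `|A p t| <= C * M.
Proof.
have [C C0 kC] := kB r T; exists C => // p M t tp p0 pM tT.
apply: le_trans (kC p M tp p0 pM); apply: Rint_norm_le.
- exact: integ_meas (integ_sgi t (kc tp)).
- exact: ik.
- by move=> s; rewrite normrM ler_wpM2r// sgi_itv.
Qed.

Let BB (r T : R) : exists2 C : R, 0 < C & forall p (M t : R), test_function p ->
  (forall x, r < `|x| -> p x = 0) -> (forall x, `|p x| <= M) -> `|t| <= T -> `|B p t| <= C * M.
Proof.
have [C C0 kC] := kB r T; exists (2 * `|T| * C + C).
  by rewrite ltr_wpDl// mulr_ge0 ?mulr_ge0// ltW.
move=> p M t tp p0 pM tT; have M0 : 0 <= M by exact: le_trans (pM 0).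
apply: (@le_trans _ _ (2 * `|T| * (C * M))); last first.
  by rewrite [leRHS]mulrDl -[2 * _ * C * M]mulrA lerDl mulr_ge0// ltW.
apply: le_trans (ler_wpM2l _ (kC p M tp p0 pM)); last by rewrite mulr_ge0.
rewrite -RintZ; last exact: ik.
apply: Rint_norm_le.
- exact: integ_meas (integ_sgi t (@ctk p t tp)).
- by apply: integZ; exact: ik.
- move=> s; rewrite !normrM.
  have [sT|sT] := boolP (s \in (`[- T, T]%classic : set R)).
    rewrite mulrA mulrCA mulrA ler_wpM2r//.
    rewrite indicE sT ler_pM ?sgi_le1// (le_trans (ler_normB _ _))//.
    rewrite inE/= in_itv/= -ler_norml in sT.
    rewrite mulr2n mulrDl !mul1r lerD//; first by rewrite (le_trans tT)// ler_norm.
    by rewrite (le_trans sT)// ler_norm.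
  have := sgi_itv s tT; rewrite indicE (negbTE sT) => h.
  have -> : `|sgi t s| = 0 by apply/eqP; rewrite eq_le h normr_ge0.
  by rewrite !mul0r mulr0.
Qed.

Let A_locb := functional_locb AD AB.
Let B_locb := functional_locb BD BB.

Lemma locbN (F : R -> R2 -> R) : locb F -> locb (fun t x => - F t x).
Proof.
move=> [cF bF]; split; first by move=> t x; apply: (@cvgN _ R^o); exact: cF.
by move=> T r; have [M M0 FM] := bF T r; exists M => // t x tT xr; rewrite normrN FM.
Qed.

Lemma locb_refl (F : R -> R2 -> R) : locb F -> locb (fun t x => F (- t) x).
Proof.
move=> [cF bF]; split; first by move=> t; exact: cF.
by move=> T r; have [M M0 FM] := bF T r; exists M => // t x tT xr; rewrite FM// normrN.
Qed.

Let d1_sh x q : smooth q -> d1 (sh x q) = sh x (d1 q).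
Proof. by move=> sq; apply/funext => y; rewrite /d1 /sh derive_shiftf. Qed.

Let d2_sh x q : smooth q -> d2 (sh x q) = sh x (d2 q).
Proof. by move=> sq; apply/funext => y; rewrite /d2 /sh derive_shiftf. Qed.

Let kBE x q t : test_function q ->
  k (sh x q) t = B (sh x (d1 (d1 q))) t + B (sh x (d2 (d2 q))) t.
Proof.
move=> tq; have tq1 := test_d1 tq; have tq2 := test_d2 tq.
have ts1 := test_sh x (test_d1 tq1); have ts2 := test_sh x (test_d2 tq2).
have E := BD 1 t ts1 ts2; rewrite mul1r in E; rewrite -E kE; last exact: test_sh.
have [sq _] := tq; have s1 : smooth (d1 q) := smooth_derive _ sq.
have s2 : smooth (d2 q) := smooth_derive _ sq.
have e1 : d1 (d1 (sh x q)) = sh x (d1 (d1 q)).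
  exact: (etrans (congr1 (@d1 R) (@d1_sh x q sq)) (@d1_sh x (d1 q) s1)).
have e2 : d2 (d2 (sh x q)) = sh x (d2 (d2 q)).
  exact: (etrans (congr1 (@d2 R) (@d2_sh x q sq)) (@d2_sh x (d2 q) s2)).
have -> // : lap (sh x q) = fun y => 1 * sh x (d1 (d1 q)) y + sh x (d2 (d2 q)) y.
by apply/funext => y; rewrite mul1r /lap e1 e2.
Qed.

Lemma is_deriveN_opp (f : R -> R) (x d : R) :
  is_derive x (1 : R) f (- d) -> is_derive x (1 : R) (fun x => - f x) d.
Proof. by move=> h; rewrite -[d]opprK; exact: is_deriveN. Qed.

(** For q = lap p, the functions A (sh x q), - B (sh x (d1 q)), - B (sh x (d2 q)) of (t, x) solve
    the first-order system of [energy_zero]. Hence A q = 0 for t >= 0, and for t <= 0 by time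
    reflection; then B q is constant, equal to 0, and k p = B q. *)
Lemma wave_unique p t : test_function p -> k p t = 0.
Proof.
move=> tp; have [q [tq qE]] : exists q, test_function q /\ q = lap p.
  by exists (lap p); split => //; exact: test_lap.
have tq1 := test_d1 tq; have tq2 := test_d2 tq.
have tq11 := test_d1 tq1; have tq22 := test_d2 tq2.
have dtB x r (s : R) : test_function r -> is_derive s (1 : R) (fun s => - B (sh x r) s) (- A (sh x r) s).
  by move=> tr; have h := dB s (test_sh x tr); apply: trigger_derive.
have dxA1 s (x y : R) := functional_derive1 AD AB s x y tq.
have dxA2 s (x y : R) := functional_derive2 AD AB s x y tq.
have dxB1 s (x y : R) : is_derive x (1 : R) (fun x => - B (sh (x, y) (d1 q)) s) (B (sh (x, y) (d1 (d1 q))) s).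
  exact: (@is_deriveN_opp (fun x => B (sh (x, y) (d1 q)) s) x _ (functional_derive1 BD BB s x y tq1)).
have dxB2 s (x y : R) : is_derive y (1 : R) (fun y => - B (sh (x, y) (d2 q)) s) (B (sh (x, y) (d2 (d2 q))) s).
  exact: (@is_deriveN_opp (fun y => B (sh (x, y) (d2 q)) s) y _ (functional_derive2 BD BB s x y tq2)).
have A0 r : A r 0 = 0 by rewrite /A oint0.
have B0 r : B r 0 = 0.
  by rewrite /B (Rint_eq mu1 (g := fun=> 0)) ?Rint0// => s; rewrite sgi0 mul0r.
have dtA x (s : R) : is_derive s (1 : R) (fun s => A (sh x q) s)
    (B (sh x (d1 (d1 q))) s + B (sh x (d2 (d2 q))) s).
  by have h := @dA (sh x q) s (test_sh x tq); rewrite (@kBE x q s tq) in h.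
have refl (f : R -> R) (d s : R) : is_derive (- s) (1 : R) f d ->
    is_derive s (1 : R) (fun s => f (- s)) (- d).
  move=> h; have hN : is_derive s (1 : R) (fun s : R => - s) (-1).
    by apply: trigger_derive.
  by have := @is_derive1_comp _ f (fun s => - s) s _ _ h hN; rewrite mulrN1.
have z x : [/\ A (sh x q) 0 = 0, - B (sh x (d1 q)) 0 = 0 & - B (sh x (d2 q)) 0 = 0].
  by split; rewrite ?(B0 (sh x (d1 q))) ?(B0 (sh x (d2 q))) ?oppr0// (A0 (sh x q)).
have Apos s : 0 <= s -> A (sh 0 q) s = 0.
  exact: (@energy_zero R (fun s x => A (sh x q) s) (fun s x => - B (sh x (d1 q)) s)
    (fun s x => - B (sh x (d2 q)) s) (fun s x => - A (sh x (d1 q)) s)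
    (fun s x => - A (sh x (d2 q)) s) (fun s x => B (sh x (d1 (d1 q))) s)
    (fun s x => B (sh x (d2 (d2 q))) s)
    (@A_locb q tq) (locbN (@B_locb _ tq1)) (locbN (@B_locb _ tq2))
    (locbN (@A_locb _ tq1)) (locbN (@A_locb _ tq2)) (@B_locb _ tq11) (@B_locb _ tq22)
    (fun s x => dtA x s) (fun s x => dtB x (d1 q) s tq1) (fun s x => dtB x (d2 q) s tq2)
    dxA1 dxA2 dxB1 dxB2 z s).
have z' x : [/\ A (sh x q) (- 0) = 0, B (sh x (d1 q)) (- 0) = 0 & B (sh x (d2 q)) (- 0) = 0].
  by split; rewrite oppr0 ?(B0 (sh x (d1 q))) ?(B0 (sh x (d2 q)))// (A0 (sh x q)).
have dtA' (s : R) x : is_derive s (1 : R) (fun s => A (sh x q) (- s))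
    (- B (sh x (d1 (d1 q))) (- s) + - B (sh x (d2 (d2 q))) (- s)).
  by rewrite -opprD; exact: (refl _ _ s (dtA x (- s))).
have dtB' x r (s : R) : test_function r ->
    is_derive s (1 : R) (fun s => B (sh x r) (- s)) (- A (sh x r) (- s)).
  by move=> tr; exact: (refl _ _ s (@dB _ (- s) (test_sh x tr))).
have Aneg s : 0 <= s -> A (sh 0 q) (- s) = 0.
  exact: (@energy_zero R (fun s x => A (sh x q) (- s)) (fun s x => B (sh x (d1 q)) (- s))
    (fun s x => B (sh x (d2 q)) (- s)) (fun s x => - A (sh x (d1 q)) (- s))
    (fun s x => - A (sh x (d2 q)) (- s)) (fun s x => - B (sh x (d1 (d1 q))) (- s))
    (fun s x => - B (sh x (d2 (d2 q))) (- s))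
    (locb_refl (@A_locb q tq)) (locb_refl (@B_locb _ tq1)) (locb_refl (@B_locb _ tq2))
    (locbN (locb_refl (@A_locb _ tq1))) (locbN (locb_refl (@A_locb _ tq2)))
    (locbN (locb_refl (@B_locb _ tq11))) (locbN (locb_refl (@B_locb _ tq22)))
    dtA' (fun s x => dtB' x (d1 q) s tq1) (fun s x => dtB' x (d2 q) s tq2)
    (fun s x y => dxA1 (- s) x y) (fun s x y => dxA2 (- s) x y)
    (fun s x y => functional_derive1 BD BB (- s) x y tq1)
    (fun s x y => functional_derive2 BD BB (- s) x y tq2) z' s).
have sh0 : sh 0 q = q by apply/funext => y; rewrite /sh subr0.
rewrite sh0 in Apos Aneg.
have A_0 s : A q s = 0.
  by have [/Apos//|s0] := leP 0 s; rewrite -[s]opprK Aneg// oppr_ge0 ltW.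
have dB0 (s : R) : is_derive s (1 : R) (B q) 0 by rewrite -(A_0 s); exact: dB.
rewrite (kE t tp) -qE; exact: (etrans (is_derive_0_is_cst t 0 dB0) (B0 q)).
Qed.

End Uniqueness.

(** * The oscillator at each frequency *)

Section Duhamel.
Context {R : realType}.
Notation mu := (@leb1 R).

Lemma is_derive_o (f : R -> R) (x d : R) :
  (forall e : R, 0 < e -> exists2 D : R, 0 < D & forall h, `|h| <= D ->
    `|f (x + h) - f x - h * d| <= e * `|h|) ->
  is_derive x (1 : R) f d.
Proof.
move=> fo.
have C : (fun h => h^-1 *: ((f \o shift x) (h *: (1 : R)) - f x)) @ 0^' --> d.
  apply/cvgrPdist_le => e e0; have [D D0 hD] := fo e e0; near=> h.
  have h0 : h != 0 by near: h; exact: nbhs_dnbhs_neq.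
  have h1 : `|h| <= D by near: h; exact: dnbhs0_le.
  rewrite /GRing.scale /= mulr1 [h + x]addrC.
  have -> : d - h^-1 * (f (x + h) - f x) = - (h^-1 * (f (x + h) - f x - h * d)).
    by move: (f (x + h) - f x) => E; field.
  by rewrite normrN normrM normfV ler_pdivrMl ?normr_gt0// [`|h| * e]mulrC; exact: hD.
apply: DeriveDef; first exact: cvgP C.
by rewrite /derive; exact: cvg_lim C.
Unshelve. all: by end_near. Qed.

Lemma ae_neq (t : R) : {ae mu, forall s, s != t}.
Proof.
exists [set t]; split; [exact: measurable_set1|exact: lebesgue_measure_set1|].
by move=> s /= /negP; rewrite negbK => /eqP.
Qed.

Lemma sgi_eventually (t s : R) (u : nat -> R) : s != t -> u n @[n --> \oo] --> t ->
  \forall n \near \oo, sgi (u n) s = sgi t s.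
Proof.
move=> st ut; have e0 : 0 < `|s - t| by rewrite normr_gt0 subr_eq0.
move/cvgrPdist_lt : ut => /(_ _ e0); apply: filterS => n; rewrite distrC => h.
rewrite /sgi; congr (_%:R - _); congr nat_of_bool; apply/idP/idP.
  move=> su; rewrite leNgt; apply/negP => ts.
  by move: h; rewrite (gtr0_norm (x := s - t)) ?subr_gt0// ltr_norml => /andP[_]; lra.
move=> su; rewrite leNgt; apply/negP => us.
have st' : s < t by rewrite lt_neqAle st.
by move: h; rewrite (ltr0_norm (x := s - t)) ?subr_lt0// ltr_norml => /andP[]; lra.
Qed.

(** As the upper limit varies, the oriented indicator fails to converge at s = t only, a null set,
    so dominated convergence along sequences applies. *)
Lemma sgi_cont (psi phi : R -> R) (M : R) : integ mu phi -> continuous psi ->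
  (forall x, `|psi x| <= M) ->
  continuous (fun t => \int[mu]_s (sgi t s * (psi (t - s) * phi s))).
Proof.
move=> ip cp pM t; apply/(@cvg_nbhsP _ R^o) => u ut.
have mpsi (z : R) : measurable_fun setT (fun s : R => psi (z - s)).
  apply: continuous_measurable_fun => s.
  apply: (cvg_comp (fun s : R => z - s) psi _ (cp (z - s))).
  by apply: (@cvgB _ R^o); [exact: cvg_cst|exact: cvg_id].
have mS (z : R) : measurable_fun setT (fun s : R => sgi z s * (psi (z - s) * phi s)).
  apply: measurable_funM; first exact: measurable_sgi.
  by apply: measurable_funM => //; exact: integ_meas ip.
apply: (Rint_lim (integZ M (integ_norm ip))).
- by move=> n; exact: mS.
- exact: mS.
- apply: ae_impl (ae_neq t) => s st.
  have h1 : psi (u n - s) * phi s @[n --> \oo] --> psi (t - s) * phi s.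
    apply: cvgM; last exact: cvg_cst.
    apply: (cvg_comp (fun n => u n - s) psi _ (cp (t - s))).
    by apply: (@cvgB _ R^o); [exact: ut|exact: cvg_cst].
  apply: cvgM; last exact: h1.
  by apply: cvg_near_cst; exact: sgi_eventually.
- move=> n s; rewrite !normrM -[leRHS]mul1r ler_pM ?sgi_le1//.
  by rewrite ler_wpM2r.
Qed.

Lemma integ_sgi_psi (psi phi : R -> R) (M t : R) : integ mu phi -> continuous psi ->
  (forall x, `|psi x| <= M * `|x|) -> 0 <= M ->
  integ mu (fun s => sgi t s * (psi (t - s) * phi s)).
Proof.
move=> ip cp pM M0.
have mpsi : measurable_fun setT (fun s : R => psi (t - s)).
  apply: continuous_measurable_fun => s.
  apply: (cvg_comp (fun s : R => t - s) psi _ (cp (t - s))).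
  by apply: (@cvgB _ R^o); [exact: cvg_cst|exact: cvg_id].
apply: (le_integ (integZ (M * (2 * `|t|)) (integ_norm ip))).
  apply: measurable_funM; first exact: measurable_sgi.
  by apply: measurable_funM => //; exact: integ_meas ip.
move=> s; rewrite !normrM; have [ts|st] := ltP `|t| `|s|.
  by rewrite sgi_eq0// normr0 mul0r !mulr_ge0.
have h : `|psi (t - s)| <= M * (2 * `|t|).
  rewrite (le_trans (pM _))// ler_wpM2l// (le_trans (ler_normB _ _))//.
  by rewrite mulr2n mulrDl !mul1r lerD2l.
rewrite -[leRHS]mul1r; apply: ler_pM; rewrite ?sgi_le1//.
by rewrite ler_wpM2r.
Qed.

(** phi is merely integrable, so a boundary term psi(0) phi(t) would have no meaning; psi 0 = 0
    removes it. For |s - t| > |h| the error is given by Taylor's formula. For |s - t| <= |h| it is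
    O(|h|) |phi(s)|, and the integral of |phi| over that short interval is small by continuity of
    its primitive [P]. *)
Lemma duhamel (psi dpsi phi : R -> R) (M L t : R) : integ mu phi ->
  (forall x : R, is_derive x (1 : R) psi (dpsi x)) -> psi 0 = 0 ->
  (forall x, `|dpsi x| <= M) -> (forall x y, `|dpsi y - dpsi x| <= L * `|y - x|) ->
  continuous dpsi ->
  is_derive t (1 : R) (fun t => \int[mu]_s (sgi t s * (psi (t - s) * phi s)))
    (\int[mu]_s (sgi t s * (dpsi (t - s) * phi s))).
Proof.
move=> ip dp p0 dM dL cd.
have M0 : 0 <= M by exact: le_trans (dM 0).
have L0 : 0 <= L.
  by have := dL 0 1; rewrite subr0 normr1 mulr1; exact: le_trans.
have cp : continuous psi by exact: derive_continuous dp.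
have pM x : `|psi x| <= M * `|x|.
  have [x0|x0] := leP 0 x.
    have [c _] := @MVT_segment R psi dpsi 0 x x0 (fun x _ => dp x) (continuous_subspaceT cp).
    by rewrite p0 !subr0 => ->; rewrite normrM ler_wpM2r.
  have [c _] := @MVT_segment R psi dpsi x 0 (ltW x0) (fun x _ => dp x) (continuous_subspaceT cp).
  by rewrite p0 !sub0r => /(congr1 Num.norm); rewrite normrN => ->; rewrite normrM normrN ler_wpM2r.
have ij (z : R) := integ_sgi_psi z ip cp pM M0.
have cdm (z : R) : measurable_fun setT (fun s : R => dpsi (z - s)).
  apply: continuous_measurable_fun => s.
  apply: (cvg_comp (fun s : R => z - s) dpsi _ (cd (z - s))).
  by apply: (@cvgB _ R^o); [exact: cvg_cst|exact: cvg_id].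
have id_ : integ mu (fun s => sgi t s * (dpsi (t - s) * phi s)).
  apply: (integMb (M := 1)) => //; [|exact: measurable_sgi|by move=> s; exact: sgi_le1].
  exact: (integMb ip (cdm t) (fun s => dM (t - s))).
pose N := \int[mu]_s `|phi s|.
have N0 : 0 <= N by apply: Rint_ge0.
pose P z := \int[mu]_s (sgi z s * (1 * `|phi s|)).
have iP z : integ mu (fun s => sgi z s * (1 * `|phi s|)).
  apply: (integMb (M := 1)); [|exact: measurable_sgi|by move=> s; exact: sgi_le1].
  by apply: integZ; exact: integ_norm.
have cP : continuous P.
  apply: (@sgi_cont (fun=> 1) (fun s => `|phi s|) 1) => //.
  - exact: integ_norm.
  - by move=> x; exact: cvg_cst.
  - by move=> x; rewrite normr1.
apply: is_derive_o => e e0.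
(* Near t the error is at most 4 M |h| |phi(s)| and [P] increases by at most 2 e1, which contributes
   8 M e1 |h| <= (e / 2) |h|. *)
pose e1 := e / (2 * (8 * M + 1)).
have e10 : 0 < e1 by rewrite divr_gt0// mulr_gt0// ltr_wpDl// mulr_ge0.
have /cvgrPdist_le /(_ _ e10) /nbhs_ballP[D /= D0 hD] := cP t.
(* D / 3 keeps t - 2 |h| within distance D of t; the other bound makes the Taylor part at most (e /
   2) |h|. *)
pose d := Num.min (D / 3) (e / (2 * (L * N + 1))).
have d0 : 0 < d.
  by rewrite lt_min !divr_gt0// mulr_gt0// ltr_wpDl// mulr_ge0.
exists d => // h hd; have [->|h0] := eqVneq h 0.
  by rewrite addr0 subrr mul0r subr0 normr0 mulr0.
have hp : 0 < `|h| by rewrite normr_gt0.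
have hD3 : `|h| <= D / 3 by move: hd; rewrite le_min => /andP[].
have he : `|h| <= e / (2 * (L * N + 1)) by move: hd; rewrite le_min => /andP[].
have cl z : `|z - t| < D -> `|P t - P z| <= e1.
  by move=> h1; apply: hD; rewrite -ball_normE /ball_ /= distrC.
have P1 : P (t + `|h|) - P (t - 2 * `|h|) <= 2 * e1.
  have c1 := cl (t + `|h|); have c2 := cl (t - 2 * `|h|).
  have {}c1 : `|P t - P (t + `|h|)| <= e1.
    by apply: c1; rewrite addrC addKr normr_id; move: hD3 D0; clear; lra.
  have {}c2 : `|P t - P (t - 2 * `|h|)| <= e1.
    apply: c2; rewrite addrC addKr normrN normrM normr_id ger0_norm//.
    by move: hD3 D0; clear; lra.
  move: c1 c2; rewrite !ler_norml => /andP[c1 _] /andP[_ c2]; move: c1 c2; clear; lra.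
have -> : \int[mu]_s (sgi (t + h) s * (psi (t + h - s) * phi s)) -
    \int[mu]_s (sgi t s * (psi (t - s) * phi s)) -
    h * \int[mu]_s (sgi t s * (dpsi (t - s) * phi s)) =
  \int[mu]_s (sgi (t + h) s * (psi (t + h - s) * phi s) -
     sgi t s * (psi (t - s) * phi s) - h * (sgi t s * (dpsi (t - s) * phi s))).
  by rewrite (RintB (integB (ij (t + h)) (ij t)) (integZ h id_)) (RintB (ij (t + h)) (ij t)) (RintZ h id_).
have iD := integB (integB (ij (t + h)) (ij t)) (integZ h id_).
(* The difference of the two [sgi] is the indicator of ]t - 2 |h|, t + |h|]. This interval is open
   on the left, hence the factor 2, which makes it contain every s with |s - t| <= |h|. *)
pose G s := L * h ^+ 2 * `|phi s| + 4 * M * `|h| *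
  (sgi (t + `|h|) s * (1 * `|phi s|) - sgi (t - 2 * `|h|) s * (1 * `|phi s|)).
have iG : integ mu G.
  by apply: integD; apply: integZ; [exact: integ_norm|exact: integB].
apply: (le_trans (Rint_norm_le (integ_meas iD) iG _)).
  move=> s.
  have -> : sgi (t + h) s * (psi (t + h - s) * phi s) - sgi t s * (psi (t - s) * phi s) -
     h * (sgi t s * (dpsi (t - s) * phi s)) =
     (sgi (t + h) s * psi (t + h - s) - sgi t s * psi (t - s) - h * (sgi t s * dpsi (t - s))) * phi s.
    by ring.
  rewrite normrM /G mul1r -mulrBl [4 * M * _ * _]mulrA -mulrDl ler_wpM2r//.
  have sg : 0 <= sgi (t + `|h|) s - sgi (t - 2 * `|h|) s.
    rewrite /sgi opprB addrA subrK subr_ge0 ler_nat.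
    case: (leP s (t - 2 * `|h|)) => //= h1; rewrite (_ : (s <= t + `|h|) = true)//.
    by move: h1 hp; clear; lra.
  have [sh|sh] := ltP `|h| `|s - t|.
    have E : sgi (t + h) s = sgi t s.
      rewrite /sgi; congr (_%:R - _); congr nat_of_bool.
      have hh := ler_norm h; have hh' := ler_norm (- h); rewrite normrN in hh'.
      have [st|st] := leP s t.
        rewrite (ler0_norm (x := s - t)) ?subr_le0// in sh; apply/idP.
        by move: sh hh hh'; clear; lra.
      rewrite (gtr0_norm (x := s - t)) ?subr_gt0// in sh; apply/negbTE; rewrite -ltNge.
      by move: sh hh hh'; clear; lra.
    rewrite E.
    have -> : sgi t s * psi (t + h - s) - sgi t s * psi (t - s) - h * (sgi t s * dpsi (t - s)) =
      sgi t s * (psi (t - s + h) - psi (t - s) - h * dpsi (t - s)).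
      by rewrite (_ : t + h - s = t - s + h); ring.
    apply: ler_wpDr; first by rewrite mulr_ge0// !mulr_ge0.
    rewrite normrM -[leRHS]mul1r ler_pM ?sgi_le1//.
    exact: (taylor_quad dp dL).
  have E : sgi (t + `|h|) s - sgi (t - 2 * `|h|) s = 1.
    rewrite /sgi opprB addrA subrK; move: sh; rewrite ler_norml => /andP[h1 h2].
    rewrite (_ : (s <= t + `|h|) = true); last by move: h2; clear; lra.
    rewrite (_ : (s <= t - 2 * `|h|) = false) ?subr0//; apply/negbTE; rewrite -ltNge.
    by move: h1 hp; clear; lra.
  rewrite E mulr1; apply: ler_wpDl; first exact: (mulr_ge0 L0 (sqr_ge0 h)).
  have B (z r c : R) : `|sgi z s| <= 1 -> 0 <= c -> `|r| <= c -> `|sgi z s * r| <= c.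
    by move=> h1 c0 h2; rewrite normrM -[leRHS]mul1r ler_pM.
  have q1 : `|sgi (t + h) s * psi (t + h - s)| <= M * (2 * `|h|).
    apply: B; rewrite ?sgi_le1 ?mulr_ge0// (le_trans (pM _))// ler_wpM2l//.
    rewrite (_ : t + h - s = h - (s - t)); last by ring.
    by rewrite (le_trans (ler_normB _ _))// mulr2n mulrDl !mul1r lerD2l.
  have q2 : `|sgi t s * psi (t - s)| <= M * `|h|.
    by apply: B; rewrite ?sgi_le1 ?mulr_ge0// (le_trans (pM _))// ler_wpM2l// distrC.
  have q3 : `|h * (sgi t s * dpsi (t - s))| <= M * `|h|.
    by rewrite normrM mulrC ler_wpM2r//; apply: B; rewrite ?sgi_le1.
  apply: (le_trans (ler_normB _ _)).
  apply: (le_trans (lerD (le_trans (ler_normB _ _) (lerD q1 q2)) q3)).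
  by rewrite le_eqVlt; apply/orP; left; apply/eqP; ring.
rewrite /G (RintD (integZ _ (integ_norm ip)) (integZ _ (integB (iP _) (iP _)))).
rewrite (RintZ _ (integ_norm ip)) (RintZ _ (integB (iP _) (iP _))) (RintB (iP _) (iP _)).
rewrite -/N -/(P (t + `|h|)) -/(P (t - 2 * `|h|)).
have a1 : L * h ^+ 2 * N <= e / 2 * `|h|.
  rewrite -(real_normK (num_real h)) expr2 mulrA mulrAC ler_wpM2r//.
  rewrite ler_pdivlMr ?mulr_gt0// ?ltr_wpDl ?mulr_ge0// in he.
  have : L * N * `|h| <= (L * N + 1) * `|h| by rewrite ler_wpM2r// lerDl.
  move: he; move: (`|h|) => z; rewrite (_ : L * z * N = L * N * z); last by ring.
  by move: (L * N) => y; clear; lra.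
have a2 : 4 * M * `|h| * (P (t + `|h|) - P (t - 2 * `|h|)) <= e / 2 * `|h|.
  apply: (@le_trans _ _ (4 * M * `|h| * (2 * e1))).
    by rewrite ler_wpM2l// !mulr_ge0.
  rewrite (_ : 4 * M * `|h| * (2 * e1) = 8 * M * e1 * `|h|); last by ring.
  rewrite ler_wpM2r// /e1 mulrA ler_pdivrMr; last by rewrite mulr_gt0// ltr_wpDl// mulr_ge0.
  by move: e0 M0; clear; nra.
apply: (le_trans (lerD a1 a2)).
by rewrite le_eqVlt; apply/orP; left; apply/eqP; field.
Qed.

End Duhamel.

(** * The explicit solution at a frequency and its pairings *)

Section Mode.
Context {R : realType}.
Notation mu1 := (@leb1 R).
Notation mu2 := (@leb2 R).
Notation R2 := (R * R)%type.

Lemma cosl_derive (w x : R) : is_derive x (1 : R) (fun x => cos (w * x)) (- (w * sin (w * x))).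
Proof. by apply: trigger_derive; rewrite /GRing.scale /=; ring. Qed.

Lemma sinl_derive (w x : R) : is_derive x (1 : R) (fun x => sin (w * x)) (w * cos (w * x)).
Proof. by apply: trigger_derive; rewrite /GRing.scale /=; ring. Qed.

Lemma lip_of_derive (f df : R -> R) (M : R) : (forall x : R, is_derive x (1 : R) f (df x)) ->
  (forall x, `|df x| <= M) -> forall x y, `|f y - f x| <= M * `|y - x|.
Proof.
move=> fd dM x y; have cf : continuous f by exact: derive_continuous fd.
have [xy|yx] := leP x y.
  have [c _ ->] := @MVT_segment R f df x y xy (fun x _ => fd x) (continuous_subspaceT cf).
  by rewrite normrM ler_wpM2r.
have [c _] := @MVT_segment R f df y x (ltW yx) (fun x _ => fd x) (continuous_subspaceT cf).
by rewrite distrC => ->; rewrite normrM [`|y - x|]distrC ler_wpM2r.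
Qed.

Variables (g0 g1 : R2 -> R) (F : R * R2 -> R) (N : R2 -> R).
Hypothesis m0 : measurable_fun setT g0.
Hypothesis m1 : measurable_fun setT g1.
Hypothesis mF : measurable_fun setT F.
Hypothesis mN : measurable_fun setT N.
Hypothesis iF : forall xi, integ mu1 (fun s => F (s, xi)).
Hypothesis z0 : forall xi, om xi = 0 -> [/\ g0 xi = 0, g1 xi = 0 & forall s, F (s, xi) = 0].
Hypothesis N2 : integ mu2 (fun xi => N xi ^+ 2).
Hypothesis gN : forall xi,
  `|g0 xi| + `|g1 xi| / om xi + (\int[mu1]_s `|F (s, xi)|) / om xi <= N xi.

(** Duhamel's formula for V'' + om^2 V = - F with data g0 and g1. At om xi = 0, where the quotients
    are 0 by convention, everything vanishes by [z0]. *)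
Definition mode t xi : R := cos (om xi * t) * g0 xi + sin (om xi * t) / om xi * g1 xi -
  \int[mu1]_s (sgi t s * (sin (om xi * (t - s)) / om xi * F (s, xi))).
Definition dmode t xi : R := - (om xi * sin (om xi * t)) * g0 xi + cos (om xi * t) * g1 xi -
  \int[mu1]_s (sgi t s * (cos (om xi * (t - s)) * F (s, xi))).
(** The accumulated impulse of the force. F is only integrable in time, so [dmode] need not be
    differentiable everywhere, but [dmode + imp] is. *)
Definition imp t xi : R := \int[mu1]_s (sgi t s * (1 * F (s, xi))).

Lemma Rint_sgi0 (h : R -> R) : \int[mu1]_s (sgi 0 s * h s) = 0.
Proof. by rewrite (Rint_eq mu1 (g := fun=> 0)) ?Rint0// => s; rewrite sgi0 mul0r. Qed.

Lemma mode0 xi : mode 0 xi = g0 xi.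
Proof. by rewrite /mode mulr0 cos0 sin0 mul0r mul0r Rint_sgi0 mul1r addr0 subr0. Qed.

Lemma dmode0 xi : dmode 0 xi = g1 xi.
Proof. by rewrite /dmode mulr0 cos0 sin0 mulr0 oppr0 mul0r Rint_sgi0 mul1r add0r subr0. Qed.

Lemma imp0 xi : imp 0 xi = 0. Proof. exact: Rint_sgi0. Qed.

Let R0 (t : R) (c : R -> R) xi : om xi = 0 ->
  \int[mu1]_s (sgi t s * (c s * F (s, xi))) = 0.
Proof.
move=> /z0 [_ _ h]; rewrite (Rint_eq mu1 (g := fun=> 0)) ?Rint0// => s.
by rewrite h !mulr0.
Qed.

Lemma mode_derive xi (t : R) : is_derive t (1 : R) (mode ^~ xi) (dmode t xi).
Proof.
have [w0|w0] := eqVneq (om xi) 0.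
  have [h1 h2 _] := z0 w0.
  have -> : mode ^~ xi = fun=> 0.
    by apply/funext => s; rewrite /mode h1 h2 (R0 s _ w0) !mulr0 addr0 subr0.
  by rewrite /dmode h1 h2 (R0 t _ w0) !mulr0 addr0 subr0; exact: is_derive_cst.
have dsin (x : R) : is_derive x (1 : R) (fun x => sin (om xi * x) / om xi) (cos (om xi * x)).
  have h := sinl_derive (om xi) x.
  apply: (is_derive_eq (is_deriveM h (is_derive_cst (om xi)^-1 x 1))).
  by rewrite scaler0 add0r /GRing.scale /= mulKf.
have cc : continuous (fun x => cos (om xi * x)) by exact: derive_continuous (cosl_derive (om xi)).
have h := @duhamel R (fun x => sin (om xi * x) / om xi) (fun x => cos (om xi * x))
  (fun s => F (s, xi)) 1 (om xi) t (iF xi) dsin.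
rewrite mulr0 sin0 mul0r in h; have {}h := h erefl (fun=> cos_max _).
have {}h := h (lip_of_derive (cosl_derive (om xi)) _) cc.
have {}h := h (fun x => _); rewrite /mode /dmode.
have h1 := cosl_derive (om xi) t; have h2 := dsin t.
have {}h : is_derive t (1 : R) (fun t => \int[mu1]_s (sgi t s * (sin (om xi * (t - s)) / om xi * F (s, xi))))
  (\int[mu1]_s (sgi t s * (cos (om xi * (t - s)) * F (s, xi)))).
  apply: h => x; rewrite normrN normrM (ger0_norm (om_ge0 xi)) ler_piMr ?om_ge0//.
  exact: sin_max.
move: h; set J := (fun t => _); set dJ := \int[mu1]_s (sgi t s * _) => h.
have -> : (fun t => cos (om xi * t) * g0 xi + sin (om xi * t) / om xi * g1 xi - J t) =
  (fun t => (g0 xi * cos (om xi * t) + g1 xi * (sin (om xi * t) / om xi)) - J t).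
  by apply/funext => s; ring.
apply: (is_derive_eq (is_deriveB (is_deriveD (is_deriveZ (g0 xi) h1) (is_deriveZ (g1 xi) h2)) h)).
by rewrite /GRing.scale /=; ring.
Qed.

(** Adding [imp] changes the kernel cos(om (t - s)) into cos(om (t - s)) - 1, which vanishes at s =
    t as [duhamel] requires. *)
Lemma dmode_derive xi (t : R) :
  is_derive t (1 : R) (fun t => dmode t xi + imp t xi) (- (om xi ^+ 2 * mode t xi)).
Proof.
have [w0|w0] := eqVneq (om xi) 0.
  have [h1 h2 _] := z0 w0.
  have -> : (fun t => dmode t xi + imp t xi) = fun=> 0.
    by apply/funext => s; rewrite /dmode /imp h1 h2 !(R0 s _ w0) !mulr0 !addr0 subr0.
  by rewrite w0 expr0n/= mul0r oppr0; exact: is_derive_cst.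
pose psi x := cos (om xi * x) - 1; pose dpsi x := - (om xi * sin (om xi * x)).
have dp (x : R) : is_derive x (1 : R) psi (dpsi x).
  by rewrite /psi; have h := cosl_derive (om xi) x; apply: trigger_derive; rewrite subr0.
have dd (x : R) : is_derive x (1 : R) dpsi (- (om xi ^+ 2 * cos (om xi * x))).
  by rewrite /dpsi; apply: trigger_derive; rewrite /GRing.scale /=; ring.
have cd : continuous dpsi by exact: derive_continuous dd.
have p0 : psi 0 = 0 by rewrite /psi mulr0 cos0 subrr.
have dM x : `|dpsi x| <= om xi.
  by rewrite normrN normrM (ger0_norm (om_ge0 xi)) ler_piMr ?om_ge0// sin_max.
have dL : forall x y, `|dpsi y - dpsi x| <= om xi ^+ 2 * `|y - x|.
  apply: (lip_of_derive dd) => x.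
  by rewrite normrN normrM (ger0_norm (sqr_ge0 _)) ler_piMr ?sqr_ge0// cos_max.
have h := duhamel t (iF xi) dp p0 dM dL cd.
have cc : continuous (fun x => cos (om xi * x)) by exact: derive_continuous (cosl_derive (om xi)).
have ms (z : R) : measurable_fun setT (fun s : R => cos (om xi * (z - s))).
  apply: meas_cos; apply: measurable_funM => //; exact: measurable_funB.
have I1 (z : R) : integ mu1 (fun s => sgi z s * (cos (om xi * (z - s)) * F (s, xi))).
  apply: (integMb (M := 1)); [|exact: measurable_sgi|by move=> s; exact: sgi_le1].
  by apply: (integMb (iF xi) (ms z) (fun s => cos_max _)).
have I2 (z : R) : integ mu1 (fun s => sgi z s * (1 * F (s, xi))).
  apply: (integMb (M := 1)); [|exact: measurable_sgi|by move=> s; exact: sgi_le1].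
  by apply: integZ; exact: iF.
have E : (fun t => dmode t xi + imp t xi) = (fun t => (g0 xi * dpsi t + g1 xi * cos (om xi * t)) -
  \int[mu1]_s (sgi t s * (psi (t - s) * F (s, xi)))).
  apply/funext => z; rewrite /dmode /imp /dpsi.
  have -> : \int[mu1]_s (sgi z s * (psi (z - s) * F (s, xi))) =
      \int[mu1]_s (sgi z s * (cos (om xi * (z - s)) * F (s, xi))) -
      \int[mu1]_s (sgi z s * (1 * F (s, xi))).
    by rewrite -(RintB (I1 z) (I2 z)); apply: Rint_eq => s; rewrite /psi; ring.
  by ring.
rewrite E; have h1 := cosl_derive (om xi) t; have h2 := dd t.
apply: (is_derive_eq (is_deriveB (is_deriveD (is_deriveZ (g0 xi) h2) (is_deriveZ (g1 xi) h1)) h)).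
have -> : \int[mu1]_s (sgi t s * (dpsi (t - s) * F (s, xi))) =
  - (om xi ^+ 2 * \int[mu1]_s (sgi t s * (sin (om xi * (t - s)) / om xi * F (s, xi)))).
  have I3 : integ mu1 (fun s => sgi t s * (sin (om xi * (t - s)) / om xi * F (s, xi))).
    apply: (integMb (M := 1)); [|exact: measurable_sgi|by move=> s; exact: sgi_le1].
    apply: (integMb (M := (om xi)^-1)); first exact: iF.
      apply: measurable_funM => //; apply: meas_sin; apply: measurable_funM => //.
      exact: measurable_funB.
    move=> s; rewrite normrM normfV (ger0_norm (om_ge0 xi)) ler_piMl ?invr_ge0 ?om_ge0//.
    exact: sin_max.
  rewrite -(RintZ _ I3) -RintN; last exact: integZ.
  by apply: Rint_eq => s; rewrite /dpsi; field.
rewrite /GRing.scale /= /mode; move: (\int[mu1]_s _) => J.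
by field.
Qed.

Let omI_ge0 (xi : R2) : 0 <= (om xi)^-1. Proof. by rewrite invr_ge0 om_ge0. Qed.

Let Rint_mode_le (t : R) (c : R -> R) xi (M : R) : measurable_fun setT c ->
  (forall s, `|c s| <= M) ->
  `|\int[mu1]_s (sgi t s * (c s * F (s, xi)))| <= M * \int[mu1]_s `|F (s, xi)|.
Proof.
move=> mc cM; rewrite -(RintZ M (integ_norm (iF xi))); apply: Rint_norm_le.
- apply: measurable_funM; first exact: measurable_sgi.
  by apply: measurable_funM => //; exact: integ_meas (iF xi).
- by apply: integZ; exact: integ_norm.
- move=> s; rewrite !normrM -[leRHS]mul1r ler_pM ?sgi_le1//.
  by rewrite ler_wpM2r.
Qed.

Lemma mode_le t xi : `|mode t xi| <= N xi.
Proof.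
apply: le_trans (gN xi); apply: (le_trans (ler_normB _ _)); apply: lerD.
  apply: (le_trans (ler_normD _ _)); apply: lerD.
    by rewrite normrM ler_piMl// cos_max.
  rewrite !normrM normfV (ger0_norm (om_ge0 xi)) mulrAC -mulrA ler_piMl//.
    by rewrite mulr_ge0.
  exact: sin_max.
rewrite [leRHS]mulrC; apply: Rint_mode_le.
  apply: measurable_funM => //; apply: meas_sin; apply: measurable_funM => //.
  exact: measurable_funB.
by move=> s; rewrite normrM normfV (ger0_norm (om_ge0 xi)) ler_piMl// sin_max.
Qed.

Let omN xi : om xi * N xi >= `|g1 xi| + \int[mu1]_s `|F (s, xi)| + om xi * `|g0 xi|.
Proof.
have [w0|w0] := eqVneq (om xi) 0.
  have [-> -> h] := z0 w0; rewrite w0 normr0 !mul0r add0r addr0.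
  by rewrite (Rint_eq mu1 (g := fun=> 0)) ?Rint0// => s; rewrite h normr0.
apply: le_trans (ler_wpM2l (om_ge0 xi) (gN xi)).
by rewrite le_eqVlt; apply/orP; left; apply/eqP; field.
Qed.

Lemma dmode_le t xi : `|dmode t xi| <= om xi * N xi.
Proof.
apply: le_trans (omN xi).
have a1 : `|- (om xi * sin (om xi * t)) * g0 xi| <= om xi * `|g0 xi|.
  have n3 (x y z : R) : 0 <= x -> `|y| <= 1 -> `|- (x * y) * z| <= x * `|z|.
    move=> x0 y1; rewrite mulNr normrN !normrM (ger0_norm x0) -mulrA ler_wpM2l//.
    by rewrite ler_piMl.
  by apply: n3; [exact: om_ge0|exact: sin_max].
have a2 : `|cos (om xi * t) * g1 xi| <= `|g1 xi| by rewrite normrM ler_piMl// cos_max.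
have a3 := @Rint_mode_le t (fun s => cos (om xi * (t - s))) xi 1
  (meas_cos (measurable_funM (measurable_cst _) (measurable_funB (measurable_cst _) (@meas_id _ _))))
  (fun s => cos_max _).
apply: (le_trans (ler_normB _ _)).
have a4 := ler_normD (- (om xi * sin (om xi * t)) * g0 xi) (cos (om xi * t) * g1 xi).
by move: a1 a2 a3 a4; lra.
Qed.

Let meas_J (c : R -> R -> R) (t : R) : measurable_fun setT (fun z : R * R2 => c z.1 (om z.2)) ->
  measurable_fun setT (fun xi => \int[mu1]_s (sgi t s * (c s (om xi) * F (s, xi)))).
Proof.
move=> mc; apply: (@meas_Rint2 _ _ _ _ _ mu1 (fun z : R * R2 => sgi t z.1 * (c z.1 (om z.2) * F z))).
apply: measurable_funM; last exact: measurable_funM.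
apply: (meas_comp (measurable_sgi t)); exact: measurable_fst.
Qed.

Let mo2 : measurable_fun setT (fun z : R * R2 => om z.2).
Proof. by apply: (meas_comp meas_om); exact: measurable_snd. Qed.

Let mts (t : R) : measurable_fun setT (fun z : R * R2 => t - z.1).
Proof. by apply: measurable_funB => //; exact: measurable_fst. Qed.

Lemma meas_mode t : measurable_fun setT (mode t).
Proof.
have mo := @meas_om R.
apply: measurable_funB; last first.
  apply: (@meas_J (fun s w => sin (w * (t - s)) / w)).
  apply: measurable_funM; last exact: (meas_comp (@meas_inv R) mo2).
  by apply: meas_sin; exact: measurable_funM.
apply: measurable_funD; apply: measurable_funM => //.
  by apply: meas_cos; exact: measurable_funM.
apply: measurable_funM; last exact: (meas_comp (@meas_inv R) mo).
by apply: meas_sin; exact: measurable_funM.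
Qed.

Lemma meas_dmode t : measurable_fun setT (dmode t).
Proof.
have mo := @meas_om R.
apply: measurable_funB; last first.
  apply: (@meas_J (fun s w => cos (w * (t - s)))).
  by apply: meas_cos; exact: measurable_funM.
apply: measurable_funD; apply: measurable_funM => //.
  apply: measurableT_comp => //; apply: measurable_funM => //.
  by apply: meas_sin; exact: measurable_funM.
by apply: meas_cos; exact: measurable_funM.
Qed.

Lemma meas_imp t : measurable_fun setT (imp t).
Proof. exact: (@meas_J (fun _ _ => 1)). Qed.

Lemma mode_cont xi : continuous (mode ^~ xi).
Proof. by apply: (derive_continuous (df := dmode ^~ xi)) => t; exact: mode_derive. Qed.

Lemma imp_cont xi : continuous (imp ^~ xi).
Proof.
apply: (@sgi_cont R (fun=> 1) (fun s => F (s, xi)) 1) => //; last by rewrite normr1.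
by move=> x; exact: cvg_cst.
Qed.

Lemma dmode_cont xi : continuous (dmode ^~ xi).
Proof.
have h : continuous (fun t => dmode t xi + imp t xi).
  by apply: (derive_continuous (df := fun t => - (om xi ^+ 2 * mode t xi))) => t; exact: dmode_derive.
move=> t; have -> : dmode ^~ xi = fun t => (dmode t xi + imp t xi) - imp t xi.
  by apply/funext => s; rewrite addrK.
by apply: (@cvgB _ R^o); [exact: h|exact: imp_cont].
Qed.

Lemma imp_le t xi : `|imp t xi| <= om xi * N xi.
Proof.
apply: le_trans (omN xi).
have := @Rint_mode_le t (fun=> 1) xi 1 (measurable_cst _) (fun=> ltac:(by rewrite normr1)).
rewrite mul1r => h; apply: (le_trans h).
have : 0 <= om xi * `|g0 xi| by rewrite mulr_ge0 ?om_ge0.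
by have := normr_ge0 (g1 xi); lra.
Qed.

Section Pairing.
(** This will be the cosine or sine transform of a test function. As N is only square integrable and
    [dmode] only bounded by om N, the decay of q is required in the form that q, om q and om^2 q are
    square integrable. *)
Variable q : R2 -> R.
Hypothesis mq : measurable_fun setT q.
Hypothesis q2 : integ mu2 (fun xi => q xi ^+ 2).
Hypothesis oq2 : integ mu2 (fun xi => (om xi * q xi) ^+ 2).
Hypothesis ooq2 : integ mu2 (fun xi => (om xi ^+ 2 * q xi) ^+ 2).

Let moq : measurable_fun setT (fun xi => om xi * q xi).
Proof. by apply: measurable_funM => //; exact: meas_om. Qed.

Let mooq : measurable_fun setT (fun xi => om xi ^+ 2 * q xi).
Proof. by apply: measurable_funM => //; apply: measurable_funX; exact: meas_om. Qed.

Let iNn (f : R2 -> R) : measurable_fun setT f -> integ mu2 (fun xi => f xi ^+ 2) ->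
  integ mu2 (fun xi => N xi * `|f xi|).
Proof.
move=> mf f2; apply: integ_sqM2 => //; first exact: measurableT_comp.
by apply: (eq_integ _ f2) => xi; rewrite real_normK ?num_real.
Qed.

Let iN1 := iNn moq oq2.
Let iN2 := iNn mooq ooq2.

Let omq_le (c : R) xi : `|c| <= om xi * N xi -> `|c * q xi| <= N xi * `|om xi * q xi|.
Proof.
have h (x y z : R) : 0 <= x -> `|c| <= x * y -> `|c * z| <= y * `|x * z|.
  move=> x0 h; rewrite !normrM (ger0_norm x0) mulrA ler_wpM2r//.
  by rewrite [leRHS]mulrC.
by move=> h1; apply: h => //; exact: om_ge0.
Qed.

Lemma mode_q_integ t : integ mu2 (fun xi => mode t xi * q xi).
Proof.
apply: (le_integ (iNn mq q2)); first by apply: measurable_funM => //; exact: meas_mode.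
by move=> xi; rewrite normrM ler_wpM2r// mode_le.
Qed.

Lemma dmode_q_integ t : integ mu2 (fun xi => dmode t xi * q xi).
Proof.
apply: (le_integ iN1); first by apply: measurable_funM => //; exact: meas_dmode.
by move=> xi; apply: omq_le; exact: dmode_le.
Qed.

Lemma mode_pair_derive (t : R) :
  is_derive t (1 : R) (fun t => \int[mu2]_xi (mode t xi * q xi)) (\int[mu2]_xi (dmode t xi * q xi)).
Proof.
apply: (@Rint_derive _ _ _ mu2 _ _ iN1 (fun t xi => dmode t xi * q xi)).
- exact: mode_q_integ.
- move=> s xi; have h := is_deriveM (mode_derive xi s) (is_derive_cst (q xi) s 1).
  by apply: (is_derive_eq h); rewrite scaler0 add0r /GRing.scale /= mulrC.
- by move=> s xi; apply: omq_le; exact: dmode_le.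
Qed.

Let iFq : integ (mu1 \x mu2)%E (fun z : R * R2 => F z * q z.2).
Proof.
have mFq : measurable_fun setT (fun z : R * R2 => F z * q z.2).
  by apply: measurable_funM => //; apply: (meas_comp mq); exact: measurable_snd.
apply: (@integ_tonelli2 R _ _ _ _ mu1 mu2 _ _ mFq iN1).
  by move=> xi; exact: (integZr (q xi) (iF xi)).
move=> xi /=; rewrite (Rint_eq mu1 (g := fun s => `|F (s, xi)| * `|q xi|)); last first.
  by move=> s; rewrite normrM.
rewrite RintZr; last exact: integ_norm.
have c0 : 0 <= \int[mu1]_s `|F (s, xi)| by exact: Rint_ge0.
have K : `|\int[mu1]_s `|F (s, xi)| | <= om xi * N xi.
  rewrite (ger0_norm c0); apply: le_trans (omN xi).
  have : 0 <= om xi * `|g0 xi| by rewrite mulr_ge0 ?om_ge0.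
  by move=> h; rewrite addrAC lerDr addr_ge0.
have := omq_le K; rewrite [X in X <= _ -> _]normrM (ger0_norm c0); exact.
Qed.

Lemma force_q_integ : integ mu1 (fun s => \int[mu2]_xi (F (s, xi) * q xi)).
Proof. exact: (fubini1 iFq).1. Qed.

Let imp_pair t : \int[mu2]_xi (imp t xi * q xi) =
  oint (fun s => \int[mu2]_xi (F (s, xi) * q xi)) t.
Proof.
have h : integ (mu1 \x mu2)%E (fun z : R * R2 => sgi t z.1 * (F z * q z.2)).
  apply: (integMb (M := 1) iFq); last by move=> z; exact: sgi_le1.
  by apply: (meas_comp (measurable_sgi t)); exact: measurable_fst.
have := fubiniC h => /= E; transitivity (\int[mu2]_xi \int[mu1]_s (sgi t s * (F (s, xi) * q xi))).
  apply: Rint_eq => xi; rewrite /imp -RintZr.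
    by apply: Rint_eq => s; ring.
  apply: (integMb (M := 1)); [|exact: measurable_sgi|by move=> s; exact: sgi_le1].
  by apply: integZ; exact: iF.
rewrite -E /oint.
apply: ae_eq_Rint.
- exact: integ_meas (fubini1 h).1.
- apply: measurable_funM; first exact: measurable_sgi.
  exact: integ_meas (fubini1 iFq).1.
- apply: ae_impl (ae_integ_section1 iFq) => s hs /=.
  exact: (RintZ (sgi t s) hs).
Qed.

(** The fundamental theorem of calculus is applied to the pairing of [dmode + imp], which is
    differentiable in time; the pairing of [imp] is then a primitive by Fubini. *)
Lemma dmode_pair (t : R) : \int[mu2]_xi (dmode t xi * q xi) = \int[mu2]_xi (g1 xi * q xi) -
  oint (fun s => \int[mu2]_xi (mode s xi * (om xi ^+ 2 * q xi))) t -
  oint (fun s => \int[mu2]_xi (F (s, xi) * q xi)) t.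
Proof.
have iI s : integ mu2 (fun xi => imp s xi * q xi).
  apply: (le_integ iN1); first by apply: measurable_funM => //; exact: meas_imp.
  by move=> xi; apply: omq_le; exact: imp_le.
pose D s := \int[mu2]_xi ((dmode s xi + imp s xi) * q xi).
have DE s : D s = \int[mu2]_xi (dmode s xi * q xi) + \int[mu2]_xi (imp s xi * q xi).
  rewrite -(RintD (dmode_q_integ s) (iI s)); apply: Rint_eq => xi; exact: mulrDl.
have i2 s : integ mu2 (fun xi => mode s xi * (om xi ^+ 2 * q xi)).
  apply: (le_integ iN2); first by apply: measurable_funM => //; exact: meas_mode.
  by move=> xi; rewrite normrM ler_wpM2r// mode_le.
have dD (s : R) : is_derive s (1 : R) D (- \int[mu2]_xi (mode s xi * (om xi ^+ 2 * q xi))).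
  rewrite -(RintN (i2 s)).
  apply: (@Rint_derive _ _ _ mu2 _ _ iN2 (fun s xi => - (mode s xi * (om xi ^+ 2 * q xi)))).
  - move=> z; apply: (eq_integ _ (integD (dmode_q_integ z) (iI z))) => xi.
    exact/esym/mulrDl.
  - move=> z xi; have h := is_deriveM (dmode_derive xi z) (is_derive_cst (q xi) z 1).
    by apply: (is_derive_eq h); rewrite scaler0 add0r /GRing.scale /=; ring.
  - by move=> z xi; rewrite normrN normrM ler_wpM2r// mode_le.
have cH0 : continuous (fun s => \int[mu2]_xi (mode s xi * (om xi ^+ 2 * q xi))).
  apply: (@Rint_continuous _ _ _ mu2 (fun s xi => mode s xi * (om xi ^+ 2 * q xi)) _ iN2).
  - by move=> z; exact: integ_meas (i2 z).
  - by move=> xi z; apply: cvgM; [exact: mode_cont|exact: cvg_cst].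
  - by move=> z xi; rewrite normrM ler_wpM2r// mode_le.
have cH : continuous (fun s => - \int[mu2]_xi (mode s xi * (om xi ^+ 2 * q xi))).
  by move=> s; apply: (@cvgN _ R^o); exact: cH0.
have := oint_FTC t cH dD.
rewrite !DE imp_pair.
have -> : \int[mu2]_xi (dmode 0 xi * q xi) = \int[mu2]_xi (g1 xi * q xi).
  by apply: Rint_eq => xi; rewrite dmode0.
have -> : \int[mu2]_xi (imp 0 xi * q xi) = 0.
  by rewrite (Rint_eq mu2 (g := fun=> 0)) ?Rint0// => xi; rewrite imp0 mul0r.
have -> : oint (fun s => - \int[mu2]_xi (mode s xi * (om xi ^+ 2 * q xi))) t =
   - oint (fun s => \int[mu2]_xi (mode s xi * (om xi ^+ 2 * q xi))) t.
  rewrite /oint -RintN; first by apply: Rint_eq => s; rewrite mulrN.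
  exact: (integ_sgi t cH0).
by lra.
Qed.

End Pairing.

End Mode.

(** * Functions vanishing against all test functions *)

Section ZeroIntegral.
Context {R : realType} d (T : measurableType d).
Variables (mu : {measure set T -> \bar R}) (g : T -> R).
Hypothesis gi : integ mu g.

Lemma integ_indicM (A : set T) : measurable A -> integ mu (fun x => \1_A x * g x).
Proof.
move=> mA; apply: (integMb (M := 1) gi) => // x; rewrite indicE.
by case: (_ \in _); rewrite ?normr1 ?normr0.
Qed.

Lemma Rint_dynkin (G : set (set T)) : @measurable _ T = <<s G >> -> setI_closed G ->
  \int[mu]_x g x = 0 -> (forall A, G A -> \int[mu]_x (\1_A x * g x) = 0) ->
  forall A, measurable A -> \int[mu]_x (\1_A x * g x) = 0.
Proof.
move=> GE GI g0 GA A mA.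
have : <<s G >> A by rewrite -GE.
move: A {mA}; apply: (dynkin_induction GE GI).
- by rewrite -[RHS]g0; apply: Rint_eq => x; rewrite indicT mul1r.
- exact: GA.
- move=> S mS S0; rewrite (Rint_eq mu (g := fun x => g x - \1_S x * g x)); last first.
    by move=> x; rewrite !indicE in_setC; case: (x \in S); rewrite /= ?mul1r ?mul0r ?subr0 ?subrr.
  by rewrite RintB ?g0 ?S0 ?subr0//; exact: integ_indicM.
move=> F mF tF F0.
(* The indicator of the union of the first n sets; disjointness bounds it by 1, so dominated
   convergence reaches the countable union. *)
pose s n x : R := \sum_(k < n) \1_(F k) x.
have sE k0 x n : F k0 x -> s n x = (k0 < n)%N%:R.
  move=> xF; elim: n => [|n IH]; first by rewrite /s big_ord0 ltn0.
  rewrite /s big_ord_recr/= -/(s n x) IH indicE ltnS.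
  have [kn|kn] := eqVneq k0 n.
    by rewrite -kn ltnn leqnn mem_set// add0r.
  have xn : ~ F n x.
    move=> xn; move/trivIsetP : tF => /(_ k0 n I I kn)/seteqP[h _].
    exact: (h x (conj xF xn)).
  by rewrite memNset// addr0 [in RHS]leq_eqVlt (negbTE kn).
have sN x n : ~ (\bigcup_k F k) x -> s n x = 0.
  move=> xF; rewrite /s big1// => k _; rewrite indicE memNset// => xk; apply: xF.
  by exists k.
have ms n : measurable_fun setT (s n).
  by apply: measurable_sum => k; exact: measurable_indic.
have s1 n x : `|s n x| <= 1.
  have [[k _ xk]|xF] := pselect ((\bigcup_k F k) x); last by rewrite sN// normr0.
  by rewrite (sE k)//; case: (k < n)%N; rewrite ?normr1 ?normr0.
have is_ n : integ mu (fun x => s n x * g x) by apply: (integMb gi (ms n) (s1 n)).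
have z n : \int[mu]_x (s n x * g x) = 0.
  elim: n => [|n IH].
    by rewrite (Rint_eq mu (g := fun=> 0)) ?Rint0// => x; rewrite /s big_ord0 mul0r.
  rewrite (Rint_eq mu (g := fun x => s n x * g x + \1_(F n) x * g x)).
    by rewrite RintD ?IH ?F0 ?addr0//; exact: integ_indicM.
  by move=> x; rewrite /s big_ord_recr/= mulrDl.
have mB : measurable (\bigcup_k F k) by exact: bigcupT_measurable.
have L : \int[mu]_x (s n x * g x) @[n --> \oo] --> \int[mu]_x (\1_(\bigcup_k F k) x * g x).
  apply: (Rint_lim (integ_norm gi)).
  - by move=> n; exact: integ_meas (is_ n).
  - exact: integ_meas (integ_indicM mB).
  - apply: (ae_impl (P := fun=> True)); last exact: aeW.
    move=> x _; apply: cvg_near_cst.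
    have [[k _ xk]|xF] := pselect ((\bigcup_k F k) x); last first.
      by apply: nearW => n; rewrite sN// indicE memNset.
    exists k.+1 => // n /= kn; rewrite (sE k)// kn indicE mem_set//.
    by exists k.
  - by move=> n x; rewrite normrM -[leRHS]mul1r ler_pM.
by rewrite (funext z) in L; apply: (lim_uniq L); exact: cvg_cst.
Qed.

Lemma ae_zero : (forall A, measurable A -> \int[mu]_x (\1_A x * g x) = 0) ->
  {ae mu, forall x, g x = 0}.
Proof.
move=> h; have := @integral_ae_eq _ T R mu setT measurableT (cst 0%E) (EFin \o g) gi (measurable_cst _).
move=> /(_ _)H; have {}H : ae_eq mu setT (EFin \o g) (cst 0%E).
  apply: H => E _ mE; rewrite integral0 integral_mkcond.
  transitivity (\int[mu]_x (\1_E x * g x)%:E)%E; last first.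
    by rewrite -EFin_Rint ?h//; exact: integ_indicM.
  apply: eq_integral => x _; rewrite /patch indicE.
  by case: (x \in E); rewrite ?mul1r ?mul0r.
by apply: ae_impl H => x /(_ I) /= [].
Qed.

End ZeroIntegral.

Lemma ae_integ_section2 (R : realType) d1 d2 (T1 : measurableType d1) (T2 : measurableType d2)
  (m1 : {sigma_finite_measure set T1 -> \bar R}) (m2 : {sigma_finite_measure set T2 -> \bar R})
  (f : T1 * T2 -> R) : integ (m1 \x m2)%E f ->
  {ae m2, forall y, integ m1 (fun x => f (x, y))}.
Proof. by move=> fi; apply: (ae_integrable2 fi). Qed.

Section Fundamental.
Context {R : realType}.
Notation mu1 := (@leb1 R).
Notation mu2 := (@leb2 R).
Notation R2 := (R * R)%type.

Lemma line_zero (g : R -> R) : integ mu1 g ->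
  (forall a b : R, \int[mu1]_x (\1_(`]a, b]%classic) x * g x) = 0) ->
  forall A, measurable A -> \int[mu1]_x (\1_A x * g x) = 0.
Proof.
move=> gi g0; apply: (Rint_dynkin gi (G := @ocitv R)) => //.
- exact: ocitvI.
- have L : \int[mu1]_x (\1_(`]- n%:R, n%:R]%classic) x * g x) @[n --> \oo] --> \int[mu1]_x g x.
    apply: (Rint_lim (integ_norm gi)).
    + move=> n; apply: (measurable_funM (measurable_indic _) (integ_meas gi)).
      exact: measurable_itv.
    + exact: integ_meas gi.
    + apply: (ae_impl (P := fun=> True)); last exact: aeW.
      move=> x _; apply: cvg_near_cst; near=> n; rewrite indicE mem_set ?mul1r//=.
      have : `|x| < n%:R by near: n; exact: nbhs_infty_gtr.
      by rewrite in_itv/= ltr_norml => /andP[-> /ltW ->].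
    + move=> n x; rewrite normrM ler_piMl// indicE.
      by case: (_ \in _); rewrite ?normr1 ?normr0.
  rewrite (_ : (fun n => _) = fun=> 0) in L; last by apply/funext => n; exact: g0.
  by apply: (lim_uniq L); exact: cvg_cst.
- by move=> _ [[a b] _ <-]; exact: g0.
Unshelve. all: by end_near. Qed.

(** One coordinate at a time: the marginal of g over an interval of the second coordinate is
    integrable, and [line_zero] extends intervals to measurable sets in the first coordinate; then
    the roles are exchanged. Measurable rectangles generate the product sigma-algebra. *)
Lemma plane_zero (g : R2 -> R) : integ mu2 g ->
  (forall a b c e : R, \int[mu2]_x (\1_(`]a, b]%classic) x.1 * (\1_(`]c, e]%classic) x.2 * g x)) = 0) ->
  {ae mu2, forall x, g x = 0}.
Proof.
move=> gi g0; apply: (ae_zero gi).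
have mi (a b : R) : measurable (`]a, b]%classic : set (measurableTypeR R)) by exact: measurable_itv.
have m1 (A : set (measurableTypeR R)) : measurable A -> measurable_fun setT (fun x : R2 => \1_A x.1 : R).
  by move=> mA; apply: (meas_comp (measurable_indic mA)); exact: measurable_fst.
have m2 (A : set (measurableTypeR R)) : measurable A -> measurable_fun setT (fun x : R2 => \1_A x.2 : R).
  by move=> mA; apply: (meas_comp (measurable_indic mA)); exact: measurable_snd.
have i1 (A : set (measurableTypeR R)) (x : R) : `|\1_A x : R| <= 1.
  by rewrite indicE; case: (_ \in _); rewrite ?normr1 ?normr0.
have I (A B : set (measurableTypeR R)) : measurable A -> measurable B ->
    integ mu2 (fun x : R2 => \1_A x.1 * (\1_B x.2 * g x)).
  move=> mA mB; apply: (integMb (M := 1)); [|exact: m1|by move=> x].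
  by apply: (integMb (M := 1) gi); [exact: m2|move=> x].
have J (B : set (measurableTypeR R)) : measurable B -> integ mu2 (fun x : R2 => \1_B x.2 * g x).
  by move=> mB; apply: (integMb (M := 1) gi); [exact: m2|move=> x].
have J' (B : set (measurableTypeR R)) : measurable B -> integ mu2 (fun x : R2 => \1_B x.1 * g x).
  by move=> mB; apply: (integMb (M := 1) gi); [exact: m1|move=> x].
have step1 (A : set (measurableTypeR R)) (c e : R) : measurable A ->
    \int[mu2]_x (\1_A x.1 * (\1_(`]c, e]%classic) x.2 * g x)) = 0.
  move=> mA.
  have h (B : set (measurableTypeR R)) (mB : measurable B) : \int[mu2]_x (\1_B x.1 * (\1_(`]c, e]%classic) x.2 * g x)) =
      \int[mu1]_x (\1_B x * \int[mu1]_y (\1_(`]c, e]%classic) y * g (x, y))).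
    rewrite -(fubini1 (I B _ mB (mi c e))).2; apply: ae_eq_Rint.
    - exact: integ_meas (fubini1 (I B _ mB (mi c e))).1.
    - apply: measurable_funM; first exact: measurable_indic.
      exact: integ_meas (fubini1 (J _ (mi c e))).1.
    - apply: ae_impl (ae_integ_section1 (J _ (mi c e))) => x hx /=.
      exact: (RintZ (\1_B x) hx).
  rewrite h//; apply: line_zero => //; first exact: (fubini1 (J _ (mi c e))).1.
  by move=> a b; rewrite -h//; exact: g0.
have step2 (A B : set (measurableTypeR R)) : measurable A -> measurable B ->
    \int[mu2]_x (\1_A x.1 * (\1_B x.2 * g x)) = 0.
  move=> mA mB.
  have h (D : set (measurableTypeR R)) (mD : measurable D) : \int[mu2]_x (\1_A x.1 * (\1_D x.2 * g x)) =
      \int[mu1]_y (\1_D y * \int[mu1]_x (\1_A x * g (x, y))).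
    rewrite -(fubini2 (I A D mA mD)).2; apply: ae_eq_Rint.
    - exact: integ_meas (fubini2 (I A D mA mD)).1.
    - apply: measurable_funM; first exact: measurable_indic.
      exact: integ_meas (fubini2 (J' _ mA)).1.
    - apply: ae_impl (ae_integ_section2 (J' _ mA)) => y hy /=.
      by rewrite -(RintZ (\1_D y) hy); apply: Rint_eq => x; rewrite mulrCA.
  rewrite h//; apply: line_zero => //; first exact: (fubini2 (J' _ mA)).1.
  by move=> a b; rewrite -h//; exact: step1.
apply: (Rint_dynkin gi (G := [set A `*` B | A in measurable & B in measurable])).
- by rewrite -measurable_prod_measurableType.
- move=> _ _ [A1 mA1 [A2 mA2 <-]] [B1 mB1 [B2 mB2 <-]].
  exists (A1 `&` B1); first exact: measurableI.
  by exists (A2 `&` B2); [exact: measurableI|rewrite setXI].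
- rewrite -(step2 setT setT measurableT measurableT); apply: Rint_eq => x.
  by rewrite !indicT !mul1r.
- move=> _ [A mA [B mB <-]]; rewrite -(step2 A B mA mB); apply: Rint_eq => x.
  rewrite !indicE in_setX mulrA; congr (_ * _).
  by case: (_ \in A); rewrite ?mul1r ?mul0r.
Qed.

Lemma ae_coord (u v : R) : {ae mu2, forall x : R2, x.1 != u /\ x.2 != v}.
Proof.
exists ([set u] `*` setT `|` setT `*` [set v]); split.
- by apply: measurableU; apply: measurableX.
- have Z (A B : set R) : measurable A -> measurable B -> (leb1 A * leb1 B = 0)%E ->
      mu2 (A `*` B) = 0%E by move=> mA mB h; rewrite /leb2 product_measure1E.
  have z (c : R) : @leb1 R [set c] = 0%E by exact: lebesgue_measure_set1.
  rewrite null_set_setU//; try exact: measurableX.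
    by apply: Z => //; rewrite z mul0e.
  by apply: Z => //; rewrite z mule0.
- move=> [a b] /= h; have [->|a0] := eqVneq a u; first by left.
  by right; split => //; have [//|b0] := eqVneq b v; case: h.
Qed.

Lemma ae_and d (T : measurableType d) (mu : {measure set T -> \bar R}) (P Q : T -> Prop) :
  {ae mu, forall x, P x} -> {ae mu, forall x, Q x} -> {ae mu, forall x, P x /\ Q x}.
Proof. exact: filterI. Qed.

Lemma indic_itv_cut (a b r x : R) : x != Num.max a (- r) -> x != Num.min b r ->
  \1_(`]a, b]%classic) x * \1_(`[- r, r]%classic) x =
  \1_(`]Num.max a (- r), Num.min b r[%classic) x :> R.
Proof.
move=> xa xb; rewrite !indicE -natrM mulnb; congr (_%:R); congr nat_of_bool.
apply/idP/idP; rewrite !inE/= !in_itv/=; last first.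
  rewrite gt_max lt_min => /andP[/andP[h1 h2] /andP[h3 h4]].
  by apply/andP; split; rewrite inE/= in_itv/=; apply/andP; split => //; exact: ltW.
move=> /andP[]; rewrite !inE/= !in_itv/= => /andP[h1 h2] /andP[h3 h4].
by rewrite lt_neqAle eq_sym xa ge_max (ltW h1) h3/= lt_neqAle xb le_min h2 h4.
Qed.

(** Bump functions supported in a cube approximate the indicators of rectangles in it, up to the
    edges, which are null sets; so each truncation of w has zero integral over every rectangle. *)
Lemma test_zero (w : R2 -> R) : measurable_fun setT w ->
  (forall n : nat, integ mu2 (trunc w n)) ->
  (forall p, test_function p -> \int[mu2]_x (w x * p x) = 0) ->
  {ae mu2, forall x, w x = 0}.
Proof.
move=> mw iw w0.
have H n : {ae mu2, forall x, trunc w n x = 0}.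
  apply: plane_zero => // a b c e; pose r : R := n%:R.
  (* Cutting the rectangle to the cube before smoothing keeps the bumps where w is dominated by its
     integrable truncation. *)
  pose a' := Num.max a (- r); pose b' := Num.min b r.
  pose c' := Num.max c (- r); pose e' := Num.min e r.
  pose T k (x : R2) := bump k%:R a' b' x.1 * bump k%:R c' e' x.2.
  have tT k : test_function (T k).
    by apply: (test_tensor2 (f := bump k%:R a' b') (g := bump k%:R c' e')); exact: bump_test.
  pose S (x : R2) : R := \1_(`]a', b'[%classic) x.1 * \1_(`]c', e'[%classic) x.2.
  have mi (u v : R) : measurable (`]u, v[%classic : set (measurableTypeR R)) by exact: measurable_itv.
  have mic (u v : R) : measurable (`]u, v]%classic : set (measurableTypeR R)) by exact: measurable_itv.
  have mS : measurable_fun setT S.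
    apply: measurable_funM.
      by apply: (meas_comp (measurable_indic (mi a' b'))); exact: measurable_fst.
    by apply: (meas_comp (measurable_indic (mi c' e'))); exact: measurable_snd.
  have L : \int[mu2]_x (w x * T k x) @[k --> \oo] --> \int[mu2]_x (w x * S x).
    apply: (Rint_lim (integ_norm (iw n))).
    + by move=> k; apply: measurable_funM => //; exact: test2_meas.
    + exact: measurable_funM.
    + apply: (ae_impl (P := fun=> True)); last exact: aeW.
      by move=> x _; apply: cvgM; [exact: cvg_cst|apply: cvgM; exact: bump_cvg].
    + move=> k x; suff hT : `|T k x| <= `|cube2 n%:R x|.
        have N (p q z : R) : `|q| <= `|z| -> `|p * q| <= `|z * p|.
          by move=> qz; rewrite !normrM mulrC ler_wpM2r.
        exact: N hT.
      have b1 (u v : R) y : `|bump k%:R u v y| <= 1 by rewrite ger0_norm ?bump_ge0 ?bump_le1.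
      have out (u v y : R) : y \notin `]Num.max u (- r), Num.min v r[ ->
          bump k%:R (Num.max u (- r)) (Num.min v r) y = 0 by exact: bump_out.
      have [x1|x1] := boolP (x.1 \in `]a', b'[); last by rewrite /T out// mul0r normr0.
      have [x2|x2] := boolP (x.2 \in `]c', e'[); last by rewrite /T [X in _ * X]out// mulr0 normr0.
      have -> : cube2 n%:R x = 1.
        rewrite /cube2 cube2E indicE mem_set//; move: x1 x2.
        rewrite !in_itv/= !gt_max !lt_min => /andP[/andP[_ h1] /andP[_ h2]] /andP[/andP[_ h3] /andP[_ h4]].
        by split; rewrite /= in_itv/= !ltW.
      by rewrite normr1 /T normrM mulr_ile1.
  have L0 : \int[mu2]_x (w x * S x) = 0.
    rewrite (funext (fun k => w0 _ (tT k))) in L.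
    by apply/esym/(lim_uniq _ L); exact: cvg_cst.
  rewrite -[RHS]L0; apply: ae_eq_Rint.
  - apply: measurable_funM.
      by apply: (meas_comp (measurable_indic (mic a b))); exact: measurable_fst.
    apply: measurable_funM; last exact: integ_meas (iw n).
    by apply: (meas_comp (measurable_indic (mic c e))); exact: measurable_snd.
  - exact: measurable_funM.
  - apply: ae_impl (ae_and (ae_coord a' c') (ae_coord b' e')) => x [[xa xc] [xb xe]].
    rewrite /S -(indic_itv_cut xa xb) -(indic_itv_cut xc xe) /trunc /cube2 cube2E.
    rewrite [X in _ * (_ * (X * _))]indicE in_setX.
    move: (\1_(`]a, b]%classic) x.1) (\1_(`]c, e]%classic) x.2) (w x) => A B W.
    rewrite !indicE; case: (x.1 \in _); case: (x.2 \in _) => /=; ring.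
have := ae_foralln H; apply: ae_impl => x h.
have [n xn] : exists n : nat, `|x| <= n%:R.
  exists (Num.truncn `|x|).+1; exact/ltW/truncnS_gt.
by have := h n; rewrite /trunc /cube2 indicE mem_set// mul1r.
Qed.

End Fundamental.

(** * Weak solutions as equations in time *)

Section WeakOde.
Context {R : realType}.
Notation mu := (@leb1 R).
Notation dd f := ('D_(1 : R) f).

Lemma is_derive_line1 (a c y : R) : is_derive y (1 : R) (fun y : R => a + y * c) c.
Proof. by apply: trigger_derive; rewrite /GRing.scale /=; ring. Qed.

(** The parameter occurs in b alone, so continuity of g suffices; while it moves by at most 1, the
    support stays in the interval of radius [T]. *)
Lemma conv_derive (g b : R -> R) (t : R) : continuous g -> test_function b ->
  is_derive t (1 : R) (fun t => \int[mu]_s (g s * b (s - t))) (- \int[mu]_s (g s * dd b (s - t))).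
Proof.
move=> cg tb; have [sb [r br]] := tb.
have cb := smooth_cont sb; have sb' := smooth_derive (1 : R) sb; have cb' := smooth_cont sb'.
have br' : forall x, r < `|x| -> dd b x = 0 by exact: derive_supp.
pose T : R := `|t| + 1 + r.
have sup (f : R -> R) (z s : R) : (forall x, r < `|x| -> f x = 0) -> t - 1 < z < t + 1 ->
    T < `|s| -> f (s - z) = 0.
  move=> f0 /andP[z1 z2] sT; apply: f0.
  have zt : `|z| <= `|t| + 1.
    rewrite -[z](subrK t) (le_trans (ler_normD _ _))// addrC lerD2l ler_norml.
    by apply/andP; split; move: z1 z2; clear; lra.
  have := ler_normD (s - z) z; rewrite subrK; move: zt sT; rewrite /T; clear; lra.
have csh (f : R -> R) (z : R) : continuous f -> continuous (fun s => g s * f (s - z)).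
  move=> cf s; apply: cvgM; first exact: cg.
  apply: (cvg_comp (fun s : R => s - z) f _ (cf (s - z))).
  by apply: (@cvgB _ R^o); [exact: cvg_id|exact: cvg_cst].
have ish (f : R -> R) (z : R) : continuous f -> (forall x, r < `|x| -> f x = 0) ->
    t - 1 < z < t + 1 -> integ mu (fun s => g s * f (s - z)).
  move=> cf f0 zt; apply: (@integ_csupp _ _ T); first exact: csh.
  by move=> s sT; rewrite sup// mulr0.
have [M M0 bM] := cont_itv_bounded r cb'.
have {}bM x : `|dd b x| <= M.
  by have [/bM//|xr] := leP `|x| r; rewrite br'// normr0 ltW.
have [K K0 gK] := cont_itv_bounded T cg.
have tt : t - 1 < t < t + 1 by rewrite ltrDl ltr01 gtrDl ltrN10.
rewrite -(RintN (ish (dd b) t cb' br' tt)).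
apply: (@Rint_derive_loc _ _ _ mu _ (fun z s => - (g s * dd b (s - z))) _ (t - 1) (t + 1) t
   (integZ (K * M) (integ_indic_itv (- T) T true false)) tt).
- by move=> z zt; exact: (ish b z cb br zt).
- move=> z s zt.
  have h1 : is_derive z (1 : R) (fun z : R => s - z) (-1).
    by apply: trigger_derive; ring.
  have h2 := @is_derive1_comp _ b (fun z => s - z) z _ _ (smooth_is_derive (s - z) (1 : R) sb) h1.
  have h3 := is_deriveZ (g s) h2.
  by apply: (is_derive_eq h3); rewrite /GRing.scale /=; ring.
- move=> z s zt; rewrite normrN normrM indicE; have [|] := leP `|s| T => sT.
    rewrite mem_set; last by rewrite /= in_itv/= -ler_norml.
    by rewrite mulr1 ler_pM// gK.
  by rewrite [dd b _]sup// normr0 mulr0 !mulr_ge0// ?ltW// ler0n.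
Qed.

(** The convolution of g with a bump has zero second derivative in the ordinary sense, hence is
    affine. It is compared with g at the points 0, 1 and t only, so continuity of g at these points
    gives the closeness that is needed. *)
Lemma affine_of_weak (g : R -> R) : continuous g ->
  (forall eta, test_function eta -> \int[mu]_s (g s * dd (dd eta) s) = 0) ->
  forall t, g t = g 0 + t * (g 1 - g 0).
Proof.
move=> cg g0 t; apply/eqP; rewrite -subr_eq0 -normr_eq0.
set X := g t - _; apply/eqP/le_anti; rewrite normr_ge0 andbT.
apply/ler_addgt0Pr => e e0; rewrite add0r.
(* The errors at t, 0 and 1 enter with weights 1, |1 - t| <= 1 + |t| and |t|, whose sum is at most 2
   + 2 |t|. *)
pose e1 := e / (2 + 2 * `|t|).
have K0 : 0 < 2 + 2 * `|t| by rewrite ltr_pwDl// mulr_ge0.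
have e10 : 0 < e1 by rewrite divr_gt0.
have near_g (x : R) : exists2 D : R, 0 < D & forall y, `|y - x| < D -> `|g y - g x| <= e1.
  have /cvgrPdist_le /(_ _ e10) /nbhs_ballP[D /= D0 hD] := cg x.
  exists D => // y yx; rewrite distrC; apply: hD.
  by rewrite -ball_normE /ball_ /= distrC.
have [D0 D00 h0] := near_g 0; have [D1 D10 h1] := near_g 1; have [D2 D20 h2] := near_g t.
pose D := Num.min D0 (Num.min D1 D2).
have D_0 : 0 < D by rewrite !lt_min D00 D10 D20.
have [b [tb bout bge0 b0]] : exists b : R -> R, [/\ test_function b,
    (forall y, D <= `|y| -> b y = 0), (forall y, 0 <= b y) & 0 < b 0].
  exists (bump 1 (- D) D); split; [exact: bump_test| |by move=> y; exact: bump_ge0|].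
    by move=> y Dy; apply: bump_out => //; rewrite in_itv/= -ltr_norml -leNgt.
  by apply: bump_gt0 => //; rewrite in_itv/= oppr_lt0 D_0.
pose G (f : R -> R) z := \int[mu]_s (f s * b (s - z)).
have c1 : continuous (fun _ : R => 1 : R) by move=> x; exact: cvg_cst.
have td := test_derive (1 : R) tb.
have dsh (f : R -> R) z : test_function f -> dd (fun s => f (s - z)) = fun s => dd f (s - z).
  by move=> [sf _]; apply/funext => s; rewrite derive_shiftf.
have dG (z : R) : is_derive z (1 : R) (G g) (- \int[mu]_s (g s * dd b (s - z))).
  exact: conv_derive.
have dG' (z : R) : is_derive z (1 : R) (fun z => - \int[mu]_s (g s * dd b (s - z))) 0.
  have h := conv_derive z cg td.
  have E : \int[mu]_s (g s * dd (dd b) (s - z)) = 0.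
    rewrite -(g0 _ (test_shift z tb)); apply: Rint_eq => s.
    have e2 : dd (dd (fun s => b (s - z))) = fun s => dd (dd b) (s - z).
      by rewrite (dsh b z tb); exact: (dsh (dd b) z td).
    exact: (congr1 (fun f : R -> R => g s * f s) (esym e2)).
  by rewrite E oppr0 in h; have := is_deriveN h; rewrite oppr0.
pose c := - \int[mu]_s (g s * dd b (s - 0)).
have cE z : - (\int[mu]_s (g s * dd b (s - z))) = c by exact: (is_derive_0_is_cst z 0 dG').
have Gaff z : G g z = G g 0 + z * c.
  have dH (y : R) : is_derive y (1 : R) (fun y => G g y - (0 + y * c)) 0.
    have h := dG y; rewrite cE in h.
    have h' := is_derive_line1 0 c y.
    by apply: (is_derive_eq (is_deriveB h h')); rewrite subrr.
  have := is_derive_0_is_cst z 0 dH; rewrite mul0r !add0r subr0 => /eqP.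
  by rewrite subr_eq => /eqP.
have I0 z : G (fun=> 1) z = G (fun=> 1) 0.
  apply: (@is_derive_0_is_cst R (G (fun=> 1))) => y.
  have h := conv_derive y c1 tb.
  have E : \int[mu]_s (1 * dd b (s - y)) = 0.
    have ts := test_shift y tb; have [ss [r sr]] := ts.
    have := @RintT_derive_csupp R (fun s => b (s - y)) (dd (fun s => b (s - y))) r
      (smooth_cont (smooth_derive _ ss)) (fun s => smooth_is_derive s (1 : R) ss) sr.
    rewrite (dsh _ y tb) => <-; apply: Rint_eq => s; exact: mul1r.
  by rewrite E oppr0 in h.
pose I_ := G (fun=> 1) 0.
have ib z : integ mu (fun s => b (s - z)).
  have [ss [r sr]] := test_shift z tb.
  by apply: (@integ_csupp _ _ r) => //; exact: smooth_cont.
have cb := smooth_cont tb.1.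
have igb z : integ mu (fun s => g s * b (s - z)).
  have [ss [r sr]] := test_shift z tb.
  apply: (@integ_csupp _ _ r) => [s|s rs]; last by rewrite sr// mulr0.
  have cs := smooth_cont ss; exact: (cvgM (cg s) (cs s)).
have Ipos : 0 < I_.
  have i0 : I_ = \int[mu]_s b s by apply: Rint_eq => s; rewrite mul1r subr0.
  have ib0 : integ mu b by apply: (eq_integ _ (ib 0)) => s; rewrite subr0.
  have I_ge0 : 0 <= I_ by rewrite i0; apply: Rint_ge0 => s; exact: bge0.
  rewrite lt_neqAle I_ge0 andbT eq_sym; apply/eqP => I0'.
  (* Positivity of the integral of b follows from the planar lemma [Rint_le0_cont] applied to b(x1)
     b(x2), whose integral is the square. *)
  have [it Et] := Rint_tensor ib0 ib0.
  have ct : continuous (fun x : R * R => b x.1 * b x.2).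
    by have [st _] := test_tensor2 tb tb; exact: smooth_cont st.
  have := @Rint_le0_cont R (fun x : R * R => b x.1 * b x.2) 0 ct it
    (fun x => mulr_ge0 (bge0 _) (bge0 _)).
  rewrite [Rintegral _ _ _]Et -i0 I0' mul0r lexx => /(_ isT) /eqP.
  by rewrite mulf_eq0 /= (gt_eqF b0).
have close z Dz : D <= Dz -> (forall y, `|y - z| < Dz -> `|g y - g z| <= e1) ->
    `|G g z - g z * I_| <= e1 * I_.
  move=> DD hz; rewrite /I_ -(I0 z) /G.
  have i1 : integ mu (fun s => 1 * b (s - z)) by apply: integZ.
  rewrite -(RintZ (g z) i1) -(RintB (igb z) (integZ (g z) i1)) -(RintZ e1 i1).
  apply: Rint_norm_le.
  - exact: integ_meas (integB (igb z) (integZ (g z) i1)).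
  - exact: integZ.
  - move=> s; rewrite mul1r -mulrBl normrM (ger0_norm (bge0 _)).
    have [sz|sz] := ltP `|s - z| D; last by rewrite bout// !mulr0.
    by rewrite ler_wpM2r ?bge0// hz// (lt_le_trans sz).
have a0 : `|G g 0 - g 0 * I_| <= e1 * I_ by apply: (close 0 D0) => //; rewrite ge_min lexx.
have a1 : `|G g 1 - g 1 * I_| <= e1 * I_ by apply: (close 1 D1) => //; rewrite !ge_min lexx orbT.
have a2 : `|G g t - g t * I_| <= e1 * I_ by apply: (close t D2) => //; rewrite !ge_min lexx !orbT.
have E : X * I_ = - (G g t - g t * I_) + (G g 0 - g 0 * I_) * (1 - t) + t * (G g 1 - g 1 * I_).
  by rewrite /X (Gaff t) (Gaff 1); ring.
rewrite -(ler_pM2r Ipos) -[X in _ * X <= _](gtr0_norm Ipos) -normrM E.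
apply: (le_trans (ler_normD _ _)).
apply: (le_trans (lerD (ler_normD _ _) (lexx _))); rewrite normrN !normrM.
have t1 : `|1 - t| <= 1 + `|t| by rewrite (le_trans (ler_normB _ _))// normr1.
have bb0 : `|G g 0 - g 0 * I_| * `|1 - t| <= e1 * I_ * (1 + `|t|) by rewrite ler_pM.
have bb1 : `|t| * `|G g 1 - g 1 * I_| <= `|t| * (e1 * I_) by rewrite ler_wpM2l.
have ee : e = e1 * (2 + 2 * `|t|) by rewrite /e1 divfK// gt_eqF.
rewrite ee; apply: (le_trans (lerD (lerD a2 bb0) bb1)).
by rewrite le_eqVlt; apply/orP; left; apply/eqP; ring.
Qed.

Lemma test1_bound (f : R -> R) : test_function f -> exists2 M : R, 0 < M & forall x, `|f x| <= M.
Proof.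
move=> [sf [r fr]]; have [M M0 fM] := cont_itv_bounded r (smooth_cont sf).
exists M => // x; have [/fM//|xr] := leP `|x| r.
by rewrite fr// normr0 ltW.
Qed.

Lemma test1_integ (f : R -> R) : test_function f -> integ mu f.
Proof. by move=> [sf [r fr]]; apply: (integ_csupp (smooth_cont sf) fr). Qed.

Lemma by_parts (F f eta : R -> R) : continuous f -> (forall x : R, is_derive x (1 : R) F (f x)) ->
  test_function eta -> \int[mu]_s (F s * dd eta s) = - \int[mu]_s (f s * eta s).
Proof.
move=> cf Ff te; have [se [r er]] := te; have cF : continuous F by exact: derive_continuous Ff.
have [se' [r' er']] := test_derive (1 : R) te.
have cM (u v : R -> R) : continuous u -> continuous v -> continuous (fun x => u x * v x).
  by move=> cu cv x; apply: cvgM; [exact: cu|exact: cv].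
have ce := smooth_cont se; have ce' := smooth_cont se'.
have i1 : integ mu (fun s => F s * dd eta s).
  by apply: (integ_csupp (cM _ _ cF ce') (r := r')) => s sr; rewrite er'// mulr0.
have i2 : integ mu (fun s => f s * eta s).
  by apply: (integ_csupp (cM _ _ cf ce) (r := r)) => s sr; rewrite er// mulr0.
apply/eqP; rewrite -addr_eq0 -(RintD i1 i2); apply/eqP.
apply: (@RintT_derive_csupp R (fun s => F s * eta s) (fun s => F s * dd eta s + f s * eta s) r).
- by move=> x; apply: (@cvgD _ R^o); [exact: (cM _ _ cF ce')|exact: (cM _ _ cf ce)].
- move=> x; have h := is_deriveM (Ff x) (smooth_is_derive x (1 : R) se).
  by apply: (is_derive_eq h); rewrite /GRing.scale /= [eta x * _]mulrC.
- by move=> x xr; rewrite er// mulr0.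
Qed.

Lemma integ_step (eta : R -> R) (s : R) : test_function eta ->
  integ mu (fun t => sgi t s * dd eta t).
Proof.
move=> te; apply: (integMb (M := 1) (test1_integ (test_derive (1 : R) te))).
  apply: measurable_funB => //.
  rewrite (_ : (fun t => _) = \1_(`[s, +oo[%classic)); first exact: measurable_indic.
  apply/funext => t; rewrite indicE; congr (nat_of_bool _)%:R.
  by apply/idP/idP; rewrite inE/= in_itv/= andbT.
by move=> t; exact: sgi_le1.
Qed.

Lemma measurable_sgi2 : measurable_fun setT (fun z : R * R => sgi z.1 z.2).
Proof.
apply: measurable_funB.
  rewrite (_ : (fun z => _) = fun z : R * R => \1_(`[(0 : R), +oo[%classic) (z.1 - z.2)).
    apply: (meas_comp (measurable_indic _)); first exact: measurable_itv.
    by apply: measurable_funB; [exact: measurable_fst|exact: measurable_snd].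
  apply/funext => z; rewrite indicE; congr (nat_of_bool _)%:R.
  by apply/idP/idP; rewrite inE/= in_itv/= andbT subr_ge0.
rewrite (_ : (fun z => _) = fun z : R * R => \1_(`]-oo, (0 : R)]%classic) z.2).
  apply: (meas_comp (measurable_indic _)); first exact: measurable_itv.
  exact: measurable_snd.
apply/funext => z; rewrite indicE; congr (nat_of_bool _)%:R.
by apply/idP/idP; rewrite inE/= in_itv/=.
Qed.

(** As a function of t, [sgi t s] is a unit step at s minus a constant; its distributional
    derivative is the point mass at s. *)
Lemma Rint_step (eta : R -> R) (s : R) : test_function eta ->
  \int[mu]_t (sgi t s * dd eta t) = - eta s.
Proof.
move=> te; have [se [r er]] := te; have te' := test_derive (1 : R) te.
have [se' [r' er']] := te'.
pose m : R := Num.max `|r| `|r'| + 1 + `|s|.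
have ie' := test1_integ te'; have ce' := smooth_cont se'.
have fd (x : R) : is_derive x (1 : R) eta (dd eta x) by exact: smooth_is_derive.
have rm : r < m /\ r' < m.
  have := ler_norm r; have := ler_norm r'; have : `|r| <= Num.max `|r| `|r'| by rewrite le_max lexx.
  have : `|r'| <= Num.max `|r| `|r'| by rewrite le_max lexx orbT.
  have := normr_ge0 s; rewrite /m; move: (Num.max _ _) => z; by split; lra.
have m0 : 0 <= m by rewrite !addr_ge0// le_max normr_ge0.
pose L (a : R) := \int[mu]_t ((t <= a)%R%:R * dd eta t).
have iL (a : R) : integ mu (fun t => (t <= a)%R%:R * dd eta t).
  have E t : (t <= a)%R%:R * dd eta t = sgi a t * dd eta t - sgi (- m) t * dd eta t :> R.
    rewrite /sgi; have [tm|tm] := leP t (- m); last by rewrite /=; ring.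
    rewrite (er' t) ?mulr0 ?subrr//; apply: (lt_le_trans rm.2).
    by rewrite -normrN (le_trans _ (ler_norm _))// lerNr.
  apply: (eq_integ _ (integB (integ_sgi a ce') (integ_sgi (- m) ce'))) => t.
  exact/esym/E.
have LE (a : R) : L a = eta a.
  rewrite /L (Rint_eq mu (g := fun t => sgi a t * dd eta t - sgi (- m) t * dd eta t)); last first.
    move=> t; rewrite /sgi; have [tm|tm] := leP t (- m); last by rewrite /=; ring.
    rewrite (er' t) ?mulr0 ?subrr//; apply: (lt_le_trans rm.2).
    by rewrite -normrN (le_trans _ (ler_norm _))// lerNr.
  rewrite (RintB (integ_sgi a ce') (integ_sgi (- m) ce')).
  rewrite -/(oint (dd eta) a) -/(oint (dd eta) (- m)) !(oint_FTC _ ce' fd).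
  rewrite (er (- m)); first by ring.
  by rewrite normrN ger0_norm// rm.1.
have z : \int[mu]_t dd eta t = 0 by exact: (RintT_derive_csupp ce' fd er).
have E : {ae mu, forall t, sgi t s * dd eta t = (1 - (s <= 0)%R%:R) * dd eta t - (t <= s)%R%:R * dd eta t}.
  apply: ae_impl (ae_neq s) => t ts; rewrite /sgi -mulrBl; congr (_ * _).
  by case: (ltgtP s t) ts => // _ _; rewrite /=; ring.
have iR : integ mu (fun t => (1 - (s <= 0)%R%:R) * dd eta t - (t <= s)%R%:R * dd eta t).
  by apply: integB; [exact: integZ|exact: iL].
rewrite (ae_eq_Rint _ (integ_meas iR) E).
  by rewrite (RintB (integZ _ ie') (iL s)) (RintZ _ ie') z mulr0 sub0r -/(L s) LE.
exact: integ_meas (integ_step s te).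
Qed.

(** [J] is a second primitive of H2 - phi, and h - J is affine by [affine_of_weak]. Since h and J
    are differentiable everywhere, equating derivatives at t and at 0 gives the identity at every
    time. *)
Lemma weak_ode (h dh H2 phi : R -> R) : (forall t : R, is_derive t (1 : R) h (dh t)) ->
  continuous H2 -> integ mu phi ->
  (forall eta, test_function eta ->
    \int[mu]_s (h s * dd (dd eta) s) = \int[mu]_s (eta s * (H2 s - phi s))) ->
  forall t, dh t = dh 0 + oint H2 t - oint phi t.
Proof.
move=> hd cH ip weak.
pose Phi t := \int[mu]_s (sgi t s * (1 * phi s)).
have cPhi : continuous Phi.
  by apply: (@sgi_cont R (fun=> 1) phi 1) => // x; rewrite ?normr1//; exact: cvg_cst.
have coH : continuous (oint H2) by apply: derive_continuous (fun t => oint_derive t cH).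
pose J t := oint (oint H2) t - oint Phi t.
have dJ (t : R) : is_derive t (1 : R) J (oint H2 t - Phi t).
  by apply: is_deriveB; exact: oint_derive.
have cB (u v : R -> R) : continuous u -> continuous v -> continuous (fun x => u x - v x).
  by move=> cu cv x; apply: (@cvgB _ R^o); [exact: cu|exact: cv].
have cJ' := cB _ _ coH cPhi.
have cM (u v : R -> R) : continuous u -> continuous v -> continuous (fun x => u x * v x).
  by move=> cu cv x; apply: cvgM; [exact: cu|exact: cv].
have ic (u v : R -> R) : continuous u -> test_function v -> integ mu (fun s => u s * v s).
  move=> cu [sv [r vr]]; apply: (integ_csupp (cM _ _ cu (smooth_cont sv)) (r := r)) => s sr.
  by rewrite vr// mulr0.
have JE eta : test_function eta -> \int[mu]_s (J s * dd (dd eta) s) = \int[mu]_s (eta s * (H2 s - phi s)).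
  move=> te; have te' := test_derive (1 : R) te.
  rewrite (by_parts cJ' dJ te').
  have ce := smooth_cont te.1.
  have [M M0 eM] := test1_bound te.
  have iep : integ mu (fun s => eta s * phi s).
    by apply: (integMb ip) => //; exact: continuous_measurable_fun.
  have iHe : integ mu (fun s => eta s * H2 s).
    by apply: (eq_integ _ (ic _ _ cH te)) => s; exact: mulrC.
  have -> : \int[mu]_s (eta s * (H2 s - phi s)) = \int[mu]_s (eta s * H2 s) - \int[mu]_s (eta s * phi s).
    by rewrite -(RintB iHe iep); apply: Rint_eq => s; exact: mulrBr.
  rewrite (Rint_eq mu (g := fun s => oint H2 s * dd eta s - Phi s * dd eta s)); last first.
    by move=> s; exact: mulrBl.
  rewrite (RintB (ic _ _ coH te') (ic _ _ cPhi te')) (by_parts cH (fun t => oint_derive t cH) te).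
  rewrite opprB opprK addrC; congr (_ + _); first by apply: Rint_eq => s; exact: mulrC.
  (* [by_parts] does not apply to [Phi], whose derivative phi is not continuous; exchanging the
     integrals and applying [Rint_step] replaces it. *)
  have F : integ (mu \x mu)%E (fun z : R * R => sgi z.1 z.2 * (phi z.2 * dd eta z.1)).
    have [it _] := Rint_tensor (test1_integ te') ip.
    apply: (le_integ (integ_norm it)).
      apply: measurable_funM; last first.
        by apply: measurable_funM; [apply: (meas_comp (integ_meas ip)); exact: measurable_snd|
          apply: (meas_comp (integ_meas (test1_integ te'))); exact: measurable_fst].
      exact: measurable_sgi2.
    by move=> z; rewrite normrM -[leRHS]mul1r ler_pM ?sgi_le1// !normrM mulrC.
  have S := fubiniC F.
  transitivity (\int[mu]_t \int[mu]_s (sgi t s * (phi s * dd eta t))).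
    apply: Rint_eq => t; rewrite /Phi -RintZr; first by apply: Rint_eq => s; ring.
    apply: (integMb (M := 1)); [exact: integZ|exact: measurable_sgi|by move=> s; exact: sgi_le1].
  rewrite S -(RintN iep); apply: Rint_eq => s /=.
  rewrite (Rint_eq mu (g := fun t => phi s * (sgi t s * dd eta t))); last by move=> t; ring.
  apply: (etrans (RintZ (phi s) (integ_step s te))); rewrite (Rint_step s te) mulrN.
  by rewrite mulrC.
have cg : continuous (fun t => h t - J t).
  by apply: cB; [exact: derive_continuous hd|exact: derive_continuous dJ].
have gw eta : test_function eta -> \int[mu]_s ((h s - J s) * dd (dd eta) s) = 0.
  move=> te; have te2 := test_derive (1 : R) (test_derive (1 : R) te).
  rewrite (Rint_eq mu (g := fun s => h s * dd (dd eta) s - J s * dd (dd eta) s)); last first.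
    by move=> s; exact: mulrBl.
  rewrite (RintB (ic _ _ (derive_continuous hd) te2) (ic _ _ (derive_continuous dJ) te2)).
  by rewrite JE// weak// subrr.
have A := affine_of_weak cg gw.
have dhJ (t : R) : dh t - (oint H2 t - Phi t) = h 1 - J 1 - (h 0 - J 0).
  have h1 := is_deriveB (hd t) (dJ t).
  have E : h - J = fun t : R => h 0 - J 0 + t * (h 1 - J 1 - (h 0 - J 0)).
    by apply/funext => s; exact: A.
  have h2 : is_derive t (1 : R) (h - J) (h 1 - J 1 - (h 0 - J 0)).
    by rewrite E; exact: is_derive_line1.
  by rewrite -(deriveE h1) (deriveE h2).
have P0 u : Phi u = oint phi u by apply: Rint_eq => s; rewrite mul1r.
move=> t; have := dhJ 0; rewrite P0 !oint0 -(dhJ t) P0; lra.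
Qed.

End WeakOde.

(** * From space-time test functions to pairings at a fixed time *)

Section SpaceTimeWeak.
Context {R : realType}.
Notation mu1 := (@leb1 R).
Notation mu2 := (@leb2 R).
Notation mu12 := (@leb12 R).
Notation R2 := (R * R)%type.
Notation R12 := (R * (R * R))%type.
Notation dd f := ('D_(1 : R) f).

Lemma is_derive_dir0 (V : normedModType R) (f : V -> R) (x : V) : is_derive x 0 f 0.
Proof.
apply: (@is_derive_line R V f x 0 0).
have -> : (fun h : R => f (h *: 0 + x)) = fun=> f x.
  by apply/funext => h; rewrite scaler0 add0r.
exact: is_derive_cst.
Qed.

Lemma tensor_derive (f : R -> R) (g : R2 -> R) (z v : R12) (a b : R) :
  is_derive z.1 v.1 f a -> is_derive z.2 v.2 g b ->
  is_derive z v (fun z : R12 => f z.1 * g z.2) (a * g z.2 + f z.1 * b).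
Proof.
move=> fa gb; apply: (@is_derive_line R R12 (fun z : R12 => f z.1 * g z.2) z v).
have H : is_derive (0 : R) (1 : R) (fun h : R => f (h *: v.1 + z.1) * g (h *: v.2 + z.2)) _
  := is_deriveM (derive_line fa) (derive_line gb).
apply: (is_derive_eq H); rewrite !scale0r !add0r addrC; congr (_ + _).
exact: mulrC.
Qed.

Lemma tensor_derive_time (f : R -> R) (g : R2 -> R) : smooth f ->
  'D_((1, (0, 0)) : R12) (fun z : R12 => f z.1 * g z.2) = fun z => dd f z.1 * g z.2.
Proof.
move=> sf; apply/funext => z.
have h2 : is_derive z.2 ((0, 0) : R2) g 0 := is_derive_dir0 g z.2.
have := @tensor_derive f g z (1, (0, 0)) _ _ (smooth_is_derive z.1 1 sf) h2.
by rewrite mulr0 addr0 => h; exact: (deriveE h).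
Qed.

Lemma tensor_derive_space (f : R -> R) (g : R2 -> R) (w : R2) : smooth g ->
  'D_((0, w) : R12) (fun z : R12 => f z.1 * g z.2) = fun z => f z.1 * 'D_w g z.2.
Proof.
move=> sg; apply/funext => z.
have h1 : is_derive z.1 (0 : R) f 0 := is_derive_dir0 f z.1.
have := @tensor_derive f g z (0, w) _ _ h1 (smooth_is_derive z.2 w sg).
by rewrite mul0r add0r => h; exact: (deriveE h).
Qed.

Lemma dalembertian_tensor (f : R -> R) (p : R2 -> R) : test_function f -> test_function p ->
  forall z, dalembertian (fun z : R12 => f z.1 * p z.2) z =
    - (dd (dd f) z.1 * p z.2) + f z.1 * lap p z.2.
Proof.
move=> tf tp z; rewrite /dalembertian.
have sf' := smooth_derive (1 : R) tf.1.
have E1 := etrans (congr1 (fun g => 'D_((1, (0, 0)) : R12) g) (tensor_derive_time p tf.1))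
  (tensor_derive_time p sf').
have E2 := etrans (congr1 (fun g => 'D_((0, (1, 0)) : R12) g) (tensor_derive_space f (1, 0) tp.1))
  (tensor_derive_space f (1, 0) (test_d1 tp).1).
have E3 := etrans (congr1 (fun g => 'D_((0, (0, 1)) : R12) g) (tensor_derive_space f (0, 1) tp.1))
  (tensor_derive_space f (0, 1) (test_d2 tp).1).
have at_z (F G : R12 -> R) : F = G -> F z = G z by move=> ->.
apply: (etrans (congr2 +%R (congr2 +%R (congr1 -%R (at_z _ _ E1)) (at_z _ _ E2)) (at_z _ _ E3))).
by rewrite -addrA -mulrDr.
Qed.

Lemma integ_restrict d (T : measurableType d) (mu : {measure set T -> \bar R}) (D : set T)
  (f : T -> R) : measurable D -> mu.-integrable D (EFin \o f) ->
  integ mu (fun x => \1_D x * f x).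
Proof.
move=> mD /(integrable_mkcond _ mD); apply: eq_integrable => // z _ /=.
by rewrite /patch /= indicE; case: ifPn => zD; rewrite ?mul1r ?mul0r.
Qed.

Lemma meas_exhaust d (T : measurableType d) (D : nat -> set T) (f : T -> R) :
  (forall n, measurable_fun setT (fun x => \1_(D n) x * f x)) ->
  (forall x, \forall n \near \oo, D n x) -> measurable_fun setT f.
Proof.
move=> mf ex; apply: (measurable_fun_cvg mf) => x _.
apply: cvg_near_cst; have := ex x; apply: filterS => n Dx.
by rewrite indicE mem_set// mul1r.
Qed.

Lemma near_norm (V : normedModType R) (x : V) : \forall n \near \oo, `|x| <= n%:R.
Proof. exact: nbhs_infty_ger. Qed.

Lemma measurable_cube12 (r : R) :
  measurable ([set z | `|z : R12| <= r] :
    set (measurableTypeR R * (measurableTypeR R * measurableTypeR R))).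
Proof.
rewrite cube12E; apply: measurableX; first exact: measurable_itv.
exact: measurable_cube2.
Qed.

Definition cube12 (r : R) : R12 -> R := \1_[set z : R12 | `|z| <= r].

Lemma loc12_cut (w : R12 -> R) (r : R) : locally_integrable12 w ->
  integ mu12 (fun z => cube12 r z * w z).
Proof. by move=> iw; apply: integ_restrict; [exact: measurable_cube12|exact: iw]. Qed.

Lemma loc2_cut (w : R2 -> R) (r : R) : locally_integrable2 w ->
  integ mu2 (fun z => cube2 r z * w z).
Proof. by move=> iw; apply: integ_restrict; [exact: measurable_cube2|exact: iw]. Qed.

Lemma loc12_meas (w : R12 -> R) : locally_integrable12 w -> measurable_fun setT w.
Proof.
move=> iw; apply: (@meas_exhaust _ _ (fun n : nat => [set z : R12 | `|z| <= n%:R])).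
  by move=> n; exact: integ_meas (loc12_cut n%:R iw).
by move=> z; exact: near_norm.
Qed.

Lemma loc2_meas (w : R2 -> R) : locally_integrable2 w -> measurable_fun setT w.
Proof.
move=> iw; apply: (@meas_exhaust _ _ (fun n : nat => [set z : R2 | `|z| <= n%:R])).
  by move=> n; exact: integ_meas (loc2_cut n%:R iw).
by move=> z; exact: near_norm.
Qed.

Lemma loc12_test (w P : R12 -> R) : locally_integrable12 w -> test_function P ->
  integ mu12 (fun z => w z * P z).
Proof.
move=> iw [sP [r Pr]]; have cP := smooth_cont sP.
have [M M0 PM] := csupp_bound (cube12_compact (r := r)) cP Pr.
apply: (eq_integ _ (integMb (loc12_cut r iw) (cont_meas12 cP) PM)) => z.
rewrite /cube12 indicE; have [zr|zr] := leP `|z| r; first by rewrite mem_set// mul1r mulrC.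
by rewrite (Pr _ zr) !(mulr0, mul0r).
Qed.

Lemma loc2_test (w p : R2 -> R) : locally_integrable2 w -> test_function p ->
  integ mu2 (fun z => w z * p z).
Proof.
move=> iw tp; have [_ [r pr]] := tp; have [M M0 pM] := test2_bound tp.
apply: (eq_integ _ (integMb (loc2_cut r iw) (test2_meas tp) pM)) => z.
rewrite /cube2 indicE; have [zr|zr] := leP `|z| r; first by rewrite mem_set// mul1r mulrC.
by rewrite (pr _ zr) !(mulr0, mul0r).
Qed.

Lemma cube12_section (q s : R) (x : R2) : `|s| <= q -> cube12 q (s, x) = cube2 q x.
Proof.
move=> sq; have E : (`|(s, x) : R12| <= q) = (`|x| <= q).
  by rewrite [`|(s, x) : R12|]prod_normE /= [LHS]ge_max sq.
rewrite /cube12 /cube2 !indicE; congr (nat_of_bool _)%:R.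
by apply/idP/idP; rewrite !inE /= E.
Qed.

Section Pair.
Variable w : R12 -> R.
Hypothesis iw : locally_integrable12 w.
Hypothesis sw : forall t, locally_integrable2 (at_time w t).

Lemma pair_tensor (e : R -> R) (p : R2 -> R) : test_function e -> test_function p ->
  integ mu1 (fun t => e t * distr_of_fun (at_time w t) p) /\
  \int[mu12]_z (w z * (e z.1 * p z.2)) = \int[mu1]_t (e t * distr_of_fun (at_time w t) p).
Proof.
move=> te tp; have [i E] := fubini1 (m1 := mu1) (m2 := mu2) (loc12_test iw (test_tensor12 te tp)).
have H t : \int[mu2]_x (w (t, x) * (e t * p x)) = e t * distr_of_fun (at_time w t) p.
  rewrite -(RintZ (e t) (loc2_test (sw t) tp)); apply: Rint_eq => x; exact: mulrCA.
split; first by apply: (eq_integ _ i) => t; exact: H.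
by apply: (etrans (esym E)); apply: Rint_eq => t; exact: H.
Qed.

(** Local integrability in space-time makes W, the L^1 norm of w on a cube as a function of time,
    integrable; no bound at an individual time results. The cube contains both the time interval and
    the supports of the p considered. *)
Lemma pair_bound (r T : R) : exists2 C : R, 0 < C & forall p (M : R), test_function p ->
  (forall x, r < `|x| -> p x = 0) -> (forall x, `|p x| <= M) ->
  measurable_fun setT (fun s => distr_of_fun (at_time w s) p) ->
  integ mu1 (fun s => \1_(`[- T, T]%classic) s * `|distr_of_fun (at_time w s) p|) /\
  \int[mu1]_s (\1_(`[- T, T]%classic) s * `|distr_of_fun (at_time w s) p|) <= C * M.
Proof.
pose q : R := Num.max `|T| r.
have iv := integ_norm (loc12_cut q iw).
have [iW _] := fubini1 (m1 := mu1) (m2 := mu2) iv.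
set W := (fun x : R => _) in iW.
have W0 t : 0 <= W t by apply: Rint_ge0 => x; exact: normr_ge0.
exists (\int[mu1]_t W t + 1); first by rewrite ltr_wpDl// Rint_ge0.
move=> p M tp pr pM mp; have M0 : 0 <= M := le_trans (normr_ge0 _) (pM 0).
have mI : measurable_fun setT (\1_(`[- T, T]%classic) : R -> R).
  exact: integ_meas (integ_indic_itv (- T) T true false).
have B s : \1_(`[- T, T]%classic) s * `|distr_of_fun (at_time w s) p| <= M * W s.
  rewrite indicE; have [sT|sT] := boolP (s \in _); last by rewrite mul0r mulr_ge0.
  rewrite mul1r; move: sT; rewrite inE /= in_itv /= => /andP[s1 s2].
  have sq : `|s| <= q.
    by rewrite le_max (le_trans _ (_ : T <= `|T|)) ?ler_norm// ler_norml s1.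
  have ic := integ_norm (loc2_cut q (sw s)).
  have WE : W s = \int[mu2]_x `|cube2 q x * at_time w s x|.
    by apply: Rint_eq => x; rewrite (cube12_section x sq).
  rewrite WE -(RintZ M ic); apply: Rint_norm_le; first exact: integ_meas (loc2_test (sw s) tp).
    exact: integZ.
  move=> x; rewrite normrM /cube2 indicE.
  have [xr|xr] := leP `|x| r; last by rewrite (pr _ xr) normr0 mulr0 mulr_ge0.
  rewrite mem_set /=; last by rewrite le_max xr orbT.
  by rewrite mul1r mulrC ler_wpM2r.
have i : integ mu1 (fun s => \1_(`[- T, T]%classic) s * `|distr_of_fun (at_time w s) p|).
  apply: (le_integ (integZ M iW)).
    by apply: measurable_funM => //; exact: measurableT_comp.
  by move=> s; rewrite ger0_norm// mulr_ge0.
split=> //; apply: (le_trans (Rint_le i (integZ M iW) B)).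
by rewrite (RintZ M iW) mulrC ler_wpM2r// lerDl.
Qed.

End Pair.

(** Testing the equation on products e(t) p(x) leaves a weak second-order equation in time for the
    pairing with p, to which [weak_ode] applies. *)
Lemma weak_pair_derive (u f : R12 -> R) u0 u1 (p : R2 -> R) : weak_solution u f u0 u1 ->
  integ mu12 f -> (forall t, locally_integrable2 (at_time f t)) -> test_function p ->
  let h p t := distr_of_fun (at_time u t) p in
  [/\ integ mu1 (fun s => distr_of_fun (at_time f s) p),
    forall t : R, is_derive t (1 : R) (h p) (dt_distr u t p) &
    forall t, dt_distr u t p = u1 p + oint (h (lap p)) t -
      oint (fun s => distr_of_fun (at_time f s) p) t].
Proof.
move=> [[iu _] [su du] weq _ ud] fi sf tp h.
have hd q (t : R) : test_function q -> is_derive t (1 : R) (h q) (dt_distr u t q).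
  move=> tq; rewrite /dt_distr derive1E; apply: DeriveDef => //; exact: du.
have if12 : locally_integrable12 f.
  by move=> r; apply: (integrableS _ _ _ fi) => //; exact: measurable_cube12.
have ip : integ mu1 (fun s => distr_of_fun (at_time f s) p).
  have [M M0 pM] := test2_bound tp.
  have mP : measurable_fun setT (fun z : R12 => p z.2).
    by apply: (meas_comp (test2_meas tp)); exact: measurable_snd.
  have [i _] := fubini1 (m1 := mu1) (m2 := mu2) (integMb (M := M) fi mP (fun z => pM z.2)).
  by apply: (eq_integ _ i) => t; apply: Rint_eq => x; exact: mulrC.
split; [exact: ip|by move=> t; exact: hd|move=> t].
rewrite -(ud p tp).
apply: (weak_ode (fun t => hd p t tp) _ ip).
  exact: (derive_continuous (fun t : R => hd (lap p) t (test_lap tp))).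
move=> e te.
have te2 := test_derive (1 : R) (test_derive (1 : R) te).
have [i1 E1] := pair_tensor iu su te2 tp.
have [i2 E2] := pair_tensor iu su te (test_lap tp).
have [i3 E3] := pair_tensor if12 sf te tp.
have W := weq _ (test_tensor12 te tp).
have j1 := loc12_test iu (test_tensor12 te2 tp).
have j2 := loc12_test iu (test_tensor12 te (test_lap tp)).
rewrite (Rint_eq mu12 (g := fun z => u z * (e z.1 * lap p z.2) - u z * (dd (dd e) z.1 * p z.2))) in W; last first.
  by move=> z; rewrite (dalembertian_tensor te tp) addrC mulrBr.
rewrite (RintB j2 j1) E1 E2 E3 in W.
rewrite (Rint_eq mu1 (g := fun s => dd (dd e) s * h p s)); last by move=> s; exact: mulrC.
rewrite (Rint_eq mu1 (f := fun s => e s * (h (lap p) s - distr_of_fun (at_time f s) p)) (g := fun s => e s * h (lap p) s - e s * distr_of_fun (at_time f s) p)); last first.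
  by move=> s; exact: mulrBr.
rewrite (RintB i2 i3) -W opprB addrCA subrr addr0.
by apply: Rint_eq.
Qed.

End SpaceTimeWeak.

(** * The force term at each frequency *)

Section Force.
Context {R : realType}.
Notation mu1 := (@leb1 R).
Notation mu2 := (@leb2 R).
Notation mu12 := (@leb12 R).
Notation R2 := (R * R)%type.
Notation R12 := (R * (R * R))%type.

Lemma four_mul_le (x y : R) : 4 * (x * y) <= (x + y) ^+ 2.
Proof. by have := sqr_ge0 (x - y); rewrite sqrrB sqrrD; lra. Qed.

Lemma sum_sqr_ge (a b c d : R) (S := a ^+ 2 + b ^+ 2 + (c ^+ 2 + d ^+ 2)) :
  [/\ a ^+ 2 <= S, b ^+ 2 <= S, c ^+ 2 <= S & d ^+ 2 <= S].
Proof.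
rewrite /S; have := sqr_ge0 a; have := sqr_ge0 b; have := sqr_ge0 c; have := sqr_ge0 d.
by move: (a ^+ 2) (b ^+ 2) (c ^+ 2) (d ^+ 2) => *; split; lra.
Qed.

Lemma ae_eq_integ2 (f g : R2 -> R) : measurable_fun setT g -> integ mu2 f ->
  {ae mu2, forall x, f x = g x} -> integ mu2 g.
Proof. exact: (@ae_eq_integ R _ _ mu2 f g). Qed.

Lemma meas_sqrt : measurable_fun setT (@Num.sqrt R).
Proof. by apply: continuous_measurable_fun; exact: sqrt_continuous. Qed.

Lemma norm_le_of_sqr (a b : R) : 0 <= b -> a ^+ 2 <= b ^+ 2 -> `|a| <= b.
Proof. by move=> b0; rewrite -[a ^+ 2]real_normK ?num_real// ler_sqr ?nnegrE. Qed.

Lemma sqr_mul_le (a n h : R) : 0 <= n -> 0 <= h -> a ^+ 2 <= n * h -> `|a| <= n + h.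
Proof.
move=> n0 h0 ah; apply: norm_le_of_sqr; first exact: addr_ge0.
by apply: (le_trans ah); have := mulr_ge0 n0 h0; have := sqr_ge0 n; have := sqr_ge0 h; rewrite sqrrD; lra.
Qed.

(** Cauchy-Schwarz for sqrt n and sqrt H. Integrability of g comes first, from sqrt (n H) <= n +
    H. *)
Lemma weighted_CS (g n H : R -> R) (w : R) : 0 <= w -> measurable_fun setT g -> integ mu1 n -> integ mu1 H ->
  (forall s, 0 <= n s) -> (forall s, 0 <= H s) -> (forall s, g s ^+ 2 <= w ^+ 2 * (n s * H s)) ->
  integ mu1 g /\ (\int[mu1]_s `|g s|) ^+ 2 <= w ^+ 2 * ((\int[mu1]_s n s) * \int[mu1]_s H s).
Proof.
move=> w0 mg i_n iH n0 H0 gnH.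
have gle s : `|g s| <= w * n s + w * H s.
  apply: sqr_mul_le; [exact: mulr_ge0|exact: mulr_ge0|].
  by apply: (le_trans (gnH s)); rewrite expr2 mulrACA.
have ig : integ mu1 g by apply: (le_integ (integD (integZ w i_n) (integZ w iH)) mg gle).
split => //.
pose a (s : measurableTypeR R) : R := Num.sqrt (n s); pose b (s : measurableTypeR R) : R := Num.sqrt (H s).
have ma : measurable_fun setT a by apply: measurableT_comp; [exact: meas_sqrt|exact: integ_meas i_n].
have mb : measurable_fun setT b by apply: measurableT_comp; [exact: meas_sqrt|exact: integ_meas iH].
have a2 s : a s ^+ 2 = n s by rewrite /a sqr_sqrtr.
have b2 s : b s ^+ 2 = H s by rewrite /b sqr_sqrtr.
have ia : integ mu1 (fun s => a s ^+ 2) by apply: (eq_integ _ i_n) => s; exact/esym/a2.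
have ib : integ mu1 (fun s => b s ^+ 2) by apply: (eq_integ _ iH) => s; exact/esym/b2.
have gab s : `|g s| <= w * (a s * b s).
  have ab0 : 0 <= a s * b s by apply: mulr_ge0; exact: sqrtr_ge0.
  apply: norm_le_of_sqr; [exact: mulr_ge0|].
  by rewrite exprMn [(a s * b s) ^+ 2]exprMn a2 b2; exact: gnH.
have iab := @integ_sqM R _ _ mu1 a b ma mb ia ib.
have I0 : 0 <= \int[mu1]_s `|g s| by apply: Rint_ge0.
have I1 := Rint_le (integ_norm ig) (integZ w iab) gab.
have CS := @Rint_CS R _ _ mu1 a b ma mb ia ib.
rewrite (Rint_eq mu1 a2) (Rint_eq mu1 b2) in CS.
rewrite (RintZ w iab) in I1.
have J0 : 0 <= w * \int[mu1]_x (a x * b x) := le_trans I0 I1.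
have := ler_pM I0 I0 I1 I1; rewrite -!expr2 exprMn => L.
by apply: (le_trans L); rewrite ler_wpM2l// sqr_ge0.
Qed.

Variables f1 f2 : R12 -> R.
Hypothesis i1 : integ mu12 f1.
Hypothesis i2 : integ mu12 f2.
Hypothesis df : forall (t : R) p, test_function p ->
  \int[mu2]_x (f1 (t, x) * d1 p x + f2 (t, x) * d2 p x) = 0.

Let K : R := \int[mu12]_z `|f1 z| + \int[mu12]_z `|f2 z|.

(** Fc - i Fs is the transform of f in space, set to 0 on null sets of times and of frequencies so
    that integrability and the bound by M hold at every frequency. The price is that the pairing
    identities hold for almost every time only. *)
Definition force_data (f Fc Fs : R12 -> R) (M : R2 -> R) :=
  [/\ measurable_fun setT Fc /\ measurable_fun setT Fs,
    (forall xi, integ mu1 (fun s => Fc (s, xi)) /\ integ mu1 (fun s => Fs (s, xi))),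
    (forall xi, om xi = 0 -> forall s, Fc (s, xi) = 0 /\ Fs (s, xi) = 0),
    (forall xi, (\int[mu1]_s `|Fc (s, xi)|) / om xi <= M xi /\
                (\int[mu1]_s `|Fs (s, xi)|) / om xi <= M xi) &
    forall p, test_function p -> {ae mu1, forall s, [/\
      \int[mu2]_xi (Fc (s, xi) * fc p xi) + \int[mu2]_xi (Fs (s, xi) * fs p xi) =
        \int[mu2]_x (f (s, x) * p x),
      \int[mu2]_xi (Fs (s, xi) * fc p xi) = \int[mu2]_xi (Fc (s, xi) * fs p xi),
      integ mu2 (fun xi => Fs (s, xi) * fc p xi) &
      integ mu2 (fun xi => Fs (s, xi) * fs p xi)]}].

(** Multiplication by - om^2 is the transform of the Laplacian, and (om q)^2 = q (om^2 q) is bounded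
    by the sum of the two squares. *)
Lemma test_om_sqr p : test_function p ->
  [/\ integ mu2 (fun xi => (om xi * fc p xi) ^+ 2), integ mu2 (fun xi => (om xi * fs p xi) ^+ 2),
      integ mu2 (fun xi => (om xi ^+ 2 * fc p xi) ^+ 2) &
      integ mu2 (fun xi => (om xi ^+ 2 * fs p xi) ^+ 2)].
Proof.
move=> tp; have tl := test_lap tp.
have ip := test2_integ tp; have il := test2_integ tl.
have c2 := fc_sqr_integ ip (test2_sqr tp); have s2 := fs_sqr_integ ip (test2_sqr tp).
have lc2 := fc_sqr_integ il (test2_sqr tl); have ls2 := fs_sqr_integ il (test2_sqr tl).
have oc : integ mu2 (fun xi => (om xi ^+ 2 * fc p xi) ^+ 2).
  by apply: (eq_integ _ lc2) => xi; rewrite (fc_lap xi tp) sqrrN.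
have os : integ mu2 (fun xi => (om xi ^+ 2 * fs p xi) ^+ 2).
  by apply: (eq_integ _ ls2) => xi; rewrite (fs_lap xi tp) sqrrN.
have mc := meas_fc (test2_meas tp); have ms := meas_fs (test2_meas tp).
have H (w a : R) : `|(w * a) ^+ 2| <= a ^+ 2 + (w ^+ 2 * a) ^+ 2.
  rewrite ger0_norm ?sqr_ge0//.
  have h := sqr_ge0 (a - w ^+ 2 * a); have h2 := sqr_ge0 a; have h3 := sqr_ge0 (w ^+ 2 * a).
  have -> : (w * a) ^+ 2 = a * (w ^+ 2 * a) by ring.
  by move: h; rewrite sqrrB; move: (a * (w ^+ 2 * a)) (a ^+ 2) ((w ^+ 2 * a) ^+ 2) h2 h3 => *; lra.
split => //.
- apply: (le_integ (integD c2 oc)) => [|xi]; last exact: H.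
  by apply: measurable_funX; apply: measurable_funM => //; exact: meas_om.
- apply: (le_integ (integD s2 os)) => [|xi]; last exact: H.
  by apply: measurable_funX; apply: measurable_funM => //; exact: meas_om.
Qed.

Lemma om_neq0 (xi : R2) : xi.1 != 0 -> om xi != 0.
Proof.
move=> x0; apply/eqP => o0; have := om_sqr xi; rewrite o0 expr0n /= => /esym/eqP.
rewrite mulf_eq0 expf_eq0 /= mulf_eq0 pnatr_eq0 /= (gt_eqF (pi_gt0 R)) /=.
rewrite /dot => /eqP h; have := mulr_gt0 (_ : 0 < `|xi.1|) (_ : 0 < `|xi.1|).
rewrite normr_gt0 x0 -normrM ger0_norm -?expr2 ?sqr_ge0// => /(_ isT isT).
by have := sqr_ge0 xi.2; move: h; rewrite -!expr2; lra.
Qed.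

Lemma force_bound : exists Fc1 Fs1 Fc2 Fs2 : R12 -> R, exists M : R2 -> R,
  [/\ force_data f1 Fc1 Fs1 M, force_data f2 Fc2 Fs2 M,
      measurable_fun setT M, (forall xi, 0 <= M xi) &
      integ mu2 (fun xi => M xi ^+ 2) /\ \int[mu2]_xi (M xi ^+ 2) <= K ^+ 2].
Proof.
(* [A] contains the times at which a section of f fails to be integrable; the factor [c] suppresses
   them, so that the sections of g1 and g2 are integrable at every time. *)
have [A [mA A0 subA]] := ae_and (ae_integ_section1 (m1 := mu1) (m2 := mu2) i1)
  (ae_integ_section1 (m1 := mu1) (m2 := mu2) i2).
have good s : ~ A s -> integ mu2 (fun x => f1 (s, x)) /\ integ mu2 (fun x => f2 (s, x)).
  by move=> nA; apply: contrapT => h; apply: nA; apply: subA.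
have aeA : {ae mu1, forall s, ~ A s}.
  by exists A; split => // s /= /contrapT.
pose c (s : R) : R := \1_(~` A) s.
have c01 s : (A s /\ c s = 0) \/ (~ A s /\ c s = 1).
  rewrite /c indicE; have [As|nA] := pselect (A s).
    by left; rewrite memNset//; exact: (fun h => h As).
  by right; rewrite mem_set.
have mc : measurable_fun setT c by exact: measurable_indic (measurableC mA).
have cut_meas (f : R12 -> R) : integ mu12 f ->
    measurable_fun setT (fun z : R12 => c z.1 * f z).
  move=> fi; apply: measurable_funM; last exact: integ_meas fi.
  by apply: (meas_comp mc); exact: measurable_fst.
pose g1 (z : R12) := c z.1 * f1 z; pose g2 (z : R12) := c z.1 * f2 z.
have mg1 : measurable_fun setT g1 := cut_meas _ i1.
have mg2 : measurable_fun setT g2 := cut_meas _ i2.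
have sec0 (f : R12 -> R) s : A s -> (fun x => c s * f (s, x)) = (fun=> 0).
  by move=> As; apply/funext => x; case: (c01 s) => -[h ->]; rewrite ?mul0r.
have sec1 (f : R12 -> R) s : ~ A s -> (fun x => c s * f (s, x)) = (fun x => f (s, x)).
  by move=> As; apply/funext => x; case: (c01 s) => -[h ->]; rewrite ?mul1r.
have sg1 s : integ mu2 (fun x => g1 (s, x)).
  rewrite /g1 /=; have [As|nA] := pselect (A s); first by rewrite (sec0 _ s As); exact: integ0.
  by rewrite (sec1 _ s nA); exact: (good s nA).1.
have sg2 s : integ mu2 (fun x => g2 (s, x)).
  rewrite /g2 /=; have [As|nA] := pselect (A s); first by rewrite (sec0 _ s As); exact: integ0.
  by rewrite (sec1 _ s nA); exact: (good s nA).2.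
have dg s p : test_function p -> \int[mu2]_x (g1 (s, x) * d1 p x + g2 (s, x) * d2 p x) = 0.
  move=> tp; rewrite /g1 /g2 /=; case: (c01 s) => -[h ->].
    rewrite (Rint_eq mu2 (g := fun=> 0)) ?Rint0// => x.
    by rewrite !mul0r addr0.
  by rewrite -(df s tp); apply: Rint_eq => x; rewrite !mul1r.
pose n1 s := \int[mu2]_x `|g1 (s, x)|; pose n2 s := \int[mu2]_x `|g2 (s, x)|.
have cle (f : R12 -> R) (z : R12) : `|(fun z : R12 => c z.1 * f z) z| <= `|f z|.
  by rewrite normrM; case: (c01 z.1) => -[_ ->]; rewrite ?normr0 ?normr1 ?mul0r ?mul1r.
have ig1 : integ mu12 g1 by exact: (le_integ (integ_norm i1) mg1 (cle f1)).
have ig2 : integ mu12 g2 by exact: (le_integ (integ_norm i2) mg2 (cle f2)).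
have [in1 E1] := fubini1 (m1 := mu1) (m2 := mu2) (integ_norm ig1).
have [in2 E2] := fubini1 (m1 := mu1) (m2 := mu2) (integ_norm ig2).
have n10 s : 0 <= n1 s by apply: Rint_ge0 => x; exact: normr_ge0.
have n20 s : 0 <= n2 s by apply: Rint_ge0 => x; exact: normr_ge0.
pose n s := n1 s + n2 s.
have n0 s : 0 <= n s := addr_ge0 (n10 s) (n20 s).
have i_n : integ mu1 n := integD in1 in2.
have nK : \int[mu1]_s n s <= K.
  rewrite (RintD in1 in2) E1 E2; apply: lerD.
    by apply: (Rint_le (integ_norm ig1) (integ_norm i1)); exact: cle.
  by apply: (Rint_le (integ_norm ig2) (integ_norm i2)); exact: cle.
have mF (g : R12 -> R) (tr : R -> R) : measurable_fun setT g -> continuous tr ->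
    measurable_fun setT (fun z : R12 => \int[mu2]_x (g (z.1, x) * tr (ph x z.2))).
  move=> mg ct.
  apply: (@meas_Rint1 R _ _ _ _ mu2 (fun w : R12 * R2 => g (w.1.1, w.2) * tr (ph w.2 w.1.2))).
  have m11 : measurable_fun setT (fun w : R12 * R2 => w.1.1) by apply: meas_fst; exact: measurable_fst.
  have m12 : measurable_fun setT (fun w : R12 * R2 => w.1.2) by apply: meas_snd; exact: measurable_fst.
  apply: measurable_funM.
    by apply: (meas_comp mg); apply/measurable_fun_pairP; split; [exact: m11|exact: measurable_snd].
  apply: measurableT_comp; first exact: continuous_measurable_fun.
  by apply: meas_ph; [exact: measurable_snd|exact: m12].
pose a1 (z : R12) := fc (fun x => g1 (z.1, x)) z.2; pose b1 (z : R12) := fs (fun x => g1 (z.1, x)) z.2.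
pose a2 (z : R12) := fc (fun x => g2 (z.1, x)) z.2; pose b2 (z : R12) := fs (fun x => g2 (z.1, x)) z.2.
have ccos : continuous (@cos R) by exact: continuous_cos.
have csin : continuous (@sin R) by exact: continuous_sin.
have ma1 : measurable_fun setT a1 := mF _ _ mg1 ccos.
have mb1 : measurable_fun setT b1 := mF _ _ mg1 csin.
have ma2 : measurable_fun setT a2 := mF _ _ mg2 ccos.
have mb2 : measurable_fun setT b2 := mF _ _ mg2 csin.
have mo : measurable_fun setT (fun z : R12 => om z.2).
  by apply: (meas_comp meas_om); exact: measurable_snd.
pose E (z : R12) := (a1 z ^+ 2 + b1 z ^+ 2 + (a2 z ^+ 2 + b2 z ^+ 2)) / om z.2 ^+ 2.
have E0 z : 0 <= E z.
  apply: mulr_ge0; last by rewrite invr_ge0 sqr_ge0.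
  by apply: addr_ge0; apply: addr_ge0; exact: sqr_ge0.
have mE : measurable_fun setT E.
  apply: measurable_funM; last by apply: (meas_comp meas_inv); exact: measurable_funX.
  by apply: measurable_funD; apply: measurable_funD; exact: measurable_funX.
have En s : integ mu2 (fun xi => E (s, xi)) /\ \int[mu2]_xi E (s, xi) <= n s ^+ 2.
  have D := divfree_fourier (sg1 s) (sg2 s) (dg s).
  have [iE LE] := divfree_energy (sg1 s) (sg2 s) (fun xi => (D xi).1) (fun xi => (D xi).2).
  split; first exact: iE.
  apply: (le_trans LE); rewrite /n -/(n1 s) -/(n2 s).
  exact: four_mul_le.
have E_n0 s xi : n s = 0 -> E (s, xi) = 0.
  move=> ns; have h1 : n1 s = 0 by apply/eqP; rewrite eq_le n10 andbT -ns lerDl.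
  have h2 : n2 s = 0 by apply/eqP; rewrite eq_le n20 andbT -ns lerDr.
  have z (x y : R) : `|x| <= y -> y = 0 -> x = 0.
    by move=> + y0; rewrite y0 normr_le0 => /eqP.
  rewrite /E /a1 /b1 /a2 /b2 /=.
  rewrite (z _ _ (fc_le xi (sg1 s)) h1) (z _ _ (fs_le xi (sg1 s)) h1).
  by rewrite (z _ _ (fc_le xi (sg2 s)) h2) (z _ _ (fs_le xi (sg2 s)) h2) expr0n /= !addr0 mul0r.
(* Division by the L^1 norm n turns the bound n^2 for the energy at time s into n, which is
   integrable in time. Where n s = 0 the energy vanishes too, so E = n H without exception. *)
pose H (z : R12) := (n z.1)^-1 * E z.
have H0 z : 0 <= H z by apply: mulr_ge0 => //; rewrite invr_ge0.
have EH s xi : E (s, xi) = n s * H (s, xi).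
  rewrite /H /= mulrA; have [ns|ns] := eqVneq (n s) 0; last by rewrite divff// mul1r.
  by rewrite ns !mul0r E_n0.
have mH : measurable_fun setT H.
  apply: measurable_funM => //; apply: (meas_comp (f := fun s : R => (n s)^-1)); last exact: measurable_fst.
  by apply: (meas_comp meas_inv); exact: integ_meas i_n.
have sH s : integ mu2 (fun xi => H (s, xi)) := integZ (n s)^-1 (En s).1.
have nH s : \int[mu2]_xi `|H (s, xi)| <= n s.
  rewrite (Rint_eq mu2 (g := fun xi => (n s)^-1 * E (s, xi))); last first.
    by move=> xi; rewrite ger0_norm.
  rewrite (RintZ _ (En s).1); have [ns|ns] := eqVneq (n s) 0; first by rewrite ns invr0 mul0r.
  have ns0 : 0 < n s by rewrite lt_neqAle eq_sym ns n0.
  by rewrite mulrC ler_pdivrMr// -expr2; exact: (En s).2.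
have iH : integ mu12 H := integ_tonelli (m1 := mu1) (m2 := mu2) mH i_n sH nH.
have iHn : \int[mu12]_z H z <= K.
  apply: le_trans nK; have [iI <-] := fubini1 (m1 := mu1) (m2 := mu2) iH.
  apply: (Rint_le iI i_n) => s; apply: le_trans (nH s).
  by apply: (Rint_le (sH s) (integ_norm (sH s))) => xi; exact: ler_norm.
(* [B] contains the frequencies where H is not integrable in time or a coordinate vanishes; outside
   it om != 0. *)
have [B [mB B0 subB]] := ae_and (ae_integ_section2 (m1 := mu1) (m2 := mu2) iH) (@ae_coord0 R).
have goodB xi : ~ B xi -> integ mu1 (fun s => H (s, xi)) /\ om xi != 0.
  move=> nB; have [h1 [h2 h3]] : integ mu1 (fun s => H (s, xi)) /\ (xi.1 != 0 /\ xi.2 != 0).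
    by apply: contrapT => h; apply: nB; apply: subB.
  by split => //; exact: om_neq0.
have aeB : {ae mu2, forall xi, ~ B xi}.
  by exists B; split => // s /= /contrapT.
pose x (xi : R2) : R := \1_(~` B) xi.
have x01 xi : (B xi /\ x xi = 0) \/ (~ B xi /\ x xi = 1).
  rewrite /x indicE; have [As|nA] := pselect (B xi).
    by left; rewrite memNset//; exact: (fun h => h As).
  by right; rewrite mem_set.
have mx : measurable_fun setT x by exact: measurable_indic (measurableC mB).
pose H' xi := \int[mu1]_s H (s, xi).
have mH' : measurable_fun setT H' by exact: (@meas_Rint2 R _ _ _ _ mu1 H mH).
have H'0 xi : 0 <= H' xi by apply: Rint_ge0.
(* By [weighted_CS] and the bound K for the time integral of n, this dominates the time integral of
   |F| / om; its square has integral at most K times that of H, hence at most K^2. *)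
pose M xi := x xi * Num.sqrt (K * H' xi).
have K0 : 0 <= K by apply: addr_ge0; apply: Rint_ge0 => z; exact: normr_ge0.
have KH xi : 0 <= K * H' xi by exact: mulr_ge0.
have mM : measurable_fun setT M.
  apply: measurable_funM => //; apply: measurableT_comp; first exact: meas_sqrt.
  exact: measurable_funM.
have M0 xi : 0 <= M xi.
  by apply: mulr_ge0; [case: (x01 xi) => -[_ ->]|exact: sqrtr_ge0].
have [iH' EH'] := fubini2 (m1 := mu1) (m2 := mu2) iH.
have M2le xi : M xi ^+ 2 <= K * H' xi.
  rewrite /M exprMn sqr_sqrtr//.
  by case: (x01 xi) => -[_ ->]; rewrite ?expr0n ?expr1n /= ?mul0r ?mul1r.
have iM2 : integ mu2 (fun xi => M xi ^+ 2).
  apply: (le_integ (integZ K iH')); first exact: measurable_funX.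
  by move=> xi; rewrite ger0_norm ?sqr_ge0.
have IM2 : \int[mu2]_xi (M xi ^+ 2) <= K ^+ 2.
  apply: (le_trans (Rint_le iM2 (integZ K iH') M2le)).
  by rewrite (RintZ K iH') EH' expr2 ler_wpM2l.
pose cutx (a : R12 -> R) (z : R12) := x z.2 * a z.
have mcut (a : R12 -> R) : measurable_fun setT a -> measurable_fun setT (cutx a).
  by move=> ma; apply: measurable_funM => //; apply: (meas_comp mx); exact: measurable_snd.
have comp (a : R12 -> R) : measurable_fun setT a -> (forall z, a z ^+ 2 <= a1 z ^+ 2 + b1 z ^+ 2 + (a2 z ^+ 2 + b2 z ^+ 2)) ->
    [/\ forall xi, integ mu1 (fun s => cutx a (s, xi)),
      forall xi, om xi = 0 -> forall s, cutx a (s, xi) = 0,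
      forall xi, (\int[mu1]_s `|cutx a (s, xi)|) / om xi <= M xi &
      forall s, integ mu2 (fun xi => (cutx a (s, xi) / om xi) ^+ 2)].
  move=> ma aE.
  have mcs xi : measurable_fun setT (fun s => cutx a (s, xi)).
    by apply: (meas_comp (mcut a ma)); exact: measurable_pair2.
  have bnd s xi : ~ B xi -> a (s, xi) ^+ 2 <= om xi ^+ 2 * (n s * H (s, xi)).
    move=> nB; rewrite -EH; apply: (le_trans (aE (s, xi))).
    have o2 : om xi ^+ 2 != 0 by rewrite expf_neq0 ?(goodB xi nB).2.
    by rewrite /E [leRHS]mulrC divfK.
  have W xi : integ mu1 (fun s => cutx a (s, xi)) /\
      (\int[mu1]_s `|cutx a (s, xi)|) / om xi <= M xi.
    case: (x01 xi) => -[Bx xE].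
      have Z : (fun s => cutx a (s, xi)) = fun=> 0 by apply/funext => s; rewrite /cutx /= xE mul0r.
      split; first by rewrite Z; exact: integ0.
      rewrite (Rint_eq mu1 (g := fun=> 0)) ?Rint0 ?mul0r// => s.
      by rewrite /cutx /= xE mul0r normr0.
    have [h1 h2] := goodB xi Bx.
    have cle2 s : cutx a (s, xi) ^+ 2 <= om xi ^+ 2 * (n s * H (s, xi)).
      by rewrite /cutx /= xE mul1r; exact: bnd.
    have [ic CS] := weighted_CS (om_ge0 xi) (mcs xi) i_n h1 n0 (fun s => H0 (s, xi)) cle2.
    split => //.
    have o0 : 0 < om xi by rewrite lt_neqAle eq_sym h2 om_ge0.
    rewrite ler_pdivrMr//; apply: (le_trans (ler_norm _)).
    apply: norm_le_of_sqr; first exact: mulr_ge0 (M0 xi) (om_ge0 xi).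
    apply: (le_trans CS).
    rewrite [(M xi * om xi) ^+ 2]exprMn [leRHS]mulrC ler_wpM2l ?sqr_ge0//.
    rewrite /M xE mul1r sqr_sqrtr//.
    by rewrite ler_wpM2r ?H'0.
  split.
  - by move=> xi; exact: (W xi).1.
  - move=> xi o0 s; rewrite /cutx /=; case: (x01 xi) => -[Bx ->]; first by rewrite mul0r.
    by have := (goodB xi Bx).2; rewrite o0 eqxx.
  - by move=> xi; exact: (W xi).2.
  - move=> s; apply: (le_integ (En s).1).
      apply: measurable_funX; apply: measurable_funM; last by apply: (meas_comp meas_inv); exact: meas_om.
      by apply: (meas_comp (mcut a ma)); exact: measurable_pair1.
    move=> xi; rewrite ger0_norm ?sqr_ge0// /cutx /= expr_div_n ler_wpM2r ?invr_ge0 ?sqr_ge0//.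
    apply: le_trans (aE (s, xi)); rewrite exprMn.
    by case: (x01 xi) => -[_ ->]; rewrite ?expr0n ?expr1n /= ?mul0r ?mul1r ?sqr_ge0.
have data (f g a b : R12 -> R) : (forall s, integ mu2 (fun x => g (s, x))) ->
    (forall s x, ~ A s -> g (s, x) = f (s, x)) ->
    (forall z, a z = fc (fun x => g (z.1, x)) z.2) -> (forall z, b z = fs (fun x => g (z.1, x)) z.2) ->
    measurable_fun setT a -> measurable_fun setT b ->
    (forall z, a z ^+ 2 <= a1 z ^+ 2 + b1 z ^+ 2 + (a2 z ^+ 2 + b2 z ^+ 2)) ->
    (forall z, b z ^+ 2 <= a1 z ^+ 2 + b1 z ^+ 2 + (a2 z ^+ 2 + b2 z ^+ 2)) ->
    force_data f (cutx a) (cutx b) M.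
  move=> sg gf aE bE ma mb aL bL.
  have [p1 p2 p3 p4] := comp a ma aL; have [q1 q2 q3 q4] := comp b mb bL.
  split => //; try by [split; apply: mcut].
  - by move=> xi o0 s; split; [exact: p2|exact: q2].
  move=> p tp; apply: ae_impl aeA => s nA.
  have [oc os _ _] := test_om_sqr tp.
  have mpc := meas_fc (test2_meas tp); have mps := meas_fs (test2_meas tp).
  have moi : measurable_fun setT (fun xi : R2 => (om xi)^-1).
    by apply: (meas_comp meas_inv); exact: meas_om.
  (* (v / om) (om q) is a product of square integrable functions. *)
  have prod_integ (v q : R2 -> R) : measurable_fun setT v -> measurable_fun setT q ->
      integ mu2 (fun xi => (v xi / om xi) ^+ 2) -> integ mu2 (fun xi => (om xi * q xi) ^+ 2) ->
      (forall xi, om xi = 0 -> v xi = 0) -> integ mu2 (fun xi => v xi * q xi).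
    move=> mv mq v2 q2' v0; have mo' := @meas_om R.
    have mq' : measurable_fun setT (fun xi => om xi * q xi) by exact: measurable_funM.
    have mv' : measurable_fun setT (fun xi => v xi / om xi) by exact: measurable_funM.
    apply: (eq_integ _ (integ_sqM2 mv' mq' v2 q2')) => xi; rewrite mulrA.
    have [w0|w0] := eqVneq (om xi) 0; last by rewrite divfK.
    by rewrite (v0 _ w0) !mul0r.
  have ms1 (v : R12 -> R) : measurable_fun setT v -> measurable_fun setT (fun xi => cutx v (s, xi)).
    by move=> mv; apply: (meas_comp (mcut v mv)); exact: measurable_pair1.
  have jcc := prod_integ _ _ (ms1 a ma) mpc (p4 s) oc (fun xi o => p2 xi o s).
  have jcs := prod_integ _ _ (ms1 a ma) mps (p4 s) os (fun xi o => p2 xi o s).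
  have jsc := prod_integ _ _ (ms1 b mb) mpc (q4 s) oc (fun xi o => q2 xi o s).
  have jss := prod_integ _ _ (ms1 b mb) mps (q4 s) os (fun xi o => q2 xi o s).
  pose gs := fun x => g (s, x).
  have mga : measurable_fun setT (fc gs) := meas_fc (integ_meas (sg s)).
  have mgb : measurable_fun setT (fs gs) := meas_fs (integ_meas (sg s)).
  have cE (v : R12 -> R) (w : R -> R2 -> R) (q : R2 -> R) : (forall z, v z = w z.1 z.2) -> {ae mu2, forall xi, cutx v (s, xi) * q xi = w s xi * q xi}.
    move=> vw; apply: ae_impl aeB => xi nB; rewrite /cutx /= vw /=.
    by case: (x01 xi) => -[Bx ->] //; rewrite mul1r.
  have cEa q := cE a (fun s => fc (fun x => g (s, x))) q aE.
  have cEb q := cE b (fun s => fs (fun x => g (s, x))) q bE.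
  have mM' (v q : R2 -> R) : measurable_fun setT v -> measurable_fun setT q ->
    measurable_fun setT (fun xi => v xi * q xi) by exact: measurable_funM.
  have kcc := ae_eq_integ2 (mM' _ _ mga mpc) jcc (cEa _).
  have kcs := ae_eq_integ2 (mM' _ _ mga mps) jcs (cEa _).
  have ksc := ae_eq_integ2 (mM' _ _ mgb mpc) jsc (cEb _).
  have kss := ae_eq_integ2 (mM' _ _ mgb mps) jss (cEb _).
  have [P1 P2] := parseval (sg s) tp kcc kss kcs ksc.
  have tr (v w q : R2 -> R) : measurable_fun setT v -> measurable_fun setT w -> measurable_fun setT q ->
      {ae mu2, forall xi, v xi * q xi = w xi * q xi} ->
      \int[mu2]_xi (v xi * q xi) = \int[mu2]_xi (w xi * q xi).
    by move=> mv mw mq h; apply: ae_eq_Rint => //; exact: mM'.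
  rewrite (tr _ _ _ (ms1 a ma) mga mpc (cEa _)) (tr _ _ _ (ms1 b mb) mgb mps (cEb _)).
  rewrite (tr _ _ _ (ms1 b mb) mgb mpc (cEb _)) (tr _ _ _ (ms1 a ma) mga mps (cEa _)).
  split; [|by apply/eqP; rewrite -subr_eq0; apply/eqP; rewrite -(RintB ksc kcs)|exact: jsc|exact: jss].
    rewrite -(RintD kcc kss) P1; apply: Rint_eq => y; by rewrite /= gf.
have gf1 s y : ~ A s -> g1 (s, y) = f1 (s, y).
  by move=> nA; rewrite /g1 /=; case: (c01 s) => -[h ->] //; rewrite mul1r.
have gf2 s y : ~ A s -> g2 (s, y) = f2 (s, y).
  by move=> nA; rewrite /g2 /=; case: (c01 s) => -[h ->] //; rewrite mul1r.
exists (cutx a1), (cutx b1), (cutx a2), (cutx b2), M; split => //.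
- by apply: (data f1 g1 a1 b1 sg1 gf1) => // z; have [] := sum_sqr_ge (a1 z) (b1 z) (a2 z) (b2 z).
- by apply: (data f2 g2 a2 b2 sg2 gf2) => // z; have [] := sum_sqr_ge (a1 z) (b1 z) (a2 z) (b2 z).
Qed.

End Force.

(** * A uniqueness criterion, and square integrability from pairings *)

Section Uniq.
Context {R : realType}.
Notation mu1 := (@leb1 R).
Notation mu2 := (@leb2 R).
Notation R2 := (R * R)%type.

(** Both sides of Cauchy's formula for a repeated integral have the same derivative in t; this
    converts the differentiated equation into the kernel t - s that [wave_unique] expects. *)
Lemma unique_of_derive (k : (R2 -> R) -> R -> R) :
  (forall (c : R) p q t, test_function p -> test_function q ->
    k (fun x => c * p x + q x) t = c * k p t + k q t) ->
  (forall p, test_function p -> k p 0 = 0) ->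
  (forall p (t : R), test_function p -> is_derive t (1 : R) (k p) (oint (k (lap p)) t)) ->
  (forall r T : R, exists2 C : R, 0 < C & forall p (M : R), test_function p ->
    (forall x, r < `|x| -> p x = 0) -> (forall x, `|p x| <= M) ->
    \int[mu1]_s (\1_(`[- T, T]%classic) s * `|k p s|) <= C * M) ->
  forall p t, test_function p -> k p t = 0.
Proof.
move=> kD k0 kd kB.
have kc p : test_function p -> continuous (k p).
  by move=> tp; exact: (derive_continuous (fun t => kd p t tp)).
have kE p t : test_function p -> k p t = \int[mu1]_s (sgi t s * ((t - s) * k (lap p) s)).
  move=> tp; have cg := kc _ (test_lap tp); set g := k (lap p) in cg *.
  have csg : continuous (fun s : R => s * g s).
    by move=> s; apply: cvgM; [exact: cvg_id|exact: cg].
  have cog : continuous (oint g) by exact: (derive_continuous (fun t : R => oint_derive t cg)).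
  pose B (t : R) := t * oint g t - oint (fun s => s * g s) t.
  have BE : \int[mu1]_s (sgi t s * ((t - s) * g s)) = B t.
    rewrite /B /oint -(RintZ t (integ_sgi t cg)) -(RintB (integZ t (integ_sgi t cg)) (integ_sgi t csg)).
    have E (a b c d : R) : a * ((b - c) * d) = b * (a * d) - a * (c * d) by ring.
    by apply: Rint_eq => s; exact: E.
  have dB (y : R) : is_derive y (1 : R) B (oint g y).
    have h1 : is_derive y (1 : R) (fun y : R => y * oint g y) _ :=
      is_deriveM (is_derive_id y (1 : R)) (oint_derive y cg).
    apply: (is_derive_eq (is_deriveB h1 (oint_derive y csg))).
    have E (a b : R) : a + b * 1 - a = b by ring.
    exact: E.
  have F1 := oint_FTC t cog (fun x => kd p x tp).
  have F2 := oint_FTC t cog dB.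
  have B0 : B 0 = 0 by rewrite /B mul0r oint0 subr0.
  by rewrite BE -[B t]subr0 -[in RHS]B0 -F2 F1 k0// subr0.
by move=> p t tp; exact: (@wave_unique R k kD kc kB kE p t tp).
Qed.

Lemma ointB (a b : R -> R) (t : R) : integ mu1 (fun s => sgi t s * a s) ->
  integ mu1 (fun s => sgi t s * b s) -> oint (fun s => a s - b s) t = oint a t - oint b t.
Proof. by move=> ia ib; rewrite /oint -(RintB ia ib); apply: Rint_eq => s; exact: mulrBr. Qed.

Lemma ointD (a b : R -> R) (t : R) : integ mu1 (fun s => sgi t s * a s) ->
  integ mu1 (fun s => sgi t s * b s) -> oint (fun s => a s + b s) t = oint a t + oint b t.
Proof. by move=> ia ib; rewrite /oint -(RintD ia ib); apply: Rint_eq => s; exact: mulrDr. Qed.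

Lemma integ_sgi1 (a : R -> R) (t : R) : integ mu1 a -> integ mu1 (fun s => sgi t s * a s).
Proof.
move=> ia; apply: (integMb (M := 1) ia); first exact: measurable_sgi.
by move=> s; exact: sgi_le1.
Qed.

Lemma ae_oint (a b : R -> R) (t : R) : measurable_fun setT a -> measurable_fun setT b ->
  {ae mu1, forall s, a s = b s} -> oint a t = oint b t.
Proof.
move=> ma mb ab; apply: (@ae_eq_Rint R _ _ mu1 (fun s => sgi t s * a s) (fun s => sgi t s * b s)).
- by apply: measurable_funM => //; exact: measurable_sgi.
- by apply: measurable_funM => //; exact: measurable_sgi.
- by apply: ae_impl ab => s ->.
Qed.

Lemma sqr2_le (x y : R) : (x - y) ^+ 2 <= 2 * x ^+ 2 + 2 * y ^+ 2.
Proof. by have := sqr_ge0 (x + y); rewrite sqrrB sqrrD; lra. Qed.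

(** The multiplication formula in [square_fourier] gives the square integrable function ac - bs the
    same pairings as w, so the two agree almost everywhere by [test_zero]. The factor 2 comes from
    (x - y)^2 <= 2 x^2 + 2 y^2. *)
Lemma square_of_pairing (w Vc Vs : R2 -> R) : locally_integrable2 w ->
  measurable_fun setT Vc -> measurable_fun setT Vs ->
  integ mu2 (fun xi => Vc xi ^+ 2) -> integ mu2 (fun xi => Vs xi ^+ 2) ->
  (forall p, test_function p -> \int[mu2]_x (w x * p x) =
    \int[mu2]_xi (Vc xi * fc p xi) - \int[mu2]_xi (Vs xi * fs p xi)) ->
  integ mu2 (fun x => w x ^+ 2) /\
  \int[mu2]_x (w x ^+ 2) <= 2 * (\int[mu2]_xi (Vc xi ^+ 2) + \int[mu2]_xi (Vs xi ^+ 2)).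
Proof.
move=> iw mc ms c2 s2 wE; have mw := loc2_meas iw.
have [ac [bc [[mac mbc] [ac2 bc2] Lc Pc]]] := square_fourier mc c2.
have [as_ [bs [[mas mbs] [as2 bs2] Ls Ps]]] := square_fourier ms s2.
have mab : measurable_fun setT (fun x => ac x - bs x) by exact: measurable_funB.
have Z : {ae mu2, forall x, w x - (ac x - bs x) = 0}.
  apply: test_zero; first exact: measurable_funB.
  - move=> n; have [_ t1 _] := trunc_integ n mac ac2; have [_ t2 _] := trunc_integ n mbs bs2.
    apply: (eq_integ _ (integB (loc2_cut n%:R iw) (integB t1 t2))) => x.
    by rewrite /trunc -!mulrBr.
  - move=> p tp; have [e1 _ _ _] := Pc p tp; have [_ e2 _ _] := Ps p tp.
    have mp := test2_meas tp; have p2 := test2_sqr tp.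
    have j1 := loc2_test iw tp.
    have j2 := integ_sqM2 mac mp ac2 p2; have j3 := integ_sqM2 mbs mp bs2 p2.
    rewrite (Rint_eq mu2 (g := fun x => w x * p x - (ac x * p x - bs x * p x))); last first.
      by move=> x; rewrite !mulrBl.
    by rewrite (RintB j1 (integB j2 j3)) (RintB j2 j3) -e1 -e2 (wE p tp) subrr.
have bd x : (ac x - bs x) ^+ 2 <= 2 * ac x ^+ 2 + 2 * bs x ^+ 2 by exact: sqr2_le.
have idom := integD (integZ 2 ac2) (integZ 2 bs2).
have i2 : integ mu2 (fun x => (ac x - bs x) ^+ 2).
  apply: (le_integ idom); first exact: measurable_funX.
  by move=> x; rewrite ger0_norm ?sqr_ge0.
have aw : {ae mu2, forall x, (ac x - bs x) ^+ 2 = w x ^+ 2}.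
  by apply: ae_impl Z => x /eqP; rewrite subr_eq0 => /eqP ->.
have mw2 : measurable_fun setT (fun x => w x ^+ 2) by exact: measurable_funX.
split; first exact: (ae_eq_integ2 mw2 i2 aw).
have -> : \int[mu2]_x (w x ^+ 2) = \int[mu2]_x ((ac x - bs x) ^+ 2).
  by apply/esym/(@ae_eq_Rint R _ _ mu2) => //; exact: measurable_funX.
apply: (le_trans (Rint_le i2 idom bd)).
rewrite (RintD (integZ 2 ac2) (integZ 2 bs2)) (RintZ 2 ac2) (RintZ 2 bs2) -mulrDr.
rewrite ler_wpM2l//; apply: lerD.
  by apply: le_trans Lc; rewrite lerDl; apply: Rint_ge0 => x; exact: sqr_ge0.
by apply: le_trans Ls; rewrite lerDr; apply: Rint_ge0 => x; exact: sqr_ge0.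
Qed.

Lemma fc_test_bound (r M : R) p : test_function p -> (forall x, r < `|x| -> p x = 0) ->
  (forall x, `|p x| <= M) ->
  \int[mu2]_xi (fc p xi ^+ 2) <= M ^+ 2 * \int[mu2]_x cube2 r x /\
  \int[mu2]_xi (fs p xi ^+ 2) <= M ^+ 2 * \int[mu2]_x cube2 r x.
Proof.
move=> tp pr pM; have ip := test2_integ tp; have p2 := test2_sqr tp.
have [is_ Ls] := plancherel_le ip p2.
have c2 := fc_sqr_integ ip p2; have s2 := fs_sqr_integ ip p2.
have pC : \int[mu2]_x (p x ^+ 2) <= M ^+ 2 * \int[mu2]_x cube2 r x.
  have ic := integZ (M ^+ 2) (integ_cube2 (R := R) r).
  rewrite -(RintZ _ (integ_cube2 r)); apply: (Rint_le p2 ic) => x.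
  rewrite /cube2 indicE; have [xr|xr] := leP `|x| r.
    rewrite mem_set// mulr1 -[p x ^+ 2]real_normK ?num_real//.
    by rewrite lerXn2r ?nnegrE//; exact: le_trans (normr_ge0 _) (pM x).
  by rewrite (pr _ xr) expr0n /= mulr_ge0 ?sqr_ge0.
split; apply: le_trans pC; apply: le_trans Ls.
  by apply: (Rint_le c2 is_) => x; rewrite lerDl sqr_ge0.
by apply: (Rint_le s2 is_) => x; rewrite lerDr sqr_ge0.
Qed.

(** Linear in M, as a functional of order 0 must be; replacing sqrt (a c) by a + c avoids square
    roots. *)
Lemma pair_l2_bound (V N q : R2 -> R) (M c : R) : measurable_fun setT V -> measurable_fun setT q ->
  (forall xi, `|V xi| <= N xi) -> integ mu2 (fun xi => N xi ^+ 2) ->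
  integ mu2 (fun xi => q xi ^+ 2) -> \int[mu2]_xi (q xi ^+ 2) <= M ^+ 2 * c -> 0 <= M -> 0 <= c ->
  `|\int[mu2]_xi (V xi * q xi)| <= (\int[mu2]_xi (N xi ^+ 2) + c) * M.
Proof.
move=> mV mq VN N2 q2 qM M0 c0.
have VN2 xi : V xi ^+ 2 <= N xi ^+ 2.
  rewrite -[V xi ^+ 2]real_normK ?num_real// lerXn2r ?nnegrE//.
  exact: le_trans (normr_ge0 _) (VN xi).
have V2 : integ mu2 (fun xi => V xi ^+ 2).
  apply: (le_integ N2); first exact: measurable_funX.
  by move=> x; rewrite ger0_norm ?sqr_ge0.
have CS := @Rint_CS R _ _ mu2 V q mV mq V2 q2.
have A0 : 0 <= \int[mu2]_xi (N xi ^+ 2) by apply: Rint_ge0 => x; exact: sqr_ge0.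
have B0 : 0 <= \int[mu2]_xi (V xi ^+ 2) by apply: Rint_ge0 => x; exact: sqr_ge0.
have C0 : 0 <= \int[mu2]_xi (q xi ^+ 2) by apply: Rint_ge0 => x; exact: sqr_ge0.
have AB := Rint_le V2 N2 VN2.
apply: norm_le_of_sqr; first by apply: mulr_ge0 => //; exact: addr_ge0.
apply: (le_trans CS); apply: (le_trans (ler_pM B0 C0 AB qM)).
rewrite exprMn mulrCA mulrC ler_wpM2r ?sqr_ge0//.
apply: le_trans (four_mul_le _ _); have := mulr_ge0 A0 c0.
by move: (_ * c) => z z0; rewrite ler_peMl// ler1n.
Qed.

(** Equal to 1 except at zero frequency, where division by 0 makes it 0; it imposes there the
    vanishing of data that [mode] requires. *)
Definition chi (xi : R2) : R := om xi / om xi.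

Lemma chi01 xi : (om xi = 0 /\ chi xi = 0) \/ (om xi != 0 /\ chi xi = 1).
Proof.
rewrite /chi; have [->|o] := eqVneq (om xi) 0; first by left; rewrite mul0r.
by right; rewrite divff.
Qed.

Lemma meas_chi : measurable_fun setT chi.
Proof. by apply: measurable_funM; [exact: meas_om|apply: (meas_comp meas_inv); exact: meas_om]. Qed.

Lemma chi_le (g : R2 -> R) xi : `|chi xi * g xi| <= `|g xi|.
Proof. by case: (chi01 xi) => -[_ ->]; rewrite ?mul0r ?mul1r ?normr0. Qed.

Lemma ae_chi : {ae mu2, forall xi, chi xi = 1}.
Proof.
apply: ae_impl (@ae_coord0 R) => xi [x0 _]; have := om_neq0 x0.
by case: (chi01 xi) => -[-> //]; rewrite eqxx.
Qed.

Lemma chi_pair (g q : R2 -> R) : measurable_fun setT g -> measurable_fun setT q ->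
  \int[mu2]_xi (chi xi * g xi * q xi) = \int[mu2]_xi (g xi * q xi).
Proof.
move=> mg mq; apply: (@ae_eq_Rint R _ _ mu2).
- by apply: measurable_funM => //; apply: measurable_funM => //; exact: meas_chi.
- exact: measurable_funM.
- by apply: ae_impl ae_chi => xi ->; rewrite mul1r.
Qed.

End Uniq.

Section ModeTest.
Context {R : realType}.
Notation mu1 := (@leb1 R).
Notation mu2 := (@leb2 R).
Notation R2 := (R * R)%type.

Definition mode_data (g0 g1 : R2 -> R) (F : R * R2 -> R) (N : R2 -> R) :=
  [/\ (measurable_fun setT g0 /\ measurable_fun setT g1) /\ (measurable_fun setT F /\ measurable_fun setT N),
    (forall xi, integ mu1 (fun s => F (s, xi))),
    (forall xi, om xi = 0 -> [/\ g0 xi = 0, g1 xi = 0 & forall s, F (s, xi) = 0]),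
    integ mu2 (fun xi => N xi ^+ 2) &
    (forall xi, `|g0 xi| + `|g1 xi| / om xi + (\int[mu1]_s `|F (s, xi)|) / om xi <= N xi)].

(** [ql] stands for the transform of [lap p] when q is that of p, so the factor - om^2 becomes a
    Laplacian on the test function. *)
Lemma mode_test g0 g1 F N (q ql : R2 -> R) : mode_data g0 g1 F N -> measurable_fun setT q ->
  integ mu2 (fun xi => q xi ^+ 2) -> integ mu2 (fun xi => (om xi * q xi) ^+ 2) ->
  integ mu2 (fun xi => (om xi ^+ 2 * q xi) ^+ 2) -> (forall xi, om xi ^+ 2 * q xi = - ql xi) ->
  integ mu2 (fun xi => ql xi ^+ 2) -> measurable_fun setT ql ->
  [/\ forall t, integ mu2 (fun xi => mode g0 g1 F t xi * q xi),
      forall t, integ mu2 (fun xi => dmode g0 g1 F t xi * q xi),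
      forall t : R, is_derive t (1 : R) (fun t => \int[mu2]_xi (mode g0 g1 F t xi * q xi))
        (\int[mu2]_xi (dmode g0 g1 F t xi * q xi)),
      forall t, \int[mu2]_xi (dmode g0 g1 F t xi * q xi) = \int[mu2]_xi (g1 xi * q xi) +
        oint (fun s => \int[mu2]_xi (mode g0 g1 F s xi * ql xi)) t -
        oint (fun s => \int[mu2]_xi (F (s, xi) * q xi)) t &
      integ mu1 (fun s => \int[mu2]_xi (F (s, xi) * q xi))].
Proof.
move=> [[[m0 m1] [mF mN]] iF z0 N2 gN] mq q2 oq2 ooq2 qE ql2 mql.
split.
- by move=> t; exact: (mode_q_integ m0 m1 mF mN iF N2 gN mq q2 t).
- by move=> t; exact: (dmode_q_integ m0 m1 mF mN iF z0 N2 gN mq oq2 t).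
- by move=> t; exact: (mode_pair_derive m0 m1 mF mN iF z0 N2 gN mq q2 oq2 t).
- move=> t; rewrite (dmode_pair m0 m1 mF mN iF z0 N2 gN mq oq2 ooq2 t); congr (_ + _ - _).
  have il s := mode_q_integ m0 m1 mF mN iF N2 gN mql ql2 s.
  have E s : \int[mu2]_xi (mode g0 g1 F s xi * (om xi ^+ 2 * q xi)) =
      - (\int[mu2]_xi (mode g0 g1 F s xi * ql xi)).
    by rewrite -(RintN (il s)); apply: Rint_eq => xi; rewrite qE mulrN.
  have cl : continuous (fun s => \int[mu2]_xi (mode g0 g1 F s xi * ql xi)).
    apply: (@Rint_continuous R _ _ mu2 _ (fun xi => N xi * `|ql xi|)).
    + apply: (@integ_sqM2 R N (fun xi => `|ql xi|) mN _ N2).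
        exact: measurableT_comp.
      by apply: (eq_integ _ ql2) => xi; rewrite real_normK ?num_real.
    + by move=> s; apply: measurable_funM => //; exact: (meas_mode m0 m1 mF s).
    + by move=> xi s; apply: cvgM; [exact: (mode_cont iF z0)|exact: cvg_cst].
    + by move=> s xi; rewrite normrM ler_wpM2r//; exact: (mode_le iF gN).
  rewrite -[RHS]opprK; congr (- _); apply: (etrans _ (RintN (integ_sgi t cl))).
  by apply: Rint_eq => s; rewrite E mulrN.
- exact: (force_q_integ mF mN iF z0 N2 gN mq oq2).
Qed.

End ModeTest.

(** * The solution in Fourier variables *)

Section Component.
Context {R : realType}.
Notation mu1 := (@leb1 R).
Notation mu2 := (@leb2 R).
Notation mu12 := (@leb12 R).
Notation R2 := (R * R)%type.
Notation R12 := (R * (R * R))%type.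

Lemma five_sqr (x y z w v : R) : (`|x| + `|y| + `|z| + `|w| + v) ^+ 2 <=
  5 * (x ^+ 2 + y ^+ 2 + z ^+ 2 + w ^+ 2 + v ^+ 2).
Proof.
have n2 (c : R) : c ^+ 2 = `|c| ^+ 2 by rewrite real_normK ?num_real.
rewrite (n2 x) (n2 y) (n2 z) (n2 w).
move: `|x| `|y| `|z| `|w| => a b c d; rewrite -subr_ge0.
have -> : 5 * (a ^+ 2 + b ^+ 2 + c ^+ 2 + d ^+ 2 + v ^+ 2) - (a + b + c + d + v) ^+ 2 =
  (a - b) ^+ 2 + (a - c) ^+ 2 + (a - d) ^+ 2 + (a - v) ^+ 2 + (b - c) ^+ 2 + (b - d) ^+ 2 +
  (b - v) ^+ 2 + (c - d) ^+ 2 + (c - v) ^+ 2 + (d - v) ^+ 2 by ring.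
by do !apply: addr_ge0; exact: sqr_ge0.
Qed.

Lemma sum_drop (x y z w m : R) : 0 <= y -> 0 <= w -> x + z + m <= x + y + z + w + m.
Proof. lra. Qed.

Lemma sum_cancel (g g' P Q A B : R) : g + g' = 0 -> P + Q = 0 ->
  g + A - P + (g' + B - Q) = A + B.
Proof. lra. Qed.

Lemma fc_lin (c : R) p q (xi : R2) : test_function p -> test_function q ->
  fc (fun x => c * p x + q x) xi = c * fc p xi + fc q xi /\
  fs (fun x => c * p x + q x) xi = c * fs p xi + fs q xi.
Proof.
move=> tp tq; have ip := test2_integ tp; have iq := test2_integ tq.
rewrite (fcD xi (integZ c ip) iq) (fsD xi (integZ c ip) iq); split; congr (_ + _).
  by rewrite /fc -(RintZ c (integ_cos xi ip)); apply: Rint_eq => x; rewrite mulrA.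
by rewrite /fs -(RintZ c (integ_sin xi ip)); apply: Rint_eq => x; rewrite mulrA.
Qed.

Lemma pair_lin (V A B D : R2 -> R) (c : R) : (forall xi, D xi = c * A xi + B xi) ->
  integ mu2 (fun xi => V xi * A xi) -> integ mu2 (fun xi => V xi * B xi) ->
  \int[mu2]_xi (V xi * D xi) = c * \int[mu2]_xi (V xi * A xi) + \int[mu2]_xi (V xi * B xi).
Proof.
move=> DE iA iB; rewrite -(RintZ c iA) -(RintD (integZ c iA) iB).
by apply: Rint_eq => xi; rewrite DE mulrDr mulrCA.
Qed.

Definition mode_pairing g0 g1 F (Q : (R2 -> R) -> R2 -> R) (p : R2 -> R) :=
  [/\ forall t, integ mu2 (fun xi => mode g0 g1 F t xi * Q p xi),
      forall t, integ mu2 (fun xi => dmode g0 g1 F t xi * Q p xi),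
      forall t : R, is_derive t (1 : R) (fun t => \int[mu2]_xi (mode g0 g1 F t xi * Q p xi))
        (\int[mu2]_xi (dmode g0 g1 F t xi * Q p xi)),
      forall t, \int[mu2]_xi (dmode g0 g1 F t xi * Q p xi) = \int[mu2]_xi (g1 xi * Q p xi) +
        oint (fun s => \int[mu2]_xi (mode g0 g1 F s xi * Q (lap p) xi)) t -
        oint (fun s => \int[mu2]_xi (F (s, xi) * Q p xi)) t &
      integ mu1 (fun s => \int[mu2]_xi (F (s, xi) * Q p xi))].

Lemma mode_test_fourier g0 g1 F N p : mode_data g0 g1 F N -> test_function p ->
  mode_pairing g0 g1 F fc p /\ mode_pairing g0 g1 F fs p.
Proof.
move=> D tp; have tl := test_lap tp; have [oc os ooc oos] := test_om_sqr tp.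
have mp := test2_meas tp; have ml := test2_meas tl.
have p2 := test2_sqr tp; have l2 := test2_sqr tl.
have ip := test2_integ tp; have il := test2_integ tl.
have qc xi : om xi ^+ 2 * fc p xi = - fc (lap p) xi by rewrite (fc_lap xi tp) opprK.
have qs xi : om xi ^+ 2 * fs p xi = - fs (lap p) xi by rewrite (fs_lap xi tp) opprK.
split.
  exact: (mode_test D (meas_fc mp) (fc_sqr_integ ip p2) oc ooc qc (fc_sqr_integ il l2) (meas_fc ml)).
exact: (mode_test D (meas_fs mp) (fs_sqr_integ ip p2) os oos qs (fs_sqr_integ il l2) (meas_fs ml)).
Qed.

Definition good_modes (N : R2 -> R) (V dV : R -> R2 -> R) :=
  [/\ (forall t, measurable_fun setT (V t)) /\ (forall t, measurable_fun setT (dV t)),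
    (forall xi, continuous (V ^~ xi)) /\ (forall xi, continuous (dV ^~ xi)),
    forall t xi, `|V t xi| <= N xi & forall t xi, `|dV t xi| <= om xi * N xi].

Lemma good_modes_mode g0 g1 F N : mode_data g0 g1 F N ->
  good_modes N (mode g0 g1 F) (dmode g0 g1 F).
Proof.
move=> [[[m0 m1] [mF mN]] iF z0 N2 gN]; split.
- by split=> t; [exact: (meas_mode m0 m1 mF t)|exact: (meas_dmode m0 m1 mF t)].
- by split=> xi; [exact: (mode_cont iF z0)|exact: (dmode_cont iF z0)].
- by move=> t xi; exact: (mode_le iF gN).
- by move=> t xi; exact: (dmode_le iF z0 gN).
Qed.

(** The part of k coming from u is bounded after integration in time by [pair_bound]; the part
    coming from the modes is bounded uniformly in time, with A the integral of N^2. *)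
Lemma kernel_bound (u : R12 -> R) (k : (R2 -> R) -> R -> R) (A : R) :
  locally_integrable12 u -> (forall t, locally_integrable2 (at_time u t)) ->
  (forall p, test_function p -> continuous (fun s => distr_of_fun (at_time u s) p)) -> 0 <= A ->
  (forall p, test_function p -> continuous (k p)) ->
  (forall r p (M s : R), test_function p -> (forall x, r < `|x| -> p x = 0) ->
    (forall x, `|p x| <= M) -> `|k p s| <= `|distr_of_fun (at_time u s) p| +
      2 * ((A + \int[mu2]_x cube2 r x) * M)) ->
  forall r T : R, exists2 C : R, 0 < C & forall p (M : R), test_function p ->
    (forall x, r < `|x| -> p x = 0) -> (forall x, `|p x| <= M) ->
    \int[mu1]_s (\1_(`[- T, T]%classic) s * `|k p s|) <= C * M.
Proof.
move=> iu su ch A0 ck bk r T; have [C1 C10 H1] := pair_bound iu su r T.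
have iI : integ mu1 (\1_(`[- T, T]%classic) : R -> R) := integ_indic_itv (- T) T true false.
pose L := \int[mu1]_s (\1_(`[- T, T]%classic) s : R).
have I0 s : 0 <= (\1_(`[- T, T]%classic) s : R) by rewrite indicE.
have L0 : 0 <= L by exact: Rint_ge0.
pose c := \int[mu2]_x cube2 (R := R) r x.
have c0 : 0 <= c by apply: Rint_ge0 => x; rewrite /cube2 indicE.
have D0 : 0 <= 2 * (A + c) * L by rewrite mulr_ge0// mulr_ge0// addr_ge0.
exists (C1 + 2 * (A + c) * L); first by rewrite ltr_wpDr.
move=> p M tp pr pM; have M0 : 0 <= M := le_trans (normr_ge0 _) (pM 0).
have [i1 L1] := H1 p M tp pr pM (continuous_measurable_fun (ch p tp)).
pose K := 2 * ((A + c) * M).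
have i2 := integZ K iI.
have B s : \1_(`[- T, T]%classic) s * `|k p s| <=
    \1_(`[- T, T]%classic) s * `|distr_of_fun (at_time u s) p| + K * \1_(`[- T, T]%classic) s.
  by rewrite [K * _]mulrC -mulrDr ler_wpM2l//; exact: bk.
have ik : integ mu1 (fun s => \1_(`[- T, T]%classic) s * `|k p s|).
  apply: (le_integ (integD i1 i2)).
    apply: measurable_funM; first exact: integ_meas iI.
    by apply: measurableT_comp => //; apply: continuous_measurable_fun; exact: ck.
  by move=> s; rewrite ger0_norm ?mulr_ge0.
apply: (le_trans (Rint_le ik (integD i1 i2) B)).
rewrite (RintD i1 i2) (RintZ K iI) [leRHS]mulrDl; apply: lerD => //.
by have -> : 2 * (A + c) * L * M = K * L by rewrite /K; ring.
Qed.

Variables (u f : R12 -> R) (u0 : R2 -> R) (u1 : distribution2 R) (Fc Fs : R12 -> R).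
Variables (M G1r G1i : R2 -> R).
Hypothesis wu : weak_solution u f u0 u1.
Hypothesis fi : integ mu12 f.
Hypothesis sf : forall t, locally_integrable2 (at_time f t).
Hypothesis mu0 : measurable_fun setT u0.
Hypothesis u02 : integ mu2 (fun x => u0 x ^+ 2).
Hypothesis fd : force_data f Fc Fs M.
Hypothesis mM : measurable_fun setT M.
Hypothesis M2 : integ mu2 (fun xi => M xi ^+ 2).
Hypothesis mr : measurable_fun setT G1r.
Hypothesis mi : measurable_fun setT G1i.
Hypothesis r2 : integ mu2 (fun xi => (G1r xi / om xi) ^+ 2).
Hypothesis i2 : integ mu2 (fun xi => (G1i xi / om xi) ^+ 2).
Hypothesis hG : forall p, test_function p ->
  \int[mu2]_xi (G1r xi * fc p xi - G1i xi * fs p xi) = u1 p /\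
  \int[mu2]_xi (G1r xi * fs p xi + G1i xi * fc p xi) = 0.

(** V = Vc + i Vs is built from the data alone. Its pairing with fc p + i fs p has a real part, to
    be identified with the pairing of u with p, and an imaginary part, to be shown zero; each claim
    is an instance of [unique_of_derive]. *)
Lemma component : exists (Vc Vs dVc dVs : R -> R2 -> R) (N : R2 -> R),
  [/\ (measurable_fun setT N /\ integ mu2 (fun xi => N xi ^+ 2)) /\
      \int[mu2]_xi (N xi ^+ 2) <= 5 * (\int[mu2]_x (u0 x ^+ 2) +
        \int[mu2]_xi ((G1r xi / om xi) ^+ 2) + \int[mu2]_xi ((G1i xi / om xi) ^+ 2) +
        \int[mu2]_xi (M xi ^+ 2)),
    good_modes N Vc dVc, good_modes N Vs dVs,
    forall p t, test_function p -> distr_of_fun (at_time u t) p =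
      \int[mu2]_xi (Vc t xi * fc p xi) - \int[mu2]_xi (Vs t xi * fs p xi) &
    forall p t, test_function p ->
    [/\ integ mu2 (fun xi => dVc t xi * fc p xi) /\ integ mu2 (fun xi => dVs t xi * fs p xi),
      integ mu2 (fun xi => dVs t xi * fc p xi) /\ integ mu2 (fun xi => dVc t xi * fs p xi),
      dt_distr u t p = \int[mu2]_xi (dVc t xi * fc p xi) - \int[mu2]_xi (dVs t xi * fs p xi) &
      \int[mu2]_xi (dVs t xi * fc p xi) + \int[mu2]_xi (dVc t xi * fs p xi) = 0]].
Proof.
have [[mFc mFs] iF zF bF pF] := fd.
have [[iu _] [su _] _ uu0 _] := wu.
have [a [b [[ma mb] [a2 b2] Lab Pab]]] := square_fourier mu0 u02.
have moi : measurable_fun setT (fun xi : R2 => (om xi)^-1).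
  by apply: (meas_comp meas_inv); exact: meas_om.
have mr' : measurable_fun setT (fun xi => G1r xi / om xi) by exact: measurable_funM.
have mi' : measurable_fun setT (fun xi => G1i xi / om xi) by exact: measurable_funM.
(* One majorant serves both modes. Its five terms are the source of the factor 5, and a^2 + b^2
   integrates to at most the square of the norm of u0. *)
pose N xi := `|a xi| + `|b xi| + `|G1r xi / om xi| + `|G1i xi / om xi| + M xi.
have mN : measurable_fun setT N.
  by rewrite /N; do !apply: measurable_funD => //; exact: measurableT_comp.
have idom := integZ 5 (integD (integD (integD (integD a2 b2) r2) i2) M2).
have N2le xi : N xi ^+ 2 <= 5 * (a xi ^+ 2 + b xi ^+ 2 + (G1r xi / om xi) ^+ 2 +
  (G1i xi / om xi) ^+ 2 + M xi ^+ 2) by exact: five_sqr.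
have N2 : integ mu2 (fun xi => N xi ^+ 2).
  apply: (le_integ idom); first exact: measurable_funX.
  by move=> xi; rewrite ger0_norm ?sqr_ge0.
have Nbound : \int[mu2]_xi (N xi ^+ 2) <= 5 * (\int[mu2]_x (u0 x ^+ 2) +
    \int[mu2]_xi ((G1r xi / om xi) ^+ 2) + \int[mu2]_xi ((G1i xi / om xi) ^+ 2) +
    \int[mu2]_xi (M xi ^+ 2)).
  apply: (le_trans (Rint_le N2 idom N2le)).
  rewrite (RintZ 5 (integD (integD (integD (integD a2 b2) r2) i2) M2)).
  rewrite (RintD (integD (integD (integD a2 b2) r2) i2) M2) (RintD (integD (integD a2 b2) r2) i2).
  rewrite (RintD (integD a2 b2) r2) (RintD a2 b2) ler_wpM2l//.
  by rewrite lerD2r lerD2r lerD2r.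
have omdiv (g : R2 -> R) xi : `|chi xi * g xi| / om xi <= `|g xi / om xi|.
  rewrite [leRHS]normrM normfV (ger0_norm (om_ge0 xi)) ler_wpM2r ?chi_le//.
  by rewrite invr_ge0 om_ge0.
have mchi (g : R2 -> R) : measurable_fun setT g -> measurable_fun setT (fun xi => chi xi * g xi).
  by move=> mg; apply: measurable_funM => //; exact: meas_chi.
have chi0 (g : R2 -> R) xi : om xi = 0 -> chi xi * g xi = 0.
  by rewrite /chi => ->; rewrite mul0r mul0r.
have Dc : mode_data (fun xi => chi xi * a xi) (fun xi => chi xi * G1r xi) Fc N.
  split=> //.
  - by split; split => //; exact: mchi.
  - by move=> xi; exact: (iF xi).1.
  - move=> xi o0; split; [exact: chi0|exact: chi0|].
    by move=> s; exact: (zF xi o0 s).1.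
  - move=> xi; have h1 := chi_le a xi; have h2 := omdiv G1r xi; have [h3 _] := bF xi.
    have h4 := normr_ge0 (b xi); have h5 := normr_ge0 (G1i xi / om xi).
    apply: (le_trans (lerD (lerD h1 h2) h3)); rewrite /N.
    exact: sum_drop.
(* The signs of b and Fs are those of the imaginary part of fc - i fs; G1i is already an imaginary
   part. *)
have Ds : mode_data (fun xi => chi xi * - b xi) (fun xi => chi xi * G1i xi) (fun z => - Fs z) N.
  split=> //.
  - split; split => //; [|exact: mchi|]; last exact: measurableT_comp.
    by apply: (mchi (fun xi => - b xi)); exact: measurableT_comp.
  - by move=> xi; exact: integN (iF xi).2.
  - move=> xi o0; split; [exact: (chi0 (fun xi => - b xi))|exact: chi0|].
    by move=> s; rewrite (zF xi o0 s).2 oppr0.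
  - move=> xi; have h1 := chi_le (fun xi => - b xi) xi; have h2 := omdiv G1i xi; have [_ h3] := bF xi.
    have h4 := normr_ge0 (a xi); have h5 := normr_ge0 (G1r xi / om xi).
    rewrite (Rint_eq mu1 (f := fun s => `|- Fs (s, xi)|) (g := fun s => `|Fs (s, xi)|)); last first.
      by move=> s; rewrite normrN.
    apply: (le_trans (lerD (lerD h1 h2) h3)); rewrite /N normrN.
    by rewrite [X in _ <= X + _ + _ + _]addrC [X in _ <= X + _]addrAC; exact: sum_drop.
pose Vc := mode (fun xi => chi xi * a xi) (fun xi => chi xi * G1r xi) Fc.
pose dVc := dmode (fun xi => chi xi * a xi) (fun xi => chi xi * G1r xi) Fc.
pose Vs := mode (fun xi => chi xi * - b xi) (fun xi => chi xi * G1i xi) (fun z => - Fs z).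
pose dVs := dmode (fun xi => chi xi * - b xi) (fun xi => chi xi * G1i xi) (fun z => - Fs z).
have gc : good_modes N Vc dVc := good_modes_mode Dc.
have gs : good_modes N Vs dVs := good_modes_mode Ds.
have mfc (p : R2 -> R) (tp : test_function p) := meas_fc (test2_meas tp).
have mfs (p : R2 -> R) (tp : test_function p) := meas_fs (test2_meas tp).
have fc2 (p : R2 -> R) (tp : test_function p) := fc_sqr_integ (test2_integ tp) (test2_sqr tp).
have fs2 (p : R2 -> R) (tp : test_function p) := fs_sqr_integ (test2_integ tp) (test2_sqr tp).
pose h p s := distr_of_fun (at_time u s) p.
pose hc (V : R -> R2 -> R) p s := \int[mu2]_xi (V s xi * fc p xi).
pose hs (V : R -> R2 -> R) p s := \int[mu2]_xi (V s xi * fs p xi).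
have dcont (g dg : R -> R) : (forall t : R, is_derive t (1 : R) g (dg t)) -> continuous g.
  exact: derive_continuous.
have ch p : test_function p -> continuous (h p).
  by move=> tp; have [_ hd _] := weak_pair_derive wu fi sf tp; exact: (dcont _ _ hd).
have cont4 p : test_function p -> [/\ continuous (hc Vc p), continuous (hs Vc p),
    continuous (hc Vs p) & continuous (hs Vs p)].
  move=> tp; have [[_ _ x1 _ _] [_ _ x2 _ _]] := mode_test_fourier Dc tp.
  have [[_ _ x3 _ _] [_ _ x4 _ _]] := mode_test_fourier Ds tp.
  by split; [exact: (dcont _ _ x1)|exact: (dcont _ _ x2)|exact: (dcont _ _ x3)|exact: (dcont _ _ x4)].
have cB (x y : R -> R) : continuous x -> continuous y -> continuous (fun s => x s - y s).
  by move=> cx cy s; apply: (@cvgB _ R^o); [exact: cx|exact: cy].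
have cD (x y : R -> R) : continuous x -> continuous y -> continuous (fun s => x s + y s).
  by move=> cx cy s; apply: (@cvgD _ R^o); [exact: cx|exact: cy].
have A0 : 0 <= \int[mu2]_xi (N xi ^+ 2) by apply: Rint_ge0 => xi; exact: sqr_ge0.
have [[mVc mdVc] _ Vcle dVcle] := gc; have [[mVs mdVs] _ Vsle dVsle] := gs.
have pb r p (K s : R) : test_function p -> (forall x, r < `|x| -> p x = 0) -> (forall x, `|p x| <= K) ->
    let B := (\int[mu2]_xi (N xi ^+ 2) + \int[mu2]_x cube2 r x) * K in
    [/\ `|hc Vc p s| <= B, `|hs Vc p s| <= B, `|hc Vs p s| <= B & `|hs Vs p s| <= B].
  move=> tp pr pK; have K0 : 0 <= K := le_trans (normr_ge0 _) (pK 0).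
  have [Bc Bs] := fc_test_bound tp pr pK.
  have c0 : 0 <= \int[mu2]_x cube2 (R := R) r x by apply: Rint_ge0 => x; rewrite /cube2 indicE.
  split.
  - exact: (pair_l2_bound (mVc s) (mfc p tp) (Vcle s) N2 (fc2 p tp) Bc K0 c0).
  - exact: (pair_l2_bound (mVc s) (mfs p tp) (Vcle s) N2 (fs2 p tp) Bs K0 c0).
  - exact: (pair_l2_bound (mVs s) (mfc p tp) (Vsle s) N2 (fc2 p tp) Bc K0 c0).
  - exact: (pair_l2_bound (mVs s) (mfs p tp) (Vsle s) N2 (fs2 p tp) Bs K0 c0).
(* As chi = om / om, the product chi g q is (g / om) (om q), a product of two square integrable
   functions. *)
have gq (g q : R2 -> R) : measurable_fun setT g -> integ mu2 (fun xi => (g xi / om xi) ^+ 2) ->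
    measurable_fun setT q -> integ mu2 (fun xi => (om xi * q xi) ^+ 2) ->
    integ mu2 (fun xi => chi xi * g xi * q xi).
  move=> mg g2 mq q2; have mo := @meas_om R.
  have mg' : measurable_fun setT (fun xi => g xi / om xi) by exact: measurable_funM.
  have mq' : measurable_fun setT (fun xi => om xi * q xi) by exact: measurable_funM.
  apply: (eq_integ _ (integ_sqM2 mg' mq' g2 q2)) => xi; rewrite /chi.
  have E (x y z w : R) : x * y * (z * w) = z * y * x * w by ring.
  exact: E.
have data1 p : test_function p ->
    \int[mu2]_xi (chi xi * G1r xi * fc p xi) - \int[mu2]_xi (chi xi * G1i xi * fs p xi) = u1 p /\
    \int[mu2]_xi (chi xi * G1i xi * fc p xi) + \int[mu2]_xi (chi xi * G1r xi * fs p xi) = 0.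
  move=> tp; have [oc os _ _] := test_om_sqr tp; have [e1 e2] := hG tp.
  have j1 := gq _ _ mr r2 (mfc p tp) oc; have j2 := gq _ _ mi i2 (mfs p tp) os.
  have j3 := gq _ _ mi i2 (mfc p tp) oc; have j4 := gq _ _ mr r2 (mfs p tp) os.
  split.
    rewrite -e1 -(RintB j1 j2); apply: (@ae_eq_Rint R _ _ mu2).
    + exact: (integ_meas (integB j1 j2)).
    + by apply: measurable_funB; apply: measurable_funM => //; [exact: mfc|exact: mfs].
    + by apply: ae_impl (@ae_chi R) => xi ->; rewrite !mul1r.
  rewrite -e2 -(RintD j3 j4); apply: (@ae_eq_Rint R _ _ mu2).
  + exact: (integ_meas (integD j3 j4)).
  + by apply: measurable_funD; apply: measurable_funM => //; [exact: mfs|exact: mfc].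
  + by apply: ae_impl (@ae_chi R) => xi ->; rewrite !mul1r addrC.
(* [kRe] is the discrepancy between u and V, and [kIm] measures the failure of V to be the transform
   of a real distribution. Both satisfy the homogeneous equation with zero data. *)
pose kRe p s := h p s - (hc Vc p s - hs Vs p s).
pose kIm p s := hc Vs p s + hs Vc p s.
have Re0 p t : test_function p -> kRe p t = 0.
  apply: (@unique_of_derive R kRe).
  - move=> c {}p q {}t tp tq; rewrite /kRe.
    have [[x1 _ _ _ _] _] := mode_test_fourier Dc tp; have [_ [x2 _ _ _ _]] := mode_test_fourier Ds tp.
    have [[y1 _ _ _ _] _] := mode_test_fourier Dc tq; have [_ [y2 _ _ _ _]] := mode_test_fourier Ds tq.
    have L1 : h (fun x => c * p x + q x) t = c * h p t + h q t.
      by apply: pair_lin => //; exact: loc2_test.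
    have L2 : hc Vc (fun x => c * p x + q x) t = c * hc Vc p t + hc Vc q t.
      by apply: pair_lin => // xi; exact: (fc_lin c xi tp tq).1.
    have L3 : hs Vs (fun x => c * p x + q x) t = c * hs Vs p t + hs Vs q t.
      by apply: pair_lin => // xi; exact: (fc_lin c xi tp tq).2.
    rewrite L1 L2 L3; move: (h p t) (h q t) (hc Vc p t) (hc Vc q t) (hs Vs p t) (hs Vs q t) => *.
    by ring.
  - move=> {}p tp; have [_ _ e _] := Pab p tp.
    have Z : h p 0 = \int[mu2]_x (u0 x * p x).
      apply: (@ae_eq_Rint R _ _ mu2).
      + exact: (integ_meas (loc2_test (su 0) tp)).
      + by apply: measurable_funM => //; exact: test2_meas.
      + by apply: ae_impl uu0 => x E; rewrite /at_time E.
    rewrite /kRe Z -e /hc /hs.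
    rewrite (Rint_eq mu2 (f := fun xi => Vc 0 xi * fc p xi) (g := fun xi => chi xi * a xi * fc p xi)); last first.
      by move=> xi; rewrite /Vc mode0.
    rewrite (Rint_eq mu2 (f := fun xi => Vs 0 xi * fs p xi) (g := fun xi => chi xi * - b xi * fs p xi)); last first.
      by move=> xi; rewrite /Vs mode0.
    have mNb : measurable_fun setT (fun xi => - b xi) by exact: measurableT_comp.
    rewrite (chi_pair ma (mfc p tp)) (chi_pair mNb (mfs p tp)).
    have -> : \int[mu2]_xi (- b xi * fs p xi) = - (\int[mu2]_xi (b xi * fs p xi)).
      by rewrite -(RintN (integ_sqM2 mb (mfs p tp) b2 (fs2 p tp))); apply: Rint_eq => xi; rewrite mulNr.
    by rewrite opprK subrr.
  - move=> {}p {}t tp; have [ip hd hE] := weak_pair_derive wu fi sf tp.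
    have [[_ _ x1 x2 x3] _] := mode_test_fourier Dc tp; have [_ [_ _ y1 y2 y3]] := mode_test_fourier Ds tp.
    have [d1_ _] := data1 p tp.
    apply: (is_derive_eq (is_deriveB (hd t) (is_deriveB (x1 t) (y1 t)))).
    have phE : oint (fun s => distr_of_fun (at_time f s) p) t =
        oint (fun s => \int[mu2]_xi (Fc (s, xi) * fc p xi)) t -
        oint (fun s => \int[mu2]_xi (- Fs (s, xi) * fs p xi)) t.
      rewrite -(ointB (integ_sgi1 t x3) (integ_sgi1 t y3)).
      apply: ae_oint; [exact: integ_meas ip|exact: integ_meas (integB x3 y3)|].
      apply: ae_impl (pF p tp) => s [e1 _ _ j2]; apply: (etrans (esym e1)); congr (_ + _).
      by apply/esym; rewrite -[RHS]opprK -(RintN j2); congr (- _); apply: Rint_eq => xi; rewrite mulNr.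
    have [c1 _ _ c4] := cont4 _ (test_lap tp); have c0 := ch _ (test_lap tp).
    have -> : oint (kRe (lap p)) t = oint (h (lap p)) t - (oint (hc Vc (lap p)) t - oint (hs Vs (lap p)) t).
      by rewrite -(ointB (integ_sgi t c1) (integ_sgi t c4)) -(ointB (integ_sgi t c0) (integ_sgi t (cB _ _ c1 c4))).
    rewrite hE phE (x2 t) (y2 t) -d1_.
    have E (g g' U P Q A B : R) : g - g' + U - (P - Q) - (g + A - P - (g' + B - Q)) = U - (A - B) by ring.
    exact: E.
  - apply: (kernel_bound iu su ch A0).
      by move=> {}p tp; have [c1 _ _ c4] := cont4 p tp; exact: cB (ch p tp) (cB _ _ c1 c4).
    move=> r {}p K s tp pr pK; have [B1 _ _ B4] := pb r p K s tp pr pK.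
    apply: (le_trans (ler_normB _ _)); rewrite lerD2l; apply: (le_trans (ler_normB _ _)).
    apply: (le_trans (lerD B1 B4)); rewrite -mulr2n mulr_natl; exact: lexx.
have Im0 p t : test_function p -> kIm p t = 0.
  apply: (@unique_of_derive R kIm).
  - move=> c {}p q {}t tp tq; rewrite /kIm.
    have [[x1 _ _ _ _] _] := mode_test_fourier Ds tp; have [_ [x2 _ _ _ _]] := mode_test_fourier Dc tp.
    have [[y1 _ _ _ _] _] := mode_test_fourier Ds tq; have [_ [y2 _ _ _ _]] := mode_test_fourier Dc tq.
    have L2 : hc Vs (fun x => c * p x + q x) t = c * hc Vs p t + hc Vs q t.
      by apply: pair_lin => // xi; exact: (fc_lin c xi tp tq).1.
    have L3 : hs Vc (fun x => c * p x + q x) t = c * hs Vc p t + hs Vc q t.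
      by apply: pair_lin => // xi; exact: (fc_lin c xi tp tq).2.
    rewrite L2 L3; move: (hc Vs p t) (hc Vs q t) (hs Vc p t) (hs Vc q t) => *.
    by ring.
  - move=> {}p tp; have [_ _ _ e] := Pab p tp.
    rewrite /kIm /hc /hs.
    rewrite (Rint_eq mu2 (f := fun xi => Vc 0 xi * fs p xi) (g := fun xi => chi xi * a xi * fs p xi)); last first.
      by move=> xi; rewrite /Vc mode0.
    rewrite (Rint_eq mu2 (f := fun xi => Vs 0 xi * fc p xi) (g := fun xi => chi xi * - b xi * fc p xi)); last first.
      by move=> xi; rewrite /Vs mode0.
    have mNb : measurable_fun setT (fun xi => - b xi) by exact: measurableT_comp.
    rewrite (chi_pair ma (mfs p tp)) (chi_pair mNb (mfc p tp)) e.
    have -> : \int[mu2]_xi (- b xi * fc p xi) = - (\int[mu2]_xi (b xi * fc p xi)).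
      by rewrite -(RintN (integ_sqM2 mb (mfc p tp) b2 (fc2 p tp))); apply: Rint_eq => xi; rewrite mulNr.
    by rewrite addrC subrr.
  - move=> {}p {}t tp.
    have [[_ _ x1 x2 x3] _] := mode_test_fourier Ds tp; have [_ [_ _ y1 y2 y3]] := mode_test_fourier Dc tp.
    have [_ d2_] := data1 p tp.
    apply: (is_derive_eq (is_deriveD (x1 t) (y1 t))).
    have phE : oint (fun s => \int[mu2]_xi (- Fs (s, xi) * fc p xi)) t +
        oint (fun s => \int[mu2]_xi (Fc (s, xi) * fs p xi)) t = 0.
      rewrite -(ointD (integ_sgi1 t x3) (integ_sgi1 t y3)).
      transitivity (oint (fun=> (0 : R)) t); last first.
        by rewrite /oint (Rint_eq mu1 (g := fun=> 0)) ?Rint0// => s; exact: mulr0.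
      apply: ae_oint; [exact: integ_meas (integD x3 y3)|exact: measurable_cst|].
      apply: ae_impl (pF p tp) => s [_ e2 j1 _]; rewrite -e2.
      have -> : \int[mu2]_xi (- Fs (s, xi) * fc p xi) = - (\int[mu2]_xi (Fs (s, xi) * fc p xi)).
        by rewrite -(RintN j1); apply: Rint_eq => xi; rewrite mulNr.
      by rewrite addrC subrr.
    have [_ c2 c3 _] := cont4 _ (test_lap tp).
    have -> : oint (kIm (lap p)) t = oint (hc Vs (lap p)) t + oint (hs Vc (lap p)) t.
      by rewrite -(ointD (integ_sgi t c3) (integ_sgi t c2)).
    rewrite (x2 t) (y2 t).
    exact: sum_cancel.
  - apply: (kernel_bound iu su ch A0).
      by move=> {}p tp; have [_ c2 c3 _] := cont4 p tp; exact: cD c3 c2.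
    move=> r {}p K s tp pr pK; have [_ B2 B3 _] := pb r p K s tp pr pK.
    apply: (le_trans (ler_normD _ _)); apply: (le_trans (lerD B3 B2)).
    by rewrite -mulr2n [in leRHS]mulr_natl lerDr.
exists Vc, Vs, dVc, dVs, N; split => //.
  by move=> p t tp; apply/eqP; rewrite -subr_eq0; apply/eqP; exact: Re0.
move=> p t tp; have [ip hd _] := weak_pair_derive wu fi sf tp.
have [[_ x0 x1 _ _] [_ z0 z1 _ _]] := mode_test_fourier Dc tp.
have [[_ w0 w1 _ _] [_ y0 y1 _ _]] := mode_test_fourier Ds tp.
(* The statements on [dt_distr] are the time derivatives of [Re0] and [Im0]. *)
have zero (g : R -> R) d : (forall s, g s = 0) -> is_derive t (1 : R) g d -> d = 0.
  move=> g0 gd; have Eg : g = fun=> 0 by apply/funext.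
  by rewrite Eg in gd; rewrite -(deriveE gd) derive_cst.
split=> //.
  apply/eqP; rewrite -subr_eq0; apply/eqP.
  exact: (zero _ _ (fun s => Re0 p s tp) (is_deriveB (hd t) (is_deriveB (x1 t) (y1 t)))).
exact: (zero _ _ (fun s => Im0 p s tp) (is_deriveD (w1 t) (z1 t))).
Qed.

End Component.

(** * Norm estimates *)

Section Norms.
Context {R : realType}.
Notation mu1 := (@leb1 R).
Notation mu2 := (@leb2 R).
Notation mu12 := (@leb12 R).
Notation R2 := (R * R)%type.
Notation R12 := (R * (R * R))%type.

Lemma Lp2E (g : R2 -> R) : measurable_fun setT g -> integ mu2 (fun x => g x ^+ 2) ->
  Lp_norm 2 g = (Num.sqrt (\int[mu2]_x (g x ^+ 2)))%:E.
Proof.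
move=> mg i2; rewrite /Lp_norm asboolT// unlock /=.
rewrite (_ : (\int[mu2]_x _)%E = (\int[mu2]_x (g x ^+ 2))%:E); last first.
  rewrite (EFin_Rint i2); apply: eq_integral => x _.
  by rewrite /= powR_mulrn ?normr_ge0// real_normK ?num_real.
by rewrite /= powR12_sqrt// Rint_ge0// => x; exact: sqr_ge0.
Qed.

Lemma Lp2_fin (g : R2 -> R) (r : R) : Lp_norm 2 g = r%:E ->
  [/\ measurable_fun setT g, integ mu2 (fun x => g x ^+ 2), 0 <= r &
    \int[mu2]_x (g x ^+ 2) = r ^+ 2].
Proof.
move=> gr; have mg : measurable_fun setT g.
  by move: gr; rewrite /Lp_norm; case: asboolP.
have i2 : integ mu2 (fun x => g x ^+ 2).
  apply: integ_ge0_lty; [exact: measurable_funX|by move=> x; exact: sqr_ge0|].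
  rewrite ltNge leye_eq; apply/negP => /eqP E.
  move: gr; rewrite /Lp_norm asboolT// unlock /=.
  rewrite (_ : (\int[mu2]_x _)%E = +oo%E); last first.
    rewrite -[RHS]E; apply: eq_integral => x _.
    by rewrite /= powR_mulrn ?normr_ge0// real_normK ?num_real.
  by rewrite poweRyr.
move: gr; rewrite (Lp2E mg i2) => -[<-]; split; [exact: mg|exact: i2|exact: sqrtr_ge0|].
by rewrite sqr_sqrtr// Rint_ge0// => x; exact: sqr_ge0.
Qed.

Lemma sqrt_le_of_sqr (x b : R) : 0 <= b -> x <= b ^+ 2 -> Num.sqrt x <= b.
Proof. by move=> b0 xb; rewrite -[leRHS]ger0_norm// -sqrtr_sqr ler_wsqrtr. Qed.

Lemma Lp_norm_ge0 (r : \bar R) (g : R2 -> R) : (0 <= Lp_norm r g)%E.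
Proof. by rewrite /Lp_norm; case: ifP => _; [exact: Lnorm_ge0|exact: leey]. Qed.

Lemma Hdot_norm_ge0 (s : R) (g : distribution2 R) : (0 <= Hdot_norm s g)%E.
Proof. by apply: le_ereal_inf_tmp => _ [G _ <-]; exact: Lp_norm_ge0. Qed.

Lemma om_powN1 (xi : R2) : (2 * pi * Num.sqrt (dot xi xi)) `^ (-1) = (om xi)^-1.
Proof. by rewrite powR_inv1 ?om_ge0. Qed.

Lemma Hdot_le (g : distribution2 R) (Gr Gi : R2 -> R) (B : R) :
  measurable_fun setT Gr -> measurable_fun setT Gi ->
  (forall p, test_function p ->
    [/\ integ mu2 (fun xi => Gr xi * fc p xi) /\ integ mu2 (fun xi => Gi xi * fs p xi),
      integ mu2 (fun xi => Gi xi * fc p xi) /\ integ mu2 (fun xi => Gr xi * fs p xi),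
      g p = \int[mu2]_xi (Gr xi * fc p xi) - \int[mu2]_xi (Gi xi * fs p xi) &
      \int[mu2]_xi (Gi xi * fc p xi) + \int[mu2]_xi (Gr xi * fs p xi) = 0]) ->
  integ mu2 (fun xi => (Gr xi ^+ 2 + Gi xi ^+ 2) / om xi ^+ 2) -> 0 <= B ->
  \int[mu2]_xi ((Gr xi ^+ 2 + Gi xi ^+ 2) / om xi ^+ 2) <= B ^+ 2 ->
  (Hdot_norm (-1) g <= B%:E)%E.
Proof.
move=> mGr mGi H i2 B0 LB; pose G (xi : R2) : R[i] := (Gr xi +i* Gi xi)%C.
have hG : has_fourier g G.
  split => // p tp; have [[j1 j2] [j3 j4] e1 e2] := H p tp.
  apply/eqP; rewrite eq_complex /=; apply/andP; split; apply/eqP.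
    by rewrite e1 -(RintB j1 j2).
  by rewrite -e2 -(RintD j3 j4); apply: Rint_eq => xi; rewrite addrC.
apply: (le_trans (ereal_inf_lbound _)); first by exists G.
have E xi : ((2 * pi * Num.sqrt (dot xi xi)) `^ (-1) * Normc.normc (G xi)) ^+ 2 =
    (Gr xi ^+ 2 + Gi xi ^+ 2) / om xi ^+ 2.
  rewrite om_powN1 exprMn /= sqr_sqrtr ?addr_ge0 ?sqr_ge0// mulrC.
  by rewrite exprVn.
rewrite Lp2E.
- by rewrite lee_fin (Rint_eq mu2 E); exact: sqrt_le_of_sqr.
- apply: (@eq_measurable_fun _ _ _ _ setT
    (fun xi => (om xi)^-1 * Num.sqrt (Gr xi ^+ 2 + Gi xi ^+ 2))).
    by move=> xi _; rewrite om_powN1.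
  apply: measurable_funM; first by apply: (meas_comp meas_inv); exact: meas_om.
  by apply: (meas_comp meas_sqrt); apply: measurable_funD; exact: measurable_funX.
- by apply: (eq_integ _ i2) => xi; exact/esym/E.
Qed.

(** An almost optimal transform dispenses with a proof that the transform is unique; the excess e is
    sent to 0 in the theorem. *)
Lemma Hdot_adherent (g : distribution2 R) (h e : R) : Hdot_norm (-1) g = h%:E -> 0 < e ->
  exists (Gr Gi : R2 -> R) (b : R), [/\ 0 <= b /\ b <= h + e,
    measurable_fun setT Gr /\ measurable_fun setT Gi,
    integ mu2 (fun xi => (Gr xi / om xi) ^+ 2) /\ integ mu2 (fun xi => (Gi xi / om xi) ^+ 2),
    \int[mu2]_xi ((Gr xi / om xi) ^+ 2) + \int[mu2]_xi ((Gi xi / om xi) ^+ 2) = b ^+ 2 &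
    forall p, test_function p ->
      \int[mu2]_xi (Gr xi * fc p xi - Gi xi * fs p xi) = g p /\
      \int[mu2]_xi (Gr xi * fs p xi + Gi xi * fc p xi) = 0].
Proof.
move=> gh e0; have hf : Hdot_norm (-1) g \is a fin_num by rewrite gh.
have [_ [G [mr mi hG] <-]] := lb_ereal_inf_adherent e0 hf.
rewrite -/(Hdot_norm (-1) g) gh -EFinD.
have := Lp_norm_ge0 2 (fun xi => (2 * pi * Num.sqrt (dot xi xi)) `^ (-1) * Normc.normc (G xi)).
case Eb : (Lp_norm 2 _) => [b| |] // _; rewrite lte_fin => bh.
have [_ i2 b0 bE] := Lp2_fin Eb.
pose Gr xi := complex.Re (G xi); pose Gi xi := complex.Im (G xi).
have E xi : ((2 * pi * Num.sqrt (dot xi xi)) `^ (-1) * Normc.normc (G xi)) ^+ 2 =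
    (Gr xi / om xi) ^+ 2 + (Gi xi / om xi) ^+ 2.
  rewrite om_powN1 /Gr /Gi; case: (G xi) => x y /=.
  by rewrite exprMn sqr_sqrtr ?addr_ge0 ?sqr_ge0// !expr_div_n exprVn mulrC mulrDl.
have moi : measurable_fun setT (fun xi : R2 => (om xi)^-1).
  by apply: (meas_comp meas_inv); exact: meas_om.
have j1 : integ mu2 (fun xi => (Gr xi / om xi) ^+ 2).
  apply: (le_integ i2); first by apply: measurable_funX; exact: measurable_funM.
  by move=> xi; rewrite ger0_norm ?sqr_ge0// E lerDl sqr_ge0.
have j2 : integ mu2 (fun xi => (Gi xi / om xi) ^+ 2).
  apply: (le_integ i2); first by apply: measurable_funX; exact: measurable_funM.
  by move=> xi; rewrite ger0_norm ?sqr_ge0// E lerDr sqr_ge0.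
exists Gr, Gi, b; split => //; first by rewrite (ltW bh).
  by rewrite -(RintD j1 j2) -bE; apply: Rint_eq => xi; exact/esym/E.
move=> p tp; have eG := hG p tp.
have e1 := congr1 (@complex.Re R) eG; have e2 := congr1 (@complex.Im R) eG.
split.
  apply: (etrans _ e1); apply: Rint_eq => xi; rewrite /Gr /Gi.
  by case: (G xi).
apply: (etrans _ e2); apply: Rint_eq => xi; rewrite /Gr /Gi.
by case: (G xi).
Qed.

Lemma Lp1E (g : R2 -> R) : measurable_fun setT g ->
  Lp_norm 1 g = (\int[mu2]_x `|(g x)%:E|)%E.
Proof. by move=> mg; rewrite /Lp_norm asboolT// Lnorm1. Qed.

Lemma mixed_norm_ge0 (f : R12 -> R2) : (0 <= mixed_norm 1 1 f)%E.
Proof. exact: Lnorm_ge0. Qed.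

(** Tonelli identifies the mixed norm with the sum of the space-time integrals of the two
    components, so its finiteness makes both integrable. *)
Lemma mixed_fin (f : R12 -> R2) (K : R) : locally_integrable12 (comp1 f) ->
  locally_integrable12 (comp2 f) -> mixed_norm 1 1 f = K%:E ->
  [/\ integ mu12 (comp1 f), integ mu12 (comp2 f) &
    \int[mu12]_z `|comp1 f z| + \int[mu12]_z `|comp2 f z| = K].
Proof.
move=> l1 l2 fK; have m1 := loc12_meas l1; have m2 := loc12_meas l2.
have sec (g : R12 -> R) t : measurable_fun setT g -> measurable_fun setT (fun x => g (t, x)).
  by move=> mg; apply: (meas_comp mg); exact: measurable_pair1.
have mE (g : R12 -> R) : measurable_fun setT g ->
    measurable_fun setT (fun z : R12 => `|(g z)%:E|%E).
  by move=> mg; apply: measurableT_comp => //; exact/measurable_EFinP.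
have T (g : R12 -> R) : measurable_fun setT g ->
    (\int[mu1]_t \int[mu2]_x `|(g (t, x))%:E| = \int[mu12]_z `|(g z)%:E|)%E.
  move=> mg; apply/esym.
  exact: (@fubini_tonelli1 _ _ _ _ _ mu1 mu2 (fun z : R12 => `|(g z)%:E|%E) (mE g mg) (fun z => abse_ge0 _)).
have mF (g : R12 -> R) : measurable_fun setT g ->
    measurable_fun setT (fun t : R => (\int[mu2]_x `|(g (t, x))%:E|)%E).
  move=> mg.
  exact: (@measurable_fun_fubini_tonelli_F _ _ _ _ _ mu2 (fun z : R12 => `|(g z)%:E|%E) (mE g mg) (fun z => abse_ge0 _)).
have S : (\int[mu12]_z `|(comp1 f z)%:E| + \int[mu12]_z `|(comp2 f z)%:E| = K%:E)%E.
  rewrite -fK /mixed_norm Lnorm1 -(T _ m1) -(T _ m2) -ge0_integralD//; last 4 first.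
  - by move=> t _; exact: integral_ge0.
  - exact: mF.
  - by move=> t _; exact: integral_ge0.
  - exact: mF.
  apply: eq_integral => t _; rewrite /Lp_norm_vec.
  rewrite (Lp1E (sec _ t m1)) (Lp1E (sec _ t m2)) gee0_abs//.
  by apply: adde_ge0; exact: integral_ge0.
have I10 : (0 <= \int[mu12]_z `|(comp1 f z)%:E|)%E by exact: integral_ge0.
have I20 : (0 <= \int[mu12]_z `|(comp2 f z)%:E|)%E by exact: integral_ge0.
have F1 : (\int[mu12]_z `|(comp1 f z)%:E| < +oo)%E.
  by apply: le_lt_trans (ltry K); rewrite -S leeDl.
have F2 : (\int[mu12]_z `|(comp2 f z)%:E| < +oo)%E.
  by apply: le_lt_trans (ltry K); rewrite -S leeDr.
have i1 : integ mu12 (comp1 f).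
  by apply/integrableP; split => //; exact/measurable_EFinP.
have i2 : integ mu12 (comp2 f).
  by apply/integrableP; split => //; exact/measurable_EFinP.
split => //; apply: EFin_inj; rewrite EFinD.
by rewrite (EFin_Rint (integ_norm i1)) (EFin_Rint (integ_norm i2)).
Qed.

Lemma loc2B (v w : R2 -> R) : locally_integrable2 v -> locally_integrable2 w ->
  locally_integrable2 (fun x => v x - w x).
Proof.
move=> iv iw r; have mD := measurable_cube2 (R := R) r.
have := integrableB mD (iv r) (iw r).
by apply: eq_integrable => // x _; rewrite /= EFinB.
Qed.

Lemma le_of_double (x y q z : R) : 0 <= x -> 0 <= y -> 0 <= q -> 2 * (x + y) + q <= z ->
  [/\ x <= z, y <= z, q <= z & 2 * x + 2 * y <= z].
Proof. by move=> *; split; lra. Qed.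

(** A single majorant Z controls both norms; its coefficient 2 is the one lost in
    [square_of_pairing]. The lemma serves twice: for the solution at one time and for the difference
    of two times. *)
Lemma pair_norms (w : R2 -> R) (g : distribution2 R) (Vc Vs dVc dVs Z : R2 -> R) (B : R) :
  locally_integrable2 w -> measurable_fun setT Vc -> measurable_fun setT Vs ->
  measurable_fun setT dVc -> measurable_fun setT dVs -> integ mu2 Z ->
  (forall xi, 2 * (Vc xi ^+ 2 + Vs xi ^+ 2) + (dVc xi ^+ 2 + dVs xi ^+ 2) / om xi ^+ 2 <= Z xi) ->
  (forall p, test_function p -> \int[mu2]_x (w x * p x) =
    \int[mu2]_xi (Vc xi * fc p xi) - \int[mu2]_xi (Vs xi * fs p xi)) ->
  (forall p, test_function p ->
    [/\ integ mu2 (fun xi => dVc xi * fc p xi) /\ integ mu2 (fun xi => dVs xi * fs p xi),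
      integ mu2 (fun xi => dVs xi * fc p xi) /\ integ mu2 (fun xi => dVc xi * fs p xi),
      g p = \int[mu2]_xi (dVc xi * fc p xi) - \int[mu2]_xi (dVs xi * fs p xi) &
      \int[mu2]_xi (dVs xi * fc p xi) + \int[mu2]_xi (dVc xi * fs p xi) = 0]) ->
  0 <= B -> \int[mu2]_xi Z xi <= B ^+ 2 ->
  (Lp_norm 2 w <= B%:E)%E /\ (Hdot_norm (-1) g <= B%:E)%E.
Proof.
move=> iw mc ms mdc mds iZ ZL wE gE B0 ZB.
have q0 xi : 0 <= (dVc xi ^+ 2 + dVs xi ^+ 2) / om xi ^+ 2.
  by apply: divr_ge0; [apply: addr_ge0; exact: sqr_ge0|exact: sqr_ge0].
have Zb xi := le_of_double (sqr_ge0 (Vc xi)) (sqr_ge0 (Vs xi)) (q0 xi) (ZL xi).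
have c2 : integ mu2 (fun xi => Vc xi ^+ 2).
  apply: (le_integ iZ); first exact: measurable_funX.
  by move=> xi; rewrite ger0_norm ?sqr_ge0//; case: (Zb xi).
have s2 : integ mu2 (fun xi => Vs xi ^+ 2).
  apply: (le_integ iZ); first exact: measurable_funX.
  by move=> xi; rewrite ger0_norm ?sqr_ge0//; case: (Zb xi).
have d2 : integ mu2 (fun xi => (dVc xi ^+ 2 + dVs xi ^+ 2) / om xi ^+ 2).
  apply: (le_integ iZ).
    apply: measurable_funM; first by apply: measurable_funD; exact: measurable_funX.
    by apply: (meas_comp meas_inv); apply: measurable_funX; exact: meas_om.
  by move=> xi; rewrite ger0_norm//; case: (Zb xi).
split.
  have [w2 W] := square_of_pairing iw mc ms c2 s2 wE.
  rewrite (Lp2E (loc2_meas iw) w2) lee_fin; apply: sqrt_le_of_sqr => //.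
  apply: (le_trans W); apply: le_trans ZB.
  rewrite mulrDr -(RintZ 2 c2) -(RintZ 2 s2) -(RintD (integZ 2 c2) (integZ 2 s2)).
  by apply: (Rint_le (integD (integZ 2 c2) (integZ 2 s2)) iZ) => xi; case: (Zb xi).
apply: (Hdot_le mdc mds gE d2 B0); apply: le_trans ZB.
by apply: (Rint_le d2 iZ) => xi; case: (Zb xi).
Qed.

Lemma sqr_diff_le (x y n : R) : `|x| <= n -> `|y| <= n -> (x - y) ^+ 2 <= 4 * n ^+ 2.
Proof.
move=> xn yn; have n0 : 0 <= n := le_trans (normr_ge0 _) xn.
have h : `|x - y| <= 2 * n by apply: (le_trans (ler_normB _ _)); lra.
have -> : 4 * n ^+ 2 = (2 * n) ^+ 2 by ring.
rewrite -[leLHS]real_normK ?num_real//.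
by rewrite lerXn2r ?nnegrE// mulr_ge0.
Qed.

Lemma om_div_le (x y n : R) (xi : R2) : 0 <= n -> x <= om xi ^+ 2 * n -> y <= om xi ^+ 2 * n ->
  (x + y) / om xi ^+ 2 <= 2 * n.
Proof.
move=> n0 xn yn; have [w0|w0] := eqVneq (om xi) 0.
  by rewrite w0 expr0n /= invr0 mulr0 mulr_ge0.
have o2 : 0 < om xi ^+ 2 by rewrite exprn_gt0// lt_neqAle eq_sym w0 om_ge0.
rewrite ler_pdivrMr//; apply: (le_trans (lerD xn yn)).
by have -> : 2 * n * om xi ^+ 2 = om xi ^+ 2 * n + om xi ^+ 2 * n by ring.
Qed.

(** W s t is a modulus for the distance between times s and t. Its convergence to 0 provides the
    continuity without which [C0_norm] would be infinite. *)
Definition norm_bound (u : R12 -> R) (B : R) := exists W : R -> R -> R,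
  [/\ forall t, (Lp_norm 2 (at_time u t) <= B%:E)%E /\ (Hdot_norm (-1) (dt_distr u t) <= B%:E)%E,
    forall s t, (Lp_norm 2 (fun x => at_time u s x - at_time u t x)%R <= (W s t)%:E)%E /\
      (Hdot_norm (-1) (fun p => dt_distr u s p - dt_distr u t p)%R <= (W s t)%:E)%E &
    forall t : R, W s t @[s --> t] --> (0 : R)].

Lemma component_norms (u f : R12 -> R) (u0 : R2 -> R) (u1 : distribution2 R) (Fc Fs : R12 -> R)
  (M : R2 -> R) (a h e K : R) : weak_solution u f u0 u1 -> integ mu12 f ->
  (forall t, locally_integrable2 (at_time f t)) -> Lp_norm 2 u0 = a%:E ->
  Hdot_norm (-1) u1 = h%:E -> 0 < e ->
  force_data f Fc Fs M -> measurable_fun setT M -> (forall xi, 0 <= M xi) ->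
  integ mu2 (fun xi => M xi ^+ 2) -> \int[mu2]_xi (M xi ^+ 2) <= K ^+ 2 -> 0 <= K ->
  norm_bound u (7 * (a + (h + e) + K)).
Proof.
move=> wu fi sf ua uh e0 fd mM M0 M2 MK K0.
have [mu0 u02 a0 aE] := Lp2_fin ua.
have [Gr [Gi [b [[b0 bh] [mr mi] [r2 i2] bE hG]]]] := Hdot_adherent uh e0.
have [Vc [Vs [dVc [dVs [N [[[mN N2] NB] gc gs uE dE]]]]]] :=
  component wu fi sf mu0 u02 fd mM M2 mr mi r2 i2 hG.
have [_ [su _] _ _ _] := wu.
have [[mc mdc] [cc cdc] lc ldc] := gc; have [[ms mds] [cs cds] ls lds] := gs.
(* With |V| <= N and |dV| <= om N the majorant of [pair_norms] is at most (4 + 2) N^2, and N^2 has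
   integral at most 5 (a^2 + b^2 + K^2); 30 <= 7^2 gives the factor 7. *)
have DB : 6 * \int[mu2]_xi (N xi ^+ 2) <= (7 * (a + (h + e) + K)) ^+ 2.
  rewrite aE in NB.
  have L : (7 * (a + b + K)) ^+ 2 <= (7 * (a + (h + e) + K)) ^+ 2.
    have S7 : 7 * (a + b + K) <= 7 * (a + (h + e) + K) by rewrite ler_wpM2l// lerD2r lerD2l.
    have T7 : 0 <= 7 * (a + b + K) by rewrite mulr_ge0// !addr_ge0.
    by rewrite lerXn2r ?nnegrE//; exact: le_trans S7.
  apply: le_trans L.
  have ab := mulr_ge0 a0 b0; have aK := mulr_ge0 a0 K0; have bK := mulr_ge0 b0 K0.
  have -> : (7 * (a + b + K)) ^+ 2 = 49 * (a ^+ 2 + b ^+ 2 + K ^+ 2) + 98 * (a * b + a * K + b * K) by ring.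
  move: NB MK bE (sqr_ge0 a) (sqr_ge0 b) (sqr_ge0 K).
  move: (a ^+ 2) (b ^+ 2) (K ^+ 2) (a * b) (a * K) (b * K) ab aK bK.
  move: (\int[mu2]_xi (N xi ^+ 2)) (\int[mu2]_xi (M xi ^+ 2)).
  move: (\int[mu2]_xi ((Gr xi / om xi) ^+ 2)) (\int[mu2]_xi ((Gi xi / om xi) ^+ 2)) => *.
  lra.
have B0 : 0 <= 7 * (a + (h + e) + K) by apply: mulr_ge0 => //; exact: addr_ge0 (addr_ge0 a0 (le_trans b0 bh)) K0.
have vn (V : R -> R2 -> R) t xi : `|V t xi| <= N xi -> V t xi ^+ 2 <= N xi ^+ 2.
  move=> h1; rewrite -[leLHS]real_normK ?num_real// lerXn2r ?nnegrE//.
  exact: le_trans (normr_ge0 _) h1.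
have dn (V : R -> R2 -> R) t xi : `|V t xi| <= om xi * N xi -> V t xi ^+ 2 <= om xi ^+ 2 * N xi ^+ 2.
  move=> h1; rewrite -exprMn -[leLHS]real_normK ?num_real// lerXn2r ?nnegrE//.
  exact: le_trans (normr_ge0 _) h1.
have n0 xi : 0 <= N xi := le_trans (normr_ge0 _) (lc 0 xi).
pose Z s t xi := 2 * ((Vc s xi - Vc t xi) ^+ 2 + (Vs s xi - Vs t xi) ^+ 2) +
  ((dVc s xi - dVc t xi) ^+ 2 + (dVs s xi - dVs t xi) ^+ 2) / om xi ^+ 2.
have Z0 s t xi : 0 <= Z s t xi.
  apply: addr_ge0; first by rewrite mulr_ge0// addr_ge0// sqr_ge0.
  by apply: divr_ge0; [apply: addr_ge0; exact: sqr_ge0|exact: sqr_ge0].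
(* The factor 6 of a single time becomes 24 because (x - y)^2 <= 4 n^2 when |x|, |y| <= n. *)
have ZN s t xi : Z s t xi <= 24 * N xi ^+ 2.
  have h1 := sqr_diff_le (lc s xi) (lc t xi); have h2 := sqr_diff_le (ls s xi) (ls t xi).
  have h3 : ((dVc s xi - dVc t xi) ^+ 2 + (dVs s xi - dVs t xi) ^+ 2) / om xi ^+ 2 <= 2 * (4 * N xi ^+ 2).
    apply: om_div_le; first by rewrite mulr_ge0// sqr_ge0.
      by apply: (le_trans (sqr_diff_le (ldc s xi) (ldc t xi))); rewrite exprMn mulrCA.
    by apply: (le_trans (sqr_diff_le (lds s xi) (lds t xi))); rewrite exprMn mulrCA.
  rewrite /Z; move: (_ / _) ((Vc s xi - Vc t xi) ^+ 2) ((Vs s xi - Vs t xi) ^+ 2) (N xi ^+ 2) h1 h2 h3 => *.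
  lra.
have mZ s t : measurable_fun setT (Z s t).
  apply: measurable_funD.
    apply: measurable_funM => //; apply: measurable_funD; apply: measurable_funX; exact: measurable_funB.
  apply: measurable_funM.
    by apply: measurable_funD; apply: measurable_funX; exact: measurable_funB.
  by apply: (meas_comp meas_inv); apply: measurable_funX; exact: meas_om.
have iZ s t : integ mu2 (Z s t).
  by apply: (le_integ (integZ 24 N2) (mZ s t)) => xi; rewrite ger0_norm.
(* Continuity in time of the solution in norm: dominated convergence, each mode being continuous in
   time at every frequency. *)
have cZ t : continuous (fun s => \int[mu2]_xi Z s t xi).
  apply: (@Rint_continuous R _ _ mu2 (fun s => Z s t) (fun xi => 24 * N xi ^+ 2)).
  - exact: integZ.
  - by move=> s; exact: mZ.
  - move=> xi s; have sq (V : R -> R2 -> R) : continuous (V ^~ xi) ->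
        (V s' xi - V t xi) ^+ 2 @[s' --> s] --> (V s xi - V t xi) ^+ 2.
      move=> cV; have h1 : V s' xi - V t xi @[s' --> s] --> V s xi - V t xi.
        by apply: (@cvgB _ R^o); [exact: cV|exact: cvg_cst].
      by under eq_fun do rewrite expr2; rewrite expr2; exact: cvgM.
    apply: (@cvgD _ R^o).
      apply: cvgM; first exact: cvg_cst.
      by apply: (@cvgD _ R^o); [exact: sq (cc xi)|exact: sq (cs xi)].
    apply: cvgM; last exact: cvg_cst.
    by apply: (@cvgD _ R^o); [exact: sq (cdc xi)|exact: sq (cds xi)].
  - by move=> s xi; rewrite ger0_norm.
pose W s t := Num.sqrt (\int[mu2]_xi Z s t xi).
exists W; split.
- move=> t; have zb xi : 2 * (Vc t xi ^+ 2 + Vs t xi ^+ 2) +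
      (dVc t xi ^+ 2 + dVs t xi ^+ 2) / om xi ^+ 2 <= 6 * N xi ^+ 2.
    have h1 := vn Vc t xi (lc t xi); have h2 := vn Vs t xi (ls t xi).
    have h3 := om_div_le (sqr_ge0 (N xi)) (dn dVc t xi (ldc t xi)) (dn dVs t xi (lds t xi)).
    move: (_ / _) (Vc t xi ^+ 2) (Vs t xi ^+ 2) (N xi ^+ 2) h1 h2 h3 => *.
    lra.
  apply: (pair_norms (su t) (mc t) (ms t) (mdc t) (mds t) (integZ 6 N2) zb) => //.
  + by move=> p tp; exact: uE.
  + by move=> p tp; exact: dE.
  + by rewrite (RintZ 6 N2).
- move=> s t.
  have fc2 p (tp : test_function p) := fc_sqr_integ (test2_integ tp) (test2_sqr tp) : integ mu2 (fun xi : R2 => fc p xi ^+ 2).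
  have fs2 p (tp : test_function p) := fs_sqr_integ (test2_integ tp) (test2_sqr tp) : integ mu2 (fun xi : R2 => fs p xi ^+ 2).
  have sqi (V : R -> R2 -> R) r : (forall r, measurable_fun setT (V r)) -> (forall r xi, `|V r xi| <= N xi) ->
      integ mu2 (fun xi => V r xi ^+ 2).
    move=> mV lV; apply: (le_integ N2); first by apply: measurable_funX; exact: mV.
    by move=> xi; rewrite ger0_norm ?sqr_ge0//; exact: vn.
  have BE (V : R2 -> R) (V' q : R2 -> R) : integ mu2 (fun xi => V xi * q xi) ->
      integ mu2 (fun xi => V' xi * q xi) ->
      integ mu2 (fun xi => (V xi - V' xi) * q xi) /\
      \int[mu2]_xi ((V xi - V' xi) * q xi) = \int[mu2]_xi (V xi * q xi) - \int[mu2]_xi (V' xi * q xi).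
    move=> k1 k2; split; first by apply: (eq_integ _ (integB k1 k2)) => xi; rewrite mulrBl.
    by rewrite -(RintB k1 k2); apply: Rint_eq => xi; rewrite mulrBl.
  have mB (V : R -> R2 -> R) : (forall r, measurable_fun setT (V r)) ->
      measurable_fun setT (fun xi => V s xi - V t xi) by move=> mV; exact: measurable_funB.
  apply: (pair_norms (loc2B (su s) (su t)) (mB Vc mc) (mB Vs ms) (mB dVc mdc) (mB dVs mds) (iZ s t)) => //.
  + move=> p tp.
    have mfc := meas_fc (test2_meas tp); have mfs := meas_fs (test2_meas tp).
    have kc r := integ_sqM2 (mc r) mfc (sqi Vc r mc lc) (fc2 p tp).
    have ks r := integ_sqM2 (ms r) mfs (sqi Vs r ms ls) (fs2 p tp).
    have [_ ->] := BE _ _ _ (loc2_test (su s) tp) (loc2_test (su t) tp).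
    have [_ ->] := BE _ _ _ (kc s) (kc t); have [_ ->] := BE _ _ _ (ks s) (ks t).
    have e1 := uE p s tp; have e2 := uE p t tp; rewrite /distr_of_fun in e1 e2.
    rewrite e1 e2; have E (x y z w : R) : x - y - (z - w) = x - z - (y - w) by ring.
    exact: E.
  + move=> p tp; have [[s1 s2] [s3 s4] s5 s6] := dE p s tp.
    have [[t1 t2] [t3 t4] t5 t6] := dE p t tp.
    have [x1 y1] := BE _ _ _ s1 t1; have [x2 y2] := BE _ _ _ s2 t2.
    have [x3 y3] := BE _ _ _ s3 t3; have [x4 y4] := BE _ _ _ s4 t4.
    split; [split; [exact: x1|exact: x2]|split; [exact: x3|exact: x4]| |].
      apply: (etrans (congr2 (fun x y : R => x - y) s5 t5)).
      apply: (etrans _ (esym (congr2 (fun x y : R => x - y) y1 y2))).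
      have E (x y z w : R) : x - y - (z - w) = x - z - (y - w) by ring.
      exact: E.
    apply: (etrans (congr2 (fun x y : R => x + y) y3 y4)).
    by rewrite addrACA -opprD s6 t6 subr0.
  + exact: sqrtr_ge0.
  + by rewrite /W sqr_sqrtr// Rint_ge0.
- move=> t; have Wt : W t t = 0.
    rewrite /W (Rint_eq mu2 (g := fun=> 0)) ?Rint0 ?sqrtr0// => xi.
    by rewrite /Z !subrr expr0n /= !addr0 mulr0 mul0r addr0.
  rewrite -[X in _ --> X]Wt.
  by apply: (@continuous_comp _ _ _ (fun s => \int[mu2]_xi Z s t xi) (@Num.sqrt R) t);
    [exact: cZ|exact: sqrt_continuous].
Qed.

Lemma C0_norm_le (X : zmodType) (N : X -> \bar R) (v : R -> X) (B : R) (W : R -> R -> R) :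
  (forall x, 0 <= N x)%E -> (forall t, N (v t) <= B%:E)%E ->
  (forall s t, N (v s - v t)%R <= (W s t)%:E)%E -> (forall t : R, W s t @[s --> t] --> (0 : R)) ->
  (C0_norm N v <= B%:E)%E.
Proof.
move=> N0 NB NW W0; rewrite /C0_norm asboolT.
  by apply: ge_ereal_sup => _ [t _ <-]; exact: NB.
split=> t; first by apply: le_lt_trans (NB t) (ltry B).
have c0 : (fun=> 0%E : \bar R) s @[s --> t] --> (0%E : \bar R) by exact: cvg_cst.
apply: (squeeze_cvge _ c0); last first.
  apply: (cvg_EFin (f := fun s : R => (W s t)%:E)); last exact: W0.
  by near=> s.
by near=> s; rewrite N0 NW.
Unshelve. all: by end_near. Qed.

End Norms.

Theorem proposition1 (R : realType) :
  exists C : R, 0 < C /\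
    forall (u f : R * (R * R) -> R * R) (u0 : R * R -> R * R)
           (u1 : distribution2 R * distribution2 R),
      weak_solution_system u f u0 u1 ->
      (forall t : R, divergence_free (at_time f t)) ->
      (C0_norm (Lp_norm_vec 2) (at_time u)
         + C0_norm (Hdot_norm_vec (-1)) (dt_distr_vec u)
       <= C%:E * (Lp_norm_vec 2 u0 + Hdot_norm_vec (-1) u1
                  + mixed_norm 1 1 f))%E.
Proof.
(* The bound 7 (a + h + K) for each component counts K twice in the sum over components, and the two
   norms on the left double it again: 28 = 7 * 2 * 2. *)
exists 28; split => // u f u0 u1 [w1 w2] df.
rewrite /Lp_norm_vec /Hdot_norm_vec.
have a10 := Lp_norm_ge0 2 (comp1 u0); have a20 := Lp_norm_ge0 2 (comp2 u0).
have h10 := Hdot_norm_ge0 (-1) u1.1; have h20 := Hdot_norm_ge0 (-1) u1.2.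
have K0 := mixed_norm_ge0 f.
(* If one of the norms of the data is infinite, so is the right side and there is nothing to
   prove. *)
case E1 : (Lp_norm 2 (comp1 u0)) a10 => [a1| |] // a10; last first.
  by rewrite !addye ?gt0_muley ?leey// -ltNye; apply: lt_le_trans (ltNyr 0) _; rewrite ?adde_ge0.
case E2 : (Lp_norm 2 (comp2 u0)) a20 => [a2| |] // a20; last first.
  by rewrite addey// !addye ?gt0_muley ?leey// -ltNye; apply: lt_le_trans (ltNyr 0) _; rewrite ?adde_ge0.
case E3 : (Hdot_norm (-1) u1.1) h10 => [h1| |] // h10; last first.
  rewrite [(+oo + _)%E]addye ?addey// ?addye ?gt0_muley ?leey// -ltNye;
    apply: lt_le_trans (ltNyr 0) _; rewrite ?adde_ge0//.
case E4 : (Hdot_norm (-1) u1.2) h20 => [h2| |] // h20; last first.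
  by rewrite !addey// addye ?gt0_muley ?leey// -ltNye; apply: lt_le_trans (ltNyr 0) _.
case E5 : (mixed_norm 1 1 f) K0 => [K| |] // K0; last first.
  by rewrite addey// gt0_muley ?leey.
rewrite -/(Lp_norm_vec 2) -/(Hdot_norm_vec (-1)).
rewrite !lee_fin in a10 a20 h10 h20 K0.
have l1 : locally_integrable12 (comp1 f) by case: w1 => -[].
have l2 : locally_integrable12 (comp2 f) by case: w2 => -[].
have [i1 i2 KE] := mixed_fin l1 l2 E5.
have dfe (t : R) p : test_function p ->
    \int[@leb2 R]_x (comp1 f (t, x) * d1 p x + comp2 f (t, x) * d2 p x) = 0.
  by move=> tp; have [_ _ H] := df t; exact: H.
have [Fc1 [Fs1 [Fc2 [Fs2 [M [fd1 fd2 mM M0 [M2 MK]]]]]]] := force_bound i1 i2 dfe.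
rewrite KE in MK.
(* [d] is the excess allowed in choosing the transform of u1; it enters the final bound as 28 d, at
   most e. *)
apply/lee_addgt0Pr => e e0; pose d := e / 56.
have d0 : 0 < d by rewrite divr_gt0.
have s1 t : locally_integrable2 (at_time (comp1 f) t) by have [] := df t.
have s2 t : locally_integrable2 (at_time (comp2 f) t) by have [] := df t.
have [W1 [b1 c1 z1]] := component_norms w1 i1 s1 E1 E3 d0 fd1 mM M0 M2 MK K0.
have [W2 [b2 c2 z2]] := component_norms w2 i2 s2 E2 E4 d0 fd2 mM M0 M2 MK K0.
pose B := 7 * (a1 + (h1 + d) + K) + 7 * (a2 + (h2 + d) + K).
have zW t : W1 s t + W2 s t @[s --> t] --> (0 : R).
  by rewrite -[X in _ --> X]addr0; apply: (@cvgD _ R^o); [exact: z1|exact: z2].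
have LU : (C0_norm (Lp_norm_vec 2) (at_time u) <= B%:E)%E.
  apply: (C0_norm_le (W := fun s t => W1 s t + W2 s t)) => //.
  - by move=> v; apply: adde_ge0; exact: Lp_norm_ge0.
  - by move=> t; rewrite /B EFinD; exact: (leeD (b1 t).1 (b2 t).1).
  - by move=> s t; rewrite EFinD; exact: (leeD (c1 s t).1 (c2 s t).1).
have LH : (C0_norm (Hdot_norm_vec (-1)) (dt_distr_vec u) <= B%:E)%E.
  apply: (C0_norm_le (W := fun s t => W1 s t + W2 s t)) => //.
  - by move=> v; apply: adde_ge0; exact: Hdot_norm_ge0.
  - by move=> t; rewrite /B EFinD; exact: (leeD (b1 t).2 (b2 t).2).
  - by move=> s t; rewrite EFinD; exact: (leeD (c1 s t).2 (c2 s t).2).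
apply: (le_trans (leeD LU LH)).
have e56 : e = 56 * d by rewrite /d mulrC divfK.
have L : B + B <= 28 * (a1 + a2 + (h1 + h2) + K) + e.
  by rewrite e56 /B; move: a10 a20 h10 h20 K0 d0; clear; lra.
exact: L.
Qed.
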